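(* Let $G=(V,E)$ be an undirected graph with $n$ vertices and $m$ edges, with positive edge capacities $c:E\to\mathbb{R}_{>0}$, and let $k\in\mathbb{N}$. For sufficiently small $\varepsilon>0$, there is a deterministic algorithm that computes a $k$-cut $C\subseteq E$ with total capacity $\sum_{e\in C}c_e$ at most $(2+\varepsilon)$ times the optimum value of the linear program (L) below, in $O(m\log^3(n)/\varepsilon^2)$ time. (L): minimize $\sum_{e\in E} c_e x_e$ over $x:E\to\mathbb{R}$ subject to $\sum_{e\in T}x_e\ge k-1$ for every spanning tree $T$ of $G$, and $0\le x_e\le 1$ for every edge $e\in E$.
   Context: A $k$-cut is a set of edges $C\subseteq E$ whose removal leaves $G$ with at least $k$ connected components. The capacity of $C$ is $\sum_{e\in C}c_e$. The feasible integral solutions of (L) are exactly the indicator vectors of $k$-cuts, so (L) is an LP relaxation of the minimum $k$-cut problem.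
   Formalization: G is taken connected and k ≤ n: if G is disconnected with fewer than k components, (L) has no constraints and value 0 while every k-cut has positive capacity, and for k > n there is no k-cut; the time bound is stated for n ≥ 2, since log 1 = 0. *)

(* Defs.v *)
From HB Require Import structures.
From mathcomp Require Import all_boot all_order all_algebra.
From mathcomp Require Import all_classical all_reals all_analysis.

Set Implicit Arguments.
Unset Strict Implicit.
Unset Printing Implicit Defensive.

Import Order.TTheory GRing.Theory Num.Theory.

Local Open Scope ring_scope.

(* A simple undirected graph with vertex set 'I_n and edge set 'I_m.  The
   order of each pair of endpoints and the numbering of the edges carry no
   meaning; they are what an edge list given to an algorithm looks like. *)
Record ugraph (n m : nat) := UGraph {
  ends : 'I_m -> 'I_n * 'I_n;
  ends_loopless : forall e, (ends e).1 != (ends e).2;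
  ends_simple : forall e f,
    ends e = ends f \/ ends e = ((ends f).2, (ends f).1) -> e = f
}.

Section Graph.
Variables (n m : nat) (G : ugraph n m).
Implicit Types F C T : {set 'I_m}.

Definition adj F : rel 'I_n := fun u v =>
  [exists e in F, (ends G e == (u, v)) || (ends G e == (v, u))].

Definition connects F := forall u v : 'I_n, connect (adj F) u v.

Definition connected_graph := connects [set: 'I_m].

(* In a simple graph a cycle is a closed walk through at least three pairwise
   distinct vertices; [ucycle] alone also accepts [::] and [:: u; v]. *)
Definition acyclic F := forall p : seq 'I_n, ucycle (adj F) p -> (size p < 3)%N.

Definition spanning_tree T := connects T /\ acyclic T.

Definition is_kcut (k : nat) C := (k <= n_comp (adj (~: C)) [set: 'I_n])%N.

Variable R : realType.
Variable c : 'I_m -> R.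

Definition capacity C : R := \sum_(e in C) c e.

Definition lp_feasible (k : nat) (x : 'I_m -> R) : Prop :=
  (forall T, spanning_tree T -> k%:R - 1 <= \sum_(e in T) x e) /\
  (forall e, 0 <= x e <= 1).

Definition lp_optimum (k : nat) : R :=
  inf [set \sum_e c e * x e | x in lp_feasible k]%classic.

End Graph.

(** * A real RAM

   Integer and real values live in separate registers and separate, indirectly
   addressed memories.  Reals are exact and admit only field operations and
   comparisons: there is no rounding or any other passage from reals to
   integers, nor any source of randomness.  Integers are bounded: an instruction
   whose integer result exceeds the word bound [W] has no execution.  Control is
   structured; every instruction and every test costs one unit of time. *)

Variant int_op := IAdd | ISub | IMul | IDiv | IMod.
Variant real_op := RAdd | RSub | RMul | RDiv.

Variant instr :=
  | IConst (x a : nat)                  (* I[x] := a *)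
  | IOp (o : int_op) (x y z : nat)      (* I[x] := I[y] o I[z] *)
  | ILoad (x y : nat)                   (* I[x] := IM[I[y]] *)
  | IStore (x y : nat)                  (* IM[I[x]] := I[y] *)
  | RofI (x y : nat)                    (* R[x] := I[y] *)
  | ROp (o : real_op) (x y z : nat)     (* R[x] := R[y] o R[z] *)
  | RLoad (x y : nat)                   (* R[x] := RM[I[y]] *)
  | RStore (x y : nat).                 (* RM[I[x]] := R[y] *)

Variant test :=
  | ILt (x y : nat)                     (* I[x] < I[y] *)
  | RLt (x y : nat).                    (* R[x] < R[y] *)

Inductive program :=
  | Do (i : instr)
  | Seq (p q : program)
  | If (b : test) (p q : program)
  | While (b : test) (p : program).

Record state (R : realType) := State {
  ireg : nat -> nat;
  rreg : nat -> R;
  imem : nat -> nat;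
  rmem : nat -> R
}.

Section Machine.
Variable R : realType.
Implicit Type s : state R.

(* Subtraction is truncated; a %/ 0 = 0 and a %% 0 = a.  Below, likewise,
   a / 0 = 0. *)
Definition int_eval (o : int_op) (a b : nat) : nat :=
  match o with
  | IAdd => a + b | ISub => a - b | IMul => a * b
  | IDiv => a %/ b | IMod => a %% b
  end%N.

Definition real_eval (o : real_op) (a b : R) : R :=
  match o with
  | RAdd => a + b | RSub => a - b | RMul => a * b | RDiv => a / b
  end.

Definition set_ireg s x a :=
  State [eta ireg s with x |-> a] (rreg s) (imem s) (rmem s).
Definition set_rreg s x (a : R) :=
  State (ireg s) [eta rreg s with x |-> a] (imem s) (rmem s).
Definition set_imem s x a :=
  State (ireg s) (rreg s) [eta imem s with x |-> a] (rmem s).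
Definition set_rmem s x (a : R) :=
  State (ireg s) (rreg s) (imem s) [eta rmem s with x |-> a].

Definition instr_eval (i : instr) s : state R :=
  match i with
  | IConst x a => set_ireg s x a
  | IOp o x y z => set_ireg s x (int_eval o (ireg s y) (ireg s z))
  | ILoad x y => set_ireg s x (imem s (ireg s y))
  | IStore x y => set_imem s (ireg s x) (ireg s y)
  | RofI x y => set_rreg s x (ireg s y)%:R
  | ROp o x y z => set_rreg s x (real_eval o (rreg s y) (rreg s z))
  | RLoad x y => set_rreg s x (rmem s (ireg s y))
  | RStore x y => set_rmem s (ireg s x) (rreg s y)
  end.

Definition no_overflow (W : nat) (i : instr) s : bool :=
  match i with
  | IConst _ a => (a <= W)%N
  | IOp o _ y z => (int_eval o (ireg s y) (ireg s z) <= W)%N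
  | _ => true
  end.

Definition test_eval (b : test) s : bool :=
  match b with
  | ILt x y => (ireg s x < ireg s y)%N
  | RLt x y => rreg s x < rreg s y
  end.

(* [exec W p s t s']: started in [s] on a machine with word bound [W], [p] halts
   after [t] units of time in [s']. *)
Inductive exec (W : nat) : program -> state R -> nat -> state R -> Prop :=
  | ExecDo i s : no_overflow W i s -> exec W (Do i) s 1 (instr_eval i s)
  | ExecSeq p q s1 t1 s2 t2 s3 :
      exec W p s1 t1 s2 -> exec W q s2 t2 s3 ->
      exec W (Seq p q) s1 (t1 + t2) s3
  | ExecIf b p q s t s' :
      exec W (if test_eval b s then p else q) s t s' ->
      exec W (If b p q) s t.+1 s'
  | ExecWhileStop b p s : ~~ test_eval b s -> exec W (While b p) s 1 s
  | ExecWhileStep b p s1 t1 s2 t2 s3 :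
      test_eval b s1 -> exec W p s1 t1 s2 -> exec W (While b p) s2 t2 s3 ->
      exec W (While b p) s1 (t1 + t2).+1 s3.

Lemma exec_deterministic W p s t1 s1 t2 s2 :
  exec W p s t1 s1 -> exec W p s t2 s2 -> t1 = t2 /\ s1 = s2.
Proof.
move=> e1; elim: e1 t2 s2 => {p s t1 s1}.
- by move=> i s _ t2 s2 e2; inversion e2.
- move=> p q s1 t1 s2 u1 s3 _ IHp _ IHq t2 s4 e2.
  inversion e2 as [|? ? ? ? ? ? ? ep eq| | |]; subst.
  have [? ?] := IHp _ _ ep; subst.
  by have [? ?] := IHq _ _ eq; subst.
- move=> b p q s t s' _ IH t2 s4 e2.
  inversion e2 as [| |? ? ? ? ? ? ep| |]; subst.
  by have [-> ->] := IH _ _ ep.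
- move=> b p s bF t2 s2 e2.
  inversion e2 as [| | | |? ? ? ? ? ? ? bT]; subst => //.
  by rewrite bT in bF.
- move=> b p s1 t1 s2 u1 s3 bT _ IHp _ IHw t2 s4 e2.
  inversion e2 as [| | |? ? ? bF|? ? ? ? ? ? ? _ ep ew]; subst.
    by rewrite bT in bF.
  have [? ?] := IHp _ _ ep; subst.
  by have [-> ->] := IHw _ _ ew.
Qed.

End Machine.

Section InputOutput.
Variables (R : realType) (n m : nat).

(* I[0], I[1], I[2] hold n, m, k and R[0] holds eps; for e < m the endpoints of
   edge e are in IM[2e] and IM[2e+1], and its capacity is in RM[e]; everything
   else is zero. *)
Definition input (G : ugraph n m) (c : 'I_m -> R) (k : nat) (eps : R) :
    state R :=
  State (nth 0%N [:: n; m; k])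
        (nth 0 [:: eps])
        (fun a => if insub a./2 : option 'I_m is Some e
                  then (if odd a then (ends G e).2 else (ends G e).1) : nat
                  else 0%N)
        (fun a => if insub a : option 'I_m is Some e then c e else 0).

(* The returned edge set, read off as an indicator vector in IM[0..m-1]. *)
Definition output (s : state R) : {set 'I_m} := [set e : 'I_m | imem s e != 0%N].

(* Integers polynomial in n and 1/eps, i.e. words of O(log (n / eps)) bits;
   the edge numbers are covered since m <= n^2. *)
Definition word_bound (d : nat) (eps : R) : nat :=
  ((n + Num.truncn eps^-1 + 2) ^ d)%N.

End InputOutput.

(* Main.v *)
Require Import Defs.
From mathcomp Require Import all_boot all_order all_algebra.
From mathcomp Require Import all_classical all_reals all_analysis.
From mathcomp Require Import zify ring lra.

Set Implicit Arguments.
Unset Strict Implicit.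
Unset Printing Implicit Defensive.

Import Order.TTheory GRing.Theory Num.Theory.

Local Open Scope ring_scope.

(* A chain of [L = O(log n / eps^2)] levels is computed.  A level is an ordering
   of the vertices with a boundary [d j] in front of the [j]-th one; at time [t]
   its parts are separated by the boundaries [d j <= t].  The next level is found
   by a maximum adjacency search over the parts of the previous one, where edge
   [e] is in use during [s e <= t < s e + c e]: at time [t] the edges in use link
   the new parts into the old ones and are at most as many as the parts they
   save.  Integrating over [t] and summing over the levels gives a fractional
   packing of spanning trees, hence [g <= LP] for the average [g] of the [k - 1]
   smallest boundaries of the last level.  Conversely the parts of level [l] at
   time [t] are cut off by edges of weight at most the decrease at [t] of the
   slack [int_0^t #{j | d j <= t}] from level [l - 1] to level [l].  If no
   available cut beats [lam * p - cost p <= a], the slack grows slowly along the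
   chain, so that [lam * (k - 1) - a <= (1 + O(1/N)) * g] for [N >= 6 / eps].
   Bisection on [lam] finds two cuts, with [p1 < k <= p2 + 1] new parts, whose
   interpolation at [k - 1] costs at most [(1 + 3/N) * g].  At a factor of two,
   either the finer cut will do, or the coarser one is completed by the cheapest
   parts of the finer one, sparing one of these for each coarse part. *)

(** * A structured language compiled to the real RAM *)

(** The search is the scanning of Nagamochi and Ibaraki with time in the role of the forest number,
    run at every time on a different contraction of the graph. Maximum adjacency makes the use of an
    edge end before a boundary that it crosses opens. So one inequality, edges in use plus new parts
    at most old parts, both feeds the packing and pays for the cuts, and no cut is ever searched
    for: a packing that stalls has cheap cuts among its own levels. For the rate, let [S l i] be the
    slack of level [l] at time [lam * i]. Convexity in time and the failure of all cuts give [2 * S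
    (l+1) (i+1) <= S (l+1) i + S l (i+1) + a]. The homogeneous recurrence is solved by
    [1 / ((1 + eta)^l * (1 - eta)^i)], because [(1 + eta) + (1 - eta) = 2]. Along
    [l = (1 + 1/N) * i] this gains a factor [1 + O(1/N)] every [N + 1] levels, and an initial slack
    of order [n] has to be worn down, whence [log n / eps^2] levels. Reals cannot be rounded on this
    machine, so all integers come from counting and comparing. *)

Inductive iexp :=
  | IVar of nat
  | ICst of nat
  | IBin of int_op & iexp & iexp
  | IArr of nat & iexp.

Inductive rexp :=
  | RVar of nat
  | RInt of iexp
  | RBin of real_op & rexp & rexp
  | RMin of rexp & rexp
  | RMax of rexp & rexp
  | RArr of nat & iexp.

Variant bexp := CI of iexp & iexp | CR of rexp & rexp.

(* Arrays are numbered and interleaved in the memory above the input.  [GetW]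
   and [GetC] read the input part of the two memories, [PutW] overwrites it. *)
Inductive cmd :=
  | SetI of nat & iexp
  | SetR of nat & rexp
  | PutI of nat & iexp & iexp
  | PutR of nat & iexp & rexp
  | GetW of nat & iexp
  | GetC of nat & iexp
  | PutW of iexp & iexp
  | Skip
  | Then of cmd & cmd
  | Cond of bexp & cmd & cmd
  | Loop of bexp & cmd.

Definition upd1 T (f : nat -> T) x v : nat -> T :=
  fun y => if y == x then v else f y.
Definition upd2 T (f : nat -> nat -> T) a i v : nat -> nat -> T :=
  fun b => if b == a then upd1 (f a) i v else f b.

Record hst (R : Type) := HSt {
  iv : nat -> nat; rv : nat -> R;
  ia : nat -> nat -> nat; ra : nat -> nat -> R;
  iw : nat -> nat; rw : nat -> R }.

Definition setI R (h : hst R) x v :=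
  HSt (upd1 (iv h) x v) (rv h) (ia h) (ra h) (iw h) (rw h).
Definition setR R (h : hst R) x v :=
  HSt (iv h) (upd1 (rv h) x v) (ia h) (ra h) (iw h) (rw h).
Definition putI R (h : hst R) a i v :=
  HSt (iv h) (rv h) (upd2 (ia h) a i v) (ra h) (iw h) (rw h).
Definition putR R (h : hst R) a i v :=
  HSt (iv h) (rv h) (ia h) (upd2 (ra h) a i v) (iw h) (rw h).
Definition putW R (h : hst R) i v :=
  HSt (iv h) (rv h) (ia h) (ra h) (upd1 (iw h) i v) (rw h).

Section Semantics.
Variable R : realType.
Implicit Types h : hst R.

Fixpoint evI h e : nat :=
  match e with
  | IVar x => iv h x
  | ICst a => a
  | IBin o e1 e2 => int_eval o (evI h e1) (evI h e2)
  | IArr a e => ia h a (evI h e)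
  end.

Fixpoint evR h e : R :=
  match e with
  | RVar x => rv h x
  | RInt e => (evI h e)%:R
  | RBin o e1 e2 => real_eval o (evR h e1) (evR h e2)
  | RMin e1 e2 => Num.min (evR h e1) (evR h e2)
  | RMax e1 e2 => Num.max (evR h e1) (evR h e2)
  | RArr a e => ra h a (evI h e)
  end.

Definition evB h b : bool :=
  match b with
  | CI e1 e2 => (evI h e1 < evI h e2)%N
  | CR e1 e2 => evR h e1 < evR h e2
  end.

(* [X] bounds the stored integers, [B] is the length of the input part of the
   memory.  A tick is one iteration of a loop: up to a factor depending only on
   the program, this is the running time. *)
Variables X B : nat.

Inductive hexec : cmd -> hst R -> nat -> hst R -> Prop :=
  | HSetI x e h : (evI h e <= X)%N -> hexec (SetI x e) h 0 (setI h x (evI h e))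
  | HSetR x e h : hexec (SetR x e) h 0 (setR h x (evR h e))
  | HPutI a e f h : (evI h f <= X)%N ->
      hexec (PutI a e f) h 0 (putI h a (evI h e) (evI h f))
  | HPutR a e f h : hexec (PutR a e f) h 0 (putR h a (evI h e) (evR h f))
  | HGetW x e h : (evI h e < B)%N -> hexec (GetW x e) h 0 (setI h x (iw h (evI h e)))
  | HGetC x e h : (evI h e < B)%N -> hexec (GetC x e) h 0 (setR h x (rw h (evI h e)))
  | HPutW e f h : (evI h e < B)%N -> (evI h f <= X)%N ->
      hexec (PutW e f) h 0 (putW h (evI h e) (evI h f))
  | HSkip h : hexec Skip h 0 h
  | HThen c1 c2 h t1 h1 t2 h2 : hexec c1 h t1 h1 -> hexec c2 h1 t2 h2 ->
      hexec (Then c1 c2) h (t1 + t2) h2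
  | HCond b c1 c2 h t h' : hexec (if evB h b then c1 else c2) h t h' ->
      hexec (Cond b c1 c2) h t h'
  | HStop b c h : ~~ evB h b -> hexec (Loop b c) h 0 h
  | HStep b c h t1 h1 t2 h2 : evB h b -> hexec c h t1 h1 ->
      hexec (Loop b c) h1 t2 h2 -> hexec (Loop b c) h (t1 + t2).+1 h2.

Definition run c (Q : hst R -> nat -> Prop) h k :=
  exists t h', [/\ hexec c h t h', (t <= k)%N & Q h' (k - t)%N].

(** Variables and arrays that a command may change *)

Fixpoint miv c := match c with
  | SetI x _ | GetW x _ => [:: x]
  | Then c1 c2 | Cond _ c1 c2 => miv c1 ++ miv c2
  | Loop _ c => miv c | _ => [::] end.
Fixpoint mrv c := match c with
  | SetR x _ | GetC x _ => [:: x]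
  | Then c1 c2 | Cond _ c1 c2 => mrv c1 ++ mrv c2
  | Loop _ c => mrv c | _ => [::] end.
Fixpoint mia c := match c with
  | PutI a _ _ => [:: a]
  | Then c1 c2 | Cond _ c1 c2 => mia c1 ++ mia c2
  | Loop _ c => mia c | _ => [::] end.
Fixpoint mra c := match c with
  | PutR a _ _ => [:: a]
  | Then c1 c2 | Cond _ c1 c2 => mra c1 ++ mra c2
  | Loop _ c => mra c | _ => [::] end.
Fixpoint miw c := match c with
  | PutW _ _ => true
  | Then c1 c2 | Cond _ c1 c2 => miw c1 || miw c2
  | Loop _ c => miw c | _ => false end.

(** The frame condition. It depends only on the text of [c], so the specifications below need to
    mention just what a command changes. *)
Record agree c h h' : Prop := Agree {
  agree_iv : forall x, x \notin miv c -> iv h' x = iv h x;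
  agree_rv : forall x, x \notin mrv c -> rv h' x = rv h x;
  agree_ia : forall a, a \notin mia c -> ia h' a = ia h a;
  agree_ra : forall a, a \notin mra c -> ra h' a = ra h a;
  agree_iw : ~~ miw c -> iw h' = iw h;
  agree_rw : rw h' = rw h }.

Lemma agree_refl c h : agree c h h.
Proof. by split. Qed.

Lemma agree_trans c h1 h2 h3 : agree c h1 h2 -> agree c h2 h3 -> agree c h1 h3.
Proof.
case=> a1 a2 a3 a4 a5 a6 [b1 b2 b3 b4 b5 b6].
split=> [x xN|x xN|x xN|x xN|xN|]; by
  [rewrite b1 ?a1|rewrite b2 ?a2|rewrite b3 ?a3|rewrite b4 ?a4|rewrite b5 ?a5|rewrite b6 a6].
Qed.

Lemma agree_sub c d h h' :
  {subset miv c <= miv d} -> {subset mrv c <= mrv d} ->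
  {subset mia c <= mia d} -> {subset mra c <= mra d} -> (miw c -> miw d) ->
  agree c h h' -> agree d h h'.
Proof.
move=> s1 s2 s3 s4 s5 [a1 a2 a3 a4 a5 a6].
split=> // [x xN|x xN|x xN|x xN|xN].
- by apply: a1; apply: contra xN; apply: s1.
- by apply: a2; apply: contra xN; apply: s2.
- by apply: a3; apply: contra xN; apply: s3.
- by apply: a4; apply: contra xN; apply: s4.
- by apply: a5; apply: contra xN.
Qed.

Lemma hexec_agree c h t h' : hexec c h t h' -> agree c h h'.
Proof.
elim=> {c h t h'}; try by move=> *; exact: agree_refl.
- by move=> x e h _; split=> //= y; rewrite inE /upd1 => /negbTE ->.
- by move=> x e h; split=> //= y; rewrite inE /upd1 => /negbTE ->.
- by move=> x e f h _; split=> //= y; rewrite inE /upd2 => /negbTE ->.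
- by move=> x e f h; split=> //= y; rewrite inE /upd2 => /negbTE ->.
- by move=> x e h _; split=> //= y; rewrite inE /upd1 => /negbTE ->.
- by move=> x e h _; split=> //= y; rewrite inE /upd1 => /negbTE ->.
- by move=> e f h _ _; split.
- move=> c1 c2 h t1 h1 t2 h2 _ A1 _ A2; apply: (@agree_trans _ _ h1).
    by apply: agree_sub A1 => [x|x|x|x|] /=; rewrite ?mem_cat => ->.
  by apply: agree_sub A2 => [x|x|x|x|] /=; rewrite ?mem_cat => ->; rewrite orbT.
- move=> b c1 c2 h t h' _; case: evB => A.
    by apply: agree_sub A => [x|x|x|x|] /=; rewrite ?mem_cat => ->.
  by apply: agree_sub A => [x|x|x|x|] /=; rewrite ?mem_cat => ->; rewrite orbT.
- move=> b c h t1 h1 t2 h2 _ _ A1 _ A2; apply: (@agree_trans _ _ h1) => //.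
  exact: agree_sub A1.
Qed.

Lemma run_mono c Q Q' h k : run c Q h k ->
  (forall h' k', agree c h h' -> (k' <= k)%N -> Q h' k' -> Q' h' k') -> run c Q' h k.
Proof.
move=> [t [h' [e tk q]]] QQ; exists t, h'; split=> //.
by apply: QQ q; [exact: hexec_agree e|exact: leq_subr].
Qed.

Lemma run_SetI x e Q h k : (evI h e <= X)%N -> Q (setI h x (evI h e)) k ->
  run (SetI x e) Q h k.
Proof. by move=> eX q; exists 0%N, (setI h x (evI h e)); rewrite subn0; split=> //; constructor. Qed.
Lemma run_SetR x e Q h k : Q (setR h x (evR h e)) k -> run (SetR x e) Q h k.
Proof. by move=> q; exists 0%N, (setR h x (evR h e)); rewrite subn0; split=> //; constructor. Qed.
Lemma run_PutI a e f Q h k : (evI h f <= X)%N ->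
  Q (putI h a (evI h e) (evI h f)) k -> run (PutI a e f) Q h k.
Proof. by move=> eX q; eexists 0%N, _; rewrite subn0; split; [constructor| |exact: q]. Qed.
Lemma run_PutR a e f Q h k :
  Q (putR h a (evI h e) (evR h f)) k -> run (PutR a e f) Q h k.
Proof. by move=> q; eexists 0%N, _; rewrite subn0; split; [constructor| |exact: q]. Qed.
Lemma run_GetW x e Q h k : (evI h e < B)%N -> Q (setI h x (iw h (evI h e))) k ->
  run (GetW x e) Q h k.
Proof. by move=> eX q; eexists 0%N, _; rewrite subn0; split; [constructor| |exact: q]. Qed.
Lemma run_GetC x e Q h k : (evI h e < B)%N -> Q (setR h x (rw h (evI h e))) k ->
  run (GetC x e) Q h k.
Proof. by move=> eX q; eexists 0%N, _; rewrite subn0; split; [constructor| |exact: q]. Qed.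
Lemma run_PutW e f Q h k : (evI h e < B)%N -> (evI h f <= X)%N ->
  Q (putW h (evI h e) (evI h f)) k -> run (PutW e f) Q h k.
Proof. by move=> eX fX q; eexists 0%N, _; rewrite subn0; split; [constructor| |exact: q]. Qed.
Lemma run_Skip Q h k : Q h k -> run Skip Q h k.
Proof. by move=> q; eexists 0%N, _; rewrite subn0; split; [constructor| |exact: q]. Qed.
Lemma run_Then c1 c2 Q h k : run c1 (run c2 Q) h k -> run (Then c1 c2) Q h k.
Proof.
move=> [t1 [h1 [e1 tk1 [t2 [h2 [e2 tk2 q]]]]]].
exists (t1 + t2)%N, h2; rewrite subnDA; split=> //; last by lia.
by apply: HThen e1 e2.
Qed.
Lemma run_Cond b c1 c2 Q h k : (evB h b -> run c1 Q h k) ->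
  (~~ evB h b -> run c2 Q h k) -> run (Cond b c1 c2) Q h k.
Proof.
move=> r1 r2; have [t [h' [e tk q]]] : run (if evB h b then c1 else c2) Q h k.
  by case: (evB h b) r1 r2 => [r1 _|_ r2]; [exact: r1|exact: r2].
by exists t, h'; split=> //; constructor.
Qed.

(* Every iteration pays one tick, so the ticks that are left serve as the
   termination measure. *)
Lemma run_Loop (I : hst R -> nat -> Prop) b c Q h k :
  (forall h' k', agree c h h' -> I h' k' -> evB h' b ->
     (0 < k')%N /\ run c I h' k'.-1) ->
  (forall h' k', agree c h h' -> (k' <= k)%N -> I h' k' -> ~~ evB h' b -> Q h' k') ->
  I h k -> run (Loop b c) Q h k.
Proof.
move=> Istep Istop.
suff main k' h' : (k' <= k)%N -> agree c h h' -> I h' k' -> run (Loop b c) Q h' k'.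
  by apply: main => //; exact: agree_refl.
elim/ltn_ind: k' h' => k' IH h' k'k A Ih.
have [bT|bF] := boolP (evB h' b); last first.
  by exists 0%N, h'; rewrite subn0; split=> //; [exact: HStop|exact: Istop].
have [k0 [t1 [h1 [e1 tk1 I1]]]] := Istep _ _ A Ih bT.
have A1 : agree c h h1 by apply: agree_trans A (hexec_agree e1).
have [||t2 [h2 [e2 tk2 q]]] := IH (k'.-1 - t1)%N _ h1 _ A1 I1; [lia|lia|].
exists (t1 + t2).+1, h2; split; [exact: HStep e2|lia|].
by move: q; congr Q; lia.
Qed.

End Semantics.

(** ** Compilation *)

Definition stride := 32%N.
(* Register 2x holds variable x; integer registers 1 and 3 hold the base address
   of the arrays and 0, real register 1 holds 0; integer register 5 is junk; the
   other odd registers form the evaluation stack. *)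
Definition sI d := (d.*2 + 7)%N.
Definition sR d := (d.*2 + 3)%N.

Definition addr_code a d :=
  Seq (Do (IConst (sI d.+1) stride)) (Seq (Do (IOp IMul (sI d) (sI d) (sI d.+1)))
  (Seq (Do (IConst (sI d.+1) a)) (Seq (Do (IOp IAdd (sI d) (sI d) (sI d.+1)))
  (Do (IOp IAdd (sI d) (sI d) 1))))).

Fixpoint compI e d : program :=
  match e with
  | IVar x => Do (IOp IAdd (sI d) x.*2 3)
  | ICst a => Do (IConst (sI d) a)
  | IBin o e1 e2 =>
      Seq (compI e1 d) (Seq (compI e2 d.+1) (Do (IOp o (sI d) (sI d) (sI d.+1))))
  | IArr a e => Seq (compI e d) (Seq (addr_code a d) (Do (ILoad (sI d) (sI d))))
  end.

Fixpoint compR e d : program :=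
  match e with
  | RVar x => Do (ROp RAdd (sR d) x.*2 1)
  | RInt e => Seq (compI e 0) (Do (RofI (sR d) (sI 0)))
  | RBin o e1 e2 =>
      Seq (compR e1 d) (Seq (compR e2 d.+1) (Do (ROp o (sR d) (sR d) (sR d.+1))))
  | RMin e1 e2 =>
      Seq (compR e1 d) (Seq (compR e2 d.+1)
        (If (RLt (sR d) (sR d.+1)) (Do (ROp RAdd (sR d) (sR d) 1))
            (Do (ROp RAdd (sR d) (sR d.+1) 1))))
  | RMax e1 e2 =>
      Seq (compR e1 d) (Seq (compR e2 d.+1)
        (If (RLt (sR d) (sR d.+1)) (Do (ROp RAdd (sR d) (sR d.+1) 1))
            (Do (ROp RAdd (sR d) (sR d) 1))))
  | RArr a e => Seq (compI e 0) (Seq (addr_code a 0) (Do (RLoad (sR d) (sI 0))))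
  end.

Definition compB b : program :=
  match b with
  | CI e1 e2 => Seq (compI e1 0) (compI e2 1)
  | CR e1 e2 => Seq (compR e1 0) (compR e2 1)
  end.

Definition compT b : test :=
  match b with CI _ _ => ILt (sI 0) (sI 1) | CR _ _ => RLt (sR 0) (sR 1) end.

(** A machine test compares two registers, so the operands of a loop test are evaluated once before
    the loop and again at the end of each pass. There is no move instruction; adding a register that
    holds zero replaces it. *)
Fixpoint comp c : program :=
  match c with
  | SetI x e => Seq (compI e 0) (Do (IOp IAdd x.*2 (sI 0) 3))
  | SetR x e => Seq (compR e 0) (Do (ROp RAdd x.*2 (sR 0) 1))
  | PutI a e f =>
      Seq (compI e 0) (Seq (addr_code a 0) (Seq (compI f 1) (Do (IStore (sI 0) (sI 1)))))
  | PutR a e f =>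
      Seq (compR f 0) (Seq (compI e 0) (Seq (addr_code a 0) (Do (RStore (sI 0) (sR 0)))))
  | GetW x e => Seq (compI e 0) (Do (ILoad x.*2 (sI 0)))
  | GetC x e => Seq (compI e 0) (Do (RLoad x.*2 (sI 0)))
  | PutW e f => Seq (compI e 0) (Seq (compI f 1) (Do (IStore (sI 0) (sI 1))))
  | Skip => Do (IConst 5 0)
  | Then c1 c2 => Seq (comp c1) (comp c2)
  | Cond b c1 c2 => Seq (compB b) (If (compT b) (comp c1) (comp c2))
  | Loop b c => Seq (compB b) (While (compT b) (Seq (comp c) (compB b)))
  end.

(** Running times, admissible array numbers, and sizes of intermediate values *)

Fixpoint szI e := match e with
  | IVar _ | ICst _ => 1 | IBin _ e1 e2 => szI e1 + szI e2 + 1 | IArr _ e => szI e + 6 end%N.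
Fixpoint szR e := match e with
  | RVar _ => 1 | RInt e => szI e + 1 | RBin _ e1 e2 => szR e1 + szR e2 + 1
  | RMin e1 e2 | RMax e1 e2 => szR e1 + szR e2 + 2 | RArr _ e => szI e + 6 end%N.
Definition szB b := match b with
  | CI e1 e2 => szI e1 + szI e2 | CR e1 e2 => szR e1 + szR e2 end%N.
Fixpoint sz c := match c with
  | SetI _ e | GetW _ e | GetC _ e => szI e + 1 | SetR _ e => szR e + 1
  | PutI _ e f => szI e + szI f + 6 | PutR _ e f => szI e + szR f + 6
  | PutW e f => szI e + szI f + 1 | Skip => 1
  | Then c1 c2 => sz c1 + sz c2 | Cond b c1 c2 => szB b + sz c1 + sz c2 + 1
  | Loop b c => szB b + sz c + 1 end%N.

Fixpoint wfI e := match e with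
  | IVar _ | ICst _ => true | IBin _ e1 e2 => wfI e1 && wfI e2
  | IArr a e => (a < stride)%N && wfI e end.
Fixpoint wfR e := match e with
  | RVar _ => true | RInt e => wfI e
  | RBin _ e1 e2 | RMin e1 e2 | RMax e1 e2 => wfR e1 && wfR e2
  | RArr a e => (a < stride)%N && wfI e end.
Definition wfB b := match b with
  | CI e1 e2 => wfI e1 && wfI e2 | CR e1 e2 => wfR e1 && wfR e2 end.
Fixpoint wf c := match c with
  | SetI _ e | GetW _ e | GetC _ e => wfI e | SetR _ e => wfR e
  | PutI a e f => [&& (a < stride)%N, wfI e & wfI f]
  | PutR a e f => [&& (a < stride)%N, wfI e & wfR f]
  | PutW e f => wfI e && wfI f | Skip => true
  | Then c1 c2 => wf c1 && wf c2 | Cond b c1 c2 => [&& wfB b, wf c1 & wf c2]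
  | Loop b c => wfB b && wf c end.

(** Exponents: a value is bounded by [X ^ wtI e]. As [2 <= X], an operation at most adds the
    exponents of its operands, a constant [a] is below [2 ^ a], and an address computation (times
    [stride], plus the array number, plus the base) costs three more. The exponent of a program does
    not depend on the input, which is why a polynomial word bound suffices. *)
Fixpoint wtI e := match e with
  | IVar _ => 1 | ICst a => a.+1 | IBin _ e1 e2 => wtI e1 + wtI e2 | IArr _ e => wtI e + 3 end%N.
Fixpoint wtR e := match e with
  | RVar _ => 1 | RInt e => wtI e
  | RBin _ e1 e2 | RMin e1 e2 | RMax e1 e2 => wtR e1 + wtR e2
  | RArr _ e => wtI e + 3 end%N.
Definition wtB b := match b with
  | CI e1 e2 => wtI e1 + wtI e2 | CR e1 e2 => wtR e1 + wtR e2 end%N.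
Fixpoint wt c := match c with
  | SetI _ e | GetW _ e | GetC _ e => wtI e | SetR _ e => wtR e
  | PutI _ e f => wtI e + 3 + wtI f | PutR _ e f => wtI e + 3 + wtR f
  | PutW e f => wtI e + wtI f | Skip => 1
  | Then c1 c2 => wt c1 + wt c2 | Cond b c1 c2 => wtB b + wt c1 + wt c2
  | Loop b c => wtB b + wt c end%N.

Section Correctness.
Variables (R : realType) (X B W : nat).
Hypotheses (sX : (stride <= X)%N) (BX : (B <= X)%N).
Implicit Types (h : hst R) (s : state R).

Record small h : Prop := Small {
  small_iv : forall x, (iv h x <= X)%N;
  small_ia : forall a i, (ia h a i <= X)%N;
  small_iw : forall i, (iw h i <= X)%N }.

Record sim h s : Prop := Sim {
  sim_iv : forall x, ireg s x.*2 = iv h x;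
  sim_base : ireg s 1 = B;
  sim_zero : ireg s 3 = 0%N;
  sim_rv : forall x, rreg s x.*2 = rv h x;
  sim_rzero : rreg s 1 = 0;
  sim_ia : forall a i, (a < stride)%N -> imem s (i * stride + a + B) = ia h a i;
  sim_iw : forall i, (i < B)%N -> imem s i = iw h i;
  sim_ra : forall a i, (a < stride)%N -> rmem s (i * stride + a + B) = ra h a i;
  sim_rw : forall i, (i < B)%N -> rmem s i = rw h i }.

Record keeps dI dR s s' : Prop := Keeps {
  keeps_i : forall x, ~~ odd x || (x < sI dI)%N && (x != 5) -> ireg s' x = ireg s x;
  keeps_r : forall x, ~~ odd x || (x < sR dR)%N -> rreg s' x = rreg s x;
  keeps_im : imem s' = imem s;
  keeps_rm : rmem s' = rmem s }.

Lemma keeps_trans dI dR s1 s2 s3 : keeps dI dR s1 s2 -> keeps dI dR s2 s3 -> keeps dI dR s1 s3.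
Proof.
case=> a1 a2 a3 a4 [b1 b2 b3 b4]; split=> [x xN|x xN||]; rewrite ?b3 ?b4 //.
  by rewrite b1 ?a1.
by rewrite b2 ?a2.
Qed.

Lemma keeps_le dI dR dI' dR' s s' : (dI' <= dI)%N -> (dR' <= dR)%N ->
  keeps dI dR s s' -> keeps dI' dR' s s'.
Proof.
move=> lI lR [a b c d]; split=> // x xN; [apply: a|apply: b]; move: xN;
  rewrite /sI /sR; lia.
Qed.

Lemma keeps_sim dI dR h s s' : keeps dI dR s s' -> sim h s -> sim h s'.
Proof.
case=> a b c d [e1 e2 e3 e4 e5 e6 e7 e8 e9]; split; rewrite ?c ?d //.
- by move=> x; rewrite a ?odd_double.
- by rewrite a // /sI; lia.
- by rewrite a // /sI; lia.
- by move=> x; rewrite b ?odd_double.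
- by rewrite b // /sR; lia.
Qed.

Lemma wtI_gt0 e : (0 < wtI e)%N.
Proof. by elim: e => //= [op e1 ? e2 ? |a e ?]; lia. Qed.

Lemma wtR_gt0 e : (0 < wtR e)%N.
Proof.
by elim: e => //= [e|op e1 ? e2 ? |e1 ? e2 ? |e1 ? e2 ? |a e]; rewrite ?wtI_gt0 //; lia.
Qed.

Let X2 : (2 <= X)%N. Proof. by apply: leq_trans sX. Qed.

Lemma expX_le w1 w2 : (w1 <= w2)%N -> (X ^ w1 <= X ^ w2)%N.
Proof. by move=> ?; rewrite leq_exp2l //. Qed.

Lemma expX_ge2 w : (0 < w)%N -> (2 <= X ^ w)%N.
Proof. by move=> /expX_le; apply: leq_trans; rewrite expn1. Qed.

Lemma evI_le h e : small h -> (evI h e <= X ^ wtI e)%N.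
Proof.
move=> hs; elim: e => [x|a|o e1 IH1 e2 IH2|a e IH] /=.
- by rewrite expn1 small_iv.
- apply: (@leq_trans (2 ^ a)); first by apply: ltnW; apply: ltn_expl.
  have E : (2 ^ a <= X ^ a)%N by case: (a) => [//|b]; rewrite leq_exp2r.
  exact: leq_trans E (expX_le (leqnSn a)).
- have g1 := expX_ge2 (wtI_gt0 e1); have g2 := expX_ge2 (wtI_gt0 e2).
  rewrite expnD; set a := evI h e1 in IH1 *; set b := evI h e2 in IH2 *.
  have [la lb] : (X ^ wtI e1 <= X ^ wtI e1 * X ^ wtI e2)%N /\
                 (X ^ wtI e2 <= X ^ wtI e1 * X ^ wtI e2)%N by split; nia.
  case: o => /=.
  + nia.
  + by apply: leq_trans la; apply: leq_trans IH1; apply: leq_subr.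
  + exact: leq_mul.
  + by apply: leq_trans la; apply: leq_trans IH1; apply: leq_div.
  + by apply: leq_trans la; apply: leq_trans IH1; apply: leq_mod.
- apply: leq_trans (small_ia hs _ _) _.
  by rewrite -[X in (X <= _)%N]expn1; apply: expX_le; lia.
Qed.

Lemma exec_seq p q s1 t1 s2 t2 s3 : exec W p s1 t1 s2 -> exec W q s2 t2 s3 ->
  exec W (Seq p q) s1 (t1 + t2) s3.
Proof. exact: ExecSeq. Qed.

Lemma set_ireg_keeps s d v dR : keeps d dR s (set_ireg s (sI d) v).
Proof.
split=> //= x xN; have -> // : (x == sI d) = false.
by move: xN; rewrite /sI; lia.
Qed.

Lemma set_rreg_keeps s d v dI : keeps dI d s (set_rreg s (sR d) v).
Proof.
split=> //= x xN; have -> // : (x == sR d) = false.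
by move: xN; rewrite /sR; lia.
Qed.

Lemma addr_code_ok h s a d dR w : (a < stride)%N -> sim h s ->
  (ireg s (sI d) <= X ^ w)%N -> (0 < w)%N -> (X ^ (w + 3) <= W)%N ->
  exists s', [/\ exec W (addr_code a d) s 5 s', keeps d dR s s' &
    ireg s' (sI d) = (ireg s (sI d) * stride + a + B)%N].
Proof.
move=> aK sm vX w0 XW; set v := ireg s (sI d) in vX *.
have g2 := expX_ge2 w0.
have b1 : (v * stride <= X ^ (w + 1))%N by rewrite addn1 expnSr; apply: leq_mul.
have b2 : (v * stride + a <= X ^ (w + 2))%N.
  have : (X ^ (w + 1) * 2 <= X ^ (w + 2))%N by rewrite addn2 expnSr addn1 leq_mul2l X2 orbT.
  have : (X <= X ^ (w+1))%N by rewrite -[X in (X <= _)%N]expn1; apply: expX_le; lia.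
  lia.
have b3 : (v * stride + a + B <= X ^ (w + 3))%N.
  have : (X ^ (w + 2) * 2 <= X ^ (w + 3))%N by rewrite addn3 expnSr addn2 leq_mul2l X2 orbT.
  have : (X <= X ^ (w+2))%N by rewrite -[X in (X <= _)%N]expn1; apply: expX_le; lia.
  lia.
have l1 : (X ^ (w + 1) <= X ^ (w + 3))%N by apply: expX_le; lia.
have l2 : (X ^ (w + 2) <= X ^ (w + 3))%N by apply: expX_le; lia.
have l3 : (X <= X ^ (w+3))%N by rewrite -[X in (X <= _)%N]expn1; apply: expX_le; lia.
have E1 : (sI d == sI d.+1) = false by rewrite /sI; lia.
have E1' : (sI d.+1 == sI d) = false by rewrite /sI; lia.
have E2 : (1 == sI d :> nat) = false by rewrite /sI; lia.
have E3 : (1 == sI d.+1 :> nat) = false by rewrite /sI; lia.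
eexists; split.
- rewrite /addr_code; apply: (@exec_seq _ _ _ 1 _ 4); first by apply: ExecDo => /=; lia.
  apply: (@exec_seq _ _ _ 1 _ 3); first by apply: ExecDo; rewrite /= E1 eqxx; lia.
  apply: (@exec_seq _ _ _ 1 _ 2); first by apply: ExecDo => /=; lia.
  apply: (@exec_seq _ _ _ 1 _ 1); first by apply: ExecDo; rewrite /= !(E1, E1', eqxx); lia.
  by apply: ExecDo; rewrite /= !(E1, E1', E2, E3, eqxx) (sim_base sm); lia.
- split=> //= x xN.
  have [n1 n2] : (x == sI d) = false /\ (x == sI d.+1) = false.
    by move: xN; rewrite /sI; lia.
  by rewrite !(n1, n2).
- by rewrite /= !(E1, E1', E2, E3, eqxx) (sim_base sm).
Qed.

Lemma compI_ok h dR : small h -> forall e d s, sim h s -> wfI e -> (X ^ wtI e <= W)%N ->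
  exists s', [/\ exec W (compI e d) s (szI e) s', keeps d dR s s' & ireg s' (sI d) = evI h e].
Proof.
move=> hs; elim=> [x|a|o e1 IH1 e2 IH2|a e IH] d s sm /=.
- move=> _ XW; exists (set_ireg s (sI d) (iv h x)).
  have v : (ireg s x.*2 + ireg s 3)%N = iv h x by rewrite (sim_iv sm) (sim_zero sm) addn0.
  split; [|exact: set_ireg_keeps|by rewrite /= eqxx].
  rewrite -v; apply: (@ExecDo _ W (IOp IAdd (sI d) x.*2 3)) => /=.
  by rewrite v; apply: leq_trans (small_iv hs x) _; rewrite expn1 in XW.
- move=> _ XW; exists (set_ireg s (sI d) a).
  split; [|exact: set_ireg_keeps|by rewrite /= eqxx].
  apply: (@ExecDo _ W (IConst (sI d) a)) => /=.
  by apply: leq_trans XW; apply: (evI_le (ICst a) hs).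
- move=> /andP[w1 w2] XW.
  have l1 : (X ^ wtI e1 <= W)%N by apply: leq_trans XW; apply: expX_le; lia.
  have l2 : (X ^ wtI e2 <= W)%N by apply: leq_trans XW; apply: expX_le; lia.
  have [s1 [x1 k1 v1]] := IH1 d s sm w1 l1.
  have [s2 [x2 k2 v2]] := IH2 d.+1 s1 (keeps_sim k1 sm) w2 l2.
  have v1' : ireg s2 (sI d) = evI h e1 by rewrite (keeps_i k2) // /sI; lia.
  exists (set_ireg s2 (sI d) (int_eval o (evI h e1) (evI h e2))); split.
  + rewrite -addnA; apply: exec_seq x1 _; apply: exec_seq x2 _.
    rewrite -v1' -v2; apply: (@ExecDo _ W (IOp o (sI d) (sI d) (sI d.+1))) => /=.
    by rewrite v1' v2; apply: leq_trans XW; apply: (evI_le (IBin o e1 e2) hs).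
  + apply: keeps_trans k1 _; apply: keeps_trans (set_ireg_keeps _ _ _ _).
    exact: keeps_le k2.
  + by rewrite /= eqxx.
- move=> /andP[aK we] XW.
  have l1 : (X ^ wtI e <= W)%N by apply: leq_trans XW; apply: expX_le; lia.
  have [s1 [x1 k1 v1]] := IH d s sm we l1.
  have sm1 := keeps_sim k1 sm.
  have [||s2 [x2 k2 v2]] := addr_code_ok (w := wtI e) (d := d) dR aK sm1 _ _ XW.
  + by rewrite v1; apply: evI_le.
  + exact: wtI_gt0.
  exists (set_ireg s2 (sI d) (ia h a (evI h e))); split.
  + rewrite (_ : szI e + 6 = szI e + (5 + 1))%N; last by lia.
    apply: exec_seq x1 _; apply: exec_seq x2 _.
    rewrite -(sim_ia (keeps_sim k2 sm1)) // -v1 -v2.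
    exact: (@ExecDo _ W (ILoad (sI d) (sI d))).
  + by apply: keeps_trans k1 _; apply: keeps_trans k2 (set_ireg_keeps _ _ _ _).
  + by rewrite /= eqxx.
Qed.

Definition compR_spec h e := forall d s, sim h s -> wfR e -> (X ^ wtR e <= W)%N ->
  exists s', [/\ exec W (compR e d) s (szR e) s', keeps 0 d s s' & rreg s' (sR d) = evR h e].

Lemma compR2_ok h e1 e2 : compR_spec h e1 -> compR_spec h e2 ->
  forall d s, sim h s -> wfR e1 && wfR e2 -> (X ^ (wtR e1 + wtR e2) <= W)%N ->
  exists s1 s2, [/\ exec W (compR e1 d) s (szR e1) s1,
    exec W (compR e2 d.+1) s1 (szR e2) s2, rreg s2 (sR d) = evR h e1,
    rreg s2 (sR d.+1) = evR h e2 &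
    rreg s2 1 = 0 /\ forall v, keeps 0 d s (set_rreg s2 (sR d) v)].
Proof.
move=> IH1 IH2 d s sm /andP[w1 w2] XW.
have l1 : (X ^ wtR e1 <= W)%N by apply: leq_trans XW; apply: expX_le; lia.
have l2 : (X ^ wtR e2 <= W)%N by apply: leq_trans XW; apply: expX_le; lia.
have [s1 [x1 k1 v1]] := IH1 d s sm w1 l1.
have [s2 [x2 k2 v2]] := IH2 d.+1 s1 (keeps_sim k1 sm) w2 l2.
exists s1, s2; split=> //; first by rewrite (keeps_r k2) // /sR; lia.
split=> [|v]; first exact: sim_rzero (keeps_sim k2 (keeps_sim k1 sm)).
apply: keeps_trans k1 _; apply: keeps_trans (set_rreg_keeps _ _ _ _).
exact: keeps_le k2.
Qed.

Lemma compR_ok h : small h -> forall e, compR_spec h e.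
Proof.
move=> hs; elim=> [x|e|o e1 IH1 e2 IH2|e1 IH1 e2 IH2|e1 IH1 e2 IH2|a e] d s sm /=.
- move=> _ XW; exists (set_rreg s (sR d) (rv h x)).
  have v : (rreg s x.*2 + rreg s 1) = rv h x by rewrite (sim_rv sm) (sim_rzero sm) addr0.
  split; [|exact: set_rreg_keeps|by rewrite /= eqxx].
  by rewrite -v; apply: (@ExecDo _ W (ROp RAdd (sR d) x.*2 1)).
- move=> we XW; have [s1 [x1 k1 v1]] := compI_ok d hs 0 sm we XW.
  exists (set_rreg s1 (sR d) (evI h e)%:R); split.
  + by apply: exec_seq x1 _; rewrite -v1; apply: (@ExecDo _ W (RofI (sR d) (sI 0))).
  + exact: keeps_trans k1 (set_rreg_keeps _ _ _ _).
  + by rewrite /= eqxx.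
- move=> w XW; have [s1 [s2 [x1 x2 v1' v2 [z2 k3]]]] := compR2_ok IH1 IH2 d sm w XW.
  exists (set_rreg s2 (sR d) (real_eval o (evR h e1) (evR h e2))); split=> //; last by rewrite /= eqxx.
  rewrite -addnA; apply: exec_seq x1 _; apply: exec_seq x2 _.
  by rewrite -v1' -v2; apply: (@ExecDo _ W (ROp o (sR d) (sR d) (sR d.+1))).
- move=> w XW; have [s1 [s2 [x1 x2 v1' v2 [z2 k3]]]] := compR2_ok IH1 IH2 d sm w XW.
  exists (set_rreg s2 (sR d) (Num.min (evR h e1) (evR h e2))); split=> //; last by rewrite /= eqxx.
  rewrite -addnA; apply: exec_seq x1 _; apply: exec_seq x2 _; apply: ExecIf => /=.
  rewrite v1' v2 minElt; case: ifP => _.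
    by rewrite -v1' -[rreg s2 (sR d)]addr0 -z2; apply: (@ExecDo _ W (ROp RAdd (sR d) (sR d) 1)).
  by rewrite -v2 -[rreg s2 (sR d.+1)]addr0 -z2; apply: (@ExecDo _ W (ROp RAdd (sR d) (sR d.+1) 1)).
- move=> w XW; have [s1 [s2 [x1 x2 v1' v2 [z2 k3]]]] := compR2_ok IH1 IH2 d sm w XW.
  exists (set_rreg s2 (sR d) (Num.max (evR h e1) (evR h e2))); split=> //; last by rewrite /= eqxx.
  rewrite -addnA; apply: exec_seq x1 _; apply: exec_seq x2 _; apply: ExecIf => /=.
  rewrite v1' v2 maxElt; case: ifP => _.
    by rewrite -v2 -[rreg s2 (sR d.+1)]addr0 -z2; apply: (@ExecDo _ W (ROp RAdd (sR d) (sR d.+1) 1)).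
  by rewrite -v1' -[rreg s2 (sR d)]addr0 -z2; apply: (@ExecDo _ W (ROp RAdd (sR d) (sR d) 1)).
- move=> /andP[aK we] XW.
  have l1 : (X ^ wtI e <= W)%N by apply: leq_trans XW; apply: expX_le; lia.
  have [s1 [x1 k1 v1]] := compI_ok d hs 0 sm we l1.
  have sm1 := keeps_sim k1 sm.
  have [||s2 [x2 k2 v2]] := addr_code_ok (w := wtI e) (d := 0) d aK sm1 _ _ XW.
  + by rewrite v1; apply: evI_le.
  + exact: wtI_gt0.
  exists (set_rreg s2 (sR d) (ra h a (evI h e))); split.
  + rewrite (_ : szI e + 6 = szI e + (5 + 1))%N; last by lia.
    apply: exec_seq x1 _; apply: exec_seq x2 _.
    rewrite -(sim_ra (keeps_sim k2 sm1)) // -v1 -v2.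
    exact: (@ExecDo _ W (RLoad (sR d) (sI 0))).
  + exact: keeps_trans (keeps_trans k1 k2) (set_rreg_keeps _ _ _ _).
  + by rewrite /= eqxx.
Qed.

Lemma compB_ok h b s : small h -> sim h s -> wfB b -> (X ^ wtB b <= W)%N ->
  exists s', [/\ exec W (compB b) s (szB b) s', sim h s' & test_eval (compT b) s' = evB h b].
Proof.
case: b => e1 e2 hs sm /= /andP[w1 w2] XW.
- have l1 : (X ^ wtI e1 <= W)%N by apply: leq_trans XW; apply: expX_le; lia.
  have l2 : (X ^ wtI e2 <= W)%N by apply: leq_trans XW; apply: expX_le; lia.
  have [s1 [x1 k1 v1]] := compI_ok 0 hs 0 sm w1 l1.
  have [s2 [x2 k2 v2]] := compI_ok 0 hs 1 (keeps_sim k1 sm) w2 l2.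
  exists s2; split; [exact: exec_seq x1 x2|exact: keeps_sim k2 (keeps_sim k1 sm)|].
  by rewrite v2 -v1 (keeps_i k2).
- have l1 : (X ^ wtR e1 <= W)%N by apply: leq_trans XW; apply: expX_le; lia.
  have l2 : (X ^ wtR e2 <= W)%N by apply: leq_trans XW; apply: expX_le; lia.
  have [s1 [x1 k1 v1]] := compR_ok hs 0 sm w1 l1.
  have [s2 [x2 k2 v2]] := compR_ok hs 1 (keeps_sim k1 sm) w2 l2.
  exists s2; split; [exact: exec_seq x1 x2|exact: keeps_sim k2 (keeps_sim k1 sm)|].
  by rewrite v2 -v1 (keeps_r k2).
Qed.

Lemma sim_setI h s x v : sim h s -> sim (setI h x v) (set_ireg s x.*2 v).
Proof.
case=> e1 e2 e3 e4 e5 e6 e7 e8 e9; split=> //=.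
- move=> y; rewrite /upd1 -e1; case: (y =P x) => [->|yx]; first by rewrite eqxx.
  by have -> : (y.*2 == x.*2) = false by lia.
- by have -> : (1 == x.*2 :> nat) = false by lia.
- by have -> : (3 == x.*2 :> nat) = false by lia.
Qed.

Lemma sim_setR h s x v : sim h s -> sim (setR h x v) (set_rreg s x.*2 v).
Proof.
case=> e1 e2 e3 e4 e5 e6 e7 e8 e9; split=> //=.
- move=> y; rewrite /upd1 -e4; case: (y =P x) => [->|yx]; first by rewrite eqxx.
  by have -> : (y.*2 == x.*2) = false by lia.
- by have -> : (1 == x.*2 :> nat) = false by lia.
Qed.

Lemma addr_inj a i b j : (a < stride)%N -> (b < stride)%N ->
  (j * stride + b + B == i * stride + a + B)%N = (b == a) && (j == i).
Proof.
rewrite /stride => aK bK; apply/eqP/andP => [E|[/eqP -> /eqP ->]] //.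
by split; apply/eqP; lia.
Qed.

Lemma sim_putI h s a i v : (a < stride)%N -> sim h s ->
  sim (putI h a i v) (set_imem s (i * stride + a + B) v).
Proof.
move=> aK [e1 e2 e3 e4 e5 e6 e7 e8 e9]; split=> //=.
- move=> b j bK; rewrite addr_inj // /upd2 /upd1.
  case: (b =P a) => [->|_] /=; last by rewrite e6.
  by case: ifP => // _; rewrite e6.
- move=> j jB; have -> : (j == i * stride + a + B)%N = false by lia.
  exact: e7.
Qed.

Lemma sim_putR h s a i v : (a < stride)%N -> sim h s ->
  sim (putR h a i v) (set_rmem s (i * stride + a + B) v).
Proof.
move=> aK [e1 e2 e3 e4 e5 e6 e7 e8 e9]; split=> //=.
- move=> b j bK; rewrite addr_inj // /upd2 /upd1.
  case: (b =P a) => [->|_] /=; last by rewrite e8.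
  by case: ifP => // _; rewrite e8.
- move=> j jB; have -> : (j == i * stride + a + B)%N = false by lia.
  exact: e9.
Qed.

Lemma sim_putW h s i v : (i < B)%N -> sim h s -> sim (putW h i v) (set_imem s i v).
Proof.
move=> iB [e1 e2 e3 e4 e5 e6 e7 e8 e9]; split=> //=.
- move=> b j bK; have -> : (j * stride + b + B == i)%N = false by lia.
  exact: e6.
- by move=> j jB; rewrite /upd1; case: eqP => // _; apply: e7.
Qed.

Lemma small_setI h x v : (v <= X)%N -> small h -> small (setI h x v).
Proof. by move=> vX [a b c]; split=> //= y; rewrite /upd1; case: ifP. Qed.
Lemma small_putI h a i v : (v <= X)%N -> small h -> small (putI h a i v).
Proof. by move=> vX [e b c]; split=> //= y z; rewrite /upd2 /upd1; do !case: ifP => // _. Qed.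
Lemma small_putW h i v : (v <= X)%N -> small h -> small (putW h i v).
Proof. by move=> vX [e b c]; split=> //= z; rewrite /upd1; case: ifP. Qed.

Lemma wt_leX w1 w2 : (w1 <= w2)%N -> (X ^ w2 <= W)%N -> (X ^ w1 <= W)%N.
Proof. by move=> /expX_le; apply: leq_trans. Qed.

(** The bound has [t.+1] because code without loops spends no tick. In a loop, the tick of a pass
    pays for its body and for the following test, and the extra one for the first test. *)
Lemma comp_ok c h t h' : hexec X B c h t h' ->
  forall s, small h -> sim h s -> wf c -> (X ^ wt c <= W)%N ->
  exists t' s', [/\ exec W (comp c) s t' s', sim h' s', small h' & (t' <= sz c * t.+1)%N].
Proof.
elim=> {c h t h'} [x e h eX|x e h|a e f h eX|a e f h|x e h eB|x e h eB|e f h eB fX|h|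
  c1 c2 h t1 h1 t2 h2 _ IH1 _ IH2|b c1 c2 h t h' _ IH|b c h bF|
  b c h t1 h1 t2 h2 bT _ IH1 _ IH2] s hs sm /=.
- move=> we XW; have [s1 [x1 k1 v1]] := compI_ok 0 hs 0 sm we XW.
  have sm1 := keeps_sim k1 sm.
  exists (szI e + 1)%N; eexists; split; [|exact: sim_setI sm1|exact: small_setI|by rewrite muln1].
  refine (exec_seq x1 _).
  have v : (ireg s1 (sI 0) + ireg s1 3)%N = evI h e by rewrite v1 (sim_zero sm1) addn0.
  rewrite -v; apply: (@ExecDo _ W (IOp IAdd x.*2 (sI 0) 3)) => /=.
  rewrite v; apply: leq_trans XW; apply: leq_trans eX _.
  by rewrite -[X in (X <= _)%N]expn1; apply: expX_le; apply: wtI_gt0.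
- move=> we XW; have [s1 [x1 k1 v1]] := compR_ok hs 0 sm we XW.
  have sm1 := keeps_sim k1 sm.
  exists (szR e + 1)%N; eexists; split; [|exact: sim_setR sm1|by case: hs => *; split|by rewrite muln1].
  refine (exec_seq x1 _).
  have v : (rreg s1 (sR 0) + rreg s1 1) = evR h e by rewrite v1 (sim_rzero sm1) addr0.
  by rewrite -v; apply: (@ExecDo _ W (ROp RAdd x.*2 (sR 0) 1)).
- move=> /and3P[aK we wf] XW.
  have [s1 [x1 k1 v1]] := compI_ok 0 hs 0 sm we (wt_leX (leq_trans (leq_addr 3 _) (leq_addr _ _)) XW).
  have sm1 := keeps_sim k1 sm.
  have [|||s2 [x2 k2 v2]] := addr_code_ok (w := wtI e) (d := 0) 0 aK sm1.
  + by rewrite v1; apply: evI_le.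
  + exact: wtI_gt0.
  + exact: wt_leX (leq_addr _ _) XW.
  have sm2 := keeps_sim k2 sm1.
  have [s3 [x3 k3 v3]] := compI_ok 0 hs 1 sm2 wf (wt_leX (leq_addl _ _) XW).
  have sm3 := keeps_sim k3 sm2.
  exists (szI e + (5 + (szI f + 1)))%N; eexists; split; [|exact: sim_putI sm3|exact: small_putI|].
    refine (exec_seq x1 _); refine (exec_seq x2 _); refine (exec_seq x3 _).
    have := @ExecDo _ W (IStore (sI 0) (sI 1)) s3 isT.
    by rewrite /instr_eval v3 (keeps_i k3) // v2 v1.
  by lia.
- move=> /and3P[aK we wf] XW.
  have [s1 [x1 k1 v1]] := compR_ok hs 0 sm wf (wt_leX (leq_addl _ _) XW).
  have sm1 := keeps_sim k1 sm.
  have [s2 [x2 k2 v2]] := compI_ok 1 hs 0 sm1 we (wt_leX (leq_trans (leq_addr 3 _) (leq_addr _ _)) XW).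
  have sm2 := keeps_sim k2 sm1.
  have [|||s3 [x3 k3 v3]] := addr_code_ok (w := wtI e) (d := 0) 1 aK sm2.
  + by rewrite v2; apply: evI_le.
  + exact: wtI_gt0.
  + exact: wt_leX (leq_addr _ _) XW.
  have sm3 := keeps_sim k3 sm2.
  exists (szR f + (szI e + (5 + 1)))%N; eexists; split; [|exact: sim_putR sm3|by case: hs => *; split|].
    refine (exec_seq x1 _); refine (exec_seq x2 _); refine (exec_seq x3 _).
    have := @ExecDo _ W (RStore (sI 0) (sR 0)) s3 isT.
    by rewrite /instr_eval v3 v2 (keeps_r k3) // (keeps_r k2) // v1.
  by lia.
- move=> we XW; have [s1 [x1 k1 v1]] := compI_ok 0 hs 0 sm we XW.
  have sm1 := keeps_sim k1 sm.
  exists (szI e + 1)%N; eexists; split; [|exact: sim_setI sm1| |by rewrite muln1].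
    refine (exec_seq x1 _); rewrite -(sim_iw sm1) // -v1.
    exact: (@ExecDo _ W (ILoad x.*2 (sI 0))).
  by apply: small_setI => //; apply: small_iw.
- move=> we XW; have [s1 [x1 k1 v1]] := compI_ok 0 hs 0 sm we XW.
  have sm1 := keeps_sim k1 sm.
  exists (szI e + 1)%N; eexists; split; [|exact: sim_setR sm1| |by rewrite muln1].
    refine (exec_seq x1 _); rewrite -(sim_rw sm1) // -v1.
    exact: (@ExecDo _ W (RLoad x.*2 (sI 0))).
  by case: hs => *; split.
- move=> /andP[we wf] XW.
  have [s1 [x1 k1 v1]] := compI_ok 0 hs 0 sm we (wt_leX (leq_addr _ _) XW).
  have sm1 := keeps_sim k1 sm.
  have [s2 [x2 k2 v2]] := compI_ok 0 hs 1 sm1 wf (wt_leX (leq_addl _ _) XW).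
  have sm2 := keeps_sim k2 sm1.
  exists (szI e + (szI f + 1))%N; eexists; split; [|exact: sim_putW sm2|exact: small_putW|].
    refine (exec_seq x1 _); refine (exec_seq x2 _).
    have := @ExecDo _ W (IStore (sI 0) (sI 1)) s2 isT.
    by rewrite /instr_eval v2 (keeps_i k2) // v1.
  by lia.
- move=> _ XW; exists (1)%N; eexists; split; [apply: ExecDo => /=; lia| |done|done].
  by apply: (@keeps_sim 0 0 _ s) => //; split=> //= x; case: eqP => // ->.
- move=> /andP[w1 w2] XW.
  have [t1' [s1 [x1 sm1 hs1 b1]]] := IH1 s hs sm w1 (wt_leX (leq_addr _ _) XW).
  have [t2' [s2 [x2 sm2 hs2 b2]]] := IH2 s1 hs1 sm1 w2 (wt_leX (leq_addl _ _) XW).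
  by exists (t1' + t2')%N, s2; split=> //; [exact: exec_seq x2|nia].
- move=> /and3P[wb w1 w2] XW.
  have [s1 [x1 sm1 v1]] := compB_ok hs sm wb (wt_leX (leq_trans (leq_addr _ _) (leq_addr _ _)) XW).
  have [||t2' [s2 [x2 sm2 hs2 b2]]] := IH s1 hs sm1.
  + by case: evB.
  + by apply: wt_leX XW; case: evB; lia.
  exists (szB b + t2'.+1)%N, s2; split=> //; last by case: evB b2; nia.
  by refine (exec_seq x1 _); apply: ExecIf; rewrite v1; case: evB x2.
- move=> /andP[wb wc] XW.
  have [s1 [x1 sm1 v1]] := compB_ok hs sm wb (wt_leX (leq_addr _ _) XW).
  exists (szB b + 1)%N, s1; split=> //; last by nia.
  by refine (exec_seq x1 _); apply: ExecWhileStop; rewrite v1.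
- move=> /andP[wb wc] XW.
  have [s1 [x1 sm1 v1]] := compB_ok hs sm wb (wt_leX (leq_addr _ _) XW).
  have [t2' [s2 [x2 sm2 hs2 b2]]] := IH1 s1 hs sm1 wc (wt_leX (leq_addl _ _) XW).
  have [|t3' [s3 [x3 sm3 hs3 b3]]] := IH2 s2 hs2 sm2 _ XW; first by rewrite /= wb.
  (* The compiled remainder of the loop begins by evaluating the test; that evaluation is taken over
     as the end of the present pass. *)
  inversion x3 as [|? ? ? u1 s4 u2 ? y1 y2| | |]; subst.
  exists (szB b + (t2' + u1 + u2).+1)%N, s3; split=> //; last by move: b3 => /=; nia.
  refine (exec_seq x1 _); apply: ExecWhileStep; first by rewrite v1.
    exact: exec_seq x2 y1.
  exact: y2.
Qed.

End Correctness.

(** * One level of the packing *)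

Section SameBlock.
Variables (R : realFieldType) (d : nat -> R).

Definition same t p w :=
  all (fun q => t < d q) (index_iota (minn p w).+1 (maxn p w).+1).

Lemma same_boundsP t p w :
  reflect (forall q, (minn p w < q <= maxn p w)%N -> t < d q) (same t p w).
Proof.
apply: (iffP allP) => H q qi; apply: H; move: qi; rewrite mem_index_iota; lia.
Qed.

Lemma same_refl t p : same t p p.
Proof. by apply/same_boundsP => q; lia. Qed.

Lemma same_sym t p w : same t p w = same t w p.
Proof. by rewrite /same minnC maxnC. Qed.

Lemma same_trans t w p x : same t p w -> same t w x -> same t p x.
Proof.
move=> /same_boundsP a /same_boundsP b; apply/same_boundsP => q qi.
case: (boolP ((minn p w < q <= maxn p w)%N)) => [|k]; first exact: a.
by apply: b; lia.
Qed.

Lemma same_adj t p : same t p p.+1 = (t < d p.+1).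
Proof.
apply/same_boundsP/idP => [->//|H q qi]; first by lia.
by have -> : q = p.+1 by lia.
Qed.

(** Blocks are intervals, so a property that differs at two positions of a block already changes
    between two neighbours of that block. *)
Lemma same_edge (P : pred nat) t u w : same t u w -> ~~ P u -> P w ->
  exists x y, [/\ x = y.+1 \/ y = x.+1, same t u x, same t u y & ~~ P x && P y] /\
    (x <= maxn u w)%N.
Proof.
move=> suw Pu; have [k] := ubnP (maxn u w - minn u w)%N.
elim: k w suw => // k IH w suw dk Pw.
have uw : u != w by apply: contraNneq Pu => ->.
have [lt|gt|/eqP] := ltngtP u w; last by rewrite (negbTE uw).
- have sw : same t u w.-1 by move/same_boundsP: suw => a; apply/same_boundsP => q qi; apply: a; lia.
  have [P1|P1] := boolP (P w.-1); first by have [|x [y [H1 H2]]] := IH _ sw _ P1; [lia|exists x, y; split=> //; lia].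
  by exists w.-1, w; split; [split=> //; [right; lia|rewrite P1]|lia].
- have sw : same t u w.+1 by move/same_boundsP: suw => a; apply/same_boundsP => q qi; apply: a; lia.
  have [P1|P1] := boolP (P w.+1); first by have [|x [y [H1 H2]]] := IH _ sw _ P1; [lia|exists x, y; split=> //; lia].
  by exists w.+1, w; split; [split=> //; [left|rewrite P1]|lia].
Qed.

Lemma same_neighbours t u x y : x = y.+1 \/ y = x.+1 -> same t u x -> same t u y ->
  t < d (maxn x y).
Proof.
by move=> xy sx sy; have /same_boundsP -> // := same_trans (etrans (same_sym t x u) sx) sy; lia.
Qed.

Lemma same_leader t u : d 0%N <= t -> exists2 p, (p <= u)%N & same t p u && (d p <= t).
Proof.
move=> d0; elim: u => [|u [p pu /andP[sp dp]]]; first by exists 0%N; rewrite ?same_refl.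
have [lt|ge] := ltP t (d u.+1); last by exists u.+1; rewrite ?same_refl.
by exists p; [lia|rewrite dp (same_trans sp) // same_adj].
Qed.

End SameBlock.

Record equivalence (E : nat -> nat -> Prop) : Prop := Equivalence {
  eq_rfl : forall x, E x x; eq_sym' : forall x y, E x y -> E y x;
  eq_trs : forall x y z, E x y -> E y z -> E x z }.

Lemma eq_chain E a b : equivalence E -> (a <= b)%N ->
  (forall q, (a < q <= b)%N -> E q.-1 q) -> E a b.
Proof.
case=> e1 e2 e3; elim: b => [|b IH] ab H; first by have -> : a = 0%N by [lia]; exact: e1.
have [->|ab'] := eqVneq a b.+1; first exact: e1.
apply: e3 (IH _ _) (H b.+1 _); [lia|by move=> q qi; apply: H; lia|lia].
Qed.

Section Search.
Variables (R : realFieldType) (n m : nat) (ea eb : nat -> nat) (c : nat -> R) (d : nat -> R).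
Hypotheses (c_gt0 : forall e, (e < m)%N -> 0 < c e) (d0 : d 0%N = 0).

Definition ends_at e x y := (ea e = x /\ eb e = y) \/ (ea e = y /\ eb e = x).

Definition uses (s : nat -> R) t e := s e <= t < s e + c e.

Definition dead (vis : seq nat) (g : nat -> R) t p :=
  (d p <= t) && all (fun w => same d t p w ==> (w \notin vis) && (g w <= t)) (iota 0 n).

(* The forests of the level, as far as they have been determined when the
   positions [vis] have been visited: position [p] is linked at all times
   [t < g p] to the position visited last, edge [e] of [sc] is used at the times
   of [uses s t e], and [dn] lists the boundaries of the new order.  [mi_count]
   counts, at time [t], the edges in use, the blocks of the new partition, and
   the blocks of the old one that nothing is linked to. *)
Record ma_inv (vis : seq nat) (g s : nat -> R) (sc : pred nat) (dn : nat -> R) : Prop := MaInv {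
  mi_lt : forall p, p \in vis -> (p < n)%N;
  mi_uniq : uniq vis;
  mi_gvis : forall p, p \in vis -> g p = -1;
  mi_gnew : forall p, (p < n)%N -> p \notin vis -> 0 <= g p;
  mi_gout : forall p, (n <= p)%N -> g p = -1;
  mi_nb : forall x y, x = y.+1 \/ y = x.+1 -> (x < n)%N -> x \notin vis -> y \in vis ->
    d (maxn x y) <= g x;
  mi_conn : forall t E, 0 <= t -> equivalence E ->
    (forall p, (0 < p < n)%N -> t < d p -> E p.-1 p) ->
    (forall e, (e < m)%N -> sc e -> uses s t e -> E (ea e) (eb e)) ->
    (forall u, t < g u -> E u (last 0%N vis)) /\
    (forall j, (0 < j < size vis)%N -> t < dn j -> E (nth 0%N vis j.-1) (nth 0%N vis j));
  mi_new : forall e x y i, (e < m)%N -> sc e -> ends_at e x y -> (i < size vis)%N ->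
    nth 0%N vis i = x -> y \notin vis ->
    s e + c e <= g y /\ forall l, (i < l < size vis)%N -> s e + c e <= dn l;
  mi_cross : forall e x y i j l, (e < m)%N -> sc e -> ends_at e x y -> nth 0%N vis i = x ->
    nth 0%N vis j = y -> (i < l <= j)%N -> (j < size vis)%N -> s e + c e <= dn l;
  mi_count : forall t, 0 <= t ->
    (\sum_(e < m) (sc e && uses s t e) + \sum_(j < size vis) (dn j <= t)%R
     + \sum_(p < n) dead vis g t p <= \sum_(p < n) (d p <= t)%R)%N;
  mi_sc : forall e, (e < m)%N -> sc e -> (ea e \in vis) || (eb e \in vis);
  mi_s : forall e, (e < m)%N -> sc e -> 0 <= s e;
  mi_dn0 : (0 < size vis)%N -> dn 0%N = 0;
  mi_dn : forall j, (0 < j < size vis)%N -> 0 < dn j }.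

Lemma ma_start : ma_inv [::] (fun p => if (p < n)%N then 0 else -1) (fun=> 0) pred0 (fun=> 0).
Proof.
split=> //; try by move=> *; lia.
- by move=> p ->.
- by move=> p pn; rewrite ltnNge pn.
- move=> t E t0 eE _ _; split=> [u|j /=]; last by lia.
  by case: ifP => _ tu; exfalso; lra.
- move=> t t0; rewrite big1 // big_ord0 !add0n; apply: leq_sum => p _.
  by rewrite /dead; case: (d p <= t); case: (all _ _).
- by move=> j /=; rewrite ltn0 andbF.
Qed.

Section Step.
Variables (vis : seq nat) (g s : nat -> R) (sc : pred nat) (dn : nat -> R).
Hypothesis I : ma_inv vis g s sc dn.

(** Each block is counted at its leftmost position. The one of the block of [u] was dead and is
    revived by [u]; no other block dies, since visits and links only increase. *)
Lemma dead_leader g' vis' t u : 0 <= t -> (u < n)%N ->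
  (forall w, (w < n)%N -> same d t u w -> (w \notin vis) && (g w <= t)) ->
  (u \in vis') || (t < g' u) ->
  (forall w, w \in vis -> w \in vis') ->
  (forall w, (w < n)%N -> w \notin vis' -> g w <= g' w) ->
  (\sum_(p < n) dead vis' g' t p < \sum_(p < n) dead vis g t p)%N.
Proof.
move=> t0 un allu out visS gS.
have [|p pleu /andP[spu dp]] := same_leader (d := d) (t := t) u; first by rewrite d0.
have pn : (p < n)%N by lia.
have Dp : dead vis g t p.
  rewrite /dead dp; apply/allP => w; rewrite mem_iota => /andP[_ wn]; apply/implyP => spw.
  by apply: allu => //; apply: same_trans spw; rewrite same_sym.
have Dp' : dead vis' g' t p = false.
  apply/negP => /andP[_ /allP /(_ u)]; rewrite mem_iota spu => /(_ un) /= /andP[a b].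
  by move: out; rewrite (negbTE a) ltNge b.
rewrite (bigD1 (Ordinal pn)) //= [X in (_ < X)%N](bigD1 (Ordinal pn)) //= Dp Dp'.
rewrite add0n add1n ltnS; apply: leq_sum => q _.
case D: (dead vis' _ _ _) => //; suff -> : dead vis g t q by [].
case/andP: D => dq /allP a; rewrite /dead dq; apply/allP => w wi; have := a w wi.
move: wi; rewrite mem_iota => /andP[_ wn]; case: same => //= /andP[wv gw].
rewrite (le_trans (gS w wn wv) gw) andbT; by apply: contra wv; apply: visS.
Qed.

Lemma dead_le g' vis' t :
  (forall w, w \in vis -> w \in vis') ->
  (forall w, (w < n)%N -> w \notin vis' -> g w <= g' w) ->
  (\sum_(p < n) dead vis' g' t p <= \sum_(p < n) dead vis g t p)%N.
Proof.
move=> visS gS; apply: leq_sum => q _.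
case D: (dead vis' _ _ _) => //; suff -> : dead vis g t q by [].
case/andP: D => dq /allP a; rewrite /dead dq; apply/allP => w wi; have := a w wi.
move: wi; rewrite mem_iota => /andP[_ wn]; case: same => //= /andP[wv gw].
rewrite (le_trans (gS w wn wv) gw) andbT; by apply: contra wv; apply: visS.
Qed.

(* A visited position of the block of [u] would have linked a neighbour in the
   block beyond time [t]. *)
Lemma block_unvisited t u : (u < n)%N -> u \notin vis ->
  (forall w, (w < n)%N -> same d t u w -> g w <= t) ->
  forall w, (w < n)%N -> same d t u w -> (w \notin vis) && (g w <= t).
Proof.
move=> un uv gt w wn sw; rewrite gt // andbT; apply/negP => wv.
have [x [y [[xy sx sy /andP[xv yv]] xm]]] := same_edge (P := mem vis) sw uv wv.
have xn : (x < n)%N by lia.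
have := mi_nb I xy xn xv yv; have := gt x xn sx; have := same_neighbours xy sx sy.
by move=> a b e; have := lt_le_trans a (le_trans e b); rewrite ltxx.
Qed.

(** Because [g v] is largest, whatever is linked to the previous last position at time [t] is so at
    a time when [v] is too, hence it is linked to [v]. Only the two neighbours of [v] gain links,
    for free, through their common old block. At times [t >= g v] the new boundary is open; then no
    position is linked, so the old block of [v] was dead, and its revival pays for the boundary. *)
Lemma ma_visit v g' : (v < n)%N -> v \notin vis -> (forall w, g w <= g v) ->
  (if vis is [::] then g v = 0 else 0 < g v) ->
  (forall p, p \in rcons vis v -> g' p = -1) -> (forall p, (n <= p)%N -> g' p = -1) ->
  (forall w, (w < n)%N -> w \notin rcons vis v -> g w <= g' w) ->
  (forall w, g w < g' w -> (w = v.+1 \/ v = w.+1) /\ g' w = d (maxn w v)) ->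
  (forall w, (w = v.+1 \/ v = w.+1) -> (w < n)%N -> w \notin rcons vis v -> d (maxn w v) <= g' w) ->
  ma_inv (rcons vis v) g' s sc (fun j => if j == size vis then g v else dn j).
Proof.
move=> vn vvis gmax gv gvis gout gle gchg gnb.
have I0 := I; set dn' := fun j => _.
have dnE j : (j < size vis)%N -> dn' j = dn j by rewrite /dn' => /ltn_eqF ->.
have dnv : dn' (size vis) = g v by rewrite /dn' eqxx.
have gv0 : 0 <= g v by case: (vis) gv => [-> //|a l /ltW].
split.
- by move=> p; rewrite mem_rcons inE => /orP[/eqP ->//|]; exact: mi_lt I p.
- by rewrite rcons_uniq vvis (mi_uniq I).
- exact: gvis.
- move=> p pn pv; apply: le_trans (gle p pn pv).
  by apply: (mi_gnew I) => //; apply: contra pv; rewrite mem_rcons inE orbC => ->.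
- exact: gout.
- move=> x y xy xn xv; rewrite mem_rcons inE => /orP[/eqP E|yv].
    by rewrite E in xy *; apply: gnb.
  apply: le_trans (gle x xn xv); apply: (mi_nb I) => //.
  by apply: contra xv; rewrite mem_rcons inE orbC => ->.
- move=> t E t0 eE Eold Ee; have [H1 H2] := mi_conn I t0 eE Eold Ee.
  rewrite last_rcons size_rcons; split=> [u tu|j jv].
    have [tgu|tgu] := ltP t (g u).
      apply: (eq_trs eE (H1 u tgu)); apply: (eq_sym' eE); apply: H1.
      exact: lt_le_trans tgu (gmax u).
    have [uv dE] := gchg u (le_lt_trans tgu tu).
    have un : (u < n)%N.
      by case: (ltnP u n) => // /gout E1; exfalso; lra.
    rewrite dE in tu; case: uv => uE; rewrite uE in tu un *.
      by apply: (eq_sym' eE); apply: (Eold v.+1) => //; rewrite (_ : maxn _ _ = v.+1) in tu; lia.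
    by apply: (Eold u.+1); [lia|rewrite (_ : maxn _ _ = u.+1) in tu; lia].
  rewrite !nth_rcons; have [jlt|jge] := ltnP j (size vis).
    by rewrite dnE // (_ : (j.-1 < _)%N); [apply: H2; lia|lia].
  have -> : j = size vis by lia.
  rewrite eqxx dnv => tv; rewrite (_ : (_.-1 < _)%N); last by lia.
  by rewrite nth_last; apply: (eq_sym' eE); apply: H1.
- move=> e x y i em se exy; rewrite size_rcons nth_rcons mem_rcons inE negb_or => iv Hx /andP[yv yvis].
  case: ltnP Hx => [ilt Hx|ige].
    have [a b] := mi_new I em se exy ilt Hx yvis.
    split=> [|l li].
      have [yn|ny] := ltnP y n.
        by apply: (le_trans a); apply: gle; rewrite // mem_rcons inE negb_or yv.
      have := c_gt0 em; have := mi_s I em se; have := mi_gout I ny; lra.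
    have [llt|lge] := ltnP l (size vis); first by rewrite dnE //; apply: b; lia.
    by have -> : l = size vis by [lia]; rewrite dnv (le_trans a).
  rewrite (_ : i = size vis) ?eqxx; last by lia.
  move=> E; have := mi_sc I em se.
  by case: exy => [[-> ->]|[-> ->]]; rewrite -E (negbTE vvis) (negbTE yvis).
- move=> e x y i j l em se exy; rewrite !nth_rcons size_rcons => Hx Hy ilj js.
  rewrite (_ : (i < size vis)%N) in Hx; last by lia.
  have [jlt|jge] := ltnP j (size vis).
    rewrite jlt in Hy; rewrite dnE; [exact: (mi_cross I em se exy Hx Hy)|lia].
  have jE : j = size vis by lia.
  rewrite jE ltnn eqxx in Hy; subst y.
  have [|a b] := mi_new I em se exy _ Hx vvis; first by lia.
  have [llt|lge] := ltnP l (size vis); first by rewrite dnE //; apply: b; lia.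
  by have -> : l = size vis by [lia]; rewrite dnv.
- move=> t t0; have := mi_count I t0.
  rewrite size_rcons big_ord_recr /= dnv.
  have -> : (\sum_(j < size vis) (dn' (widen_ord (leqnSn (size vis)) j) <= t)%R =
             \sum_(j < size vis) (dn j <= t)%R)%N.
    by apply: eq_bigr => j _; rewrite /= dnE.
  have [tv|vt] := ltP t (g v).
    have := @dead_le g' (rcons vis v) t; rewrite addn0 => H; apply: leq_trans.
    by rewrite leq_add2l; apply: H => // w; rewrite mem_rcons inE orbC => ->.
  apply: leq_trans; rewrite -!addnA !leq_add2l add1n.
  apply: (@dead_leader _ _ _ v) => //.
  + by apply: block_unvisited => // w _ _; apply: le_trans vt.
  + by rewrite mem_rcons inE eqxx.
  + by move=> w; rewrite mem_rcons inE orbC => ->.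
- by move=> e em /(mi_sc I em) /orP[a|a]; rewrite !mem_rcons !inE a !orbT.
- exact: mi_s I.
- by rewrite /dn' => _; case: eqP => [E|NE]; [case: (vis) E gv|apply: (mi_dn0 I); lia].
- move=> j; rewrite size_rcons /dn'; case: eqP => [E|NE] ji; last by apply: (mi_dn I); lia.
  by case: (vis) E gv => [/=|? ? _ //]; lia.
Qed.

(** [D] is the time up to which some position of the block of [u] is linked already. Starting the
    use of [e] at [D] therefore avoids cycles: during the use the block of [u] is dead, and its
    revival pays for the edge. Afterwards [u] is linked up to [D + c e], first through its block,
    then through [e]. *)
Lemma ma_scan e u D : vis != [::] -> (e < m)%N -> ~~ sc e -> (u < n)%N -> u \notin vis ->
  ends_at e (last 0%N vis) u ->
  (forall t, (t < D) <-> exists2 w, (w < n)%N & (t < g w) && same d t u w) ->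
  ma_inv vis (fun p => if p == u then D + c e else g p)
    (fun f => if f == e then D else s f) (fun f => (f == e) || sc f) dn.
Proof.
move=> vis0 em esc un uvis eu HD; set g' := fun p => _; set s' := fun f => _.
have ce := c_gt0 em.
have gD : g u <= D.
  rewrite leNgt; apply/negP => Dg; suff : D < D by rewrite ltxx.
  by apply/(HD D); exists u; rewrite // Dg same_refl.
have gg' p : g p <= g' p by rewrite /g'; case: eqP => [->|//]; lra.
have u'v p : p \in vis -> (p == u) = false by move=> pv; apply: contraNF uvis => /eqP <-.
have s'E f : sc f -> s' f = s f.
  by rewrite /s'; case: eqP => // ->; rewrite (negbTE esc).
have g'u : g' u = D + c e by rewrite /g' eqxx.
have s'e : s' e = D by rewrite /s' eqxx.
have D0 : 0 <= D by apply: le_trans gD; apply: (mi_gnew I).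
have lv : last 0%N vis \in vis by case: (vis) vis0 => //= a l _; apply: mem_last.
split; try by case: I.
- by move=> p pv; rewrite /g' u'v // (mi_gvis I).
- by move=> p pn pv; apply: le_trans (gg' p); apply: (mi_gnew I).
- by move=> p pn; rewrite /g'; case: eqP => [E|_]; [lia|apply: (mi_gout I)].
- by move=> x y xy xn xv yv; apply: le_trans (gg' x); apply: (mi_nb I).
- move=> t E t0 eE Eold Ee; have [|H1 H2] := mi_conn I t0 eE Eold.
    by move=> f fm scf uf; apply: Ee; rewrite ?scf ?orbT // /uses s'E.
  split=> // w; rewrite /g'; case: eqP => [->|_]; last exact: H1.
  have [tD _|Dt tDc] := ltP t D.
    have [x xn /andP[tx /same_boundsP sux]] := (HD t).1 tD.
    apply: (eq_trs eE _ (H1 x tx)).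
    clear -un xn sux Eold eE tx.
    have [ux|xu] := leqP u x.
      by apply: eq_chain => // q qi; apply: Eold; [lia|apply: sux; lia].
    apply: (eq_sym' eE); apply: eq_chain (ltnW xu) _ => // q qi.
    by apply: Eold; [lia|apply: sux; lia].
  have Eu : E (ea e) (eb e) by apply: Ee => //; rewrite ?eqxx // /uses s'e Dt.
  by case: eu Eu => [[-> ->]|[-> ->]] //; apply: (eq_sym' eE).
- move=> f x y i fm; case: (f =P e) => [-> _|fe /= scf] exy iv Hx yv; last first.
    have [a b] := mi_new I fm scf exy iv Hx yv; rewrite s'E //.
    by split=> //; apply: le_trans (gg' y).
  have xv : x \in vis by rewrite -Hx mem_nth.
  have [-> xE] : y = u /\ x = last 0%N vis.
    have yl : y != last 0%N vis by apply: contraNneq yv => ->.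
    case: eu exy => [[E1 E2]|[E1 E2]] [[a b]|[a b]].
    - by rewrite -a -b.
    - by rewrite -a E1 eqxx in yl.
    - by rewrite -b E2 eqxx in yl.
    - by rewrite -a -b.
  rewrite s'e g'u; split=> // l; rewrite xE -nth_last in Hx.
  have lt : ((size vis).-1 < size vis)%N by clear -iv; lia.
  have := nth_uniq 0%N iv lt (mi_uniq I); rewrite Hx eqxx; clear -iv; lia.
- move=> f x y i j l fm; case: (f =P e) => [-> _|fe /= scf] exy Hx Hy ilj js; last first.
    by rewrite s'E //; apply: (mi_cross I fm scf exy Hx Hy).
  have li : (i < size vis)%N by case/andP: ilj => a b; exact: ltn_trans (leq_trans a b) js.
  have xv : x \in vis by rewrite -Hx mem_nth.
  have yv : y \in vis by rewrite -Hy mem_nth.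
  by case: eu exy uvis => [[_ <-]|[<- _]] [[E1 E2]|[E1 E2]]; rewrite ?E1 ?E2 ?xv ?yv.
- move=> t t0; have := mi_count I t0.
  rewrite (bigD1 (Ordinal em)) //= (negbTE esc) add0n.
  rewrite [X in _ -> (X + _ + _ <= _)%N](bigD1 (Ordinal em)) //= eqxx /=.
  have -> : (\sum_(i < m | i != Ordinal em) ((nat_of_ord i == e) || sc i) && uses s' t i =
             \sum_(i < m | i != Ordinal em) sc i && uses s t i)%N.
    apply: eq_bigr => i; rewrite -val_eqE /= => /negbTE ie; rewrite ie /=.
    by rewrite /uses /s' ie.
  have dl := @dead_le g' vis t (fun w H => H) (fun w _ _ => gg' w).
  case U: (uses s' t e); last first.
    by rewrite add0n; apply: leq_trans; rewrite leq_add2l.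
  suff : (\sum_(p < n) dead vis g' t p < \sum_(p < n) dead vis g t p)%N.
    move=> lt; apply: leq_trans; rewrite -!addnA add1n addnA addnA -addnS leq_add2l.
    exact: lt.
  move: U; rewrite /uses s'e => /andP[Dt tDc].
  apply: (@dead_leader _ _ _ u) => //; last by rewrite g'u tDc orbT.
  apply: block_unvisited => // w wn sw; rewrite leNgt; apply/negP => tw.
  by move: Dt; rewrite leNgt => /negP; apply; apply/(HD t); exists w; rewrite ?tw.
- move=> f fm /orP[/eqP ->|/(mi_sc I fm) //].
  by case: eu => [[-> _]|[_ ->]]; rewrite lv ?orbT.
- by move=> f fm; rewrite /s'; case: eqP => // _ /=; apply: (mi_s I).
Qed.

(** A scanned edge with an unvisited end keeps that end linked until its use is over, hence for a
    positive time. *)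
Lemma ma_gt0 e x y v : (e < m)%N -> sc e -> ends_at e x y -> x \in vis -> y \notin vis ->
  (forall w, g w <= g v) -> 0 < g v.
Proof.
move=> em se exy xv yv gm.
have [|a _] := mi_new I em se exy _ (nth_index 0%N xv) yv; first by rewrite index_mem.
by have := gm y; have := c_gt0 em; have := mi_s I em se; lra.
Qed.
End Step.
End Search.

Section Level.
Variables (R : realFieldType) (n m : nat) (eu ev : nat -> nat) (c : nat -> R).

(* [vt] lists the vertices and [d j] is the boundary in front of [vt j]: at time
   [t] the blocks are separated by the boundaries [d j <= t] with [0 < j].  The
   edge [e] is used at the new level at the times of [uses c s t e]. *)
Record level_uses (vt : nat -> nat) (d : nat -> R) vt' d' (s : nat -> R) : Prop := LevelUses {
  lu_conn : forall t E, 0 <= t -> equivalence E ->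
    (forall p, (0 < p < n)%N -> t < d p -> E (vt p.-1) (vt p)) ->
    (forall e, (e < m)%N -> uses c s t e -> E (eu e) (ev e)) ->
    forall j, (0 < j < n)%N -> t < d' j -> E (vt' j.-1) (vt' j);
  lu_cross : forall e i j l, (e < m)%N ->
    (eu e = vt' i /\ ev e = vt' j) \/ (eu e = vt' j /\ ev e = vt' i) ->
    (i < l <= j)%N -> (j < n)%N -> s e + c e <= d' l;
  lu_count : forall t, 0 <= t ->
    (\sum_(e < m) uses c s t e + \sum_(j < n) (d' j <= t)%R <= \sum_(p < n) (d p <= t)%R)%N;
  lu_s : forall e, (e < m)%N -> 0 <= s e }.

Record ordering (vt : nat -> nat) (d : nat -> R) : Prop := Ordering {
  or_lt : forall j, (j < n)%N -> (vt j < n)%N;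
  or_inj : forall i j, (i < n)%N -> (j < n)%N -> vt i = vt j -> i = j;
  or_d0 : d 0%N = 0;
  or_d : forall j, (j < n)%N -> 0 <= d j }.

Record level vt d vt' d' : Prop := Level {
  lv_uses : exists s, level_uses vt d vt' d' s;
  lv_ord : ordering vt' d';
  lv_pos : forall j, (0 < j < n)%N -> 0 < d' j }.

Lemma ma_level vt d ea eb vis g s sc dn : (0 < n)%N -> ordering vt d ->
  (forall e, (e < m)%N -> vt (ea e) = eu e /\ vt (eb e) = ev e) ->
  (forall e, (e < m)%N -> (ea e < n)%N /\ (eb e < n)%N) ->
  ma_inv n m ea eb c d vis g s sc dn -> size vis = n -> (forall e, (e < m)%N -> sc e) ->
  level vt d (fun j => vt (nth 0%N vis j)) dn.
Proof.
move=> n0 [vtlt vtinj d0 dge] eE elt I sv allsc.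
have vlt j : (j < n)%N -> (nth 0%N vis j < n)%N.
  by move=> jn; apply: (mi_lt I); rewrite mem_nth ?sv.
split; last by move=> j; rewrite -sv; apply: (mi_dn I).
- exists s; split.
  + move=> t E t0 [e1 e2 e3] Eold Ee j jn tj.
    have eE' : equivalence (fun x y => E (vt x) (vt y)).
      by split=> [x|x y|x y z]; [exact: e1|exact: e2|exact: e3].
    have [||_ H] := mi_conn I t0 eE'; last by apply: H; rewrite ?sv.
      by move=> p pn tp; apply: Eold.
    by move=> e em _ u; have [-> ->] := eE e em; apply: Ee.
  + move=> e i j l em H ilj jn; have [Ea Eb] := eE e em; have [la lb] := elt e em.
    have [li lj] : (i < n)%N /\ (j < n)%N by split; lia.
    apply: (mi_cross I em (allsc e em) (x := nth 0%N vis i) (y := nth 0%N vis j) _ erefl erefl ilj).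
      case: H => [[H1 H2]|[H1 H2]]; [left|right]; split.
      - by apply: vtinj => //; [exact: vlt|rewrite Ea].
      - by apply: vtinj => //; [exact: vlt|rewrite Eb].
      - by apply: vtinj => //; [exact: vlt|rewrite Ea].
      - by apply: vtinj => //; [exact: vlt|rewrite Eb].
    by rewrite sv.
  + move=> t t0; have := mi_count I t0; rewrite sv; apply: leq_trans.
    apply: leq_trans (leq_addr _ _); rewrite leq_add2r; apply: leq_sum => e _.
    by rewrite allsc.
  + by move=> e em; apply: (mi_s I) => //; apply: allsc.
- split.
  + by move=> j jn; apply: vtlt; apply: vlt.
  + move=> i j li lj /vtinj E; apply/eqP; rewrite -(nth_uniq 0%N _ _ (mi_uniq I)) ?sv //.
    by rewrite E ?vlt.
  + by apply: (mi_dn0 I); rewrite sv.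
  + move=> [|j] jn; first by rewrite (mi_dn0 I) ?sv.
    by apply: ltW; apply: (mi_dn I); rewrite sv.
Qed.

End Level.

(** * Lower bound on the linear program and cost of the cuts found *)

Section StepFunctions.
Variable R : realFieldType.

Lemma last_below (l : seq R) T0 T : T0 < T ->
  exists T', [/\ T0 <= T', T' < T, T' = T0 \/ T' \in l &
    forall b, b \in l -> b <= T' \/ T <= b].
Proof.
move=> lt; elim: l => [|b l [T' [h1 h2 h3 h4]]]; first by exists T0; split=> //; left.
have [bT|Tb] := ltP b T; last first.
  exists T'; split=> //; first by case: h3 => [->|h]; [left|right; rewrite inE h orbT].
  by move=> x; rewrite inE => /orP[/eqP ->|/h4 //]; right.
have [bT'|Tb'] := leP b T'.
  exists T'; split=> //; first by case: h3 => [->|h]; [left|right; rewrite inE h orbT].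
  by move=> x; rewrite inE => /orP[/eqP ->|/h4 //]; left.
exists b; split=> //; [lra|by right; rewrite inE eqxx|].
move=> x; rewrite inE => /orP[/eqP ->|/h4 [xT|Tx]]; [by left|left; lra|by right].
Qed.

(* [int_{T0}^T (C + sum a [t < b]) dt >= 0]. *)
Lemma step_int (C : R) (s : seq (R * R)) T0 T : T0 <= T ->
  (forall t, T0 <= t < T -> 0 <= C + \sum_(x <- s) x.1 * (t < x.2)%R%:R) ->
  0 <= C * (T - T0) + \sum_(x <- s) x.1 * (Num.min T x.2 - Num.min T0 x.2).
Proof.
have [k] := ubnP (count (fun x => (T0 < x.2 < T)) s).
elim: k T => // k IH T ck; rewrite le_eqVlt => /orP[/eqP <-|lt] f0.
  rewrite subrr mulr0 add0r big1_seq // => x _; by rewrite subrr mulr0.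
(* The integrand is constant from the last breakpoint [T'] before [T] on. This piece is split off,
   and fewer breakpoints lie strictly inside what remains. *)
have [T' [h1 h2 h3 h4]] := last_below [seq x.2 | x <- s] lt.
have dich x : x \in s -> x.2 <= T' \/ T <= x.2.
  by move=> xs; apply: h4; apply/mapP; exists x.
have E : C * (T - T0) + \sum_(x <- s) x.1 * (Num.min T x.2 - Num.min T0 x.2) =
  (C * (T' - T0) + \sum_(x <- s) x.1 * (Num.min T' x.2 - Num.min T0 x.2)) +
  (T - T') * (C + \sum_(x <- s) x.1 * (T' < x.2)%R%:R).
  rewrite [(T - T') * _]mulrDr mulr_sumr addrACA -big_split /=; congr (_ + _); first by lra.
  apply: eq_big_seq => x /dich [xT|Tx].
    by rewrite (ltNge T') xT (min_r xT) (min_r (le_trans xT (ltW h2))) mulr0 mulr0 addr0.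
  have T'x := lt_le_trans h2 Tx.
  by rewrite T'x (min_l Tx) (min_l (ltW T'x)) /=; ring.
rewrite E; apply: addr_ge0; last first.
  by apply: mulr_ge0; [lra|by apply: f0; rewrite h1 h2].
case: h3 => [->|].
  by rewrite subrr mulr0 add0r big1_seq // => x _; rewrite subrr mulr0.
move=> /mapP[y ys Ey].
have [T'0|T'0] := eqVneq T' T0.
  by rewrite T'0 subrr mulr0 add0r big1_seq // => x _; rewrite subrr mulr0.
apply: IH => // [|t /andP[a b]]; last by apply: f0; rewrite a (lt_trans b).
suff : (count (fun x => T0 < x.2 < T')%R s < count (fun x => T0 < x.2 < T)%R s)%N by lia.
have yT0 : T0 < y.2 by rewrite -Ey lt_neqAle eq_sym T'0.
elim: (s) ys => // x l IHl; rewrite inE => /orP[/eqP <-|/IHl lt'] /=.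
  rewrite yT0 -Ey ltxx h2 /= add0n add1n ltnS; apply: sub_count => z /andP[-> zT] /=.
  exact: lt_trans h2.
suff : ((T0 < x.2 < T')%R <= (T0 < x.2 < T)%R)%N.
  by move=> le; rewrite -addnS; apply: leq_add.
case: (T0 < x.2) => //=; case: ltP => // xT; by rewrite (lt_trans xT).
Qed.

End StepFunctions.

Section Chain.
Variables (R : realType) (n m : nat) (eu ev : nat -> nat) (c : nat -> R).
Hypothesis c_gt0 : forall e, (e < m)%N -> 0 < c e.

(* The time before [T] during which the boundaries are open:
   [int_0^T #{j | 0 < j, d j <= t} dt]. *)
Definition slack (d : nat -> R) T := \sum_(1 <= j < n) Num.max 0 (T - d j).

Lemma slackE d T : slack d T = \sum_(1 <= j < n) (T - Num.min T (d j)).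
Proof.
apply: eq_bigr => j _; rewrite maxElt minElt; do 2 case: ltP => ?; lra.
Qed.

Section OneLevel.
Variables (vt vt' : nat -> nat) (d d' s : nat -> R).
Hypotheses (n0 : (0 < n)%N) (d0 : d 0%N = 0) (d0' : d' 0%N = 0).
Hypothesis L : level_uses n m eu ev c vt d vt' d' s.

Lemma level_count t : 0 <= t ->
  0 <= \sum_(1 <= j < n) (t < d' j)%R%:R - \sum_(1 <= j < n) (t < d j)%R%:R
       - \sum_(0 <= e < m) (uses c s t e)%:R :> R.
Proof.
move=> t0; have := lu_count L t0.
rewrite -(big_mkord xpredT (fun e => uses c s t e : nat)).
rewrite -(big_mkord xpredT (fun j => (d' j <= t)%R : nat)).
rewrite -(big_mkord xpredT (fun j => (d j <= t)%R : nat)).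
(* Boundary 0 is open at all times on both levels and cancels. *)
rewrite [X in (_ + X <= _)%N]big_ltn // [X in (_ <= X)%N]big_ltn // d0 d0' t0.
rewrite addnCA leq_add2l -(ler_nat R) natrD !natr_sum => H.
rewrite -sumrB.
have -> : \sum_(1 <= j < n) ((t < d' j)%R%:R - (t < d j)%R%:R) =
  \sum_(1 <= j < n) ((d j <= t)%R%:R - (d' j <= t)%R%:R) :> R.
  by apply: eq_bigr => j _; rewrite !ltNge; do 2 case: (_ <= t) => /=; lra.
by rewrite sumrB; lra.
Qed.

(** The length of the part of [[s e, s e + c e)] that lies before [T]. *)
Definition used T e := Num.min T (s e + c e) - Num.min T (s e).

(** This is [level_count] integrated: by [step_int] every indicator of [t < b] turns into a
    difference of minima. *)
Lemma level_mass T0 T : 0 <= T0 <= T ->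
  \sum_(0 <= e < m) (used T e - used T0 e) <=
  (slack d T - slack d' T) - (slack d T0 - slack d' T0).
Proof.
move=> /andP[T00 TT].
pose l := [seq (1 : R, d' j) | j <- index_iota 1 n] ++ [seq (-1, d j) | j <- index_iota 1 n]
  ++ [seq (-1, s e + c e) | e <- index_iota 0 m] ++ [seq (1, s e) | e <- index_iota 0 m].
have := @step_int _ 0 l T0 T TT.
rewrite !slackE /l !big_cat /= !big_map /= mul0r add0r.
have E f : \sum_(1 <= j < n) (T - Num.min T (f j)) - \sum_(1 <= j < n) (T0 - Num.min T0 (f j)) =
  \sum_(1 <= j < n) (T - T0) - \sum_(1 <= j < n) (1 * (Num.min T (f j) - Num.min T0 (f j))) :> R.
  by rewrite -!sumrB; apply: eq_bigr => j _; ring.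
have E' f : \sum_(1 <= j < n) (-1 * (Num.min T (f j) - Num.min T0 (f j))) =
   - \sum_(1 <= j < n) (1 * (Num.min T (f j) - Num.min T0 (f j))) :> R.
  by rewrite -sumrN; apply: eq_bigr => j _; ring.
have E3 : \sum_(0 <= e < m) (used T e - used T0 e) =
  - (\sum_(0 <= e < m) -1 * (Num.min T (s e + c e) - Num.min T0 (s e + c e)) +
     \sum_(0 <= e < m) 1 * (Num.min T (s e) - Num.min T0 (s e))).
  by rewrite -big_split -sumrN; apply: eq_bigr => e _; rewrite /used /=; ring.
have := E d; have := E d'; have := E' d; move: E3.
set A := \sum_(0 <= e < m) _; set B := \sum_(0 <= e < m) _; set C := \sum_(0 <= e < m) _.
move=> -> -> Ed' Ed H; suff : 0 <= \sum_(1 <= j < n) 1 * (Num.min T (d' j) - Num.min T0 (d' j)) +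
  (- \sum_(1 <= j < n) 1 * (Num.min T (d j) - Num.min T0 (d j)) + (B + C)) by lra.
apply: H => t /andP[T0t tT]; rewrite add0r !big_cat /= !big_map /=.
have t0 : 0 <= t by lra.
have := level_count t0.
have -> : \sum_(0 <= e < m) (uses c s t e)%:R =
  - (\sum_(0 <= e < m) -1 * (t < s e + c e)%R%:R + \sum_(0 <= e < m) 1 * (t < s e)%R%:R) :> R.
  rewrite -big_split -sumrN; apply: eq_big_nat => e em /=; rewrite /uses leNgt.
  have := c_gt0 em; have [ts ce|] := ltP t (s e); last by case: (t < _) => /=; lra.
  by rewrite (_ : t < s e + c e); [rewrite /=; lra|lra].
have -> : \sum_(1 <= j < n) -1 * (t < d j)%R%:R = - \sum_(1 <= j < n) (t < d j)%R%:R :> R.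
  by rewrite -sumrN; apply: eq_bigr => j _; ring.
have -> : \sum_(1 <= j < n) 1 * (t < d' j)%R%:R = \sum_(1 <= j < n) (t < d' j)%R%:R :> R.
  by apply: eq_bigr => j _; ring.
by lra.
Qed.

Lemma used0 e : (e < m)%N -> used 0 e = 0.
Proof.
move=> em; have := c_gt0 em; have := lu_s L em => a b.
by rewrite /used !min_l ?subrr //; lra.
Qed.

Lemma used_mono e T0 T : (e < m)%N -> T0 <= T -> used T0 e <= used T e.
Proof.
move=> em TT; have ce := c_gt0 em; rewrite /used !minElt.
by do 4 case: ltP => ?; lra.
Qed.

Lemma used_le e T : (e < m)%N -> used T e <= c e.
Proof. by move=> em; have ce := c_gt0 em; rewrite /used !minElt; do 2 case: ltP => ?; lra. Qed.

(** By [level_mass] the growth is at least the use of edges between [T0] and [T]. Hence, among the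
    times with the same boundaries open, the earliest gives the cheapest cut. *)
Lemma slack_mono T0 T : 0 <= T0 <= T -> slack d T0 - slack d' T0 <= slack d T - slack d' T.
Proof.
move=> TT; rewrite -subr_ge0; apply: le_trans (level_mass TT).
rewrite big_nat; apply: sumr_ge0 => e /andP[_ em]; rewrite subr_ge0 used_mono //.
by case/andP: TT.
Qed.

Hypothesis dge : forall j, (j < n)%N -> 0 <= d j.
Hypothesis dge' : forall j, (j < n)%N -> 0 <= d' j.

Lemma level_used T : 0 <= T -> \sum_(0 <= e < m) used T e <= slack d T - slack d' T.
Proof.
move=> T0; have := @level_mass 0 T; rewrite lexx => /(_ T0).
have z f : (forall j, (j < n)%N -> 0 <= f j) -> slack f 0 = 0.
  move=> fge; rewrite slackE big_nat big1 // => j /andP[_ jn].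
  by rewrite min_l ?subrr //; apply: fge.
rewrite (z d) // (z d') // subr0 subr0; apply: le_trans.
by rewrite le_eqVlt big_nat [X in _ == X]big_nat; apply/orP; left; apply/eqP;
  apply: eq_bigr => e /andP[_ em]; rewrite used0 // subr0.
Qed.

(** An edge whose use is over at [T] has been in use for its whole capacity, so the weight of such
    edges is part of the total use, which the decrease of the slack bounds. *)
Lemma cut_cost (P : pred nat) T : 0 <= T ->
  (forall e, (e < m)%N -> P e -> s e + c e <= T) ->
  \sum_(0 <= e < m | P e) c e <= slack d T - slack d' T.
Proof.
move=> T0 H; apply: le_trans (level_used T0); rewrite big_mkcond /=.
apply: ler_sum_nat => e /andP[_ em]; case: ifP => Pe.
  by have := H e em Pe; have := c_gt0 em => ce h; rewrite /used !min_r; lra.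
by rewrite -(used0 em) used_mono.
Qed.

End OneLevel.

Section Levels.
Variables (L : nat) (vt : nat -> nat -> nat) (d : nat -> nat -> R).
Hypotheses (n0 : (0 < n)%N) (d0 : forall j, d 0 j = 0).
Hypothesis lev : forall l, (l < L)%N -> level n m eu ev c (vt l) (d l) (vt l.+1) (d l.+1).
Hypothesis ord0 : ordering n (vt 0%N) (d 0%N).

Lemma chain_ord l : (l <= L)%N -> ordering n (vt l) (d l).
Proof. by case: l => // l /lev []. Qed.

Definition covers (x : nat -> R) (k : R) := forall (S B : pred nat) w,
  (forall j, (j < n)%N -> (w j < n)%N) ->
  (forall i j, (i < n)%N -> (j < n)%N -> w i = w j -> i = j) ->
  (forall E, equivalence E -> (forall e, (e < m)%N -> S e -> E (eu e) (ev e)) ->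
     forall j, (0 < j < n)%N -> ~~ B j -> E (w j.-1) (w j)) ->
  k - \sum_(1 <= j < n) (B j)%:R <= \sum_(0 <= e < m | S e) x e.

(* The edges in use at time [t] miss only as many links as there are boundaries
   that are open at time [t]; integrate over [0, T]. *)
Lemma chain_lp x k : (forall e, (e < m)%N -> 0 <= x e) -> covers x k ->
  forall T, 0 <= T -> T * k - slack (d L) T <= L%:R * \sum_(0 <= e < m) c e * x e.
Proof.
move=> x0 cov T T0.
have /choice [s Hs] : forall l, exists s, (l < L)%N ->
    level_uses n m eu ev c (vt l) (d l) (vt l.+1) (d l.+1) s.
  move=> l; case: (ltnP l L) => lL; last by exists (fun=> 0).
  by have [[s Hs] _ _] := lev lL; exists s.
pose ls := [seq (x e, s l e + c e) | l <- index_iota 0 L, e <- index_iota 0 m]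
  ++ [seq (- x e, s l e) | l <- index_iota 0 L, e <- index_iota 0 m]
  ++ [seq (-1, d L j) | j <- index_iota 1 n].
have := @step_int _ (\sum_(1 <= j < n) 1 - k) ls 0 T T0.
rewrite /ls !big_cat /= !big_allpairs_dep /= big_map /=.
have -> : \sum_(1 <= j < n) -1 * (Num.min T (d L j) - Num.min 0 (d L j)) =
  - \sum_(1 <= j < n) Num.min T (d L j).
  rewrite -sumrN; apply: eq_big_nat => j /andP[_ jn].
  by rewrite (min_l (or_d (chain_ord (leqnn L)) jn)); ring.
have Eu : \sum_(0 <= l < L) \sum_(0 <= e < m) x e * (Num.min T (s l e + c e) - Num.min 0 (s l e + c e))
  + \sum_(0 <= l < L) \sum_(0 <= e < m) - x e * (Num.min T (s l e) - Num.min 0 (s l e))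
  <= L%:R * \sum_(0 <= e < m) c e * x e.
  rewrite -big_split /= mulr_natl -[X in _ *+ X]subn0 -sumr_const_nat.
  apply: ler_sum_nat => l /andP[_ lL]; rewrite -big_split /=.
  apply: ler_sum_nat => e /andP[_ em].
  have se := lu_s (Hs l lL) em; have ce := c_gt0 em.
  rewrite (min_l se) (min_l (_ : 0 <= s l e + c e)); last by lra.
  have := used_le (s l) T em; rewrite /used => ule.
  have := ler_wpM2l (x0 e em) ule; lra.
rewrite slackE sumrB => H.
have /H : forall t, 0 <= t < T -> 0 <= \sum_(1 <= j < n) 1 - k +
    \sum_(z <- ls) z.1 * (t < z.2)%R%:R.
  move=> t /andP[t0 tT]; rewrite /ls !big_cat /= !big_allpairs_dep /= big_map /=.
  pose S := [pred e | has (fun l => uses c (s l) t e) (iota 0 L)].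
  have := cov S (fun j => d L j <= t) (vt L) (or_lt (chain_ord (leqnn L)))
    (or_inj (chain_ord (leqnn L))).
  have -> : \sum_(1 <= j < n) -1 * (t < d L j)%R%:R =
     \sum_(1 <= j < n) (d L j <= t)%R%:R - \sum_(1 <= j < n) 1 :> R.
    by rewrite -sumrB; apply: eq_bigr => j _; rewrite leNgt; case: (t < _) => /=; ring.
  have -> : \sum_(0 <= l < L) \sum_(0 <= e < m) - x e * (t < s l e)%R%:R =
     - \sum_(0 <= l < L) \sum_(0 <= e < m) x e * (t < s l e)%R%:R :> R.
    rewrite -sumrN; apply: eq_bigr => l _; rewrite -sumrN.
    by apply: eq_bigr => e _; rewrite mulNr.
  move=> C; have {}C := C _.
  suff U : \sum_(0 <= e < m | S e) x e <= \sum_(0 <= l < L) \sum_(0 <= e < m) x e * (t < s l e + c e)%R%:R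
    - \sum_(0 <= l < L) \sum_(0 <= e < m) x e * (t < s l e)%R%:R.
    suff : k - \sum_(1 <= j < n) (d L j <= t)%R%:R <= \sum_(0 <= e < m | S e) x e by lra.
    apply: C => E eE ES.
    (* The edges in use on the levels up to [l] join whatever is not separated at level [l]. At
       level 0 all boundaries are 0, so there is nothing to join. *)
    have ind l : (l <= L)%N -> forall j, (0 < j < n)%N -> t < d l j -> E (vt l j.-1) (vt l j).
      elim: l => [|l IH] lL j jn; first by rewrite d0 ltNge t0.
      apply: (lu_conn (Hs l lL) t0 eE) => // [|e em ue]; first exact: IH (ltnW lL).
      by apply: ES => //; apply/hasP; exists l => //; rewrite mem_iota.
    by move=> j jn dj; apply: ind => //; rewrite ltNge.
  rewrite -sumrB; under [X in _ <= X]eq_bigr => l _ do rewrite -sumrB.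
  rewrite [X in _ <= X]exchange_big /= big_mkcond /=; apply: ler_sum_nat => e /andP[_ em].
  have nn l : (l < L)%N -> 0 <= x e * (t < s l e + c e)%R%:R - x e * (t < s l e)%R%:R.
    move=> lL; rewrite -mulrBr; apply: mulr_ge0; first exact: x0.
    have ce := c_gt0 em; case: (ltP t (s l e)) => [ts|_]; last by rewrite subr0 ler0n.
    by rewrite (_ : t < s l e + c e) ?subrr //; lra.
  case: ifP => [/hasP[l]|_]; last by rewrite big_nat; apply: sumr_ge0 => l /andP[_]; apply: nn.
  rewrite mem_iota add0n => /andP[_ lL] /andP[u1 u2].
  rewrite big_mkord (bigD1 (Ordinal lL)) //= u2 ltNge u1 /= mulr1 mulr0 subr0.
  by rewrite lerDl; apply: sumr_ge0 => i _; apply: nn.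
have -> : \sum_(1 <= j < n) T = (\sum_(1 <= j < n) 1) * T.
  by rewrite mulr_suml; apply: eq_bigr => j _; rewrite mul1r.
move: Eu; set U1 := \sum_(0 <= l < L) _; set U2 := \sum_(0 <= l < L) _.
set S1 := \sum_(1 <= j < n) 1; set S2 := \sum_(1 <= j < n) _; set V := _ * _.
by move=> Eu; rewrite subr0 mulrBl [k * T]mulrC => ?; lra.
Qed.

(** ** Growth of the slack *)

Section Growth.
Variables (lam a eta : R).
Hypotheses (lam0 : 0 <= lam) (a0 : 0 <= a) (eta01 : 0 < eta < 1).
(* [a] is the conjugate at [lam] of the costs of the available cuts. *)
Hypothesis conj : forall l T, (l < L)%N -> 0 <= T ->
  lam * (\sum_(1 <= j < n) (d l.+1 j <= T)%R%:R) - (slack (d l) T - slack (d l.+1) T) <= a.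

Let bnd l i := n%:R * lam / eta / ((1 + eta) ^+ l * (1 - eta) ^+ i).

(** Double induction on level and time: [conj] trades slack of level [l] for slack of level [l + 1],
    convexity compares consecutive times, and [bnd] is an exact solution of the resulting averaging
    recurrence. [i * a] accounts for the inhomogeneous term. *)
Lemma slack_grow l i : (l <= L)%N -> slack (d l) (lam * i%:R) <= i%:R * a + bnd l i.
Proof.
case/andP: eta01 => e0 e1.
have A0 : 0 <= n%:R * lam / eta.
  by rewrite divr_ge0 ?mulr_ge0 ?ler0n // ltW.
have p0 k : 0 < (1 + eta) ^+ k by rewrite exprn_gt0 //; lra.
have q0 k : 0 < (1 - eta) ^+ k by rewrite exprn_gt0 //; lra.
have bnd0 k j : 0 <= bnd k j by rewrite /bnd divr_ge0 // mulr_ge0 // ltW.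
elim: l i => [|l IHl] i lL.
  have -> : slack (d 0%N) (lam * i%:R) = (n.-1)%:R * (lam * i%:R).
    rewrite /slack (eq_bigr (fun=> lam * i%:R)) => [|j _]; last first.
      by rewrite d0 subr0 max_r // mulr_ge0.
    by rewrite sumr_const_nat subn1 mulr_natl.
  apply: (@le_trans _ _ (bnd 0%N i)); last by rewrite lerDr mulr_ge0.
  rewrite /bnd expr0 mul1r.
  (* At level 0 the slack is [(n - 1) * lam * i]. It stays below [bnd] because [1 + i * eta <= (1 +
     eta)^i <= (1 - eta)^(-i)]. *)
  have bern : i%:R * eta * (1 - eta) ^+ i <= 1.
    have : 1 + i%:R * eta <= ((1 - eta) ^+ i)^-1.
      rewrite -exprVn; elim: (i) => [|k IH]; first by rewrite mul0r addr0 expr0.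
      have inv1 : 1 + eta <= (1 - eta)^-1.
        by rewrite -[_^-1]mul1r ler_pdivlMr; [nra|lra].
      rewrite exprS; apply: le_trans (ler_pM _ _ inv1 IH); [|lra|].
        have k0 : 0 <= k%:R :> R by [].
        by rewrite -addn1 natrD; nra.
      by rewrite addr_ge0 // mulr_ge0 // ltW.
    rewrite -[X in _ <= X]mul1r ler_pdivlMr // => H; have := q0 i; nra.
  rewrite ler_pdivlMr // ler_pdivlMr //.
  have nn : (n.-1)%:R <= n%:R :> R by rewrite ler_nat leq_pred.
  have -> : (n.-1)%:R * (lam * i%:R) * (1 - eta) ^+ i * eta =
    (n.-1)%:R * lam * (i%:R * eta * (1 - eta) ^+ i) by ring.
  apply: (@le_trans _ _ ((n.-1)%:R * lam * 1)).
    by rewrite ler_wpM2l // mulr_ge0.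
  by rewrite mulr1 ler_wpM2r.
elim: i => [|i IHi].
  rewrite mulr0 mul0r add0r; apply: le_trans (bnd0 _ _).
  rewrite /slack big_nat big1 // => j /andP[_ jn].
  by rewrite max_l // sub0r oppr_le0; apply: (or_d (chain_ord lL)).
have T0 : 0 <= lam * i.+1%:R by rewrite mulr_ge0.
have C := conj lL T0; have H1 := IHl i.+1 (ltnW lL).
(* Convexity in time: over a step of length [lam], the slack grows at most at the rate at its end,
   the number of boundaries open there. *)
have conv : slack (d l.+1) (lam * i.+1%:R) <= slack (d l.+1) (lam * i%:R) +
    lam * (\sum_(1 <= j < n) (d l.+1 j <= lam * i.+1%:R)%R%:R).
  rewrite mulr_sumr -big_split; apply: ler_sum => j _.
  have -> : lam * i.+1%:R = lam * i%:R + lam by rewrite -addn1 natrD; ring.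
  case: (leP (d l.+1 j) (lam * i%:R + lam)) => Hd /=.
    by rewrite mulr1 !maxElt /=; do 2 case: ltP => ?; lra.
  by rewrite mulr0 !maxElt /=; do 2 case: ltP => ?; lra.
have E : bnd l.+1 i + bnd l i.+1 = 2 * bnd l.+1 i.+1.
  rewrite /bnd !exprS; field; rewrite !lt0r_neq0 //; lra.
have Sa : i.+1%:R * a = i%:R * a + a by rewrite -addn1 natrD mulrDl mul1r.
by lra.
Qed.

End Growth.

Lemma bernoulli (x : R) k : -1 <= x -> 1 + k%:R * x <= (1 + x) ^+ k.
Proof.
move=> x1; elim: k => [|k IH]; first by rewrite mul0r addr0 expr0.
rewrite exprS; have k0 : 0 <= k%:R :> R by [].
apply: (@le_trans _ _ ((1 + x) * (1 + k%:R * x))); last by rewrite ler_wpM2l //; lra.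
by rewrite -addn1 natrD; nra.
Qed.

(** [slack_grow] is evaluated at [i = N * q] and [L = (N + 1) * q] for [q = 8 * N * r] and
    [eta = 1 / (2 * N)]. The denominator of [bnd] is the [q]-th power of [(1 - eta^2)^N * (1 + eta)
    >= (1 - eta / 2) * (1 + eta) >= 1 + 1 / (8 * N)], hence at least [2^r >= n]. What is left of the
    initial slack is at most [lam / eta = 2 * N * lam], and division by [i] makes it at most
    [lam / (4 * N)]. The ratio of [L] to [i] is the factor [1 + 1 / N]. *)
Lemma chain_value lam a g k N r : 0 <= lam -> 0 <= a -> (0 < N)%N -> (0 < r)%N ->
  (n <= 2 ^ r)%N -> L = (N.+1 * (8 * N * r))%N ->
  (forall l T, (l < L)%N -> 0 <= T ->
    lam * (\sum_(1 <= j < n) (d l.+1 j <= T)%R%:R) - (slack (d l) T - slack (d l.+1) T) <= a) ->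
  (forall T, 0 <= T -> T * k - slack (d L) T <= L%:R * g) ->
  lam * k - a <= (1 + N%:R^-1) * g + lam / (4 * N%:R).
Proof.
move=> lam0 a0 N0 r0 n2 LE cj Hg.
have NR : 0 < N%:R :> R by rewrite ltr0n.
have N1 : 1 <= N%:R :> R by rewrite ler1n.
pose eta : R := (2 * N%:R)^-1.
have eta01 : 0 < eta < 1.
  by rewrite invr_gt0 mulr_gt0 //= invf_lt1 ?mulr_gt0 //; lra.
have etaN : eta * N%:R = 2^-1 by rewrite /eta; field; rewrite lt0r_neq0.
case/andP: (eta01) => e0 e1.
pose q := (8 * N * r)%N; pose i := (N * q)%N.
have T0 : 0 <= lam * i%:R by rewrite mulr_ge0.
have := slack_grow lam0 a0 eta01 cj i (leqnn L).
have := Hg _ T0.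
have big : n%:R <= (1 + eta) ^+ L * (1 - eta) ^+ i.
  have -> : (1 + eta) ^+ L * (1 - eta) ^+ i = (((1 - eta ^+ 2) ^+ N * (1 + eta)) ^+ (8 * N)) ^+ r.
    have -> : 1 - eta ^+ 2 = (1 + eta) * (1 - eta) by ring.
    rewrite -exprM -/q exprMn -exprM exprMn LE -/q mulSn exprD -/i.
    by move: (_ ^+ q) (_ ^+ i) (_ ^+ i) => x y z; ring.
  apply: (@le_trans _ _ (2 ^+ r)); first by rewrite -natrX ler_nat.
  rewrite lerXn2r ?nnegrE //.
    by rewrite exprn_ge0 // mulr_ge0 // ?exprn_ge0 //; nra.
  have b1 := @bernoulli (- eta ^+ 2) N _.
  have {}b1 : 1 - N%:R * eta ^+ 2 <= (1 - eta ^+ 2) ^+ N.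
    by rewrite -mulrN; apply: b1; nra.
  have b2 : 1 + (8 * N%:R)^-1 <= (1 - eta ^+ 2) ^+ N * (1 + eta).
    apply: (@le_trans _ _ ((1 - N%:R * eta ^+ 2) * (1 + eta))); last by rewrite ler_wpM2r //; lra.
    have -> : (8 * N%:R)^-1 = eta / 4 by rewrite /eta; field; rewrite lt0r_neq0.
    have -> : N%:R * eta ^+ 2 = eta / 2 by rewrite expr2 mulrA [N%:R * _]mulrC etaN; ring.
    have : eta <= 2^-1 by rewrite -etaN; nra.
    nra.
  apply: (@le_trans _ _ ((1 + (8 * N%:R)^-1) ^+ (8 * N))).
    have i0 : 0 <= (8 * N%:R : R)^-1 by rewrite invr_ge0 mulr_ge0.
    have := @bernoulli (8 * N%:R)^-1 (8 * N) _; rewrite natrM divff; last by rewrite mulf_neq0 // lt0r_neq0.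
    by move=> b3; apply: le_trans (b3 _); lra.
  have i0 : 0 <= (8 * N%:R : R)^-1 by rewrite invr_ge0 mulr_ge0.
  by rewrite lerXn2r ?nnegrE //; lra.
set den := _ * _ in big *; move=> H1 H2.
have den0 : 0 < den by rewrite /den mulr_gt0 ?exprn_gt0 //; lra.
have tail : n%:R * lam / eta / den <= 2 * N%:R * lam.
  rewrite ler_pdivrMr // /eta invrK; have : 0 <= 2 * N%:R * lam by rewrite !mulr_ge0.
  by move=> nl; have := ler_wpM2l nl big; lra.
have iR : i%:R = 8 * N%:R * N%:R * r%:R :> R by rewrite /i /q !natrM; ring.
have r1 : 1 <= r%:R :> R by rewrite ler1n.
have i0 : 0 < i%:R :> R by rewrite iR !mulr_gt0 //; lra.
have LR : L%:R = i%:R * (1 + N%:R^-1) :> R.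
  rewrite iR LE !natrM -addn1 natrD; field; rewrite lt0r_neq0 //.
rewrite -(ler_pM2l i0).
have -> : i%:R * ((1 + N%:R^-1) * g + lam / (4 * N%:R)) = L%:R * g + 2 * N%:R * lam * r%:R.
  by rewrite LR iR; field; rewrite lt0r_neq0.
have : 2 * N%:R * lam <= 2 * N%:R * lam * r%:R by rewrite ler_peMr // !mulr_ge0.
by move: H1 H2 tail; lra.
Qed.

End Levels.
End Chain.

(** * Components and spanning trees *)

Section Components.
Import fintype finset fingraph.
Variables (n m : nat) (G : ugraph n m).
Implicit Types F T : {set 'I_m}.

Lemma adjP F u v : reflect (exists2 e, e \in F & ends G e = (u, v) \/ ends G e = (v, u)) (adj G F u v).
Proof.
apply: (iffP existsP) => [[e /andP[eF /orP[/eqP E|/eqP E]]]|[e eF [/eqP E|/eqP E]]].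
- by exists e => //; left.
- by exists e => //; right.
- by exists e; rewrite eF E.
- by exists e; rewrite eF E orbT.
Qed.

Lemma adj_sym F : symmetric (adj G F).
Proof. by move=> u v; apply/adjP/adjP => -[e eF [E|E]]; exists e => //; [right|left|right|left]. Qed.

Lemma conn_sym F : connect_sym (adj G F).
Proof. exact: sym_connect_sym (adj_sym F). Qed.

Lemma adjS F F' u v : F \subset F' -> adj G F u v -> adj G F' u v.
Proof. by move=> /subsetP s /adjP[e eF E]; apply/adjP; exists e => //; apply: s. Qed.

Lemma connS F F' u v : F \subset F' -> connect (adj G F) u v -> connect (adj G F') u v.
Proof. by move=> s; apply: connect_sub => x y xy; apply: connect1; apply: adjS s xy. Qed.

Lemma conn_edge F e : e \in F -> connect (adj G F) (ends G e).1 (ends G e).2.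
Proof. by move=> eF; apply/connect1/adjP; exists e => //; left; case: (ends G e). Qed.

Lemma conn_add F e a b u v : ends G e = (a, b) ->
  connect (adj G (e |: F)) u v -> [\/ connect (adj G F) u v,
    connect (adj G F) u a /\ connect (adj G F) b v | connect (adj G F) u b /\ connect (adj G F) a v].
Proof.
move=> E /connectP[p]; elim: p u => [|w p IH] u /=.
  by move=> _ ->; constructor 1; exact: connect0.
move=> /andP[/adjP[f fF Ef] pw] vE; have {}IH := IH w pw vE.
move: fF; rewrite in_setU1 => /orP[/eqP fe|fF]; last first.
  have uw : connect (adj G F) u w by apply/connect1/adjP; exists f.
  case: IH => [c|[c1 c2]|[c1 c2]].
  - by constructor 1; apply: connect_trans c.
  - by constructor 2; split=> //; apply: connect_trans c1.
  - by constructor 3; split=> //; apply: connect_trans c1.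
rewrite fe E in Ef; case: Ef => [[<- <-]|[<- <-]] in IH *.
- case: IH => [c|[c1 c2]|[c1 c2]].
  + by constructor 2.
  + by constructor 2.
  + by constructor 1.
- case: IH => [c|[c1 c2]|[c1 c2]].
  + by constructor 3.
  + by constructor 1.
  + by constructor 3.
Qed.

Definition cc F := n_comp (adj G F) [set: 'I_n].

Lemma ccE F : cc F = #|[set u | root (adj G F) u == u]|.
Proof. by apply: eq_card => u; rewrite !inE andbT. Qed.

Lemma conn_root F u : connect (adj G F) u (root (adj G F) u).
Proof. exact: connect_root. Qed.

Lemma root_id F u : root (adj G F) (root (adj G F) u) = root (adj G F) u.
Proof. exact: (root_root (conn_sym F)). Qed.

Lemma root_eq F u v : connect (adj G F) u v -> root (adj G F) u = root (adj G F) v.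
Proof. by move/(rootP (conn_sym F)). Qed.

Lemma cc_labels (I : finType) F (f : 'I_n -> I) : (forall u v, adj G F u v -> f u = f v) ->
  (#|[set f u | u : 'I_n]| <= cc F)%N.
Proof.
move=> fF; have fc u v : connect (adj G F) u v -> f u = f v.
  by move/connectP => [p]; elim: p u => [|w p IH] u /=; [move=> _ ->|move=> /andP[/fF -> pw] /IH ->].
rewrite ccE; apply: leq_trans (leq_imset_card f _); apply/subset_leq_card/subsetP => y.
case/imsetP => u _ ->; rewrite (fc _ _ (conn_root F u)); apply: imset_f.
by rewrite inE root_id eqxx.
Qed.

Lemma cc_le F (A : {set 'I_n}) : (forall u, exists2 v, v \in A & connect (adj G F) v u) ->
  (cc F <= #|A|)%N.
Proof.
move=> HA; rewrite ccE; apply: leq_trans (leq_imset_card (root (adj G F)) A).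
apply/subset_leq_card/subsetP => u; rewrite inE => /eqP ru.
by have [v vA /root_eq vu] := HA u; rewrite -ru -vu imset_f.
Qed.

Lemma cc_add_lt F e : ~~ connect (adj G F) (ends G e).1 (ends G e).2 -> (cc (e |: F) < cc F)%N.
Proof.
case E: (ends G e) => [a b] /= ab; set rb := root (adj G F) b.
have rbR : rb \in [set u | root (adj G F) u == u] by rewrite inE root_id eqxx.
rewrite [cc F]ccE (cardsD1 rb) rbR add1n ltnS; apply: cc_le => u.
have sF : F \subset e |: F by rewrite finset.subsetUr.
have [ru|ru] := eqVneq (root (adj G F) u) rb; last first.
  exists (root (adj G F) u); first by rewrite !inE ru root_id eqxx.
  by apply: (connS sF); rewrite conn_sym; exact: conn_root.
exists (root (adj G F) a).
  rewrite !inE root_id eqxx andbT; apply: contraNneq ab => H.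
  by apply/(rootP (conn_sym F)).
apply: connect_trans (connS sF (_ : connect _ b u)).
  apply: connect_trans (connS sF _) _; first by rewrite conn_sym; exact: conn_root.
  by have := @conn_edge (e |: F) e (setU11 _ _); rewrite E.
by apply/(rootP (conn_sym F)); rewrite ru.
Qed.

Lemma cc_add_ge F e : (cc F <= (cc (e |: F)).+1)%N.
Proof.
case E: (ends G e) => [a b]; set rb := root (adj G F) b.
have rbR : rb \in [set u | root (adj G F) u == u] by rewrite inE root_id eqxx.
rewrite [cc F]ccE (cardsD1 rb) rbR add1n ltnS ccE.
rewrite -(card_in_imset (f := root (adj G (e |: F)))) => [|u v].
  by apply/subset_leq_card/subsetP => y /imsetP[u _ ->]; rewrite inE root_id eqxx.
rewrite !inE => /andP[ub /eqP ru] /andP[vb /eqP rv] /(rootP (conn_sym _)).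
move/(conn_add E) => -[/root_eq|[_ /root_eq]|[/root_eq]].
- by rewrite ru rv.
- by rewrite rv => H; rewrite -H eqxx in vb.
- by rewrite ru => H; rewrite H eqxx in ub.
Qed.

Lemma card_cc F : (n <= cc F + #|F|)%N.
Proof.
have [k] := ubnP #|F|; elim: k F => // k IH F Fk.
have [->|[e eF]] := set_0Vmem F.
  rewrite cards0 addn0; have := @cc_labels _ finset.set0 (@id 'I_n).
  rewrite card_imset ?card_ord; last exact: inj_id.
  apply=> u v.
  by move=> /adjP[e]; rewrite inE.
have FE : e |: (F :\ e) = F by rewrite finset.setD1K.
have c1 : #|F| = #|F :\ e|.+1 by rewrite (cardsD1 e) eF.
have := IH (F :\ e) _; have := cc_add_ge (F :\ e) e; rewrite FE c1; rewrite c1 in Fk.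
by move=> h1 h2; have := h2 Fk; lia.
Qed.

Lemma cc_connects F : connects G F -> (cc F <= 1)%N.
Proof.
case: (posnP n) => [n0 _|n0 cF].
  rewrite ccE; apply: leq_trans (max_card _) _; rewrite card_ord; lia.
by rewrite -(cards1 (Ordinal n0)); apply: cc_le => u; exists (Ordinal n0); rewrite ?set11.
Qed.

Lemma tree_size T : connects G T -> (n.-1 <= #|T|)%N.
Proof. by move=> /cc_connects; have := card_cc T; lia. Qed.

Definition connectsb F := [forall u, forall v, connect (adj G F) u v].

Lemma connectsP F : reflect (connects G F) (connectsb F).
Proof. by apply: (iffP forallP) => [H u v|H u]; [have /forallP := H u; apply|apply/forallP]. Qed.

(** Greedy: while [F] does not connect, some edge joins two components, and adding it reduces their
    number. *)
Lemma extend_connects F : connected_graph G ->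
  exists X : {set 'I_m}, [/\ F \subset X, connects G X & (#|X :\: F| <= (cc F).-1)%N].
Proof.
move=> cG; have [k] := ubnP (cc F); elim: k F => // k IH F Fk.
have [/connectsP cF|/connectsP ncF] := boolP (connectsb F).
  by exists F; split=> //; rewrite finset.setDv cards0.
have [e en] : exists e, ~~ connect (adj G F) (ends G e).1 (ends G e).2.
  apply/existsP; apply: contra_notT ncF; rewrite negb_exists => /forallP H u v.
  apply: connect_sub (cG u v) => x y /adjP[e _ E].
  have := H e; rewrite negbK; case: E => -> //=; by rewrite conn_sym.
have lt := cc_add_lt en.
have [|X [sX cX dX]] := IH (e |: F); first by apply: leq_trans lt _; rewrite -ltnS.
exists X; split=> //; first by apply: subset_trans sX; rewrite finset.subsetUr.
have s : X :\: F \subset e |: (X :\: (e |: F)).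
  by apply/subsetP => f; rewrite !inE; case: eqP.
apply: leq_trans (subset_leq_card s) _; apply: leq_trans (leq_card_setU _ _) _.
rewrite cards1; have : (0 < cc (e |: F))%N; last by lia.
rewrite lt0n; apply: contra_notN ncF => /eqP z u.
exfalso; suff : u \in finset.set0 by rewrite inE.
move/eqP: z; rewrite ccE cards_eq0 => /eqP z.
by have : root (adj G (e |: F)) u \in [set u | root (adj G (e |: F)) u == u];
  [rewrite inE root_id eqxx|rewrite z inE].
Qed.

(** A minimal connecting set has no cycle: the first edge of a cycle could be dropped, since the
    rest of the cycle still joins its ends. *)
Lemma prune_tree X : connects G X -> exists2 T : {set 'I_m}, T \subset X & spanning_tree G T.
Proof.
move=> /connectsP cX; have [T /minsetP[/connectsP cT Tmin] TX] := minset_exists (P := connectsb) cX.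
exists T => //; split=> // p /andP[cyc up]; rewrite ltnNge; apply/negP => p3.
case: p cyc up p3 => [|x [|y [|z q]]] //= /and3P[xy yz pth] /and4P[xN yN zN uq] _.
have [e eT Ee] := adjP _ _ _ xy.
have other a b : a != x -> a != y -> adj G T a b -> adj G (T :\ e) a b.
  move=> ax ay /adjP[f fT Ef]; apply/adjP; exists f => //; rewrite !inE fT andbT.
  apply/eqP => fe; rewrite fe in Ef; case: Ee Ef => -> [[E1 E2]|[E1 E2]];
    by rewrite ?E1 ?E2 ?eqxx in ax ay.
move: xN yN; rewrite !inE !negb_or => /and3P[xy' xz xq] /andP[yz' yq].
have pz : connect (adj G (T :\ e)) z x.
  apply/connectP; exists (rcons q x); last by rewrite last_rcons.
  have zx : z != x by rewrite eq_sym. have zy : z != y by rewrite eq_sym.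
  elim: (q) z zx zy pth xq yq {yz zN uq xz yz'} => [|w q' IH] z zx zy /=.
    by rewrite !andbT => pth _ _; apply: other.
  move=> /andP[zw pth]; rewrite !inE !negb_or => /andP[xw xq] /andP[yw yq].
  by rewrite other //=; apply: IH => //; rewrite eq_sym.
have yx : connect (adj G (T :\ e)) y x.
  apply: connect_trans pz; apply: connect1; rewrite adj_sym; apply: other; rewrite 1?eq_sym //.
  by rewrite adj_sym.
have cT' : connects G (T :\ e).
  move=> u v; apply: connect_sub (cT u v) => a b /adjP[f fT Ef].
  have [fe|fe] := eqVneq f e; last by apply/connect1/adjP; exists f; rewrite // !inE fe.
  rewrite fe in Ef; case: Ee Ef => -> [[<- <-]|[<- <-]] //; by rewrite conn_sym.
have /(_ (subD1set _ _)) H := Tmin _ (introT (connectsP _) cT').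
by have := setD11 e T; rewrite H eT.
Qed.

End Components.

Definition ext (m : nat) (T : Type) (x0 : T) (f : 'I_m -> T) (e : nat) : T :=
  if insub e is Some e' then f e' else x0.

Lemma ext_ord m T (x0 : T) (f : 'I_m -> T) (e : 'I_m) : ext x0 f e = f e.
Proof. by rewrite /ext valK. Qed.

Section Relaxation.
Import fintype finset fingraph.
Variables (R : realType) (n m : nat) (G : ugraph n m) (c : 'I_m -> R) (k : nat).
Hypothesis cG : connected_graph G.

Definition end1 := ext 0%N (fun e => (ends G e).1 : nat).
Definition end2 := ext 0%N (fun e => (ends G e).2 : nat).

Lemma end1_ord (e : 'I_m) : end1 e = (ends G e).1.
Proof. exact: ext_ord. Qed.

Lemma end2_ord (e : 'I_m) : end2 e = (ends G e).2.
Proof. exact: ext_ord. Qed.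

(** [S] leaves at most [1 + #B] components, so at most [#B] further edges make it connecting. Each
    of them costs at most 1 by [x e <= 1], and a spanning tree inside the result has value at least
    [k - 1]. *)
Lemma lp_covers (x : 'I_m -> R) : lp_feasible G k x -> covers n m end1 end2 (ext 0 x) (k%:R - 1).
Proof.
case=> xT x01 S B w wlt winj HE.
have sumS : \sum_(0 <= e < m | S e) ext 0 x e = \sum_(e in [set e : 'I_m | S e]) x e.
  rewrite big_mkord; apply: eq_big => [e|e _]; [by rewrite inE|exact: ext_ord].
rewrite sumS; set F := [set e : 'I_m | S e].
(* Equality is added to make [E] reflexive also at numbers that are not vertices. *)
pose E a b := a = b \/ exists u v : 'I_n, [/\ u = a :> nat, v = b :> nat & connect (adj G F) u v].
have eE : equivalence E.
  split=> [a|a b|a b d]; first by left.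
    case=> [->|[u [v [<- <- uv]]]]; [by left|right].
    by exists v, u; split=> //; rewrite conn_sym.
  case=> [->//|[u [v [<- <- uv]]]] [<-|[u' [v' [/val_inj -> <- uv']]]]; right.
    by exists u, v.
  by exists u, v'; split=> //; apply: connect_trans uv'.
have ES e : (e < m)%N -> S e -> E (end1 e) (end2 e).
  move=> em Se; right; exists (ends G (Ordinal em)).1, (ends G (Ordinal em)).2.
  split; [exact/esym/(end1_ord (Ordinal em))|exact/esym/(end2_ord (Ordinal em))|].
  by apply: conn_edge; rewrite inE.
have {}HE j := HE E eE ES j.
(* Every vertex is joined to the nearest earlier position that is first or lies behind a boundary of
   [B]; these positions represent all components. *)
have ccF : (cc G F <= 1 + \sum_(1 <= j < n) B j)%N.
  case: (posnP n) => [n0|n0].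
    rewrite ccE; apply: leq_trans (max_card _) _; rewrite card_ord; lia.
  pose A := [set Ordinal (wlt j (ltn_ord j)) | j : 'I_n & (val j == 0%N) || B j].
  apply: (@leq_trans #|A|).
    apply: cc_le => u.
    have [j ju] : exists j : 'I_n, w j = u.
      have inj : injective (fun j : 'I_n => Ordinal (wlt j (ltn_ord j))).
        by move=> i j [] /winj H; apply: val_inj; apply: H.
      have /imsetP[j _ ->] : u \in [set Ordinal (wlt j (ltn_ord j)) | j : 'I_n].
        suff -> : [set Ordinal (wlt j (ltn_ord j)) | j : 'I_n] = finset.setT by rewrite inE.
        by apply/eqP; rewrite eqEcard finset.subsetT /= cardsT card_imset.
      by exists j.
    suff main i : (i < n)%N -> exists2 v, v \in A & E v (w i).
      have [v vA [E1|[a [b [/val_inj -> E2 ab]]]]] := main j (ltn_ord j).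
        by exists v => //; rewrite (_ : v = u) ?connect0 //; apply: val_inj; rewrite /= E1.
      by exists v => //; rewrite (_ : u = b) //; apply: val_inj; rewrite /= E2.
    elim: i => [|i IH] lin.
      exists (Ordinal (wlt 0%N n0)); last by left.
      by apply/imsetP; exists (Ordinal n0); [rewrite inE|apply: val_inj].
    have [Bi|nBi] := boolP (B i.+1).
      exists (Ordinal (wlt _ lin)); last by left.
      by apply/imsetP; exists (Ordinal lin); [rewrite inE /= Bi|apply: val_inj].
    have [v vA Ev] := IH (ltnW lin); exists v => //.
    by apply: (eq_trs eE Ev); apply: (HE i.+1).
  apply: leq_trans (leq_imset_card _ _) _; rewrite -sum1_card big_mkcond /=.
  apply: (@leq_trans (\sum_(0 <= j < n) ((j == 0%N) || B j))%N).
    by rewrite big_mkord; apply: leq_sum => j _; rewrite inE; case: (_ || _).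
  by rewrite big_ltn //= leq_add2l big_nat [X in (_ <= X)%N]big_nat; apply: leq_sum => -[|j].
have [X [FX cX dX]] := extend_connects F cG.
have [T TX sT] := prune_tree cX.
have xle : \sum_(e in T) x e <= \sum_(e in F) x e + \sum_(e in X :\: F) 1.
  rewrite big_mkcond [\sum_(e in F) _]big_mkcond [\sum_(e in _ :\: _) _]big_mkcond -big_split.
  apply: ler_sum => e _; case/andP: (x01 e) => x0 x1; rewrite /= finset.in_setD.
  case: (boolP (e \in T)) => [/(subsetP TX) -> |_]; rewrite ?andbT.
    by case: (e \in F) => /=; lra.
  by case: (e \in F) => /=; case: (e \in X) => /=; lra.
have := xT T sT; move=> H; apply: le_trans (_ : _ <= \sum_(e in T) x e - \sum_(1 <= j < n) (B j)%:R) _.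
  by rewrite lerD2r.
rewrite lerBlDr; apply: le_trans xle _; rewrite lerD2l sumr_const -natr_sum ler_nat.
by apply: leq_trans dX _; lia.
Qed.

Hypothesis kn : (k <= n)%N.

Lemma lp_feasible_one : lp_feasible G k (fun=> 1 : R).
Proof.
split=> [T [cT _]|e]; last by rewrite ler01 lexx.
rewrite sumr_const lerBlDr natr1 ler_nat; have := tree_size cT; lia.
Qed.

(** The infimum of the empty set would be a default value. Nonemptiness is witnessed by the all-one
    vector, whose feasibility rests on [k <= n], since a connecting set has at least [n - 1]
    edges. *)
Lemma lp_lower g : (forall x, lp_feasible G k x -> g <= \sum_e c e * x e) ->
  g <= lp_optimum G c k.
Proof.
move=> H; apply: lb_le_inf; last by move=> _ [x /H gx <-].
by eexists; exists (fun=> 1); [exact: lp_feasible_one|reflexivity].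
Qed.

Lemma chain_lp_optimum L vt d : (forall e, 0 < c e) -> (0 < n)%N -> (0 < L)%N ->
  (forall j, d 0%N j = 0) -> ordering n (vt 0%N) (d 0%N) ->
  (forall l, (l < L)%N -> level n m end1 end2 (ext 0 c) (vt l) (d l) (vt l.+1) (d l.+1)) ->
  forall T, 0 <= T -> T * (k%:R - 1) - slack n (d L) T <= L%:R * lp_optimum G c k.
Proof.
move=> c0 n0 L0 d0 o0 lev T T0; rewrite [X in _ <= X]mulrC -ler_pdivrMr ?ltr0n //.
apply: lp_lower => x Fx; rewrite ler_pdivrMr ?ltr0n // [X in _ <= X]mulrC.
have ce e : (e < m)%N -> 0 < ext 0 c e by move=> em; rewrite -[e]/(val (Ordinal em)) ext_ord.
have := chain_lp ce d0 lev o0 _ (lp_covers Fx) T0.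
rewrite big_mkord; under eq_bigr do rewrite !ext_ord; apply=> e em.
by rewrite -[e]/(val (Ordinal em)) ext_ord; case: Fx => _ /(_ (Ordinal em)) /andP[].
Qed.

Lemma kcut_labels (I : finType) (f : 'I_n -> I) (C : {set 'I_m}) :
  (forall e, e \notin C -> f (ends G e).1 = f (ends G e).2) ->
  (k <= #|[set f u | u : 'I_n]|)%N -> is_kcut G k C.
Proof.
move=> HC kf; apply: leq_trans kf _; apply: cc_labels => u v /adjP[e].
by rewrite inE => /HC E [] H; rewrite H in E.
Qed.

End Relaxation.

(** * The tournament tree *)

Arguments upd1 {T} f x v y /.
Arguments upd2 {T} f a i v b /.

Declare Scope ix_scope.
Delimit Scope ix_scope with ix.
Bind Scope ix_scope with iexp.
Notation "a + b" := (IBin IAdd a b) : ix_scope.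
Notation "a - b" := (IBin ISub a b) : ix_scope.
Notation "a * b" := (IBin IMul a b) : ix_scope.
Notation "a / b" := (IBin IDiv a b) : ix_scope.
Notation "a %% b" := (IBin IMod a b) : ix_scope.
Notation "$ x" := (IVar x) (at level 8, format "$ x") : ix_scope.
Notation "# a" := (ICst a) (at level 8, format "# a") : ix_scope.
Declare Scope rx_scope.
Delimit Scope rx_scope with rx.
Bind Scope rx_scope with rexp.
Notation "a + b" := (RBin RAdd a b) : rx_scope.
Notation "a - b" := (RBin RSub a b) : rx_scope.
Notation "a * b" := (RBin RMul a b) : rx_scope.
Notation "a / b" := (RBin RDiv a b) : rx_scope.
Notation "$ x" := (RVar x) : rx_scope.
Notation "# a" := (RInt (ICst a)) : rx_scope.
Notation "a ;; b" := (Then a b) (at level 90, right associativity).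

Notation vn := 0%N. Notation vm := 1%N. Notation vk := 2%N. Notation vN := 3%N.
Notation vM := 4%N. Notation vr := 5%N. Notation vL := 6%N. Notation vx := 7%N.
Notation vp := 8%N. Notation vj := 9%N. Notation vh := 10%N. Notation vl := 11%N.
Notation vb := 12%N. Notation vu := 13%N. Notation vi := 14%N. Notation vq := 15%N.
Notation vp1 := 16%N. Notation vp2 := 17%N. Notation vl1 := 18%N. Notation vl2 := 19%N.
Notation va := 20%N. Notation vc := 21%N.

Notation xeps := 0%N. Notation xv := 1%N. Notation xA := 2%N. Notation xL := 3%N.
Notation xR := 4%N. Notation xT := 5%N. Notation xs := 6%N. Notation xt := 7%N.
Notation xg := 8%N. Notation xlo := 9%N. Notation xhi := 10%N. Notation xgap := 11%N.

Notation aM := 0%N. Notation aL := 1%N. Notation aR := 2%N. Notation aG := 3%N.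

(** For the leaves below a node, [aM] is the smallest boundary and [aG] the largest link. [aL] is
    the supremum of the times at which a walk entering from the left, through boundaries not yet
    open, reaches a position still linked; [aR] is the same from the right. A boundary belongs to
    the position behind it, so only the walk from the left crosses the boundary of the first
    leaf. *)
Definition NODE :=
  PutR aM $vx (RMin (RArr aM ($vx * #2)) (RArr aM ($vx * #2 + #1))) ;;
  PutR aL $vx (RMax (RArr aL ($vx * #2)) (RMin (RArr aM ($vx * #2)) (RArr aL ($vx * #2 + #1)))) ;;
  PutR aR $vx (RMax (RArr aR ($vx * #2 + #1)) (RMin (RArr aM ($vx * #2 + #1)) (RArr aR ($vx * #2)))) ;;
  PutR aG $vx (RMax (RArr aG ($vx * #2)) (RArr aG ($vx * #2 + #1))).

Definition BUILD :=
  SetI vx $vM ;; Loop (CI #1 $vx) (SetI vx ($vx - #1) ;; NODE).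

Definition SETLEAF :=
  PutR aG ($vM + $vp) $xv ;; PutR aR ($vM + $vp) $xv ;;
  PutR aL ($vM + $vp) (RMin $xv (RArr aM ($vM + $vp))) ;;
  SetI vx (($vM + $vp) / #2) ;;
  Loop (CI #0 $vx) (NODE ;; SetI vx ($vx / #2)).

Definition ARGMAX :=
  SetI vx #1 ;;
  Loop (CI $vx $vM)
    (Cond (CR (RArr aG ($vx * #2)) (RArr aG ($vx * #2 + #1)))
       (SetI vx ($vx * #2 + #1)) (SetI vx ($vx * #2))) ;;
  SetI vp ($vx - $vM) ;; SetR xT (RArr aG #1).

(** Climbing from leaf [vp], [xA] is the answer within the current subtree, and [xL], [xR] are the
    smallest boundaries between [vp] and its two ends. [xR] starts as the minimum of no boundary;
    any value above all links, such as the largest link plus 1, serves as infinity. *)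
Definition QUERY :=
  SetI vx ($vM + $vp) ;; SetR xA (RArr aG $vx) ;; SetR xL (RArr aM $vx) ;;
  SetR xR (RArr aG #1 + #1) ;;
  Loop (CI #1 $vx)
    (Cond (CI #0 ($vx %% #2))
       (SetR xA (RMax $xA (RMin $xL (RArr aR ($vx - #1)))) ;;
        SetR xL (RMin $xL (RArr aM ($vx - #1))))
       (SetR xA (RMax $xA (RMin $xR (RArr aL ($vx + #1)))) ;;
        SetR xR (RMin $xR (RArr aM ($vx + #1)))) ;;
     SetI vx ($vx / #2)).

Ltac hstep := lazymatch goal with
  | |- run _ _ (Then _ _) _ _ _ => apply: run_Then
  | |- run _ _ (SetR _ _) _ _ _ => apply: run_SetR
  | |- run _ _ (PutR _ _ _) _ _ _ => apply: run_PutR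
  | |- run _ _ Skip _ _ _ => apply: run_Skip
  | |- run _ _ (SetI _ _) _ _ _ => apply: run_SetI; [rewrite /=|]
  | |- run _ _ (PutI _ _ _) _ _ _ => apply: run_PutI; [rewrite /=|]
  end.

Section Tree.
Variables (R : realType) (X B : nat).
Implicit Types (h : hst R) (A : nat -> nat -> R) (d g : nat -> R).

Definition node_ok A y := [/\
  A aM y = Num.min (A aM (y * 2)%N) (A aM (y * 2 + 1)%N),
  A aL y = Num.max (A aL (y * 2)%N) (Num.min (A aM (y * 2)%N) (A aL (y * 2 + 1)%N)),
  A aR y = Num.max (A aR (y * 2 + 1)%N) (Num.min (A aM (y * 2 + 1)%N) (A aR (y * 2)%N)) &
  A aG y = Num.max (A aG (y * 2)%N) (A aG (y * 2 + 1)%N)].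

Record leaves A M d g : Prop := Leaves {
  leaf_M : forall p, (p < M)%N -> A aM (M + p)%N = d p;
  leaf_L : forall p, (p < M)%N -> A aL (M + p)%N = Num.min (g p) (d p);
  leaf_R : forall p, (p < M)%N -> A aR (M + p)%N = g p;
  leaf_G : forall p, (p < M)%N -> A aG (M + p)%N = g p }.

Definition tree A M d g := (forall y, (0 < y < M)%N -> node_ok A y) /\ leaves A M d g.

Definition same_but A A' x := forall a y, y != x -> A' a y = A a y.

Lemma node_other A A' x y : same_but A A' x -> y != x -> (y * 2 != x)%N -> (y * 2 + 1 != x)%N ->
  node_ok A y -> node_ok A' y.
Proof. by move=> S a b c [e1 e2 e3 e4]; split; rewrite !S. Qed.

Lemma leaves_other A A' x M d g : same_but A A' x -> (x < M)%N -> leaves A M d g -> leaves A' M d g.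
Proof.
move=> S xM [l1 l2 l3 l4].
by split=> p pM; rewrite S ?l1 ?l2 ?l3 ?l4 //; apply: contraTN xM => /eqP <-; lia.
Qed.

Lemma run_NODE Q h k x : iv h vx = x -> (0 < x)%N ->
  (forall A', (forall a y, y != x -> A' a y = ra h a y) -> node_ok A' x ->
    Q (HSt (iv h) (rv h) (ia h) A' (iw h) (rw h)) k) ->
  run X B NODE Q h k.
Proof.
move=> hx x0 HQ; rewrite /NODE; do 7 hstep.
rewrite /= hx.
have E1 : (x * 2 == x)%N = false by lia.
have E2 : (x * 2 + 1 == x)%N = false by lia.
apply: HQ; last by split; rewrite /= ?E1 ?E2 ?eqxx.
by move=> a y /negbTE yx /=; case: a => [|[|[|[|a]]]] /=; rewrite ?yx.
Qed.

Lemma run_BUILD M d g Q h k : iv h vM = M -> (0 < M <= X)%N -> leaves (ra h) M d g ->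
  (M <= k)%N ->
  (forall h' k', agree BUILD h h' -> tree (ra h') M d g ->
     (k <= k' + M)%N -> Q h' k') ->
  run X B BUILD Q h k.
Proof.
move=> hM MX lv Mk HQ.
suff : run X B BUILD (fun h' k' => tree (ra h') M d g /\ (k <= k' + M)%N) h k.
  by move/run_mono; apply=> h' k' a _ [t l]; apply: HQ.
rewrite /BUILD; do 2 hstep; first by rewrite hM; lia.
apply: (run_Loop (I := fun h' k' => [/\ (0 < iv h' vx <= M)%N, leaves (ra h') M d g,
  (k + iv h' vx <= k' + M)%N & forall y, (iv h' vx <= y < M)%N -> node_ok (ra h') y])).
- move=> h' k' _ [/andP[x0 xM] lv' kk ok] /= x1; split; first by lia.
  do 2 hstep; first by lia.
  apply: (run_NODE (x := (iv h' vx - 1)%N)); [by []|by rewrite /=; lia|].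
  move=> A' S nA /=; split; [lia|apply: leaves_other S _ lv'; lia|lia|].
  move=> y yi; have [->//|yx] := eqVneq y (iv h' vx - 1)%N.
  by apply: (node_other S) => //; [lia|lia|apply: ok; lia].
- move=> h' k' _ _ [/andP[x0 xM] lv' kk ok] /= x1; have x1' : iv h' vx = 1%N by lia.
  by split; [split=> // y yi; apply: ok; rewrite x1'|lia].
- by rewrite /= hM; split=> //; lia.
Qed.

Lemma run_SETLEAF M r d g Q h k p : iv h vM = M -> M = (2 ^ r)%N -> (M * 2 <= X)%N ->
  iv h vp = p -> (p < M)%N -> tree (ra h) M d g -> (r <= k)%N ->
  (forall h' k', agree SETLEAF h h' ->
     tree (ra h') M d (fun q => if q == p then rv h xv else g q) ->
     (k <= k' + r)%N -> Q h' k') ->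
  run X B SETLEAF Q h k.
Proof.
move=> hM Mr MX hp pM [nd lv] rk HQ; set g' := fun q => _ in HQ.
suff : run X B SETLEAF (fun h' k' => tree (ra h') M d g' /\ (k <= k' + r)%N) h k.
  by move/run_mono; apply=> h' k' a _ [t l]; apply: HQ.
have M0 : (0 < M)%N by rewrite Mr expn_gt0.
rewrite /SETLEAF; do 8 hstep; first by rewrite hM hp; apply: leq_trans MX; apply: leq_trans (leq_div _ _) _; lia.
rewrite /= hM hp.
set h3 := putR (putR (putR h _ _ _) _ _ _) _ _ _; pose A := ra h3.
have lv' : leaves A M d g'.
  case: lv => l1 l2 l3 l4; split=> q qM; rewrite /A /h3 /=.
  - exact: l1.
  - rewrite eqn_add2l /g'; case: eqP => [->|_]; last exact: l2.
    by rewrite l1.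
  - by rewrite eqn_add2l /g'; case: eqP => // _; apply: l3.
  - by rewrite eqn_add2l /g'; case: eqP => // _; apply: l4.
have nd' y : (0 < y < M)%N -> (y * 2 != M + p)%N -> (y * 2 + 1 != M + p)%N -> node_ok A y.
  move=> yM a b; apply: (@node_other (ra h) A (M + p)%N) => //; [|by lia|exact: nd].
  by move=> c z /negbTE zN; rewrite /A /h3 /=; case: c => [|[|[|[|c]]]] /=; rewrite ?zN.
(* Only the current node and its ancestors may be out of date. The exponent [i] bounds the steps to
   the root. *)
apply: (run_Loop (I := fun h' k' => exists i, [/\ (iv h' vx < 2 ^ i)%N, (k + i <= k' + r)%N,
  (iv h' vx < M)%N, leaves (ra h') M d g' & forall y, (0 < y < M)%N ->
    (forall j, y != iv h' vx %/ 2 ^ j)%N -> node_ok (ra h') y])).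
- move=> h' k' ag [i [xi ki xM lvx ok]] /= x0.
  have i0 : (0 < i)%N by case: i xi {ki} => // xi; rewrite expn0 in xi; lia.
  split; first by lia.
  hstep; apply: (run_NODE (x := iv h' vx)) => // A' S nA; hstep; first by lia.
  exists i.-1; rewrite /=; split; [|lia|lia|exact: leaves_other S xM lvx|].
    by rewrite ltn_divLR // -expnSr prednK.
  move=> y yM yN; have [->//|yx] := eqVneq y (iv h' vx).
  apply: (node_other S) => //.
  + by have := yN 0%N; rewrite expn0 divn1; apply: contra => /eqP <-; rewrite mulnK.
  + have := yN 0%N; rewrite expn0 divn1; apply: contra => /eqP <-.
    by rewrite divnMDl // divn_small // addn0.
  + apply: ok => // -[|j]; first by rewrite expn0 divn1.
    by have := yN j; rewrite -divnMA -expnS.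
- move=> h' k' ag _ [i [xi ki xM lvx ok]] /=; rewrite -leqNgt leqn0 => /eqP x0.
  split; last by lia.
  by split=> // y yM; apply: ok => // j; rewrite x0 div0n; lia.
- exists r; rewrite /=; split; [|lia| |exact: lv'|].
  + by rewrite ltn_divLR // mulnC; move: pM; rewrite Mr; lia.
  + by rewrite ltn_divLR //; lia.
  + move=> y yM yN; apply: nd' => //.
      by have := yN 0%N; rewrite expn0 divn1; apply: contra => /eqP <-; rewrite mulnK.
    have := yN 0%N; rewrite expn0 divn1; apply: contra => /eqP <-.
    by rewrite divnMDl // divn_small // addn0.
Qed.

Lemma tree_max M d g A y : tree A M d g -> (0 < y < 2 * M)%N -> A aG y <= A aG 1%N.
Proof.
move=> [nd _]; elim/ltn_ind: y => y IH yM.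
have [->//|y1] := eqVneq y 1%N.
have le2 : A aG y <= A aG (y %/ 2)%N.
  have hM : (0 < y %/ 2 < M)%N by rewrite divn_gt0 // ltn_divLR //; lia.
  have [_ _ _ ->] := nd _ hM.
  rewrite le_max; have [E|E] : y = (y %/ 2 * 2)%N \/ y = (y %/ 2 * 2 + 1)%N by lia.
    by rewrite -E lexx.
  by rewrite -E lexx orbT.
apply: le_trans le2 (IH _ _ _); first by rewrite ltn_Pdiv //; lia.
by rewrite divn_gt0 //; have := leq_div y 2; lia.
Qed.

Lemma run_ARGMAX M r d g Q h k : iv h vM = M -> M = (2 ^ r)%N -> (M * 2 <= X)%N ->
  tree (ra h) M d g -> (r <= k)%N ->
  (forall h' k', agree ARGMAX h h' -> (iv h' vp < M)%N -> rv h' xT = g (iv h' vp) ->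
     (forall q, (q < M)%N -> g q <= g (iv h' vp)) -> (k <= k' + r)%N -> Q h' k') ->
  run X B ARGMAX Q h k.
Proof.
move=> hM Mr MX tr rk HQ; have M0 : (0 < M)%N by rewrite Mr expn_gt0.
suff : run X B ARGMAX (fun h' k' => [/\ (iv h' vp < M)%N, rv h' xT = g (iv h' vp),
    forall q, (q < M)%N -> g q <= g (iv h' vp) & (k <= k' + r)%N]) h k.
  by move/run_mono; apply=> h' k' a _ [t1 t2 t3 l]; apply: HQ.
rewrite /ARGMAX; do 2 hstep; first by lia.
hstep; apply: (run_Loop (I := fun h' k' => exists i, [/\ (M <= iv h' vx * 2 ^ i)%N,
  (k + i <= k' + r)%N, (0 < iv h' vx < 2 * M)%N & ra h' aG (iv h' vx) = ra h aG 1%N])).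
- move=> h' k' [a1 _ a3 a4 _ _] [i [xi ki /andP[x0 xM] xG]] /= xlt.
  have h'M : iv h' vM = M by rewrite a1 //= hM.
  have raE : ra h' aG = ra h aG by rewrite a4.
  rewrite h'M in xlt.
  have i0 : (0 < i)%N by case: i xi {ki} => // xi; rewrite expn0 in xi; lia.
  split; first by lia.
  have x0M : (0 < iv h' vx < M)%N by rewrite x0 xlt.
  have [_ _ _ nG] := tr.1 _ x0M; rewrite raE nG in xG.
  have ex : (2 ^ i = 2 * 2 ^ i.-1)%N by rewrite -expnS prednK.
  apply: run_Cond => /= c; rewrite raE in c; apply: run_SetI; rewrite /= ?raE; try lia;
    exists i.-1; split; rewrite /= ?raE; try (rewrite ex in xi; nia); try lia.
  + by rewrite -xG max_r // ltW.
  + by rewrite -xG max_l // leNgt.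
- move=> h' k' [a1 _ a3 a4 _ _] _ [i [xi ki /andP[x0 xM] xG]] /=.
  have h'M : iv h' vM = M by rewrite a1 //= hM.
  have raE : ra h' aG = ra h aG by rewrite a4.
  rewrite h'M -leqNgt => Mx; hstep; hstep; first by lia.
  hstep; rewrite /= h'M.
  have pM : (iv h' vx - M < M)%N by lia.
  have gE : g (iv h' vx - M)%N = ra h aG 1%N.
    by rewrite -xG raE -(leaf_G tr.2 pM) subnKC.
  split=> //; [by rewrite raE gE| |lia].
  by move=> q qM; rewrite gE -(leaf_G tr.2 qM); apply: tree_max tr _; lia.
- by exists r; split=> /=; rewrite ?mul1n ?Mr //; lia.
Qed.

(** Values are described by the times below them: [t < v] turns minima and maxima into conjunctions
    and existence, and this is the form in which blocks and [ma_scan] speak of times. *)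
Lemma node_sem A M r d g t : tree A M d g -> M = (2 ^ r)%N ->
  forall i y, (M <= y * 2 ^ i < 2 * M)%N -> let a := (y * 2 ^ i - M)%N in
  [/\ (t < A aM y) <-> (forall q, (a <= q < a + 2 ^ i)%N -> t < d q),
      (t < A aL y) <-> (exists w, [/\ (a <= w < a + 2 ^ i)%N, t < g w &
         forall q, (a <= q <= w)%N -> t < d q]) &
      (t < A aR y) <-> (exists w, [/\ (a <= w < a + 2 ^ i)%N, t < g w &
         forall q, (w < q < a + 2 ^ i)%N -> t < d q])].
Proof.
move=> [nd lv] Mr; elim=> [|i IH] y yi a.
  have [q qM yE] : exists2 q, (q < M)%N & y = (M + q)%N.
    by exists (y - M)%N; rewrite expn0 in yi; lia.
  have aE : a = q by rewrite /a yE expn0; lia.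
  rewrite aE yE (leaf_M lv qM) (leaf_L lv qM) (leaf_R lv qM) expn0; split.
  - by split=> [lt q' qi|]; [have -> : q' = q by lia|apply; lia].
  - rewrite lt_min; split=> [/andP[l1 l2]|[w [wi l1 H]]].
      by exists q; split=> //; [lia|move=> q' qi; have -> : q' = q by lia].
    have wq : w = q by lia.
    by rewrite -wq l1; apply: H; lia.
  - split=> [l1|[w [wi l1 H]]]; last by have <- : w = q by lia.
    by exists q; split=> //; [lia|move=> q'; lia].
rewrite expnS in yi a *.
have y0M : (0 < y < M)%N.
  have p0 : (0 < 2 ^ i)%N by rewrite expn_gt0.
  by nia.
have [e1 e2 e3 _] := nd y y0M.
have y1 : (M <= y * 2 * 2 ^ i < 2 * M)%N by rewrite -mulnA.
have y2 : (M <= (y * 2 + 1) * 2 ^ i < 2 * M)%N.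
  have p0 : (0 < 2 ^ i)%N by rewrite expn_gt0.
  rewrite mulnDl mul1n -mulnA.
  apply/andP; split; first by lia.
  case: (leqP i r) => ir; last first.
    have : (2 ^ r < 2 ^ i)%N by rewrite ltn_exp2l.
    by rewrite -Mr; nia.
  have [z Mz] : exists z, M = (z * 2 ^ i)%N by exists (2 ^ (r - i))%N; rewrite -expnD subnK.
  rewrite Mz in yi *; have yz : (y < z)%N by rewrite -(ltn_pmul2r p0); lia.
  by have := leq_mul2r (2 ^ i) y.+1 z; rewrite yz orbT mulSn; lia.
have := IH _ y1; have := IH _ y2.
have -> : (y * 2 * 2 ^ i - M)%N = a by rewrite /a -mulnA.
have -> : ((y * 2 + 1) * 2 ^ i - M)%N = (a + 2 ^ i)%N by rewrite /a mulnDl mul1n -mulnA; lia.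
move=> [M2 L2 R2] [M1 L1 R1]; rewrite e1 e2 e3.
have p0 : (0 < 2 ^ i)%N by rewrite expn_gt0.
move: (2 ^ i)%N p0 M1 L1 R1 M2 L2 R2 => s p0 M1 L1 R1 M2 L2 R2.
clear -M1 L1 R1 M2 L2 R2 p0; split.
- rewrite lt_min; split=> [/andP[/M1 H1 /M2 H2] q qi|H].
    by case: (ltnP q (a + s)) => qs; [apply: H1|apply: H2]; lia.
  by apply/andP; split; [apply/M1|apply/M2] => q qi; apply: H; lia.
- rewrite lt_max lt_min; split.
    case/orP=> [/L1[w [wi wg H]]|/andP[/M1 H1 /L2[w [wi wg H]]]].
      by exists w; split=> //; lia.
    exists w; split=> //; [lia|] => q qi.
    by case: (ltnP q (a + s)) => qs; [apply: H1|apply: H]; lia.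
  move=> [w [wi wg H]]; case: (ltnP w (a + s)) => ws; apply/orP.
    by left; apply/L1; exists w; split=> //; lia.
  right; apply/andP; split; first by apply/M1 => q qi; apply: H; lia.
  by apply/L2; exists w; split=> //; [lia|move=> q qi; apply: H; lia].
- rewrite lt_max lt_min; split.
    case/orP=> [/R2[w [wi wg H]]|/andP[/M2 H2 /R1[w [wi wg H]]]].
      by exists w; split=> //; [lia|move=> q qi; apply: H; lia].
    exists w; split=> //; [lia|] => q qi.
    by case: (ltnP q (a + s)) => qs; [apply: H|apply: H2]; lia.
  move=> [w [wi wg H]]; case: (ltnP w (a + s)) => ws; apply/orP; last first.
    by left; apply/R2; exists w; split=> //; [lia|move=> q qi; apply: H; lia].
  right; apply/andP; split; first by apply/M2 => q qi; apply: H; lia.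
  by apply/R1; exists w; split=> //; [lia|move=> q qi; apply: H; lia].
Qed.

Lemma run_QUERY M r d g Q h k p : iv h vM = M -> M = (2 ^ r)%N -> (M * 2 <= X)%N ->
  iv h vp = p -> (p < M)%N -> tree (ra h) M d g -> (r <= k)%N ->
  (forall h' k', agree QUERY h h' ->
     (forall t, t < rv h' xA <-> exists2 w, (w < M)%N & (t < g w) && same d t p w) ->
     (k <= k' + r)%N -> Q h' k') ->
  run X B QUERY Q h k.
Proof.
move=> hM Mr MX hp pM tr rk HQ; have M0 : (0 < M)%N by rewrite Mr expn_gt0.
suff : run X B QUERY (fun h' k' => (forall t, t < rv h' xA <->
    exists2 w, (w < M)%N & (t < g w) && same d t p w) /\ (k <= k' + r)%N) h k.
  by move/run_mono; apply=> h' k' a _ [t1 l]; apply: HQ.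
have gmax t w : (w < M)%N -> t < g w -> t < ra h aG 1%N.
  move=> wM; rewrite -(leaf_G tr.2 wM) => /lt_le_trans; apply.
  by apply: tree_max tr _; lia.
rewrite /QUERY; do 2 hstep; first by rewrite hM hp; lia.
do 6 hstep; rewrite /= hM hp.
(* The current subtree spans the [2^i] leaves from [a], among them [p]. The meaning of [xR] is
   claimed only below the largest link, since its initial value is finite. *)
apply: (run_Loop (I := fun h' k' => exists i a, [/\ (iv h' vx * 2 ^ i = M + a)%N,
  (k <= k' + i)%N, (i <= r)%N, (a <= p < a + 2 ^ i)%N /\ (a + 2 ^ i <= M)%N &
  forall t, [/\ (t < rv h' xA) <->
                 (exists2 w, (a <= w < a + 2 ^ i)%N & (t < g w) && same d t p w),
    (t < rv h' xL) <-> (forall q, (a <= q <= p)%N -> t < d q) &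
    t < ra h aG 1%N -> (t < rv h' xR) <-> (forall q, (p < q < a + 2 ^ i)%N -> t < d q)]])).
- move=> h' k' [_ _ _ a4 _ _] [i [a [xi ki ir [ap aM] H]]] /= x1.
  have raE c : ra h' c = ra h c by rewrite a4.
  have p0 : (0 < 2 ^ i)%N by rewrite expn_gt0.
  have ltir : (i < r)%N.
    rewrite ltn_neqAle ir andbT; apply: contraTN x1 => /eqP E; rewrite -leqNgt.
    move: xi aM; rewrite E -Mr => xi aM; have a0 : a = 0%N by lia.
    by rewrite -(leq_pmul2r M0) xi a0; lia.
  split; first by lia.
  have E2 : (2 ^ i.+1 = 2 * 2 ^ i)%N by rewrite expnS.
  have [z Mz] : exists z, M = (z * (2 * 2 ^ i))%N.
    by exists (2 ^ (r - i.+1))%N; rewrite -expnS -expnD subnK.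
  have xE := divn_eq (iv h' vx) 2.
  apply: run_Then; apply: run_Cond => /= odd; do 4 hstep; rewrite /= ?raE.
  + by apply: leq_trans (leq_div _ _) _; nia.
  + have o1 : (iv h' vx %% 2 = 1)%N by have := ltn_mod (iv h' vx) 2; lia.
    have aE : exists b, a = (b + 2 ^ i)%N.
      exists (a - 2 ^ i)%N; rewrite subnK //; move: xi; rewrite xE o1 Mz => xi.
      have [zy|yz] := leqP z (iv h' vx %/ 2).
        by have := leq_mul2r (2 ^ i) z (iv h' vx %/ 2); rewrite zy orbT; nia.
      by have := leq_mul2r (2 ^ i) (iv h' vx %/ 2).+1 z; rewrite yz orbT; nia.
    case: aE => b aE; exists i.+1, b.
    have yi : ((iv h' vx - 1) * 2 ^ i = M + b)%N by rewrite mulnBl xi; lia.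
    split; [rewrite /=|lia|done|rewrite E2; lia|].
      by move: yi; rewrite E2 {1}xE o1 addnK -mulnA.
    move=> t; have [HA HL HR] := H t; have yM : (M <= (iv h' vx - 1) * 2 ^ i < 2 * M)%N by lia.
    have := node_sem t tr Mr yM; rewrite yi addKn => -[NM NL NR].
    rewrite /= E2; clear -HA HL HR NM NR aE ap p0.
    move: (2 ^ i)%N p0 aE HA HL HR NM NR ap => s p0 -> HA HL HR NM NR ap; split.
    * rewrite lt_max lt_min; split.
        case/orP=> [/HA[w wi H]|/andP[/HL H1 /NR[w [wi wg H]]]]; first by exists w; [lia|].
        exists w; [lia|rewrite wg /=; apply/same_boundsP => q qi].
        by case: (ltnP q (b + s)) => qs; [apply: H|apply: H1]; lia.
      move=> [w wi /andP[wg /same_boundsP sw]]; case: (ltnP w (b + s)) => ws; apply/orP; last first.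
        by left; apply/HA; exists w; [lia|rewrite wg /=; apply/same_boundsP].
      right; apply/andP; split; first by apply/HL => q qi; apply: sw; lia.
      by apply/NR; exists w; split=> //; [lia|move=> q qi; apply: sw; lia].
    * rewrite lt_min; split=> [/andP[/HL H1 /NM H2] q qi|H0].
        by case: (ltnP q (b + s)) => qs; [apply: H2|apply: H1]; lia.
      by apply/andP; split; [apply/HL|apply/NM] => q qi; apply: H0; lia.
    * by move=> tG; apply: (iff_trans (HR tG)); split=> H0 q qi; apply: H0; lia.
  + by apply: leq_trans (leq_div _ _) _; nia.
  + have o1 : (iv h' vx %% 2 = 0)%N by lia.
    exists i.+1, a.
    have yi : ((iv h' vx + 1) * 2 ^ i = M + (a + 2 ^ i))%N by rewrite mulnDl xi; lia.
    have aM' : (a + 2 * 2 ^ i <= M)%N.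
      move: xi aM; rewrite {1}xE o1 Mz addn0 => xi aM.
      have [zy|yz] := leqP (2 * z) (iv h' vx %/ 2).
        by have := leq_mul2r (2 ^ i) (2 * z) (iv h' vx %/ 2); rewrite zy orbT; nia.
      by have := leq_mul2r (2 ^ i) (iv h' vx %/ 2).+1 (2 * z); rewrite yz orbT; nia.
    have yM : (M <= (iv h' vx + 1) * 2 ^ i < 2 * M)%N by lia.
    split; [rewrite /=|lia|done|rewrite E2; lia|].
      by move: xi; rewrite E2 {1}xE o1 addn0 -mulnA.
    move=> t; have [HA HL HR] := H t.
    have := node_sem t tr Mr yM; rewrite yi addKn => -[NM NL NR].
    have gm w : (a <= w < a + 2 * 2 ^ i)%N -> t < g w -> t < ra h aG 1%N.
      by move=> wi; apply: gmax; lia.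
    rewrite /= E2; clear -HA HL HR NM NL ap p0 gm.
    move: (2 ^ i)%N p0 HA HL HR NM NL ap gm => s p0 HA HL HR NM NL ap gm; split.
    * rewrite lt_max lt_min; split.
        case/orP=> [/HA[w wi H]|/andP[HRt /NL[w [wi wg H]]]]; first by exists w; [lia|].
        have tG := gm w ltac:(lia) wg; move/(HR tG): HRt => H1.
        exists w; [lia|rewrite wg /=; apply/same_boundsP => q qi].
        by case: (ltnP q (a + s)) => qs; [apply: H1|apply: H]; lia.
      move=> [w wi /andP[wg /same_boundsP sw]]; case: (ltnP w (a + s)) => ws; apply/orP.
        by left; apply/HA; exists w; [lia|rewrite wg /=; apply/same_boundsP].
      have tG := gm w ltac:(lia) wg.
      right; apply/andP; split; first by apply/(HR tG) => q qi; apply: sw; lia.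
      by apply/NL; exists w; split=> //; [lia|move=> q qi; apply: sw; lia].
    * exact: HL.
    * move=> tG; rewrite lt_min; split=> [/andP[/(HR tG) H1 /NM H2] q qi|H0].
        by case: (ltnP q (a + s)) => qs; [apply: H1|apply: H2]; lia.
      by apply/andP; split; [apply/(HR tG)|apply/NM] => q qi; apply: H0; lia.
- move=> h' k' _ _ [i [a [xi ki ir [ap aM] H]]] /= x1; split; last by lia.
  have ii : i = r.
    apply/eqP; rewrite eqn_leq ir /=.
    have p0 : (0 < 2 ^ i)%N by rewrite expn_gt0.
    have : (2 ^ r <= 2 ^ i)%N by rewrite -Mr; nia.
    by rewrite leq_exp2l.
  have a0 : a = 0%N by move: aM; rewrite ii -Mr; lia.
  move=> t; have [HA _ _] := H t; apply: (iff_trans HA); rewrite a0 ii -Mr add0n.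
  by split=> -[w wi H0]; exists w.
- exists 0%N, p; rewrite /= expn0; split; [lia|lia|lia|lia|move=> t; split].
  + rewrite (leaf_G tr.2 pM); split=> [tg|[w wi /andP[tw _]]]; last by have <- : w = p by lia.
    by exists p; [lia|rewrite tg same_refl].
  + rewrite (leaf_M tr.2 pM); split=> [tg q qi|]; last by apply; lia.
    by have -> : q = p by lia.
  + move=> tG; split=> [_ q|_]; [by lia|].
    by rewrite mulr1n; lra.
Qed.

End Tree.

(** * The program for one level *)

Notation iHD := 0%N. Notation iNX := 1%N. Notation iVT := 2%N. Notation iRK := 3%N.
Notation iPS := 4%N. Notation iBL := 5%N. Notation iF1 := 6%N. Notation iF2 := 7%N.
Notation iM1 := 8%N. Notation iM2 := 9%N. Notation iCH := 10%N.
Notation aDL := 4%N. Notation aSO := 5%N. Notation aSN := 6%N. Notation aBC := 7%N.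
Notation aDG := 8%N.

(* Half-edge 2e+b leaves from one end of edge e; [iHD] and [iNX] link the
   half-edges of a vertex, shifted by one so that 0 ends the list. *)
Definition ADJ :=
  SetI vh #0 ;;
  Loop (CI $vh ($vm * #2))
    (GetW vu $vh ;; PutI iNX $vh (IArr iHD $vu) ;; PutI iHD $vu ($vh + #1) ;;
     SetI vh ($vh + #1)).

Definition PUTLEAF :=
  PutR aG ($vM + $vp) $xv ;; PutR aR ($vM + $vp) $xv ;;
  PutR aL ($vM + $vp) (RMin $xv (RArr aM ($vM + $vp))) ;; SetI vp ($vp + #1).

(** The link value -1 marks the padding leaves, and later the visited positions; unvisited positions
    have a link of at least 0. *)
Definition LINIT :=
  SetI vp #0 ;;
  Loop (CI $vp $vM)
    (Cond (CI $vp $vn)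
       (PutI iPS (IArr iVT ($vb + $vp)) $vp ;;
        PutR aM ($vM + $vp) (RArr aDL ($vb + $vp)) ;; SetR xv #0)
       (PutR aM ($vM + $vp) #0 ;; SetR xv (#0 - #1)) ;;
     PUTLEAF) ;;
  BUILD.

(* Links position [vp] until time [xv], unless it has been visited. *)
Definition BUMP :=
  Cond (CR (#0 - #1)%rx (RArr aG ($vM + $vp)))
    (Cond (CR (RArr aG ($vM + $vp)) $xv) SETLEAF Skip) Skip.

Definition VISIT :=
  ARGMAX ;;
  SetI vu (IArr iVT ($vb + $vp)) ;;
  PutI iVT ($vb + $vn + $vj) $vu ;;
  PutR aDL ($vb + $vn + $vj) $xT ;;
  SetI vh (IArr iHD $vu) ;; SetR xv (#0 - #1) ;; SETLEAF ;;
  SetI vq $vp ;;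
  SetI vp ($vq + #1) ;;
  Cond (CI $vp $vn) (SetR xv (RArr aM ($vM + $vp)) ;; BUMP) Skip ;;
  Cond (CI #0 $vq)
    (SetI vp ($vq - #1) ;; SetR xv (RArr aM ($vM + $vq)) ;; BUMP) Skip ;;
  SetI vj ($vj + #1).

(** [vh] is the half-edge plus one. Its partner is the next number for an even half-edge and the
    previous one for an odd one, hence [vh] or [vh - 2]. *)
Definition SCAN :=
  GetW vu ($vh - #2 * (($vh - #1) %% #2)) ;;
  SetI vp (IArr iPS $vu) ;;
  Cond (CR (#0 - #1)%rx (RArr aG ($vM + $vp)))
    (QUERY ;; GetC xs (($vh - #1) / #2) ;; SetR xv ($xA + $xs) ;; SETLEAF) Skip ;;
  SetI vh (IArr iNX ($vh - #1)).

(** The loop stops when the last vertex has its place; its half-edges remain unexamined, but the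
    partner of each has been examined. *)
Definition SEARCH :=
  SetI vj #0 ;; SetI vh #0 ;;
  Loop (CI $vj $vn) (Cond (CI #0 $vh) SCAN VISIT).

(** A merge of the sorted boundaries of the old and the new level. At [T = aSN vi], either slack is
    the number of smaller boundaries times [T] minus their sum, and both counts and sums are at
    hand. [aBC] keeps the least difference over the levels; level 1 writes unconditionally, in place
    of an infinite initial value. *)
Definition COSTS :=
  SetI vi #1 ;; SetI vj #1 ;; SetR xs #0 ;; SetR xt #0 ;;
  Loop (CI $vi $vn)
    (SetI va #0 ;;
     Cond (CI $vj $vn) (Cond (CR (RArr aSO $vj) (RArr aSN $vi)) (SetI va #1) Skip) Skip ;;
     Cond (CI #0 $va)
       (SetR xs ($xs + RArr aSO $vj) ;; SetI vj ($vj + #1))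
       (SetR xT ((RInt ($vj - #1) * RArr aSN $vi - $xs)
                 - (RInt ($vi - #1) * RArr aSN $vi - $xt)) ;;
        SetI va #0 ;;
        Cond (CI #1 $vl) (Cond (CR $xT (RArr aBC $vi)) Skip (SetI va #1)) Skip ;;
        Cond (CI #0 $va) Skip (PutR aBC $vi $xT ;; PutI iBL $vi $vl) ;;
        SetR xt ($xt + RArr aSN $vi) ;; SetI vi ($vi + #1))).

Definition COPY :=
  SetI vi #1 ;;
  Loop (CI $vi $vn) (PutR aSO $vi (RArr aSN $vi) ;; SetI vi ($vi + #1)).

(** The list pointer that the adjacency pass leaves at [v] after [H] half-edges: the last of them
    that starts at [v], plus one, or 0 for none. *)
Fixpoint pvocc (src : nat -> nat) H v : nat :=
  if H is H'.+1 then if src H' == v then H else pvocc src H' v else 0%N.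

Lemma pvocc_le src H v : (pvocc src H v <= H)%N.
Proof. by elim: H => //= H IH; case: ifP => // _; lia. Qed.

Lemma pvocc_src src H v : (0 < pvocc src H v)%N -> src (pvocc src H v).-1 = v.
Proof. by elim: H => //= H IH; case: ifP => // /eqP. Qed.

Lemma pvocc_max src H v h : (h < H)%N -> src h = v -> (h < pvocc src H v)%N.
Proof.
elim: H => // H IH; rewrite ltnS => hH sh /=; case: ifP => [_|/eqP nH]; first by lia.
by apply: IH => //; rewrite ltn_neqAle hH andbT; apply: contra_notN nH => /eqP <-.
Qed.

Section LevelProgram.
Variables (R : realType) (X n m M r : nat) (src : nat -> nat) (c : nat -> R).
Hypotheses (Mr : M = (2 ^ r)%N) (nM : (n <= M)%N) (MX : (M * 2 <= X)%N) (mX : (m * 2 <= X)%N).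
Hypothesis nX : (n + 2 <= X)%N.
Hypothesis srcn : forall h, (h < m * 2)%N -> (src h < n)%N.
Hypothesis c_gt0 : forall e, (e < m)%N -> 0 < c e.
Implicit Types h : hst R.

Notation run := (run X (m * 2)).

Let M0 : (0 < M)%N. Proof. by rewrite Mr expn_gt0. Qed.

Record env h : Prop := Env {
  env_n : iv h vn = n; env_m : iv h vm = m; env_M : iv h vM = M;
  env_w : forall i, (i < m * 2)%N -> iw h i = src i;
  env_c : forall e, (e < m)%N -> rw h e = c e }.

Record adjl h : Prop := Adjl {
  adj_HD : forall v, ia h iHD v = pvocc src (m * 2) v;
  adj_NX : forall i, (i < m * 2)%N -> ia h iNX i = pvocc src i (src i) }.

Definition pure_env p := [&& vn \notin miv p, vm \notin miv p, vM \notin miv p & ~~ miw p].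
Definition pure_adj p := (iHD \notin mia p) && (iNX \notin mia p).

Lemma env_agree p h h' : agree p h h' -> pure_env p -> env h -> env h'.
Proof.
move=> [a1 _ _ _ a5 a6] /and4P[b1 b2 b3 b4] [e1 e2 e3 e4 e5].
by split; rewrite ?a1 ?a5 ?a6.
Qed.

Lemma adj_agree p h h' : agree p h h' -> pure_adj p -> adjl h -> adjl h'.
Proof. by move=> [_ _ a3 _ _ _] /andP[b1 b2] [e1 e2]; split; rewrite ?a3. Qed.

Lemma run_ADJ Q h k : env h -> (forall v, ia h iHD v = 0%N) -> (m * 2 <= k)%N ->
  (forall h' k', agree ADJ h h' -> adjl h' -> (k <= k' + m * 2)%N -> Q h' k') ->
  run ADJ Q h k.
Proof.
move=> ev hd0 mk HQ.
suff : run ADJ (fun h' k' => adjl h' /\ (k <= k' + m * 2)%N) h k.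
  by move/run_mono; apply=> h' k' a _ [t1 l]; apply: HQ.
rewrite /ADJ; do 2 hstep; first by [].
apply: (run_Loop (I := fun h' k' => [/\ (iv h' vh <= m * 2)%N, (k <= k' + iv h' vh)%N,
  forall v, ia h' iHD v = pvocc src (iv h' vh) v &
  forall i, (i < iv h' vh)%N -> ia h' iNX i = pvocc src i (src i)])).
- move=> h' k' A [hm hk HD NX] /=; have ev' : env h' by apply: (env_agree A isT); case: ev => *; split.
  rewrite (env_m ev') => lt; split; first by lia.
  hstep; apply: run_GetW => //=.
  have wE : iw h' (iv h' vh) = src (iv h' vh) by rewrite (env_w ev').
  hstep; hstep; first by rewrite /= HD wE; apply: leq_trans (pvocc_le _ _ _) _; lia.
  do 2 hstep; first by lia.
  hstep; first by lia.
  rewrite /= wE addn1; split=> //=; first by lia.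
    by move=> v; rewrite HD eq_sym.
  move=> i; rewrite ltnS leq_eqVlt => /orP[/eqP ->|lti]; first by rewrite eqxx HD.
  by rewrite (ltn_eqF lti) NX.
- move=> h' k' A _ [hm hk HD NX] /=.
  have ev' : env h' by apply: (env_agree A isT); case: ev => *; split.
  rewrite (env_m ev') -leqNgt => ge.
  have hE : iv h' vh = (m * 2)%N by lia.
  by rewrite hE in HD NX hk; split.
- by split=> //=; lia.
Qed.

Definition pleaves A (d g : nat -> R) p := forall q, (q < p)%N ->
  [/\ A aM (M + q)%N = d q, A aL (M + q)%N = Num.min (g q) (d q),
      A aR (M + q)%N = g q & A aG (M + q)%N = g q].

Lemma pleaves_all A d g : pleaves A d g M -> leaves A M d g.
Proof. by move=> H; split=> p /H[]. Qed.

Lemma run_PUTLEAF Q h k p d g : iv h vM = M -> iv h vp = p -> (p < M)%N ->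
  pleaves (ra h) d g p -> ra h aM (M + p)%N = d p -> rv h xv = g p ->
  (forall h', agree PUTLEAF h h' -> pleaves (ra h') d g p.+1 -> iv h' vp = p.+1 ->
     (forall q, ra h' aM q = ra h aM q) -> Q h' k) ->
  run PUTLEAF Q h k.
Proof.
move=> hM hp pM pl hd hg HQ.
suff : run PUTLEAF (fun h' k' => [/\ k' = k, pleaves (ra h') d g p.+1, iv h' vp = p.+1 &
     forall q, ra h' aM q = ra h aM q]) h k.
  by move/run_mono; apply=> h' k' a _ [-> a1 a2 a3]; apply: HQ.
rewrite /PUTLEAF; do 7 hstep; first by rewrite hp; lia.
rewrite /= hp hM addn1; split=> // q; rewrite ltnS leq_eqVlt => /orP[/eqP ->|qp].
  by rewrite /= eqxx hd hg.
by rewrite /= eqn_add2l (ltn_eqF qp); apply: pl.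
Qed.

Lemma run_LINIT Q h k b vt d : env h -> iv h vb = b -> (2 * M <= k)%N ->
  (forall p, (p < n)%N -> ia h iVT (b + p)%N = vt p) ->
  (forall i j, (i < n)%N -> (j < n)%N -> vt i = vt j -> i = j) ->
  (forall p, d p = if (p < n)%N then ra h aDL (b + p)%N else 0) ->
  (forall h' k', agree LINIT h h' ->
     tree (ra h') M d (fun p => if (p < n)%N then 0 else -1) ->
     (forall p, (p < n)%N -> ia h' iPS (vt p) = p) -> (k <= k' + 2 * M)%N -> Q h' k') ->
  run LINIT Q h k.
Proof.
move=> ev hb Mk hvt vtinj hd HQ; set g := fun p => _ in HQ.
suff : run LINIT (fun h' k' => [/\ tree (ra h') M d g,
    (forall p, (p < n)%N -> ia h' iPS (vt p) = p) & (k <= k' + 2 * M)%N]) h k.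
  by move/run_mono; apply=> h' k' a _ [a1 a2 a3]; apply: HQ.
rewrite /LINIT; do 2 hstep; first by [].
hstep; apply: (run_Loop (I := fun h' k' => [/\ (iv h' vp <= M)%N, (k <= k' + iv h' vp)%N,
  pleaves (ra h') d g (iv h' vp) &
  forall p, (p < n)%N -> (p < iv h' vp)%N -> ia h' iPS (vt p) = p])).
- move=> h' k' A [pM hk pl PS] /=.
  have ev' : env h' by apply: (env_agree A isT); case: ev => *; split.
  have hb' : iv h' vb = b by rewrite (agree_iv A).
  have hvt' : ia h' iVT = ia h iVT by rewrite (agree_ia A).
  have hDL : ra h' aDL = ra h aDL by rewrite (agree_ra A).
  have [hn hM] := (env_n ev', env_M ev').
  rewrite hM => lt; split; first by lia.
  hstep; apply: run_Cond => /=; rewrite hn => pn.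
  + do 2 hstep; first by lia.
    do 3 hstep; apply: (run_PUTLEAF (p := iv h' vp) (d := d) (g := g)) => //=.
    * move=> q qp; have [p1 p2 p3 p4] := pl q qp.
      by rewrite /= hM eqn_add2l (ltn_eqF qp).
    * by rewrite hM eqxx hb' hDL hd pn.
    * by rewrite /g pn mulr0n.
    * move=> h2 A2 pl2 p2 _; split; [lia|lia|by rewrite p2|].
      move=> p pn'; rewrite p2 (agree_ia A2) //= hb' hvt' hvt // => pp.
      case: eqP => [/(vtinj _ _ pn' pn) ->//|ne]; apply: PS => //.
      by rewrite ltn_neqAle -ltnS pp andbT; apply: contra_notN ne => /eqP ->.
  + do 3 hstep; apply: (run_PUTLEAF (p := iv h' vp) (d := d) (g := g)) => //=.
    * move=> q qp; have [p1 p2 p3 p4] := pl q qp.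
      by rewrite /= hM eqn_add2l (ltn_eqF qp).
    * by rewrite hM eqxx hd (negbTE pn) mulr0n.
    * by rewrite /g (negbTE pn) mulr0n mulr1n sub0r.
    * move=> h2 A2 pl2 p2 _; split; [lia|lia|by rewrite p2|].
      by move=> p pn' _; rewrite (agree_ia A2) //=; apply: PS => //; lia.
- move=> h' k' A _ [pM hk pl PS] /=.
  have ev' : env h' by apply: (env_agree A isT); case: ev => *; split.
  rewrite (env_M ev') -leqNgt => Mp; have pE : iv h' vp = M by lia.
  rewrite pE in pl hk PS.
  apply: (@run_BUILD _ _ _ M d g); rewrite ?(env_M ev') //; [lia|exact: pleaves_all|lia|].
  move=> h2 k2 A2 tr kk; split=> //; last by lia.
  by move=> p pn; rewrite (agree_ia A2) //; apply: PS => //; lia.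
- by split=> //=; lia.
Qed.

Lemma tree_eq (A A' : nat -> nat -> R) d g : (forall a, (a < 4)%N -> A' a = A a) -> tree A M d g -> tree A' M d g.
Proof.
move=> E [nd [l1 l2 l3 l4]]; split=> [y yM|].
  by have [e1 e2 e3 e4] := nd y yM; split; rewrite !E.
by split=> p pM; rewrite E //; [apply: l1|apply: l2|apply: l3|apply: l4].
Qed.

Definition raised p x (g : nat -> R) q := if [&& q == p, -1 < g p & g p < x] then x else g q.

Lemma run_BUMP Q h k p d g : env h -> iv h vp = p -> (p < M)%N -> tree (ra h) M d g -> (r <= k)%N ->
  (forall h' k', agree BUMP h h' -> tree (ra h') M d (raised p (rv h xv) g) -> (k <= k' + r)%N ->
     Q h' k') ->
  run BUMP Q h k.
Proof.
move=> ev hp pM tr rk HQ.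
suff : run BUMP (fun h' k' => tree (ra h') M d (raised p (rv h xv) g) /\ (k <= k' + r)%N) h k.
  by move/run_mono; apply=> h' k' a _ [a1 a2]; apply: HQ.
have triv : (g p <= -1) || (rv h xv <= g p) ->
    tree (ra h) M d (raised p (rv h xv) g) /\ (k <= k + r)%N.
  move=> H; split; last by lia.
  case: tr => nd [l1 l2 l3 l4]; split=> //.
  have E q : raised p (rv h xv) g q = g q.
    rewrite /raised; case: eqP => //= -> ; case: H => /orP[H|H]; first by rewrite ltNge H.
    by rewrite andbC ltNge H.
  by split=> q qM; rewrite ?E; [apply: l1|apply: l2|apply: l3|apply: l4].
have gp : ra h aG (M + p)%N = g p by apply: (leaf_G tr.2 pM).
apply: run_Cond => /=; rewrite (env_M ev) hp gp mulr0n mulr1n sub0r; last first.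
  by move=> H; hstep; apply: triv; rewrite leNgt H.
move=> gp1; apply: run_Cond => /=; rewrite (env_M ev) hp gp; last first.
  by move=> H; hstep; apply: triv; rewrite [X in _ || X]leNgt H orbT.
move=> gpx; apply: (@run_SETLEAF _ _ _ M r d g _ _ _ p); rewrite ?(env_M ev) //.
move=> h' k' _ tr' kk; split=> //.
case: tr' => nd [l1 l2 l3 l4]; split=> //.
have E q : raised p (rv h xv) g q = (if q == p then rv h xv else g q).
  by rewrite /raised gp1 gpx !andbT.
by split=> q qM; rewrite ?E; [apply: l1|apply: l2|apply: l3|apply: l4].
Qed.

Definition visited (d : nat -> R) v (g : nat -> R) :=
  let g1 q := if q == v then -1 else g q in
  let g2 := if (v.+1 < n)%N then raised v.+1 (d v.+1) g1 else g1 in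
  if (0 < v)%N then raised v.-1 (d v) g2 else g2.

Lemma run_VISIT Q h k b j d g vt : env h -> adjl h -> iv h vb = b -> iv h vj = j ->
  (j < n)%N -> tree (ra h) M d g -> (forall p, (n <= p)%N -> g p = -1) ->
  (exists2 p, (p < n)%N & 0 <= g p) ->
  (forall p, (p < n)%N -> ia h iVT (b + p)%N = vt p /\ (vt p < n)%N) -> (4 * r <= k)%N ->
  (forall h' k' v, agree VISIT h h' -> (v < n)%N -> (forall q, g q <= g v) ->
     tree (ra h') M d (visited d v g) -> iv h' vj = j.+1 ->
     iv h' vh = pvocc src (m * 2) (vt v) ->
     (forall i, ia h' iVT i = if i == (b + n + j)%N then vt v else ia h iVT i) ->
     (forall i, ra h' aDL i = if i == (b + n + j)%N then g v else ra h aDL i) ->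
     (k <= k' + 4 * r)%N -> Q h' k') ->
  run VISIT Q h k.
Proof.
move=> ev ad hb hj jn tr gout [p0 p0n gp0] hvt rk HQ.
suff : run VISIT (fun h' k' => exists v, [/\ (v < n)%N /\ (forall q, g q <= g v),
     tree (ra h') M d (visited d v g), iv h' vj = j.+1 /\
     iv h' vh = pvocc src (m * 2) (vt v),
     (forall i, ia h' iVT i = if i == (b + n + j)%N then vt v else ia h iVT i) /\
     (forall i, ra h' aDL i = if i == (b + n + j)%N then g v else ra h aDL i) &
     (k <= k' + 4 * r)%N]) h k.
  by move/run_mono; apply=> h' k' a _ [v [[a1 a2] a3 [a4 a5] [a6 a7] a8]]; apply: (HQ h' k' v).
rewrite /VISIT; hstep; apply: (@run_ARGMAX _ _ _ M r d g); rewrite ?(env_M ev) //; first by lia.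
move=> h1 k1 A1 vM1 hT gmax kk1; set v := iv h1 vp in vM1 hT gmax *.
have gmax' q : g q <= g v.
  case: (ltnP q M) => [/gmax //|Mq]; rewrite gout; last by lia.
  by have := gmax p0 ltac:(lia); lra.
have vn1 : (v < n)%N.
  by case: ltnP => // /gout E; have := gmax' p0; rewrite E; lra.
have [vtE vtn] := hvt v vn1.
have ev1 : env h1 by apply: (env_agree A1 isT).
have ad1 : adjl h1 by apply: (adj_agree A1 isT).
have [hb1 hj1] : iv h1 vb = b /\ iv h1 vj = j by rewrite !(agree_iv A1).
have iaE : ia h1 iVT = ia h iVT by rewrite (agree_ia A1).
do 2 hstep; first by rewrite hb1 iaE vtE; lia.
do 2 hstep; first by rewrite hb1 iaE vtE; lia.
do 4 hstep; first by rewrite (adj_HD ad1) hb1 iaE vtE; apply: leq_trans (pvocc_le _ _ _) mX.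
do 3 hstep; rewrite /= hb1 iaE vtE (adj_HD ad1) hj1 (env_n ev1) mulr0n mulr1n sub0r.
set h2 := setR _ _ _.
have tr2 : tree (ra h2) M d g.
  by apply: tree_eq tr => -[|[|[|[|a]]]] // _; rewrite /= (agree_ra A1).
apply: (@run_SETLEAF _ _ _ M r d g _ _ _ v);
  [by rewrite /= (env_M ev1)|exact: Mr|exact: MX|by []|exact: vM1|exact: tr2|lia|].
move=> h3 k3 A3 tr3 kk3; rewrite /= in tr3.
have hv3 : iv h3 vp = v by rewrite (agree_iv A3).
have ev3 : env h3 by apply: (env_agree A3 isT); case: ev1 => *; split.
do 2 hstep; first by rewrite hv3; lia.
do 2 hstep; first by rewrite hv3; lia.
rewrite /= hv3 addn1; hstep; set h4 := setI _ _ _.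
pose g1 q := if q == v then -1 else g q.
pose g2 := if (v.+1 < n)%N then raised v.+1 (d v.+1) g1 else g1.
have next h5 k5 : env h5 -> tree (ra h5) M d g2 -> (k <= k5 + 3 * r)%N ->
   iv h5 vq = v -> iv h5 vj = j -> iv h5 vh = iv h2 vh -> ia h5 iVT = ia h2 iVT ->
   ra h5 aDL = ra h2 aDL ->
   run (Cond (CI #0 $vq)
    (SetI vp ($vq - #1) ;; SetR xv (RArr aM ($vM + $vq)) ;; BUMP) Skip ;;
  SetI vj ($vj + #1)) (fun h' k' => exists v, [/\ (v < n)%N /\ (forall q, g q <= g v),
     tree (ra h') M d (visited d v g), iv h' vj = j.+1 /\
     iv h' vh = pvocc src (m * 2) (vt v),
     (forall i, ia h' iVT i = if i == (b + n + j)%N then vt v else ia h iVT i) /\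
     (forall i, ra h' aDL i = if i == (b + n + j)%N then g v else ra h aDL i) &
     (k <= k' + 4 * r)%N]) h5 k5.
  move=> ev5 tr5 kk5 q5 j5 h5h i5 r5; hstep; apply: run_Cond => /=; rewrite q5 => v0; last first.
    do 2 hstep; first by rewrite j5; lia.
    exists v; rewrite /= j5 addn1 h5h i5 r5; split=> //; last by lia.
      by rewrite /visited -/g1 -/g2 (negbTE v0).
    by split=> i /=; [rewrite ?iaE|rewrite hT (agree_ra A1)].
  do 2 hstep; first by rewrite q5; lia.
  do 2 hstep; rewrite /= q5 (env_M ev5).
  have -> : ra h5 aM (M + v)%N = d v by apply: (leaf_M tr5.2).
  apply: (@run_BUMP _ _ _ v.-1 d g2).
  + by case: ev5 => *; split.
  + by rewrite /= subn1.
  + by lia.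
  + exact: tr5.
  + by lia.
  move=> h6 k6 A6 tr6 kk6; hstep; first by rewrite (agree_iv A6) //= j5; lia.
  have e1 : iv h6 vj = j by rewrite (agree_iv A6) //= j5.
  have e2 : iv h6 vh = iv h2 vh by rewrite (agree_iv A6) //= h5h.
  have e3 : ia h6 iVT = ia h2 iVT by rewrite (agree_ia A6) //= i5.
  have e4 : ra h6 aDL = ra h2 aDL by rewrite (agree_ra A6) //= r5.
  exists v; rewrite /= e1 e2 e3 e4 addn1; split=> //; last by lia.
    by rewrite /visited -/g1 -/g2 v0.
  by split=> i /=; [rewrite ?iaE|rewrite hT (agree_ra A1)].
have e1 : iv h3 vj = j by rewrite (agree_iv A3) //= hj1.
have e2 : iv h3 vh = iv h2 vh by rewrite (agree_iv A3).
have e3 : ia h3 iVT = ia h2 iVT by rewrite (agree_ia A3).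
have e4 : ra h3 aDL = ra h2 aDL by rewrite (agree_ra A3).
have ev4 : env h4 by case: ev3 => *; split.
apply: run_Cond => /=; rewrite (env_n ev3) => vn2; last first.
  hstep; apply: next => //=; [|by lia].
  by rewrite /g2 (negbTE vn2).
do 2 hstep; rewrite /= (env_M ev3).
have -> : ra h3 aM (M + v.+1)%N = d v.+1 by apply: (leaf_M tr3.2); lia.
apply: (@run_BUMP _ _ _ v.+1 d g1).
+ by case: ev4 => *; split.
+ by [].
+ by lia.
+ exact: tr3.
+ by lia.
move=> h6 k6 A6 tr6 kk6; apply: next.
+ by apply: (env_agree A6 isT); case: ev4 => *; split.
+ by rewrite /g2 vn2.
+ by lia.
+ by rewrite (agree_iv A6).
+ by rewrite (agree_iv A6).
+ by rewrite (agree_iv A6).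
+ by rewrite (agree_ia A6).
+ by rewrite (agree_ra A6).
Qed.

End LevelProgram.

(** * The order in which the search examines half-edges *)

Section SearchOrder.
Variables (R : realType) (n m : nat) (src hp vt : nat -> nat) (c d : nat -> R).
Hypothesis c_gt0 : forall e, (e < m)%N -> 0 < c e.
Hypotheses (n0 : (0 < n)%N) (d0 : d 0%N = 0) (dge : forall p, (p < n)%N -> 0 <= d p).
Hypothesis hpn : forall i, (i < m * 2)%N -> (hp i < n)%N.
Hypothesis hpE : forall i, (i < m * 2)%N -> vt (hp i) = src i.
Hypothesis vtinj : forall i j, (i < n)%N -> (j < n)%N -> vt i = vt j -> i = j.
Hypothesis loopless : forall e, (e < m)%N -> src (e * 2)%N <> src (e * 2 + 1)%N.
Hypothesis cut : forall (P : pred nat) x y, (x < n)%N -> (y < n)%N -> P x -> ~~ P y ->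
  exists2 e, (e < m)%N & P (hp (e * 2)%N) != P (hp (e * 2 + 1)%N).

Let ea e := hp (e * 2)%N.
Let eb e := hp (e * 2 + 1)%N.

(* The half-edges [i] that have not been examined when the half-edges of the
   last visited position have been examined down to [H]. *)
Definition todo vis H i := (hp i \notin vis) || (hp i == last 0%N vis) && (i < H)%N.

Record sinv vis (g s : nat -> R) sc dn H : Prop := Sinv {
  si_ma : ma_inv n m ea eb c d vis g s sc dn;
  si_H : (H <= m * 2)%N;
  si_last : (0 < H)%N -> vis != [::] /\ hp H.-1 = last 0%N vis;
  si_done : forall i, (i < m * 2)%N -> ~~ todo vis H i -> sc (i %/ 2)%N;
  si_sc : forall e, (e < m)%N -> sc e -> ~~ todo vis H (e * 2) || ~~ todo vis H (e * 2 + 1);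
  si_nil : vis = [::] -> forall p, (p < n)%N -> g p = 0 }.

Lemma sinv_start : sinv [::] (fun p => if (p < n)%N then 0 else -1) (fun=> 0) pred0 (fun=> 0) 0.
Proof.
split=> //; first exact: ma_start.
by move=> _ p ->.
Qed.

Lemma hp_src i j : (i < m * 2)%N -> (j < m * 2)%N -> src i = src j -> hp i = hp j.
Proof. by move=> im jm; rewrite -!hpE // => /vtinj; apply; apply: hpn. Qed.

Lemma visited_spec vis g s sc dn v : ma_inv n m ea eb c d vis g s sc dn ->
  (v < n)%N -> v \notin vis -> (forall w, g w <= g v) ->
  let g' := visited n d v g in
  [/\ forall p, p \in rcons vis v -> g' p = -1, forall p, (n <= p)%N -> g' p = -1,
    forall w, (w < n)%N -> w \notin rcons vis v -> g w <= g' w,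
    forall w, g w < g' w -> (w = v.+1 \/ v = w.+1) /\ g' w = d (maxn w v) &
    forall w, (w = v.+1 \/ v = w.+1) -> (w < n)%N -> w \notin rcons vis v -> d (maxn w v) <= g' w].
Proof.
move=> I vn vv gm g'.
have gv0 := mi_gnew I vn vv.
pose g1 q := if q == v then -1 else g q.
have g'E (q : nat) : g' q = (if (q == v.+1) && (v.+1 < n)%N && (-1 < g q)%R && (g q < d v.+1)%R then d v.+1
   else if (0 < v)%N && (q == v.-1) && (-1 < g q)%R && (g q < d v)%R then d v else g1 q).
  pose g2 := if (v.+1 < n)%N then raised v.+1 (d v.+1) g1 else g1.
  have g2E (x : nat) : g2 x = (if (x == v.+1) && (v.+1 < n)%N && (-1 < g x)%R && (g x < d v.+1)%R
      then d v.+1 else g1 x).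
    rewrite /g2; case: ltnP => vn1; last by rewrite andbF.
    rewrite /raised; case: (x =P v.+1) => [->|//]; rewrite /= /g1.
    by have -> : (v.+1 == v) = false by lia.
  rewrite /g' /visited -/g1 -/g2; case: (ltnP 0 v) => v0; last by rewrite g2E.
  have E1 : g2 v.-1 = g v.-1.
    rewrite g2E /g1; have -> : (v.-1 == v.+1) = false by lia.
    by have -> : (v.-1 == v) = false by lia.
  rewrite /raised E1; case: (q =P v.-1) => [->|qv] /=; last by rewrite g2E.
  have -> : (v.-1 == v.+1) = false by lia.
  case: ifP => // _; rewrite E1 /g1.
  by have -> : (v.-1 == v) = false by lia.
have gneg p : p \in rcons vis v -> p != v -> g p = -1.
  by rewrite mem_rcons inE => /orP[/eqP ->|/(mi_gvis I)//]; rewrite eqxx.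
have gvv : g' v = -1.
  rewrite g'E (_ : (v == v.+1) = false); last by lia.
  case: (ltnP 0 v) => v0 /=; last by rewrite /g1 eqxx.
  by rewrite (_ : (v == v.-1) = false) /= ?/g1 ?eqxx //; lia.
have low p : g p = -1 -> g' p = -1.
  move=> gp; rewrite g'E gp ltxx !andbF /= /g1 gp; by case: ifP.
split.
- move=> p pv; have [->//|pnv] := eqVneq p v.
  by apply: low; apply: gneg.
- by move=> p pn; apply: low; apply: (mi_gout I).
- move=> w wn; rewrite mem_rcons inE negb_or => /andP[wv _].
  rewrite g'E /g1 (negbTE wv); case: ifP => [/andP[_ /ltW //]|_].
  by case: ifP => [/andP[_ /ltW //]|].
- move=> w; rewrite g'E; case: ifP => [/andP[/andP[/andP[/eqP -> _] _] _] _|_].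
    by split; [left|rewrite (_ : maxn _ _ = v.+1)//; lia].
  case: ifP => [/andP[/andP[/andP[v0 /eqP wE] _] _] _|_].
    by split; [right; lia|rewrite (_ : maxn _ _ = v)//; lia].
  by rewrite /g1; case: eqP => [->|_]; rewrite ?ltxx //; lra.
- move=> w wv wn wN; have gw : -1 < g w.
    have := mi_gnew I wn; rewrite mem_rcons inE negb_or in wN; case/andP: wN => _ wN /(_ wN); lra.
  have wv' : (w == v) = false by lia.
  rewrite g'E /g1 wv' gw !andbT; case: wv => wE.
    have -> : maxn w v = v.+1 by lia.
    rewrite wE eqxx -wE wn wE /=; case: ltP => // gd; by case: ifP => // /andP[/andP[_ /eqP]]; lia.
  have -> : maxn w v = v by lia.
  rewrite (_ : (w == v.+1) = false) /=; last by lia.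
  rewrite (_ : (0 < v)%N) /=; last by lia.
  rewrite (_ : w == v.-1) /=; last by lia.
  by case: ltP.
Qed.

Lemma sinv_visit vis g s sc dn v : sinv vis g s sc dn 0 -> (size vis < n)%N ->
  (v < n)%N -> (forall w, g w <= g v) ->
  let H := pvocc src (m * 2) (vt v) in let vis' := rcons vis v in
  [/\ sinv vis' (visited n d v g) s sc (fun j => if j == size vis then g v else dn j) H &
   forall i, todo vis' H i -> todo vis 0 i].
Proof.
case=> I _ _ Hd Hs Hnil szv vn gm H vis'.
have [p0 p0n p0v] : exists2 p, (p < n)%N & p \notin vis.
  case: (pselect (exists2 p, (p < n)%N & p \notin vis)) => // nex.
  have : (size (iota 0 n) <= size vis)%N.
    apply: uniq_leq_size (iota_uniq _ _) _ => p; rewrite mem_iota => /andP[_ pn].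
    by case: (boolP (p \in vis)) => // pv; case: nex; exists p.
  by rewrite size_iota; lia.
have gv0 : 0 <= g v by have := mi_gnew I p0n p0v; have := gm p0; lra.
have vv : v \notin vis by apply/negP => /(mi_gvis I) E; move: gv0; rewrite E ler0N1.
have [a1 a2 a3 a4 a5] := visited_spec I vn vv gm.
have mono i : todo vis' H i -> todo vis 0 i.
  rewrite /todo /vis' mem_rcons inE negb_or andbF orbF => /orP[/andP[] //|/andP[]].
  by rewrite last_rcons => /eqP ->.
split=> //; split.
- apply: ma_visit => //; case E : vis => [|x0 l0]; first exact: Hnil.
  have xv : x0 \in vis by rewrite E mem_head.
  (* By connectivity an edge leaves the visited set. No half-edge of a visited position is pending,
     so it has been scanned, and its unvisited end is linked for a positive time. *)
  have [e em] := cut (P := mem vis) (mi_lt I xv) p0n xv p0v.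
  have i1 : (e * 2 < m * 2)%N by lia.
  have i2 : (e * 2 + 1 < m * 2)%N by lia.
  have sce : (ea e \in vis) || (eb e \in vis) -> sc e.
    case/orP=> Hin; [have := Hd _ i1|have := Hd _ i2].
      by rewrite mulnK //; apply; rewrite /todo Hin andbF.
    by rewrite divnMDl // addn0; apply; rewrite /todo Hin andbF.
  rewrite -/(ea e) -/(eb e) /=; case A1: (ea e \in vis); case A2: (eb e \in vis) => // _.
    apply: (ma_gt0 c_gt0 I em (sce _) (x := ea e) (y := eb e)) => //; rewrite ?A1 ?A2 //; by left.
  apply: (ma_gt0 c_gt0 I em (sce _) (x := eb e) (y := ea e)) => //; rewrite ?A1 ?A2 //; by right.
- exact: pvocc_le.
- move=> H0; split; first by rewrite /vis'; case: (vis).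
  have Hm : (H.-1 < m * 2)%N by have := pvocc_le src (m * 2) (vt v); rewrite -/H; lia.
  rewrite /vis' last_rcons; apply: vtinj => //; first exact: hpn.
  by rewrite hpE // pvocc_src.
- move=> i im; rewrite /todo /vis' mem_rcons inE last_rcons => H1.
  apply: Hd => //; rewrite /todo andbF orbF; apply: contra H1 => iv.
  case: (hp i =P v) => [E|_]; last by rewrite iv.
  have -> : (i < H)%N by apply: pvocc_max => //; rewrite -hpE // E.
  by rewrite orbT.
- by move=> e em /(Hs e em) /orP[h1|h1]; apply/orP; [left|right]; apply: contra h1; apply: mono.
- by rewrite /vis'; case: (vis).
Qed.

(** If the other end is visited, its own half-edges were all examined before the last position was
    visited, so the edge has been scanned already. Otherwise neither of its half-edges has been
    examined, and [ma_scan] applies. *)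
Lemma sinv_scan vis g s sc dn H : sinv vis g s sc dn H -> (0 < H)%N ->
  let i0 := H.-1 in let e := (i0 %/ 2)%N in let o := (H - 2 * (i0 %% 2))%N in
  let u := hp o in let H' := pvocc src i0 (src i0) in
  [/\ (e < m)%N, (o < m * 2)%N, (u < n)%N, (\sum_(i < m * 2) todo vis H' i < \sum_(i < m * 2) todo vis H i)%N &
   (g u <= -1 -> sinv vis g s sc dn H') /\
   (-1 < g u -> forall D,
     (forall t, (t < D) <-> exists2 w, (w < n)%N & (t < g w) && same d t u w) ->
     exists s' sc', sinv vis (fun p => if p == u then D + c e else g p) s' sc' dn H')].
Proof.
case=> I Hm Hl Hd Hs Hnil H0 i0 e o u H'; have [vis0 hl] := Hl H0.
have i0m : (i0 < m * 2)%N by rewrite /i0; lia.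
have em : (e < m)%N by rewrite /e ltn_divLR.
have om : (o < m * 2)%N by rewrite /o /i0 in i0m *; have := ltn_mod H.-1 2; lia.
have un : (u < n)%N := hpn om.
have par : (i0 = e * 2 /\ o = e * 2 + 1 \/ i0 = e * 2 + 1 /\ o = e * 2)%N.
  by rewrite /o /e /i0; lia.
have eu : ends_at ea eb e (last 0%N vis) u.
  by rewrite -hl -/i0 /ends_at /ea /eb; case: par => -[E1 E2]; [left|right]; rewrite /u -?E1 -?E2; split; congr hp; lia.
have H'i : (H' <= i0)%N by apply: pvocc_le.
have Hi : H = i0.+1 by rewrite /i0; lia.
have mono i : todo vis H' i -> todo vis H i.
  by rewrite /todo => /orP[-> //|/andP[-> h2]]; apply/orP; right; rewrite Hi; lia.
have t0 : todo vis H i0 by rewrite /todo -hl eqxx Hi ltnSn orbT.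
have lv : last 0%N vis \in vis by case: (vis) vis0 => //= a l _; apply: mem_last.
have t0' : ~~ todo vis H' i0 by rewrite /todo hl lv eqxx -leqNgt.
have xu : last 0%N vis != u.
  apply/eqP => E; apply: (loopless em); rewrite -!hpE; try lia; congr vt.
  by case: eu; rewrite /ea /eb => -[-> ->].
have doneP i : (i < m * 2)%N -> ~~ todo vis H' i -> i != i0 -> ~~ todo vis H i.
  move=> im nt ii; apply: contra nt; rewrite /todo => /orP[->//|/andP[/eqP hE iH]].
  rewrite hE eqxx /=; apply/orP; right; apply: pvocc_max; first by rewrite Hi in iH; lia.
  by rewrite -!hpE // hE -hl.
have gu_vis : u \in vis -> g u = -1 by apply: (mi_gvis I).
split=> //.
  rewrite (bigD1 (Ordinal i0m)) //= [X in (_ < X)%N](bigD1 (Ordinal i0m)) //= t0 (negbTE t0').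
  rewrite add0n add1n ltnS; apply: leq_sum => i _.
  by case E: (todo _ H' _); rewrite // (mono _ E).
have lastH' : (0 < H')%N -> vis != [::] /\ hp H'.-1 = last 0%N vis.
  move=> H'0; split=> //; rewrite -hl -/i0; apply: hp_src => //; first by lia.
  by rewrite pvocc_src.
split=> [gu|gu D HD].
  have uv : u \in vis by apply: contraTT gu => /(mi_gnew I un) h; rewrite -ltNge; lra.
  have sce : sc e.
    have -> : e = (o %/ 2)%N by case: par => -[_ ->]; rewrite ?mulnK // divnMDl // addn0.
    by apply: Hd => //; rewrite /todo -/u uv eq_sym (negbTE xu).
  split=> //; [by lia| |].
  - move=> i im nt; have [->|ii] := eqVneq i i0; first exact: sce.
    by apply: Hd => //; apply: doneP.
  - by move=> f fm /(Hs f fm) /orP[h1|h1]; apply/orP; [left|right]; apply: contra h1; apply: mono.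
have uv : u \notin vis by apply/negP => /gu_vis E; move: gu; rewrite E ltxx.
have nsc : ~~ sc e.
  apply/negP => /(Hs e em); case: par => -[E1 E2]; (first [rewrite -E2 -E1|rewrite -E1 -E2]); rewrite t0 /=;
    by rewrite /todo -/u uv.
exists (fun f => if f == e then D else s f), (fun f => (f == e) || sc f); split=> //.
- by apply: ma_scan.
- by lia.
- move=> i im nt; have [->|ii] := eqVneq i i0; first by rewrite eqxx.
  by rewrite (Hd i) ?orbT //; apply: doneP.
- move=> f fm /orP[/eqP ->|/(Hs f fm) /orP[h1|h1]].
  + by apply/orP; case: par => -[E1 E2]; [left|right]; rewrite -E1.
  + by apply/orP; left; apply: contra h1; apply: mono.
  + by apply/orP; right; apply: contra h1; apply: mono.
- by move=> E; rewrite E in vis0.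
Qed.

(** Every edge has an end different from the position visited last, because it is no loop, and all
    half-edges of that end have been examined. *)
Lemma sinv_end vis g s sc dn H : sinv vis g s sc dn H -> size vis = n ->
  forall e, (e < m)%N -> sc e.
Proof.
case=> I Hm Hl Hd Hs _ sz e em.
have all p : (p < n)%N -> p \in vis.
  move=> pn; have [_ E] : (size vis = size (iota 0 n)) * (vis =i iota 0 n).
    apply: uniq_min_size (mi_uniq I) _ _; first by move=> q /(mi_lt I); rewrite mem_iota.
    by rewrite size_iota sz.
  by rewrite E mem_iota.
have i1 : (e * 2 < m * 2)%N by lia.
have i2 : (e * 2 + 1 < m * 2)%N by lia.
have [l1|l1] := eqVneq (hp (e * 2)) (last 0%N vis).
  have := Hd _ i2; rewrite divnMDl // addn0; apply.
  rewrite /todo all ?hpn //=; case: eqP => //= l2; exfalso.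
  by apply: (loopless em); rewrite -!hpE // l1 l2.
have := Hd _ i1; rewrite mulnK //; apply.
by rewrite /todo all ?hpn //= (negbTE l1).
Qed.

End SearchOrder.

(** Amortisation: a unit of the measure is worth [q.+1] ticks, one for the pass itself and [q] for
    its body. *)
Lemma pay_tick a b q k k' k2 C : (a < b)%N -> (q.+1 <= k')%N -> (k + b * q.+1 <= k' + C)%N ->
  (k'.-1 <= k2 + q)%N -> (k + a * q.+1 <= k2 + C)%N.
Proof.
move=> ab qk H H2; have : (a.+1 * q.+1 <= b * q.+1)%N by rewrite leq_mul2r ab orbT.
by rewrite mulSn; lia.
Qed.

Lemma level_ext (R : realFieldType) n m eu ev (c : nat -> R) vt d w dw vt' d' w' dw' : (0 < n)%N ->
  (forall j, (j < n)%N -> [/\ w j = vt j, dw j = d j, w' j = vt' j & dw' j = d' j]) ->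
  level n m eu ev c vt d vt' d' -> level n m eu ev c w dw w' dw'.
Proof.
move=> n0 H [[s [u1 u2 u3 u4]] [ord1 ord2 ord3 ord4] p].
have sumE t (f f' : nat -> R) : (forall j, (j < n)%N -> f j = f' j) ->
    (\sum_(j < n) (f j <= t)%R = \sum_(j < n) (f' j <= t)%R)%N.
  by move=> E; apply: eq_bigr => j _; rewrite E.
split.
- exists s; split=> //.
  + move=> t E t0 eE Eo Ee j jn; have [_ _ Ew' Ed'] := H j ltac:(lia).
    have [_ _ Ew'' _] := H j.-1 ltac:(lia).
    rewrite Ew' Ed' Ew'' => tj; apply: (u1 t) => // q qn tq.
    have [Ew Ed _ _] := H q ltac:(lia); have [Ew2 _ _ _] := H q.-1 ltac:(lia).
    by rewrite -Ew -Ew2; apply: Eo; rewrite ?Ed.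
  + move=> e i j l em HE ilj jn; have [_ _ _ ->] := H l ltac:(lia).
    have [_ _ Ei _] := H i ltac:(lia); have [_ _ Ej _] := H j ltac:(lia).
    by rewrite Ei Ej in HE; apply: u2 HE _ _.
  + move=> t t0; rewrite (sumE t dw' d') ?(sumE t dw d); [exact: u3|by move=> j /H[]|by move=> j /H[]].
- split.
  + by move=> j jn; have [_ _ -> _] := H j jn; apply: ord1.
  + by move=> i j li lj; have [_ _ -> _] := H i li; have [_ _ -> _] := H j lj; apply: ord2.
  + by have [_ _ _ ->] := H 0%N n0.
  + by move=> j jn; have [_ _ _ ->] := H j jn; apply: ord4.
- by move=> j jn; have [_ _ _ ->] := H j ltac:(lia); apply: p.
Qed.

Section LevelSearch.
Variables (R : realType) (X n m M r : nat) (src : nat -> nat) (c : nat -> R).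
Hypotheses (Mr : M = (2 ^ r)%N) (nM : (n <= M)%N) (MX : (M * 2 <= X)%N) (mX : (m * 2 <= X)%N).
Hypotheses (nX : (n + 2 <= X)%N) (n0 : (0 < n)%N).
Hypothesis srcn : forall h, (h < m * 2)%N -> (src h < n)%N.
Hypothesis c_gt0 : forall e, (e < m)%N -> 0 < c e.
Hypothesis loopless : forall e, (e < m)%N -> src (e * 2)%N <> src (e * 2 + 1)%N.
Hypothesis cut : forall (P : pred nat) x y, (x < n)%N -> (y < n)%N -> P x -> ~~ P y ->
  exists2 e, (e < m)%N & P (src (e * 2)%N) != P (src (e * 2 + 1)%N).
Implicit Types h : hst R.

Notation run := (run X (m * 2)).
Notation env := (env n m M src c).
Notation adjl := (adjl m src).
Notation eu := (fun e => src (e * 2)%N).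
Notation ev := (fun e => src (e * 2 + 1)%N).

Let M0 : (0 < M)%N. Proof. by rewrite Mr expn_gt0. Qed.

Lemma run_SCAN Q h k d g H hp : env h -> adjl h -> iv h vh = H -> (0 < H <= m * 2)%N ->
  tree (ra h) M d g -> (forall i, (i < m * 2)%N -> ia h iPS (src i) = hp i /\ (hp i < n)%N) ->
  (2 * r <= k)%N -> let u := hp (H - 2 * (H.-1 %% 2))%N in
  (forall h' k', agree SCAN h h' -> iv h' vh = pvocc src H.-1 (src H.-1) ->
    (g u <= -1 /\ tree (ra h') M d g) \/
    (-1 < g u /\ exists D, (forall t, t < D <-> exists2 w, (w < M)%N & (t < g w) && same d t u w) /\
       tree (ra h') M d (fun p => if p == u then D + c (H.-1 %/ 2)%N else g p)) ->
    (k <= k' + 2 * r)%N -> Q h' k') ->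
  run SCAN Q h k.
Proof.
move=> he ad hH Hm tr hps rk u HQ.
pose P h' k' := [/\ iv h' vh = pvocc src H.-1 (src H.-1),
    (g u <= -1 /\ tree (ra h') M d g) \/
    (-1 < g u /\ exists D, (forall t, t < D <-> exists2 w, (w < M)%N & (t < g w) && same d t u w) /\
       tree (ra h') M d (fun p => if p == u then D + c (H.-1 %/ 2)%N else g p)) &
    (k <= k' + 2 * r)%N].
suff : run SCAN P h k by move/run_mono; apply=> h' k' a _ [t1 t2 l]; apply: HQ.
set o := (H - 2 * (H.-1 %% 2))%N in u P HQ *.
have om : (o < m * 2)%N by have := ltn_mod H.-1 2; rewrite /o; lia.
have [uE un] := hps o om; rewrite -/u in uE un.
rewrite /SCAN; hstep; apply: run_GetW; rewrite /= hH subn1 -/o //.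
have -> : iw h o = src o by rewrite (env_w he).
do 2 hstep; first by rewrite uE; lia.
rewrite /= uE; hstep; set h1 := setI _ _ _.
have he1 : env h1 by case: he => *; split.
have ad1 : adjl h1 by case: ad => *; split.
have last h2 k2 : adjl h2 -> iv h2 vh = H -> (k <= k2 + 2 * r)%N -> 
   (g u <= -1 /\ tree (ra h2) M d g) \/
    (-1 < g u /\ exists D, (forall t, t < D <-> exists2 w, (w < M)%N & (t < g w) && same d t u w) /\
       tree (ra h2) M d (fun p => if p == u then D + c (H.-1 %/ 2)%N else g p)) ->
   run (SetI vh (IArr iNX ($vh - #1))) P h2 k2.
  move=> ad2 h2H kk HT; have E : ia h2 iNX (H - 1)%N = pvocc src H.-1 (src H.-1).
    by rewrite (adj_NX ad2) subn1 //; lia.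
  apply: run_SetI; rewrite /= h2H E; last by split.
  by have := pvocc_le src H.-1 (src H.-1); lia.
have Gu : ra h aG (M + u)%N = g u by apply: (leaf_G tr.2); lia.
apply: run_Cond => /=; rewrite (env_M he) Gu mulr0n mulr1n sub0r => gu; last first.
  hstep; apply: last => //; first by lia.
  by left; rewrite leNgt.
hstep; apply: (@run_QUERY _ _ _ M r d g _ _ _ u); rewrite ?(env_M he1) //; try lia.
move=> h2 k2 A2 HD kk2.
have he2 : env h2 by apply: (env_agree A2 isT).
have h2H : iv h2 vh = H by rewrite (agree_iv A2) //= hH.
hstep; apply: run_GetC; rewrite /= h2H subn1; first by rewrite ltn_divLR //; lia.
have -> : rw h2 (H.-1 %/ 2)%N = c (H.-1 %/ 2)%N by rewrite (env_c he2) // ltn_divLR //; lia.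
do 2 hstep; rewrite /=; set h3 := setR _ _ _.
have tr3 : tree (ra h3) M d g.
  by apply: tree_eq tr => a a4; rewrite /= (agree_ra A2).
apply: (@run_SETLEAF _ _ _ M r d g _ _ _ u);
  [by rewrite /= (env_M he2)|exact: Mr|exact: MX|by rewrite /= (agree_iv A2)|lia|exact: tr3|lia|].
move=> h4 k4 A4 tr4 kk4; apply: last; last 1 first.
- by right; split=> //; exists (rv h2 xA).
- by apply: (adj_agree A4 isT); case: (adj_agree A2 isT ad1) => *; split.
- by rewrite (agree_iv A4).
- lia.
Qed.

Lemma run_SEARCH Q h k b d vt : env h -> adjl h -> iv h vb = b ->
  tree (ra h) M d (fun p => if (p < n)%N then 0 else -1) -> ordering n vt d ->
  (forall p, (p < n)%N -> ia h iVT (b + p)%N = vt p) ->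
  (forall p, (p < n)%N -> ia h iPS (vt p) = p) ->
  ((n + m * 2) * (4 * r).+1 <= k)%N ->
  (forall h' k', agree SEARCH h h' ->
    (forall i, (i < b + n)%N -> ia h' iVT i = ia h iVT i /\ ra h' aDL i = ra h aDL i) ->
    level n m eu ev c vt d (fun j => ia h' iVT (b + n + j)%N)
      (fun j => if (j < n)%N then ra h' aDL (b + n + j)%N else 0) ->
    (k <= k' + (n + m * 2) * (4 * r).+1)%N -> Q h' k') ->
  run SEARCH Q h k.
Proof.
move=> he ad hb tr ord hvt hps rk HQ.
pose P h' k' := [/\ (forall i, (i < b + n)%N -> ia h' iVT i = ia h iVT i /\ ra h' aDL i = ra h aDL i),
    level n m eu ev c vt d (fun j => ia h' iVT (b + n + j)%N)
      (fun j => if (j < n)%N then ra h' aDL (b + n + j)%N else 0) &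
    (k <= k' + (n + m * 2) * (4 * r).+1)%N].
suff : run SEARCH P h k by move/run_mono; apply=> h' k' a _ [t1 t2 l]; apply: HQ.
have [ord1 ord2 ord3 ord4] := ord.
pose hp i := ia h iPS (src i).
have surj v : (v < n)%N -> exists2 p, (p < n)%N & vt p = v.
  move=> vn; pose f (i : 'I_n) : 'I_n := Ordinal (ord1 i (ltn_ord i)).
  have fi : injective f by move=> i j /(congr1 val) /= /ord2 E; apply/val_inj/E.
  have [f' _ f'K] := injF_bij fi.
  by exists (f' (Ordinal vn)); rewrite ?ltn_ord //; have /(congr1 val) := f'K (Ordinal vn).
have hpn i : (i < m * 2)%N -> (hp i < n)%N.
  by move=> im; have [p pn E] := surj _ (srcn im); rewrite /hp -E hps.
have hpE i : (i < m * 2)%N -> vt (hp i) = src i.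
  by move=> im; have [p pn E] := surj _ (srcn im); rewrite /hp -E hps.
have hcut (P0 : pred nat) x y : (x < n)%N -> (y < n)%N -> P0 x -> ~~ P0 y ->
  exists2 e, (e < m)%N & P0 (hp (e * 2)%N) != P0 (hp (e * 2 + 1)%N).
  move=> xn yn Px Py; apply: (cut (P := fun v => P0 (ia h iPS v)) (x := vt x) (y := vt y)); rewrite ?hps //; exact: ord1.
rewrite /SEARCH; do 2 hstep; first by [].
do 2 hstep; first by [].
pose T (vis : seq nat) H := (\sum_(i < m * 2) todo hp vis H i)%N.
apply: (run_Loop (I := fun h' k' => exists vis g s sc dn,
  [/\ sinv n m hp c d vis g s sc dn (iv h' vh),
   iv h' vj = size vis /\ (size vis <= n)%N, tree (ra h') M d g,
   (forall i, (i < b + n)%N -> ia h' iVT i = ia h iVT i /\ ra h' aDL i = ra h aDL i) /\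
   (forall j, (j < size vis)%N -> ia h' iVT (b + n + j)%N = vt (nth 0%N vis j) /\
      ra h' aDL (b + n + j)%N = dn j) &
   (k + (n - size vis + T vis (iv h' vh)) * (4 * r).+1 <= k' + (n + m * 2) * (4 * r).+1)%N])).
- move=> h' k' A [vis [g [s [sc [dn [I [hj jn] tr' [HB HV] kk]]]]]] /=.
  have he' : env h' by apply: (env_agree A isT); case: he => *; split.
  have ad' : adjl h' by apply: (adj_agree A isT); case: ad => *; split.
  have hb' : iv h' vb = b by rewrite (agree_iv A).
  have hps' : ia h' iPS = ia h iPS by rewrite (agree_ia A).
  rewrite hj (env_n he') => lt.
  have pay : (0 < n - size vis + T vis (iv h' vh))%N by lia.
  have pay2 : ((4 * r).+1 <= k')%N.
    by move: pay kk rk; case: (n - size vis + _)%N => // q _; rewrite mulSn; clear; lia.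
  split; first by lia.
  apply: run_Cond => /=; last first.
    rewrite -leqNgt leqn0 => /eqP H0; rewrite H0 in I kk pay.
    have gout := mi_gout (si_ma I).
    have [p0 p0n p0v] : exists2 p, (p < n)%N & p \notin vis.
      case: (pselect (exists2 p, (p < n)%N & p \notin vis)) => // nex.
      have : (size (iota 0 n) <= size vis)%N.
        apply: uniq_leq_size (iota_uniq _ _) _ => p; rewrite mem_iota => /andP[_ pn].
        by case: (boolP (p \in vis)) => // pv; case: nex; exists p.
      by rewrite size_iota; lia.
    apply: (run_VISIT (b := b) (j := size vis) (d := d) (g := g) (vt := vt) (c := c) (src := src) Mr nM MX mX nX) => //.
    + by exists p0 => //; apply: (mi_gnew (si_ma I)).
    + move=> p pn; have [-> _] := HB (b + p)%N ltac:(lia).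
      by rewrite hvt //; split=> //; apply: ord1.
    + by clear -pay2; lia.
    move=> h2 k2 v A2 vn gmax tr2 j2 vh2 VT2 DL2 kk2.
    have [I2 mono] := sinv_visit c_gt0 n0 ord3 hpn hpE ord2 hcut I lt vn gmax.
    exists (rcons vis v), (visited n d v g), s, sc, (fun j => if j == size vis then g v else dn j).
    rewrite size_rcons vh2; split=> //.
    * split=> [i ib|j]; first by rewrite VT2 DL2 (_ : (i == _) = false); [exact: HB|lia].
      rewrite ltnS leq_eqVlt => /orP[/eqP ->|jv].
        by rewrite VT2 DL2 eqxx nth_rcons ltnn !eqxx.
      rewrite VT2 DL2 nth_rcons jv (ltn_eqF jv) (_ : (_ == _) = false); last by lia.
      exact: HV.
    * have le : (T (rcons vis v) (pvocc src (m * 2) (vt v)) <= T vis 0)%N.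
        apply: leq_sum => i _; case E : (todo _ (rcons _ _) _ _) => //.
        by rewrite (mono _ E).
      have le2 : (n - (size vis).+1 + T (rcons vis v) (pvocc src (m * 2) (vt v)) <
         n - size vis + T vis 0)%N by clear -le lt; lia.
      by apply: pay_tick le2 pay2 kk _.
  move=> H0; set H := iv h' vh in H0 I kk *.
  pose u := hp (H - 2 * (H.-1 %% 2))%N; pose H' := pvocc src H.-1 (src H.-1).
  have := sinv_scan c_gt0 n0 ord3 hpn hpE ord2 loopless I H0; rewrite /= -/u -/H' => -[em om un lts [Sno Syes]].
  apply: (run_SCAN (d := d) (g := g) (H := H) (hp := hp)) => //.
  + by have := si_H I; lia.
  + by move=> i im; rewrite hps'; split=> //; apply: hpn.
  + by clear -pay2; lia.
  move=> h2 k2 A2 hH2 Hcase kk2.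
  have fin g2 s2 sc2 : sinv n m hp c d vis g2 s2 sc2 dn H' -> tree (ra h2) M d g2 ->
     exists vis g s sc dn, [/\ sinv n m hp c d vis g s sc dn (iv h2 vh),
   iv h2 vj = size vis /\ (size vis <= n)%N, tree (ra h2) M d g,
   (forall i, (i < b + n)%N -> ia h2 iVT i = ia h iVT i /\ ra h2 aDL i = ra h aDL i) /\
   (forall j, (j < size vis)%N -> ia h2 iVT (b + n + j)%N = vt (nth 0%N vis j) /\
      ra h2 aDL (b + n + j)%N = dn j) &
   (k + (n - size vis + T vis (iv h2 vh)) * (4 * r).+1 <= k2 + (n + m * 2) * (4 * r).+1)%N].
    move=> I2 tr2; exists vis, g2, s2, sc2, dn.
    have EVT : ia h2 iVT = ia h' iVT by rewrite (agree_ia A2).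
    have EDL : ra h2 aDL = ra h' aDL by rewrite (agree_ra A2).
    rewrite hH2 -/H' EVT EDL (agree_iv A2) //; split=> //.
    have le2 : (n - size vis + T vis H' < n - size vis + T vis H)%N by rewrite ltn_add2l.
    by apply: pay_tick le2 pay2 kk _; clear -kk2; lia.
  case: Hcase => [[gu tr2]|[gu [D [HD tr2]]]]; first by apply: fin (Sno gu) tr2.
  have [|s2 [sc2 I2]] := Syes gu D; last by apply: fin I2 tr2.
  (* The query also sees padding leaves. Their link -1 is smaller than that of [u], so [u] itself
     can replace such a witness. *)
  move=> t; rewrite HD; split=> -[w wn tw]; last by exists w; [lia|].
  case: (ltnP w n) => wn2; first by exists w.
  exists u => //; rewrite same_refl andbT; case/andP: tw => tw _.
  by rewrite (mi_gout (si_ma I) wn2) in tw; apply: lt_trans gu.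
- move=> h' k' A _ [vis [g [s [sc [dn [I [hj jn] tr' [HB HV] kk]]]]]] /=.
  have he' : env h' by apply: (env_agree A isT); case: he => *; split.
  rewrite hj (env_n he') -leqNgt => ge; have sz : size vis = n by lia.
  split=> //; last first.
    move: kk; rewrite sz subnn add0n; clear; lia.
  apply: (level_ext n0) (ma_level n0 ord _ _ (si_ma I) sz (sinv_end n0 hpn hpE loopless I sz)).
  + by move=> j jn'; rewrite jn'; have [-> ->] := HV j ltac:(lia).
  + by move=> e em; rewrite !hpE //; lia.
  + by move=> e em; split; apply: hpn; lia.
- exists [::], (fun p => if (p < n)%N then 0 else -1), (fun=> 0), pred0, (fun=> 0).
  split=> //=; first exact: sinv_start.
  have le : (T [::] 0%N <= m * 2)%N.
    rewrite -[X in (_ <= X)%N]card_ord -sum1_card; apply: leq_sum => i _.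
    by case: (todo _ _ _ _).
  by have := leq_mul2r (4 * r).+1 (n - 0 + T [::] 0%N) (n + m * 2); rewrite subn0 leq_add2l le orbT; clear; lia.
Qed.

End LevelSearch.

(** * Selection by increasing key *)

(* [key] leaves the value of leaf [vp] in [xv], where it finds -1. *)
Definition FILL key :=
  SetI vp #0 ;;
  Loop (CI $vp $vM) (SetR xv (#0 - #1) ;; key ;; PUTLEAF) ;;
  BUILD.

Definition SELECT act :=
  Loop (CI $vi $vq)
    (ARGMAX ;; act ;; SetR xv (#0 - #1) ;; SETLEAF ;; SetI vi ($vi + #1)).

Definition pure_key p := [&& vM \notin miv p, vp \notin miv p, nilp (mra p) & nilp (mia p)].
Definition pure_act p := [&& vM \notin miv p, vi \notin miv p, vp \notin miv p, vq \notin miv p &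
  all (fun a => 3 < a)%N (mra p)].

Section Selection.
Variables (R : realType) (X n m M r : nat).
Hypotheses (Mr : M = (2 ^ r)%N) (nM : (n <= M)%N) (MX : (M * 2 <= X)%N) (mX : (m * 2 <= X)%N).
Hypothesis nX : (n + 2 <= X)%N.
Implicit Types h : hst R.

Notation run := (run X (m * 2)).

Let M0 : (0 < M)%N. Proof. by rewrite Mr expn_gt0. Qed.

Lemma run_FILL key g Q h k : iv h vM = M -> (2 * M <= k)%N -> pure_key key ->
  (forall h' k' p, agree (FILL key) h h' -> iv h' vp = p -> (p < M)%N -> rv h' xv = -1 ->
     run key (fun h2 k2 => k2 = k' /\ rv h2 xv = g p) h' k') ->
  (forall h' k' d, agree (FILL key) h h' -> tree (ra h') M d g -> (k <= k' + 2 * M)%N -> Q h' k') ->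
  run (FILL key) Q h k.
Proof.
move=> hM Mk /and4P[pM pp /nilP pra /nilP pia] Hkey HQ.
pose d p := ra h aM (M + p)%N.
suff : run (FILL key) (fun h' k' => tree (ra h') M d g /\ (k <= k' + 2 * M)%N) h k.
  by move/run_mono; apply=> h' k' a _ [t1 l]; apply: HQ t1 l.
rewrite /FILL; do 2 hstep; first by [].
hstep; apply: (run_Loop (I := fun h' k' => [/\ (iv h' vp <= M)%N, (k <= k' + iv h' vp)%N,
  pleaves M (ra h') d g (iv h' vp) & forall q, ra h' aM q = ra h aM q])).
- move=> h' k' A [pM' hk pl hm] /=.
  have hM' : iv h' vM = M by rewrite (agree_iv A) //= mem_cat !inE orbF (negbTE pM).
  rewrite hM' => lt; split; first by lia.
  do 3 hstep; set h1 := setR _ _ _.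
  have A1 : agree (FILL key) h h1.
    have y0 : xv \in mrv (FILL key) by rewrite /= inE eqxx.
    case: A => b1 b2 b3 b4 b5 b6; split=> //.
    + move=> x; rewrite /= inE negb_or mem_cat negb_or => /andP[xp /andP[xb _]].
      by rewrite b1 //= (negbTE xp).
    + move=> x xN; rewrite /= (_ : (x == xv) = false); last by apply: contraNF xN => /eqP ->.
      by rewrite b2 //; move: xN; rewrite /= !inE !mem_cat !negb_or => /andP[-> /andP[/andP[-> _] _]].
    + by move=> x; rewrite /= mem_cat negb_or => /andP[xb _]; rewrite b3.
    + by move=> x; rewrite /= mem_cat negb_or => /andP[xb _]; rewrite b4.
    + by move=> /=; rewrite orbF => ?; rewrite b5.
  apply: run_mono (Hkey h1 k'.-1 (iv h' vp) A1 erefl lt _) _; first by rewrite /= mulr0n mulr1n sub0r.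
  move=> h2 k2 A2 _ [-> hv]; have ra2 : ra h2 = ra h'.
    by apply/funext => a; rewrite (agree_ra A2) ?pra.
  have p2 : iv h2 vp = iv h' vp by rewrite (agree_iv A2).
  have M2 : iv h2 vM = M by rewrite (agree_iv A2).
  apply: (run_PUTLEAF Mr nM MX mX nX (p := iv h' vp) (d := d) (g := g)) => //.
  + by rewrite ra2.
  + by rewrite ra2 hm.
  + by move=> h3 A3 pl3 p3 E3; split; [lia|lia|by rewrite p3|move=> q; rewrite E3 ra2].
- move=> h' k' A _ [pM' hk pl hm] /=.
  have hM' : iv h' vM = M by rewrite (agree_iv A) //= mem_cat !inE orbF (negbTE pM).
  rewrite hM' -leqNgt => Mp; have pE : iv h' vp = M by lia.
  rewrite pE in pl hk.
  apply: (@run_BUILD _ _ _ M d g) => //; [lia|exact: pleaves_all|lia|].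
  by move=> h2 k2 A2 tr kk; split=> //; lia.
- by split=> //=; lia.
Qed.

(** The third clause says both that the keys are taken in increasing order and that nothing left
    over is smaller. *)
Definition selected (D : pred nat) (key : nat -> R) ext := [/\ uniq ext,
  forall p, p \in ext -> D p &
  forall i p, (i < size ext)%N -> D p -> p \notin take i ext -> key (nth 0%N ext i) <= key p].

Lemma selected_rcons D key ext v : selected D key ext -> D v -> v \notin ext ->
  (forall p, D p -> p \notin ext -> key v <= key p) -> selected D key (rcons ext v).
Proof.
move=> [u1 u2 u3] Dv vN vmin; split; first by rewrite rcons_uniq vN.
  by move=> p; rewrite mem_rcons inE => /orP[/eqP ->|/u2].
move=> i p; rewrite size_rcons ltnS leq_eqVlt => /orP[/eqP ->|lt] Dp.
  by rewrite nth_rcons ltnn eqxx -cats1 take_size_cat // => /vmin; apply.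
by rewrite nth_rcons lt -cats1 takel_cat ?(ltnW lt) // => pN; apply: u3.
Qed.

(** [J] records what the actions have done for the elements extracted so far. It has to survive
    changes to the first four real arrays, which hold the tree. *)
Lemma run_SELECT act (D : pred nat) key (J : seq nat -> (nat -> nat -> nat) -> (nat -> nat -> R) -> Prop)
    d q Q h k : iv h vM = M -> iv h vi = 1%N -> iv h vq = q.+1 -> (q.+2 <= X)%N ->
  pure_act act -> (forall p, D p -> (p < M)%N) -> (forall p, D p -> 0 <= key p) ->
  (q <= count D (iota 0 M))%N ->
  tree (ra h) M d (fun p => if D p then 1 / (1 + key p) else -1) ->
  (forall ext f A A', (forall a, (3 < a)%N -> A' a = A a) -> J ext f A -> J ext f A') ->
  (forall h' k' ext v, agree (SELECT act) h h' -> iv h' vp = v -> iv h' vi = (size ext).+1 ->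
     (size ext < q)%N -> D v -> selected D key (rcons ext v) -> J ext (ia h') (ra h') ->
     run act (fun h2 k2 => k2 = k' /\ J (rcons ext v) (ia h2) (ra h2)) h' k') ->
  J [::] (ia h) (ra h) -> (q * (2 * r).+1 <= k)%N ->
  (forall h' k' ext, agree (SELECT act) h h' -> selected D key ext -> size ext = q ->
     J ext (ia h') (ra h') -> (k <= k' + q * (2 * r).+1)%N -> Q h' k') ->
  run (SELECT act) Q h k.
Proof.
move=> hM hi hq qX /and5P[pM pi pp pq /allP pra] DM Dkey qD tr Jst Jact J0 kq HQ.
suff : run (SELECT act) (fun h' k' => exists ext, [/\ selected D key ext, size ext = q,
     J ext (ia h') (ra h') & (k <= k' + q * (2 * r).+1)%N]) h k.
  by move/run_mono; apply=> h' k' a _ [ext [t1 t2 t3 l]]; apply: HQ t1 t2 t3 l.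
pose g (ext : seq nat) p := if D p && (p \notin ext) then 1 / (1 + key p) else -1 : R.
have pinv p : D p -> 0 < 1 / (1 + key p).
  by move=> /Dkey kp; rewrite divr_gt0 //; lra.
rewrite {1}/SELECT; apply: (run_Loop (I := fun h' k' => exists ext, [/\ selected D key ext, (size ext <= q)%N /\ iv h' vi = (size ext).+1,
     tree (ra h') M d (g ext), J ext (ia h') (ra h') &
     (k + (q - size ext) * (2 * r).+1 <= k' + q * (2 * r).+1)%N])).
- move=> h' k' A0 [ext [sel [sq ie] tr' J' kk]] /=.
  have A : agree (SELECT act) h h' by case: A0 => *; split.
  have iv0 x : x \notin miv (SELECT act) -> iv h' x = iv h x by move/(agree_iv A).
  have hM' : iv h' vM = M by rewrite iv0 // /= !inE mem_cat !inE (negbTE pM).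
  have hq' : iv h' vq = q.+1 by rewrite iv0 // /= !inE mem_cat !inE (negbTE pq).
  rewrite ie hq' => lt.
  have pay2 : ((2 * r).+1 <= k')%N.
    have [z E] : exists z, (q - size ext = z.+1)%N by exists (q - size ext).-1; lia.
    by move: kk kq; rewrite E mulSn; clear; lia.
  split; first by lia.
  hstep; apply: (@run_ARGMAX _ _ _ M r d (g ext)) => //; first by clear -pay2; lia.
  move=> h1 k1 A1 vM1 hT gm kk1; set v := iv h1 vp in vM1 hT gm *.
  have [u1 u2 u3] := sel.
  have [p0 Dp0 p0N] : exists2 p, D p & p \notin ext.
    case: (pselect (exists2 p, D p & p \notin ext)) => // nex.
    have : (size (seq.filter D (iota 0 M)) <= size ext)%N.
      apply: uniq_leq_size (filter_uniq _ (iota_uniq _ _)) _ => p; rewrite mem_filter => /andP[Dp _].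
      by case: (boolP (p \in ext)) => // pv; case: nex; exists p.
    by rewrite size_filter; lia.
  have /andP[Dv vN] : D v && (v \notin ext).
    have := gm p0 (DM _ Dp0); rewrite {1}/g Dp0 p0N /= /g; case: ifP => // _.
    by have := pinv p0 Dp0; lra.
  have vmin p : D p -> p \notin ext -> key v <= key p.
    move=> Dp pN; have := gm p (DM _ Dp); rewrite /g Dp pN Dv vN /=.
    have kp := Dkey p Dp; have kv := Dkey v Dv.
    by rewrite ler_pdivrMr ?ltr_pwDl // mulrAC mul1r ler_pdivlMr ?ltr_pwDl // mul1r lerD2l.
  have sel2 := selected_rcons sel Dv vN vmin.
  have A1' : agree (SELECT act) h h1.
    apply: (agree_trans A); case: A1 => b1 b2 b3 b4 b5 b6; split=> //.
    + move=> x xN; apply: b1; apply: contra xN => xA.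
      by rewrite -[miv (SELECT act)]/(miv ARGMAX ++ _) mem_cat xA.
    + move=> x xN; apply: b2; apply: contra xN => xA.
      by rewrite -[mrv (SELECT act)]/(mrv ARGMAX ++ _) mem_cat xA.
    + by move=> x _; apply: b3.
    + by move=> x _; apply: b4.
    + by move=> _; apply: b5.
  have J1 : J ext (ia h1) (ra h1).
    have -> : ia h1 = ia h' by apply/funext => a; rewrite (agree_ia A1).
    by apply: Jst J' => a _; rewrite (agree_ra A1).
  hstep; apply: run_mono (Jact h1 k1 ext v A1' erefl _ lt Dv sel2 J1) _; first by rewrite (agree_iv A1).
  move=> h2 k2 A2 _ [-> J2]; do 3 hstep; set h3 := setR _ _ _.
  have tr3 : tree (ra h3) M d (g ext).
    apply: tree_eq tr' => a a4; rewrite /= (agree_ra A2) ?(agree_ra A1) //.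
    by apply/negP => /pra; lia.
  have M3 : iv h3 vM = M by rewrite /= (agree_iv A2) // (agree_iv A1).
  apply: (@run_SETLEAF _ _ _ M r d (g ext) _ _ _ v) => //; [by rewrite /= (agree_iv A2)|by clear -pay2 kk1; lia|].
  move=> h4 k4 A4 tr4 kk4; rewrite /= mulr0n mulr1n sub0r in tr4.
  have i4 : iv h4 vi = (size ext).+1 by rewrite (agree_iv A4) //= (agree_iv A2) // (agree_iv A1).
  hstep; first by rewrite i4; lia.
  exists (rcons ext v); rewrite size_rcons /= i4 addn1; split=> //.
  + have -> : g (rcons ext v) = (fun p => if p == v then -1 else g ext p); last exact: tr4.
    apply/funext => p; rewrite /g mem_rcons inE negb_or.
    by case: (p =P v) => [->|] /=; rewrite ?andbF.
  + have -> : ia h4 = ia h2 by apply/funext => a; rewrite (agree_ia A4).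
    by apply: Jst J2 => -[|[|[|[|a]]]] // _; rewrite (agree_ra A4).
  + have ab : (q - (size ext).+1 < q - size ext)%N by clear -lt; lia.
    apply: (pay_tick ab pay2 kk); clear -kk1 kk4; lia.
- move=> h' k' A0 _ [ext [sel [sq ie] tr' J' kk]] /=.
  have A : agree (SELECT act) h h' by case: A0 => *; split.
  have iv0 x : x \notin miv (SELECT act) -> iv h' x = iv h x by move/(agree_iv A).
  have hq' : iv h' vq = q.+1 by rewrite iv0 // /= !inE mem_cat !inE (negbTE pq).
  rewrite ie hq' -leqNgt => ge; exists ext.
  have sE : size ext = q by lia.
  by split=> //; move: kk; rewrite sE subnn; clear; lia.
- exists [::]; split=> //; last by rewrite subn0; lia.
  have -> // : g [::] = (fun p => if D p then 1 / (1 + key p) else -1).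
  by apply/funext => p; rewrite /g in_nil andbT.
Qed.

End Selection.

(** * Sorted boundaries and the costs of one level *)

(** The tree extracts maxima. [1 / (1 + x)] is decreasing for [x >= 0], so small boundaries come
    first, and it is positive, so all of them come before the empty leaves. *)
Definition SORTKEY :=
  Cond (CI #0 $vp)
    (Cond (CI $vp $vn) (SetR xv (#1 / (#1 + RArr aDL ($vb + $vn + $vp)))) Skip) Skip.

Definition SORTACT :=
  PutI iRK ($vb + $vn + $vp) ($vi - #1) ;;
  PutR aSN $vi (RArr aDL ($vb + $vn + $vp)).

(** Boundary 0 gets the rank [n], which no threshold below [n] exceeds: it never starts a new
    part. *)
Definition SORT :=
  FILL SORTKEY ;; SetI vi #1 ;; SetI vq $vn ;; SELECT SORTACT ;;
  PutI iRK ($vb + $vn) $vn.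

(* Boundary [j] has rank [rk j] in the order of increasing [d], and [sn i] is
   the [i]-th smallest boundary for [0 < i < n]. *)
Record ranked (R : realType) n (d : nat -> R) (rk : nat -> nat) (sn : nat -> R) : Prop := Ranked {
  rkd_ext : exists2 ext, perm_eq ext (index_iota 1 n) &
    forall i, (i < n.-1)%N -> rk (nth 0%N ext i) = i /\ sn i.+1 = d (nth 0%N ext i);
  rkd_0 : rk 0%N = n;
  rkd_sorted : forall i i', (0 < i <= i')%N -> (i' < n)%N -> sn i <= sn i' }.

Section Ranked.
Variables (R : realType) (n : nat) (d : nat -> R) (rk : nat -> nat) (sn : nat -> R).
Hypothesis rkd : ranked n d rk sn.

Lemma ranked_sum (F : nat -> R -> R) :
  \sum_(1 <= j < n) F (rk j) (d j) = \sum_(1 <= i < n) F i.-1 (sn i).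
Proof.
case: rkd => -[ext pe H] _ _; have sz : size ext = n.-1 by rewrite (perm_size pe) size_iota subn1.
rewrite -(perm_big _ pe) /= (big_nth 0%N) sz big_add1 big_nat [RHS]big_nat.
by apply: eq_bigr => i /andP[_ /H[-> ->]].
Qed.

Lemma ranked_nth j : (0 < j < n)%N -> (rk j < n.-1)%N /\ d j = sn (rk j).+1.
Proof.
case: rkd => -[ext pe H] _ _ jn; have sz : size ext = n.-1 by rewrite (perm_size pe) size_iota subn1.
have jext : j \in ext by rewrite (perm_mem pe) mem_index_iota.
have := H (index j ext); rewrite -sz index_mem nth_index // => /(_ jext)[-> ->].
by rewrite index_mem.
Qed.

Lemma ranked_count p : (p < n)%N -> (\sum_(1 <= j < n) (rk j < p)%N = p)%N.
Proof.
move=> pn; apply/eqP; rewrite -(eqr_nat R) natr_sum; apply/eqP.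
rewrite (ranked_sum (fun i _ => (i < p)%N%:R)) big_add1 /= (@big_cat_nat _ _ _ p) //=; last by lia.
rewrite big_nat (eq_bigr (fun=> 1)) => [|i /andP[_ ->]//].
rewrite -big_nat sumr_const_nat subn0 big_nat [X in _ + X]big1 ?addr0 // => i /andP[pi _].
by rewrite ltnNge pi.
Qed.

End Ranked.

Lemma slack_split (R : realType) n q (f : nat -> R) T : (0 < q <= n)%N ->
  (forall j, (0 < j < q)%N -> f j <= T) -> (forall j, (q <= j < n)%N -> T <= f j) ->
  slack n f T = (q.-1)%:R * T - \sum_(1 <= j < q) f j.
Proof.
move=> /andP[q0 qn] le ge; rewrite /slack (@big_cat_nat _ _ _ q) //=.
rewrite [X in _ + X]big_nat [X in _ + X]big1 => [|j ji]; last by rewrite max_l // subr_le0; apply: ge.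
rewrite addr0 -subn1 mulr_natl -sumr_const_nat -sumrB big_nat [RHS]big_nat.
by apply: eq_bigr => j ji; rewrite max_r // subr_ge0; apply: le.
Qed.

Section LevelRest.
Variables (R : realType) (X n m M r : nat) (src : nat -> nat) (c : nat -> R).
Hypotheses (Mr : M = (2 ^ r)%N) (nM : (n <= M)%N) (MX : (M * 2 <= X)%N) (mX : (m * 2 <= X)%N).
Hypotheses (nX : (n + 2 <= X)%N) (n0 : (0 < n)%N).
Implicit Types h : hst R.

Notation run := (run X (m * 2)).
Notation env := (env n m M src c).

Lemma run_SORT Q h k b d : env h -> iv h vb = b ->
  (forall j, (j < n)%N -> ra h aDL (b + n + j)%N = d j /\ 0 <= d j) ->
  (2 * M + n * (2 * r).+1 <= k)%N ->
  (forall h' k', agree SORT h h' ->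
    ranked n d (fun j => ia h' iRK (b + n + j)%N) (ra h' aSN) ->
    (forall i, (i < b + n)%N -> ia h' iRK i = ia h iRK i) ->
    (k <= k' + (2 * M + n * (2 * r).+1))%N -> Q h' k') ->
  run SORT Q h k.
Proof.
move=> he hb hd kq HQ.
suff : run SORT (fun h' k' => [/\ ranked n d (fun j => ia h' iRK (b + n + j)%N) (ra h' aSN),
    (forall i, (i < b + n)%N -> ia h' iRK i = ia h iRK i) &
    (k <= k' + (2 * M + n * (2 * r).+1))%N]) h k.
  by move/run_mono; apply=> h' k' a _ [t1 t2 l]; apply: HQ.
pose D p := (0 < p < n)%N.
rewrite /SORT; hstep.
apply: (run_FILL (g := fun p => if D p then 1 / (1 + d p) else -1) Mr nM MX mX nX (env_M he)) => //.
- by lia.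
- move=> h' k' p A hp pM hx; have he' : env h' by apply: (env_agree A isT).
  have hb' : iv h' vb = b by rewrite (agree_iv A).
  have hDL : ra h' aDL = ra h aDL by rewrite (agree_ra A).
  apply: run_Cond => /=; rewrite hp /D => p0; last by hstep; rewrite (negbTE p0).
  rewrite p0; apply: run_Cond => /=; rewrite hp (env_n he') => pn; last by hstep; rewrite (negbTE pn).
  by hstep; rewrite pn /= hb' (env_n he') hp hDL (hd p pn).1 mulr1n.
move=> h1 k1 d1 A1 tr1 kk1; have he1 : env h1 by apply: (env_agree A1 isT).
have hb1 : iv h1 vb = b by rewrite (agree_iv A1).
have hDL1 : ra h1 aDL = ra h aDL by rewrite (agree_ra A1).
have hRK1 : ia h1 iRK = ia h iRK by rewrite (agree_ia A1).
do 2 hstep; first by lia.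
do 2 hstep; first by rewrite (env_n he1); lia.
rewrite /= (env_n he1); hstep; set h2 := setI _ _ _.
have cD : count D (iota 0 M) = n.-1.
  have -> : iota 0 M = iota 0 n ++ iota n (M - n) by rewrite -iotaD subnKC.
  rewrite count_cat; have -> : count D (iota n (M - n)) = 0%N.
    by apply/eqP; rewrite -leqn0 leqNgt -has_count; apply/hasPn => x; rewrite mem_iota /D; lia.
  rewrite addn0 -[in iota 0 n](prednK n0) /= add0n.
  by rewrite -[RHS](size_iota 1); apply/eqP; rewrite -all_count; apply/allP => x; rewrite mem_iota /D; lia.
pose J (ext : seq nat) (f : nat -> nat -> nat) (A : nat -> nat -> R) := [/\
  forall i, (i < size ext)%N -> f iRK (b + n + nth 0%N ext i)%N = i /\ A aSN i.+1 = d (nth 0%N ext i),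
  forall i, (i < b + n)%N -> f iRK i = ia h iRK i & A aDL = ra h aDL].
apply: (run_SELECT (D := D) (key := d) (J := J) (d := d1) (q := n.-1) Mr nM MX mX nX) => //.
- by rewrite /= (env_M he1).
- by rewrite /= prednK.
- by lia.
- by move=> p /andP[_ pn]; lia.
- by move=> p /andP[_ pn]; have [] := hd p pn.
- by rewrite cD.
- by move=> ext f A A' AA [j1 j2 j3]; split=> [i /j1|//|]; rewrite AA.
- move=> h' k' ext v A hv hi lt /andP[v0 vn] [/= us _ _] [j1 j2 j3].
  have he' : env h' by apply: (env_agree A isT); case: he1 => *; split.
  have hb' : iv h' vb = b by rewrite (agree_iv A).
  rewrite /SORTACT; hstep; hstep; first by rewrite hi; lia.
  hstep; split=> //; rewrite /= hb' (env_n he') hv hi subn1 /J /=; split.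
  + move=> i; rewrite size_rcons ltnS leq_eqVlt => /orP[/eqP ->|lti].
      by rewrite nth_rcons ltnn !eqxx j3 (hd v vn).1.
    rewrite nth_rcons lti eqSS (ltn_eqF lti) (_ : (_ == _) = false); first exact: j1.
    apply/negP => /eqP E; have {}E : nth 0%N ext i = v by lia.
    by move: us; rewrite rcons_uniq -E mem_nth.
  + by move=> i ib; rewrite (_ : (i == _) = false) ?j2 //; lia.
  + by [].
- by split=> //= i ib; rewrite hRK1.
- have : (n.-1 * (2 * r).+1 <= n * (2 * r).+1)%N by rewrite leq_mul2r leq_pred orbT.
  by lia.
move=> h3 k3 ext A3 [u1 u2 u3] sz [j1 j2 j3] kk3.
have he3 : env h3 by apply: (env_agree A3 isT); case: he1 => *; split.
have hb3 : iv h3 vb = b by rewrite (agree_iv A3).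
have pe : perm_eq ext (index_iota 1 n).
  have se : {subset ext <= index_iota 1 n} by move=> x /u2; rewrite mem_index_iota.
  have [_ E] := uniq_min_size u1 se ltac:(rewrite size_iota sz; lia).
  by apply: uniq_perm => //; exact: iota_uniq.
hstep; first by rewrite (env_n he3); lia.
split.
- split.
  + exists ext => // i iN; rewrite -sz in iN; have [e1 e2] := j1 i iN.
    rewrite /= hb3 (env_n he3) e1 e2 (_ : (_ == _) = false) //.
    have : nth 0%N ext i \in ext by apply: mem_nth.
    by rewrite (perm_mem pe) mem_index_iota; lia.
  + by rewrite /= hb3 (env_n he3) addn0 eqxx.
  + move=> [|i] [|i'] // ii i'n /=.
    have [|_ ->] := j1 i; first by rewrite sz; lia.
    have i'z : (i' < size ext)%N by rewrite sz; lia.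
    have [_ ->] := j1 i' i'z.
    apply: u3; [by rewrite sz; lia|by apply: u2; apply: mem_nth|].
    apply/negP => /(nthP 0%N)[z]; rewrite size_take_min => zi; rewrite nth_take; last by lia.
    by move/eqP; rewrite nth_uniq //; lia.
- by move=> i ib; rewrite /= hb3 (env_n he3) (_ : (i == _) = false) ?j2 //; lia.
- have : (n.-1 * (2 * r).+1 <= n * (2 * r).+1)%N by rewrite leq_mul2r leq_pred orbT.
  by lia.
Qed.

Definition cost_of (so sn : nat -> R) T := slack n so T - slack n sn T.

Lemma run_COSTS Q h k l so sn : env h -> iv h vl = l -> (l <= X)%N ->
  (forall i, (0 < i < n)%N -> ra h aSO i = so i /\ ra h aSN i = sn i) ->
  (forall i i', (0 < i <= i')%N -> (i' < n)%N -> so i <= so i') ->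
  (forall i i', (0 < i <= i')%N -> (i' < n)%N -> sn i <= sn i') -> (2 * n <= k)%N ->
  (forall h' k', agree COSTS h h' ->
    (forall i, (0 < i < n)%N -> if (1 < l)%N && (ra h aBC i <= cost_of so sn (sn i))
       then ra h' aBC i = ra h aBC i /\ ia h' iBL i = ia h iBL i
       else ra h' aBC i = cost_of so sn (sn i) /\ ia h' iBL i = l) ->
    ra h' aBC 0%N = ra h aBC 0%N /\ ia h' iBL 0%N = ia h iBL 0%N ->
    (k <= k' + 2 * n)%N -> Q h' k') ->
  run COSTS Q h k.
Proof.
move=> he hl lX hss sos sns kq HQ.
pose res h' i := if (1 < l)%N && (ra h aBC i <= cost_of so sn (sn i))
       then ra h' aBC i = ra h aBC i /\ ia h' iBL i = ia h iBL i
       else ra h' aBC i = cost_of so sn (sn i) /\ ia h' iBL i = l.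
pose same_as h' i := ra h' aBC i = ra h aBC i /\ ia h' iBL i = ia h iBL i.
suff : run COSTS (fun h' k' => [/\ forall i, (0 < i < n)%N -> res h' i, same_as h' 0%N &
    (k <= k' + 2 * n)%N]) h k.
  by move/run_mono; apply=> h' k' a _ [t1 t2 l']; apply: HQ.
rewrite /COSTS; do 2 hstep; first by lia.
do 2 hstep; first by lia.
do 4 hstep.
(* The old boundaries before [vj] are at most the current new one. Every pass advances exactly one
   of the two pointers, so their sum measures the ticks. *)
pose Inv h' k' := [/\ (0 < iv h' vi <= n)%N /\ (0 < iv h' vj <= n)%N,
  rv h' xs = \sum_(1 <= j < iv h' vj) so j /\ rv h' xt = \sum_(1 <= j < iv h' vi) sn j,
  (forall j, (0 < j < iv h' vj)%N -> (iv h' vi < n)%N -> so j <= sn (iv h' vi)),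
  (forall i, (0 < i < iv h' vi)%N -> res h' i) /\
  (forall i, (i == 0)%N || (iv h' vi <= i)%N -> same_as h' i) &
  (k + 2 <= k' + iv h' vi + iv h' vj)%N].
apply: (run_Loop (I := Inv)).
- move=> h' k' A [[iin jin] [hs ht] below [rs un] kk] /=.
  have he' : env h' by apply: (env_agree A isT); case: he => *; split.
  have hl' : iv h' vl = l by rewrite (agree_iv A).
  have hSO : ra h' aSO = ra h aSO by rewrite (agree_ra A).
  have hSN : ra h' aSN = ra h aSN by rewrite (agree_ra A).
  set i := iv h' vi in iin hs ht below rs un kk *.
  set j := iv h' vj in jin hs below kk *.
  rewrite (env_n he') => lt; split; first by lia.
  have [hSNi _] : ra h' aSN i = sn i /\ True by rewrite hSN; split=> //; have [] := hss i ltac:(lia).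
  do 2 hstep; first by [].
  hstep; set h1 := setI h' va _.
  have adv : (0 < j < n)%N -> so j < sn i -> iv h1 vj = j ->
     forall h2, h2 = h1 \/ h2 = setI h1 va 1 -> run
     (SetR xs ($xs + RArr aSO $vj) ;; SetI vj ($vj + #1)) Inv h2 k'.-1.
    move=> jn sosn _ h2 h2E; have [e1 e2 e3 e4 e5] : [/\ iv h2 vj = j, iv h2 vi = i, rv h2 = rv h', ra h2 = ra h' & ia h2 = ia h'].
      by case: h2E => ->.
    do 2 hstep; hstep; first by rewrite e1; lia.
    rewrite /Inv /= e1 e2 e3 e4 addn1; split=> //; first by lia.
    + by rewrite hs hSO (hss j jn).1 big_nat_recr //=; lia.
    + move=> j' /andP[j'0]; rewrite ltnS leq_eqVlt => /orP[/eqP ->|lt'] _; first by rewrite ltW.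
      by apply: below => //; rewrite j'0.
    + by split=> [i' /rs|i' /un]; rewrite /res /same_as /= e4 e5.
    + lia.
  have comp h2 : iv h2 vj = j -> iv h2 vi = i -> iv h2 vl = l -> rv h2 = rv h' -> ra h2 = ra h' -> ia h2 = ia h' ->
     (forall j', (j <= j' < n)%N -> sn i <= so j') -> run
       (SetR xT ((RInt ($vj - #1) * RArr aSN $vi - $xs)
                 - (RInt ($vi - #1) * RArr aSN $vi - $xt)) ;;
        SetI va #0 ;;
        Cond (CI #1 $vl) (Cond (CR $xT (RArr aBC $vi)) Skip (SetI va #1)) Skip ;;
        Cond (CI #0 $va) Skip (PutR aBC $vi $xT ;; PutI iBL $vi $vl) ;;
        SetR xt ($xt + RArr aSN $vi) ;; SetI vi ($vi + #1)) Inv h2 k'.-1.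
    move=> e1 e2 el e3 e4 e5 above.
    have cE : (j - 1)%N%:R * ra h' aSN i - rv h' xs - ((i - 1)%N%:R * ra h' aSN i - rv h' xt) = cost_of so sn (sn i).
      rewrite /cost_of (@slack_split _ n j so) ?(@slack_split _ n i sn) //; last 3 first.
      - by move=> j' ji; apply: sns; lia.
      - by move=> j' ji; apply: sns; lia.
      - by move=> j' ji; apply: below => //; lia.
      by rewrite hSNi hs ht !subn1.
    have [uBC uBL] := un i ltac:(by rewrite leqnn orbT).
    do 2 hstep; do 2 hstep; first by [].
    set h3 := setI _ va _.
    have [f1 f2 f3 f4 f5] : [/\ iv h3 vj = j, iv h3 vi = i, iv h3 vl = l, ra h3 = ra h' & ia h3 = ia h'] by split.
    have fT : rv h3 xT = cost_of so sn (sn i) by rewrite /= e1 e2 e3 e4 cE.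
    have fs : rv h3 xs = rv h' xs by rewrite /= e3.
    have ft : rv h3 xt = rv h' xt by rewrite /= e3.
    have fa : iv h3 va = 0%N by [].
    move: h3 f1 f2 f3 f4 f5 fT fs ft fa => h3 f1 f2 f3 f4 f5 fT fs ft fa.
    have fin h4 : iv h4 vj = j -> iv h4 vi = i -> rv h4 = rv h3 -> 
        (forall i', i' != i -> ra h4 aBC i' = ra h' aBC i' /\ ia h4 iBL i' = ia h' iBL i') -> ra h4 aSN = ra h' aSN -> res h4 i ->
        run (SetR xt ($xt + RArr aSN $vi) ;; SetI vi ($vi + #1)) Inv h4 k'.-1.
      move=> g1 g2 g3 g4 g5 g6; do 2 hstep; hstep; first by rewrite g2; lia.
      rewrite /Inv /= g1 g2 g3 g5 fs ft addn1; split=> //.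
      + by split=> //; rewrite ht hSNi big_nat_recr //=; lia.
      + move=> j' ji ii; apply: le_trans (below j' ji lt) _; apply: sns; lia.
      + split=> [i' ii|i' ii].
          have [->//|ne] := eqVneq i' i; have [a1 a2] := g4 i' ne.
          by have := rs i' ltac:(lia); rewrite /res /= a1 a2.
        have [|a1 a2] := g4 i'; first by lia.
        by have := un i' ltac:(lia); rewrite /same_as /= a1 a2.
      + lia.
    have keep h4 : iv h4 vj = j -> iv h4 vi = i -> rv h4 = rv h3 -> ra h4 = ra h' -> ia h4 = ia h' -> iv h4 va = 1%N ->
       (1 < l)%N -> ra h' aBC i <= cost_of so sn (sn i) -> 
       run (Cond (CI #0 $va) Skip (PutR aBC $vi $xT ;; PutI iBL $vi $vl) ;;
        SetR xt ($xt + RArr aSN $vi) ;; SetI vi ($vi + #1)) Inv h4 k'.-1.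
      move=> g1 g2 g3 g4 g5 g6 l1 le; hstep; apply: run_Cond => /=; rewrite g6 // => _; hstep.
      apply: fin => //; rewrite ?g4 ?g5 //.
      by rewrite /res l1 -uBC le g4 g5.
    have put h4 : iv h4 vj = j -> iv h4 vi = i -> iv h4 vl = l -> rv h4 = rv h3 -> ra h4 = ra h' -> ia h4 = ia h' -> iv h4 va = 0%N ->
       ~~ ((1 < l)%N && (ra h' aBC i <= cost_of so sn (sn i))) -> 
       run (Cond (CI #0 $va) Skip (PutR aBC $vi $xT ;; PutI iBL $vi $vl) ;;
        SetR xt ($xt + RArr aSN $vi) ;; SetI vi ($vi + #1)) Inv h4 k'.-1.
      move=> g1 g2 gl g3 g4 g5 g6 le; hstep; apply: run_Cond => /=; rewrite g6 // => _.
      do 2 hstep; hstep; first by rewrite gl.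
      apply: fin => //=; rewrite ?g4 ?g5 ?g2 ?gl //.
        by move=> i' /negbTE ->.
      by rewrite /res -uBC (negbTE le) /= ?g2 eqxx ?g3 fT ?gl.
    hstep; apply: run_Cond => /=; rewrite f3 => l1; last first.
      by hstep; apply: put => //; rewrite (negbTE l1).
    apply: run_Cond => /=; rewrite f2 f4 fT => le.
      by hstep; apply: put => //; rewrite negb_and -ltNge le orbT.
    by hstep; [lia|apply: keep => //; rewrite leNgt].
  have [e1 e2 e3] : [/\ iv h1 vj = j, iv h1 vi = i & iv h1 vl = l] by split.
  apply: run_Cond => /=; rewrite -/j (env_n he') => jn; last first.
    hstep; apply: run_Cond => /= b0; last by apply: comp => // j'; lia.
    by [].
  apply: run_Cond => /=; rewrite -/j -/i hSO (hss j ltac:(lia)).1 hSNi => cmp.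
    hstep; first by lia.
    apply: run_Cond => /= b0; first by apply: adv => //; [lia|right].
    by [].
  hstep; apply: run_Cond => /= b0; first by [].
  apply: comp => // j' ji; rewrite -leNgt in cmp; apply: le_trans cmp _; apply: sos; lia.
- move=> h' k' A _ [[iin jin] _ _ [rs un] kk] /=.
  have he' : env h' by apply: (env_agree A isT); case: he => *; split.
  rewrite (env_n he') -leqNgt => ge; split; [|by apply: un|by lia].
  by move=> i ii; apply: rs; lia.
- rewrite /Inv /=; split; [by rewrite n0|by rewrite !big_geq ?mulr0n|by move=> j ji; exfalso; lia| |lia].
  by split=> // i ii; exfalso; lia.
Qed.

Lemma run_COPY Q h k : env h -> (n <= k)%N ->
  (forall h' k', agree COPY h h' ->
    (forall i, (0 < i < n)%N -> ra h' aSO i = ra h aSN i) -> (k <= k' + n)%N -> Q h' k') ->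
  run COPY Q h k.
Proof.
move=> he kn HQ.
suff : run COPY (fun h' k' => (forall i, (0 < i < n)%N -> ra h' aSO i = ra h aSN i) /\
    (k <= k' + n)%N) h k.
  by move/run_mono; apply=> h' k' a _ [t1 l']; apply: HQ.
rewrite /COPY; do 2 hstep; first by lia.
apply: (run_Loop (I := fun h' k' => [/\ (0 < iv h' vi <= n)%N,
  (forall i, (0 < i < iv h' vi)%N -> ra h' aSO i = ra h aSN i) & (k + 1 <= k' + iv h' vi)%N])).
- move=> h' k' A [iin H kk] /=.
  have he' : env h' by apply: (env_agree A isT); case: he => *; split.
  have hSN : ra h' aSN = ra h aSN by rewrite (agree_ra A).
  rewrite (env_n he') => lt; split; first by lia.
  do 2 hstep; hstep; first by lia.
  rewrite /= addn1; split; [lia| |lia] => i /andP[i0]; rewrite ltnS leq_eqVlt => /orP[/eqP ->|lti].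
    by rewrite eqxx hSN.
  by rewrite (ltn_eqF lti) H // i0.
- move=> h' k' A _ [iin H kk] /=.
  have he' : env h' by apply: (env_agree A isT); case: he => *; split.
  by rewrite (env_n he') -leqNgt => ge; split; [move=> i ii; apply: H|]; lia.
- by rewrite /=; split; [lia|move=> i; lia|lia].
Qed.

End LevelRest.

Definition LEVEL :=
  SetI vb (($vl - #1) * $vn) ;; LINIT ;; SEARCH ;; SORT ;; COSTS ;; COPY.

Lemma ranked_eq (R : realType) n (d : nat -> R) rk rk' sn : (0 < n)%N ->
  (forall j, (j < n)%N -> rk' j = rk j) -> ranked n d rk sn -> ranked n d rk' sn.
Proof.
move=> n0 E [[ext pe H] r0 s]; split=> //; last by rewrite E.
exists ext => // i iN; have sz : size ext = n.-1 by rewrite (perm_size pe) size_iota subn1.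
have [e1 e2] := H i iN; split=> //; rewrite E //.
have : nth 0%N ext i \in ext by rewrite mem_nth ?sz.
by rewrite (perm_mem pe) mem_index_iota => /andP[].
Qed.

Section Levels.
Variables (R : realType) (X n m M r : nat) (src : nat -> nat) (c : nat -> R).
Hypotheses (Mr : M = (2 ^ r)%N) (nM : (n <= M)%N) (MX : (M * 2 <= X)%N) (mX : (m * 2 <= X)%N).
Hypotheses (nX : (n + 2 <= X)%N) (n0 : (0 < n)%N).
Hypothesis srcn : forall h, (h < m * 2)%N -> (src h < n)%N.
Hypothesis c_gt0 : forall e, (e < m)%N -> 0 < c e.
Hypothesis loopless : forall e, (e < m)%N -> src (e * 2)%N <> src (e * 2 + 1)%N.
Hypothesis cut : forall (P : pred nat) x y, (x < n)%N -> (y < n)%N -> P x -> ~~ P y ->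
  exists2 e, (e < m)%N & P (src (e * 2)%N) != P (src (e * 2 + 1)%N).
Implicit Types h : hst R.

Notation run := (run X (m * 2)).
Notation env := (env n m M src c).
Notation adjl := (adjl m src).
Notation eu := (fun e => src (e * 2)%N).
Notation ev := (fun e => src (e * 2 + 1)%N).

Definition vtl h l j := ia h iVT (l * n + j)%N.
Definition dll h l j := if (j < n)%N then ra h aDL (l * n + j)%N else 0.
Definition rkl h l j := ia h iRK (l * n + j)%N.
Definition lcost h l T := slack n (dll h l.-1) T - slack n (dll h l) T.

(** By [ls_bc] and [ls_bl], [aBC i] is the least cost over all levels of a cut with [i] open
    boundaries, and [iBL i] a level that attains it. By [ls_0], opening none costs nothing. *)
Record levels h L (sn : nat -> nat -> R) : Prop := Levels {
  ls_level : forall l, (l < L)%N -> level n m eu ev c (vtl h l) (dll h l) (vtl h l.+1) (dll h l.+1);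
  ls_ord : ordering n (vtl h 0) (dll h 0);
  ls_d0 : forall j, dll h 0 j = 0;
  ls_rank : forall l, (0 < l <= L)%N -> ranked n (dll h l) (rkl h l) (sn l);
  ls_sn0 : forall i, sn 0%N i = 0;
  ls_so : forall i, (0 < i < n)%N -> ra h aSO i = sn L i;
  ls_bc : forall l i, (0 < l <= L)%N -> (0 < i < n)%N -> ra h aBC i <= lcost h l (sn l i);
  ls_bl : forall i, (0 < L)%N -> (0 < i < n)%N -> (0 < ia h iBL i <= L)%N /\
    ra h aBC i = lcost h (ia h iBL i) (sn (ia h iBL i) i);
  ls_0 : ra h aBC 0%N = 0 /\ ia h iBL 0%N = 0%N }.

Lemma slack_sn h L sn l T : levels h L sn -> (l <= L)%N -> slack n (sn l) T = slack n (dll h l) T.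
Proof.
move=> ls lL; case: (posnP l) => [->|l0]; first by apply: eq_bigr => j _; rewrite (ls_sn0 ls) (ls_d0 ls).
have rk := ls_rank ls (l := l) ltac:(lia).
by rewrite /slack -(ranked_sum rk (fun _ x => Num.max 0 (T - x))).
Qed.

Definition level_time := (2 * M + (n + m * 2) * (4 * r).+1 + (2 * M + n * (2 * r).+1) + 3 * n)%N.

Lemma run_LEVEL Q h k l sn : env h -> adjl h -> iv h vl = l.+1 -> levels h l sn ->
  (l.+2 * n <= X)%N -> (level_time <= k)%N ->
  (forall h' k' sn', agree LEVEL h h' -> levels h' l.+1 sn' -> (k <= k' + level_time)%N -> Q h' k') ->
  run LEVEL Q h k.
Proof.
move=> he ad hl ls lX kt HQ.
suff : run LEVEL (fun h' k' => exists2 sn', levels h' l.+1 sn' & (k <= k' + level_time)%N) h k.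
  by move/run_mono; apply=> h' k' a _ [sn' t1 l']; apply: HQ t1 l'.
have lnX : (l.+1 <= X)%N by move: lX n0; clear; nia.
pose b := (l * n)%N.
have ord : ordering n (vtl h l) (dll h l).
  case: (l) ls => [|l'] ls'; first exact: (ls_ord ls').
  by have [] := ls_level ls' (l := l') ltac:(lia).
have [or1 or2 or3 or4] := ord.
rewrite /LEVEL; do 2 hstep; first by rewrite hl subn1 /= (env_n he); move: lX; clear; nia.
rewrite /= hl subn1 /= (env_n he) -/b; hstep; set h1 := setI _ _ _.
have he1 : env h1 by case: he => *; split.
move: kt; rewrite {1}/level_time => kt.
apply: (run_LINIT (d := dll h l) (vt := vtl h l) (b := b) Mr nM MX mX nX he1) => //; first by lia.
move=> h2 k2 A2 tr2 ps2 kk2.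
have he2 : env h2 by apply: (env_agree A2 isT).
have ad2 : adjl h2 by apply: (adj_agree A2 isT); case: ad => *; split.
have b2 : iv h2 vb = b by rewrite (agree_iv A2).
have [VT2 DL2 RK2] : [/\ ia h2 iVT = ia h iVT, ra h2 aDL = ra h aDL & ia h2 iRK = ia h iRK].
  by split; rewrite ?(agree_ia A2) // (agree_ra A2).
hstep; apply: (run_SEARCH (d := dll h l) (vt := vtl h l) (b := b) Mr nM MX mX nX n0 srcn c_gt0 loopless cut he2 ad2) => //.
- by move=> p pn; rewrite VT2.
- by lia.
move=> h3 k3 A3 old3 lev3 kk3.
have he3 : env h3 by apply: (env_agree A3 isT).
have b3 : iv h3 vb = b by rewrite (agree_iv A3).
have RK3 : ia h3 iRK = ia h iRK by rewrite (agree_ia A3).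
pose d' j := if (j < n)%N then ra h3 aDL (b + n + j)%N else 0.
have d'ge : forall j, (j < n)%N -> 0 <= d' j by case: lev3 => _ [].
hstep; apply: (run_SORT (d := d') (b := b) Mr nM MX mX nX n0 he3 b3).
- by move=> j jn; split; [rewrite /d' jn|exact: d'ge].
- by lia.
move=> h4 k4 A4 rk4 old4 kk4.
have he4 : env h4 by apply: (env_agree A4 isT).
have l4 : iv h4 vl = l.+1 by rewrite (agree_iv A4) // (agree_iv A3) // (agree_iv A2).
have frame a : a \in [:: aSO; aBC] -> ra h4 a = ra h a.
  by rewrite !inE => /orP[]/eqP ->; rewrite (agree_ra A4) // (agree_ra A3) // (agree_ra A2).
have BL4 : ia h4 iBL = ia h iBL by rewrite (agree_ia A4) // (agree_ia A3) // (agree_ia A2).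
have [VT4 DL4] : ia h4 iVT = ia h3 iVT /\ ra h4 aDL = ra h3 aDL by rewrite (agree_ia A4) // (agree_ra A4).
have sns : forall i i', (0 < i <= i')%N -> (i' < n)%N -> sn l i <= sn l i'.
  move=> i i' ii i'n; case: (posnP l) => [->|l0]; first by rewrite !(ls_sn0 ls).
  by apply: (rkd_sorted (ls_rank ls (l := l) ltac:(lia))).
hstep; apply: (run_COSTS (l := l.+1) (so := sn l) (sn := ra h4 aSN) (c := c) (src := src) Mr nM MX mX nX n0 he4) => //.
- by move=> i ii; rewrite frame ?inE // (ls_so ls).
- exact: rkd_sorted rk4.
- by lia.
move=> h5 k5 A5 res5 [z5 z5'] kk5.
have he5 : env h5 by apply: (env_agree A5 isT).
apply: (run_COPY Mr nM MX mX nX n0 he5); first by lia.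
move=> h6 k6 A6 so6 kk6.
pose sn' l' := if l' == l.+1 then ra h4 aSN else sn l'.
exists sn'; last by rewrite /level_time; lia.
have [VT6 RK6 BL6] : [/\ ia h6 iVT = ia h3 iVT, ia h6 iRK = ia h4 iRK & ia h6 iBL = ia h5 iBL].
  by split; [rewrite (agree_ia A6) // (agree_ia A5) // VT4|rewrite (agree_ia A6) // (agree_ia A5)|rewrite (agree_ia A6)].
have [DL6 BC6 SN6] : [/\ ra h6 aDL = ra h3 aDL, ra h6 aBC = ra h5 aBC & ra h5 aSN = ra h4 aSN].
  by split; [rewrite (agree_ra A6) // (agree_ra A5) // DL4|rewrite (agree_ra A6)|rewrite (agree_ra A5)].
have lt l' j : (l' <= l)%N -> (j < n)%N -> (l' * n + j < b + n)%N.
  move=> ll jn; have : (l' * n <= b)%N by rewrite leq_mul2r ll orbT.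
  by lia.
have dE l' : (l' <= l)%N -> dll h6 l' = dll h l'.
  move=> ll; apply/funext => j; rewrite /dll; case: ifP => // jn.
  by rewrite DL6 (old3 _ (lt _ _ ll jn)).2 DL2.
have vE l' j : (l' <= l)%N -> (j < n)%N -> vtl h6 l' j = vtl h l' j.
  by move=> ll jn; rewrite /vtl VT6 (old3 _ (lt _ _ ll jn)).1 VT2.
have rE l' j : (l' <= l)%N -> (j < n)%N -> rkl h6 l' j = rkl h l' j.
  by move=> ll jn; rewrite /rkl RK6 old4 ?lt // RK3.
have bn j : (l.+1 * n + j = b + n + j)%N by rewrite mulSn /b; lia.
have dN : dll h6 l.+1 = d' by apply/funext => j; rewrite /dll /d' bn DL6.
have vN j : vtl h6 l.+1 j = ia h3 iVT (b + n + j)%N by rewrite /vtl bn VT6.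
have rN j : rkl h6 l.+1 j = ia h4 iRK (b + n + j)%N by rewrite /rkl bn RK6.
have snN : sn' l.+1 = ra h4 aSN by rewrite /sn' eqxx.
have snO l' : (l' <= l)%N -> sn' l' = sn l' by rewrite /sn' => ll; rewrite (_ : (l' == _) = false) //; lia.
have slN T : slack n (ra h4 aSN) T = slack n d' T.
  by rewrite /slack -(ranked_sum rk4 (fun _ x => Num.max 0 (T - x))).
have costN T : cost_of n (sn l) (ra h4 aSN) T = lcost h6 l.+1 T.
  by rewrite /cost_of /lcost /= (slack_sn _ ls) // dE // dN slN.
have costO l' T : (0 < l' <= l)%N -> lcost h6 l' T = lcost h l' T.
  by move=> ll; rewrite /lcost !dE //; lia.
split.
- move=> l'; rewrite ltnS leq_eqVlt => /orP[/eqP ->|ll].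
    rewrite dE // dN; apply: (level_ext n0) lev3 => j jn.
    by split=> //; rewrite vE.
  rewrite !dE //; last by lia.
  apply: (level_ext n0) (ls_level ls ll) => j jn.
  by split=> //; rewrite vE //; lia.
- rewrite dE //; have [p1 p2 p3 p4] := ls_ord ls.
  split=> // [j jn|i j li lj]; rewrite !vE //; [exact: p1|exact: p2].
- by move=> j; rewrite dE // (ls_d0 ls).
- move=> l' /andP[l0]; rewrite leq_eqVlt => /orP[/eqP ->|ll].
    by rewrite dN snN; apply: ranked_eq n0 _ rk4 => j jn; rewrite rN.
  rewrite dE // snO //; apply: ranked_eq n0 _ (ls_rank ls (l := l') _); last by lia.
  by move=> j jn; rewrite rE.
- by move=> i; rewrite snO // (ls_sn0 ls).
- by move=> i ii; rewrite snN so6 // SN6.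
- move=> l' i /andP[l0]; rewrite BC6 leq_eqVlt => /orP[/eqP ->|ll] ii.
    rewrite snN -costN; have := res5 i ii; case: ifP => [/andP[_ le] [-> _]//|_ [-> _]//].
  have lel : (l' <= l)%N by [].
  rewrite snO // costO; last by lia.
  apply: le_trans (ls_bc ls (l := l') (i := i) _ ii); last by lia.
  have := res5 i ii; rewrite frame ?inE //.
  rewrite (_ : (1 < l.+1)%N) /=; last by lia.
  case: ifP => [_ [-> _]//|/negbT]; rewrite -ltNge => /ltW lt5 [-> _] //.
- move=> i _ ii; rewrite BC6 BL6; have := res5 i ii; rewrite frame ?inE // BL4; case: ifP.
    move=> /andP[l1 _] [-> ->]; have [p1 p2] := ls_bl ls (i := i) ltac:(lia) ii.
    by rewrite snO ?costO //; [split=> //|]; lia.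
  by move=> _ [-> ->]; rewrite snN -costN; split=> //; lia.
- by rewrite BC6 BL6 z5 z5' frame ?inE // BL4; exact: (ls_0 ls).
Qed.

End Levels.

(** * Parameters, the chain of levels, the lower bound and the bisection *)

(** [N] is the least positive number with [N * eps >= 6], found by counting up since reals cannot be
    rounded; [vr] is the logarithm of [n], rounded up. [vL] has the form required by
    [chain_value]. *)
Definition SIZES :=
  SetI vN #1 ;; Loop (CR (RInt $vN * $xeps)%rx #6) (SetI vN ($vN + #1)) ;;
  SetI vM #1 ;; SetI vr #0 ;;
  Loop (CI $vM $vn) (SetI vM ($vM * #2) ;; SetI vr ($vr + #1)) ;;
  SetI vL (($vN + #1) * (#8 * $vN * $vr)).

Definition INIT :=
  SetI vj #0 ;; Loop (CI $vj $vn) (PutI iVT $vj $vj ;; SetI vj ($vj + #1)).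

Definition LEVELS :=
  SetI vl #1 ;; Loop (CI $vl ($vL + #1)) (LEVEL ;; SetI vl ($vl + #1)).

Definition LOWER :=
  SetR xg #0 ;; SetI vi #1 ;;
  Loop (CI $vi $vk) (SetR xg ($xg + RArr aSO $vi) ;; SetI vi ($vi + #1)) ;;
  SetR xg ($xg / RInt $vL).

Definition ARGP :=
  SetI vi #0 ;; SetI vp #0 ;; SetR xT #0 ;;
  Loop (CI $vi $vn)
    (SetR xs ($xv * RInt $vi - RArr aBC $vi) ;;
     Cond (CR $xT $xs) (SetI vp $vi ;; SetR xT $xs) Skip ;; SetI vi ($vi + #1)).

(** At [lam = 0] no open boundary is a best choice, because costs are nonnegative; at [3 * g] a best
    choice opens at least [k - 1] ([best_high]). The final gap [g / (N * n)] is chosen so that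
    interpolating over at most [n] parts loses at most [g / N]. *)
Definition BISECT :=
  SetR xgap ($xg / RInt ($vN * $vn)) ;; SetR xlo #0 ;; SetI vp1 #0 ;;
  SetR xhi (#3 * $xg) ;; SetR xv $xhi ;; ARGP ;; SetI vp2 $vp ;;
  Loop (CR $xgap ($xhi - $xlo)%rx)
    (SetR xv (($xlo + $xhi) / #2) ;; ARGP ;;
     Cond (CI $vp $vk) (SetR xlo $xv ;; SetI vp1 $vp) (SetR xhi $xv ;; SetI vp2 $vp)).

(** If the finer cut is good enough, it also takes the place of the coarser one. The number
    [k - 1 - vp1] of parts to pick is then truncated to 0. *)
Definition CHOOSE :=
  SetI vl1 (IArr iBL $vp1) ;; SetI vl2 (IArr iBL $vp2) ;;
  Cond (CI $vp1 ($vk - #1))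
    (Cond (CI (#2 * ($vk - #1 - $vp1)) ($vp2 - $vp1)) Skip
       (SetI vp1 $vp2 ;; SetI vl1 $vl2)) Skip.

Section Main.
Variables (R : realType) (X n m : nat) (src : nat -> nat) (c : nat -> R).
Implicit Types h : hst R.
Notation run := (run X (m * 2)).

Lemma run_SIZES Q h k eps Nm : iv h vn = n -> rv h xeps = eps -> (1 < n)%N -> 0 < eps ->
  (0 < Nm)%N -> 6 <= Nm%:R * eps -> (2 * n <= X)%N -> (Nm.+1 * (8 * Nm * n) <= X)%N ->
  (Nm + n <= k)%N ->
  (forall h' k' N r, agree SIZES h h' -> iv h' vN = N -> iv h' vM = (2 ^ r)%N ->
     iv h' vL = (N.+1 * (8 * N * r))%N -> (0 < N <= Nm)%N -> 6 <= N%:R * eps -> (0 < r <= n)%N ->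
     (2 ^ r.-1 < n <= 2 ^ r)%N -> (k <= k' + (Nm + n))%N -> Q h' k') ->
  run SIZES Q h k.
Proof.
move=> hn he n1 eps0 Nm0 Nme nX LX kk HQ.
suff : run SIZES (fun h' k' => exists N r, [/\ iv h' vN = N /\ iv h' vM = (2 ^ r)%N,
     iv h' vL = (N.+1 * (8 * N * r))%N, (0 < N <= Nm)%N /\ 6 <= N%:R * eps, (0 < r <= n)%N /\
     (2 ^ r.-1 < n <= 2 ^ r)%N & (k <= k' + (Nm + n))%N]) h k.
  by move/run_mono; apply=> h' k' a _ [N [r [[a1 a2] a3 [a4 a5] [a6 a7] a8]]]; apply: (HQ h' k' N r).
have NmX : (Nm.+1 <= X)%N by move: LX; clear -n1 Nm0; nia.
rewrite /SIZES; do 2 hstep; first by lia.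
hstep; apply: (run_Loop (I := fun h' k' => (0 < iv h' vN <= Nm)%N /\ (k + 1 <= k' + iv h' vN)%N)).
- move=> h' k' A [Nin kk'] /=; rewrite (agree_rv A) //= he => lt.
  have ltN : (iv h' vN < Nm)%N.
    by rewrite -(ltr_nat R) -(ltr_pM2r eps0); apply: lt_le_trans lt Nme.
  by split; first lia; hstep; rewrite /= addn1; lia.
- move=> h' k' A _ [Nin kk'] /=; rewrite (agree_rv A) //= he -leNgt => ge.
  set N := iv h' vN in Nin ge kk'.
  have hn' : iv h' vn = n by rewrite (agree_iv A).
  do 2 hstep; first by lia.
  do 2 hstep; first by lia.
  hstep; apply: (run_Loop (I := fun h2 k2 => [/\ iv h2 vM = (2 ^ iv h2 vr)%N, iv h2 vN = N,
     (iv h2 vr = 0%N) \/ (2 ^ (iv h2 vr).-1 < n)%N & (k' <= k2 + iv h2 vr)%N])).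
  + move=> h2 k2 A2 [M2 N2 rn kr] /=; have hn2 : iv h2 vn = n by rewrite (agree_iv A2).
    rewrite M2 hn2 => lt; have rlt : (iv h2 vr < n)%N by apply: ltn_trans lt; apply: ltn_expl.
    split; first by lia.
    hstep; hstep; first by rewrite M2; lia.
    hstep; first by rewrite /=; lia.
    by rewrite /= addn1 /=; split; [rewrite M2 expnS mulnC| |right|lia].
  + move=> h2 k2 A2 _ [M2 N2 rn kr] /=; have hn2 : iv h2 vn = n by rewrite (agree_iv A2).
    rewrite M2 hn2 -leqNgt => ge2.
    have r0 : (0 < iv h2 vr)%N by case: (iv h2 vr) ge2 => //; rewrite expn0; lia.
    have {}rn : (2 ^ (iv h2 vr).-1 < n)%N by case: rn => // E; rewrite E in r0.
    have rlen : (iv h2 vr <= n)%N.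
      by have := ltn_expl (iv h2 vr).-1 (erefl (1 < 2)%N); lia.
    hstep.
      rewrite N2; apply: leq_trans LX; rewrite addn1; apply: leq_mul; first by lia.
      by apply: leq_mul => //; rewrite leq_mul2l /=; lia.
    exists N, (iv h2 vr); rewrite /= N2 M2 addn1; split; [by []|by []|by []|by rewrite r0 rlen rn|by lia].
  + by rewrite /=; split=> //; [left|lia].
- by rewrite /=; lia.
Qed.

Lemma run_INIT Q h k : iv h vn = n -> (n + 1 <= X)%N -> (n <= k)%N ->
  (forall h' k', agree INIT h h' -> (forall j, (j < n)%N -> ia h' iVT j = j) -> (k <= k' + n)%N -> Q h' k') ->
  run INIT Q h k.
Proof.
move=> hn nX kn HQ.
suff : run INIT (fun h' k' => (forall j, (j < n)%N -> ia h' iVT j = j) /\ (k <= k' + n)%N) h k.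
  by move/run_mono; apply=> h' k' a _ [t1 l]; apply: HQ.
rewrite /INIT; do 2 hstep; first by [].
apply: (run_Loop (I := fun h' k' => [/\ (iv h' vj <= n)%N, (k <= k' + iv h' vj)%N &
   forall j, (j < iv h' vj)%N -> ia h' iVT j = j])).
- move=> h' k' A [jn kk H] /=; have hn' : iv h' vn = n by rewrite (agree_iv A).
  rewrite hn' => lt; split; first by lia.
  hstep; hstep; first by lia.
  hstep; first by rewrite /=; lia.
  rewrite /= addn1; split; [lia|lia|] => j; rewrite ltnS leq_eqVlt => /orP[/eqP ->|jl].
    by rewrite eqxx.
  by rewrite (ltn_eqF jl) H.
- move=> h' k' A _ [jn kk H] /=; have hn' : iv h' vn = n by rewrite (agree_iv A).
  by rewrite hn' -leqNgt => ge; split; [move=> j jl; apply: H|]; lia.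
- by split=> //=; lia.
Qed.

Section Levels.
Variables (M r L : nat).
Hypotheses (Mr : M = (2 ^ r)%N) (nM : (n <= M)%N) (MX : (M * 2 <= X)%N) (mX : (m * 2 <= X)%N).
Hypotheses (nX : (n + 2 <= X)%N) (n0 : (0 < n)%N).
Hypothesis srcn : forall i, (i < m * 2)%N -> (src i < n)%N.
Hypothesis c_gt0 : forall e, (e < m)%N -> 0 < c e.
Hypothesis loopless : forall e, (e < m)%N -> src (e * 2)%N <> src (e * 2 + 1)%N.
Hypothesis cut : forall (P : pred nat) x y, (x < n)%N -> (y < n)%N -> P x -> ~~ P y ->
  exists2 e, (e < m)%N & P (src (e * 2)%N) != P (src (e * 2 + 1)%N).
Hypothesis LX : (L.+2 * n <= X)%N.
Notation env := (env n m M src c).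
Notation adjl := (adjl m src).
Notation levels := (levels n m src c).
Notation ltime := (level_time n m M r).

Lemma run_LEVELS Q h k : env h -> adjl h -> iv h vL = L -> levels h 0 (fun _ _ => 0) ->
  (L * ltime.+1 <= k)%N ->
  (forall h' k' sn, agree LEVELS h h' -> levels h' L sn -> (k <= k' + L * ltime.+1)%N -> Q h' k') ->
  run LEVELS Q h k.
Proof.
move=> he ad hL ls0 kk HQ.
suff : run LEVELS (fun h' k' => exists2 sn, levels h' L sn & (k <= k' + L * ltime.+1)%N) h k.
  by move/run_mono; apply=> h' k' a _ [sn t1 l]; apply: HQ t1 l.
have LX' : (L.+2 <= X)%N by move: LX n0; clear; nia.
rewrite /LEVELS; do 2 hstep; first by lia.
apply: (run_Loop (I := fun h' k' => exists l sn, [/\ iv h' vl = l.+1, (l <= L)%N, levels h' l sn &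
   (k <= k' + l * ltime.+1)%N])).
- move=> h' k' A [l [sn [hl lL ls kk']]] /=.
  have he' : env h' by apply: (env_agree A isT); case: he => *; split.
  have ad' : adjl h' by apply: (adj_agree A isT); case: ad => *; split.
  have hL' : iv h' vL = L by rewrite (agree_iv A).
  rewrite hl hL' addn1 ltnS => lt.
  have pay : (ltime.+1 <= k')%N.
    have : (l.+1 * ltime.+1 <= L * ltime.+1)%N by rewrite leq_mul2r lt orbT.
    by rewrite mulSn; lia.
  split; first by lia.
  hstep; apply: (run_LEVEL Mr nM MX mX nX n0 srcn c_gt0 loopless cut he' ad' hl ls).
  + by apply: leq_trans LX; rewrite leq_mul2r; apply/orP; right; lia.
  + by lia.
  move=> h2 k2 sn' A2 ls2 kk2; have hl2 : iv h2 vl = l.+1 by rewrite (agree_iv A2).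
  hstep; first by rewrite hl2; lia.
  exists l.+1, sn'; rewrite /= hl2 addn1; split=> //.
    case: ls2 => q1 q2 q3 q4 q5 q6 q7 q8 q9; by split.
  by rewrite mulSn; lia.
- move=> h' k' A _ [l [sn [hl lL ls kk']]] /=.
  have hL' : iv h' vL = L by rewrite (agree_iv A).
  rewrite hl hL' addn1 -leqNgt => ge; have E : l = L by lia.
  by exists sn; rewrite -E.
- exists 0%N, (fun _ _ => 0); split=> //=; last by lia.
  by case: ls0 => q1 q2 q3 q4 q5 q6 q7 q8 q9; split.
Qed.

End Levels.

Lemma run_LOWER Q h k kc : iv h vk = kc -> (kc + 1 <= X)%N -> (kc <= k)%N -> (0 < kc)%N ->
  (forall h' k', agree LOWER h h' ->
     rv h' xg = (\sum_(1 <= i < kc) ra h aSO i) / (iv h vL)%:R -> (k <= k' + kc)%N -> Q h' k') ->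
  run LOWER Q h k.
Proof.
move=> hk kX kk kc0 HQ.
suff : run LOWER (fun h' k' => rv h' xg = (\sum_(1 <= i < kc) ra h aSO i) / (iv h vL)%:R /\
     (k <= k' + kc)%N) h k.
  by move/run_mono; apply=> h' k' a _ [t1 l]; apply: HQ.
rewrite /LOWER; do 2 hstep; do 2 hstep; first by lia.
hstep; apply: (run_Loop (I := fun h' k' => [/\ (0 < iv h' vi <= kc)%N, (k + 1 <= k' + iv h' vi)%N &
   rv h' xg = \sum_(1 <= i < iv h' vi) ra h aSO i])).
- move=> h' k' A [iin kk' H] /=; have hk' : iv h' vk = kc by rewrite (agree_iv A).
  have SO' : ra h' aSO = ra h aSO by rewrite (agree_ra A).
  rewrite hk' => lt; split; first by lia.
  do 2 hstep; hstep; first by rewrite /=; lia.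
  by rewrite /= addn1 H SO'; split; [lia|lia|rewrite big_nat_recr //=; lia].
- move=> h' k' A _ [iin kk' H] /=; have hk' : iv h' vk = kc by rewrite (agree_iv A).
  rewrite hk' -leqNgt => ge; have E : iv h' vi = kc by lia.
  hstep; rewrite /= H E; split; last by lia.
  by congr (_ / _%:R); rewrite (agree_iv A).
- by rewrite /=; split; [lia|lia|rewrite big_geq // mulr0n].
Qed.

Section Bisect.
Variables (bc : nat -> R).
Hypotheses (n0 : (0 < n)%N) (nX : (n + 1 <= X)%N) (bc0 : bc 0%N = 0).

Definition best lam p := (p < n)%N /\
  forall q, (q < n)%N -> lam * q%:R - bc q <= lam * p%:R - bc p.

Lemma run_ARGP Q h k : iv h vn = n -> ra h aBC = bc -> (n <= k)%N ->
  (forall h' k', agree ARGP h h' -> best (rv h xv) (iv h' vp) -> (k <= k' + n)%N -> Q h' k') ->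
  run ARGP Q h k.
Proof.
move=> hn hbc kn HQ.
suff : run ARGP (fun h' k' => best (rv h xv) (iv h' vp) /\ (k <= k' + n)%N) h k.
  by move/run_mono; apply=> h' k' a _ [t1 l]; apply: HQ.
set lam := rv h xv.
rewrite /ARGP; do 2 hstep; first by [].
do 2 hstep; first by [].
do 2 hstep; apply: (run_Loop (I := fun h' k' => [/\ (iv h' vi <= n)%N, (k <= k' + iv h' vi)%N,
   (iv h' vp < n)%N, rv h' xT = lam * (iv h' vp)%:R - bc (iv h' vp) &
   forall q, (q < iv h' vi)%N -> lam * q%:R - bc q <= rv h' xT])).
- move=> h' k' A [iin kk pn hT H] /=; have hn' : iv h' vn = n by rewrite (agree_iv A).
  have hb' : ra h' aBC = bc by rewrite (agree_ra A).
  have hx' : rv h' xv = lam by rewrite (agree_rv A).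
  rewrite hn' => lt; split; first by lia.
  do 3 hstep; apply: run_Cond => /=; rewrite hb' hx' => cmp.
    hstep; hstep; first by lia.
    do 2 hstep; first by rewrite /=; lia.
    rewrite /= ?hb' ?hx' addn1; split=> //; [lia|] => q; rewrite ltnS leq_eqVlt => /orP[/eqP ->//|ql].
    by apply: le_trans (ltW cmp); apply: H.
  do 2 hstep; first by rewrite /=; lia.
  rewrite /= addn1; split=> //; [lia|] => q; rewrite ltnS leq_eqVlt => /orP[/eqP ->|ql].
    by rewrite leNgt.
  exact: H.
- move=> h' k' A _ [iin kk pn hT H] /=; have hn' : iv h' vn = n by rewrite (agree_iv A).
  rewrite hn' -leqNgt => ge; split; last by lia.
  by split=> // q qn; rewrite -hT; apply: H; lia.
- by rewrite /=; split=> //; [lia|rewrite bc0 mulr0n mulr0 subr0].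
Qed.

Lemma run_BISECT Q h k g N r kc : iv h vn = n -> ra h aBC = bc -> rv h xg = g -> 0 < g ->
  iv h vN = N -> (0 < N)%N -> iv h vk = kc -> (0 < kc)%N -> (n <= 2 ^ r)%N ->
  (forall p, (p < n)%N -> 0 <= bc p) -> (forall p, best (3 * g) p -> (kc.-1 <= p)%N) ->
  ((N + r + 3) * n.+1 <= k)%N ->
  (forall h' k' lo hi, agree BISECT h h' -> 0 <= lo -> lo <= hi -> hi <= 3 * g ->
     hi - lo <= g / (N * n)%:R -> best lo (iv h' vp1) -> best hi (iv h' vp2) ->
     (iv h' vp1 <= kc.-1 <= iv h' vp2)%N -> (k <= k' + (N + r + 3) * n.+1)%N -> Q h' k') ->
  run BISECT Q h k.
Proof.
move=> hn hbc hg g0 hN N0 hk kc0 nr bcge high kk HQ.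
suff : run BISECT (fun h' k' => exists lo hi, [/\ [/\ 0 <= lo, lo <= hi, hi <= 3 * g &
     hi - lo <= g / (N * n)%:R], best lo (iv h' vp1), best hi (iv h' vp2),
     (iv h' vp1 <= kc.-1 <= iv h' vp2)%N & (k <= k' + (N + r + 3) * n.+1)%N]) h k.
  move/run_mono; apply=> h' k' a _ [lo [hi [[a1 a2 a3 a4] a5 a6 a7 a8]]].
  exact: (HQ h' k' lo hi).
rewrite /BISECT; do 4 hstep; do 2 hstep; first by [].
do 5 hstep; apply: run_ARGP => //; first by move: kk; clear; nia.
move=> h1 k1 A1 b1 kk1; rewrite /= hg in b1.
hstep; hstep; first by case: b1 => pn _; lia.
(* Starting from a gap of [3 * g], [T] halvings reach [g / (N * n)], as [N < 2^N], [n <= 2^r] and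
   [3 < 2^2]. *)
pose T := (N + r + 2)%N.
have NnT : 3 * (N * n)%:R < 2 ^+ T :> R.
  rewrite -natrM -natrX ltr_nat /T !expnD.
  have : (N < 2 ^ N)%N by apply: ltn_expl.
  by move: nr n0; clear; move: (2 ^ N)%N (2 ^ r)%N => a b; nia.
have Nn0 : 0 < (N * n)%:R :> R by rewrite ltr0n muln_gt0 N0.
have C1 : [/\ iv h1 vn = n, iv h1 vk = kc, ra h1 aBC = bc, rv h1 xgap = g / (N * n)%:R & rv h1 xlo = 0].
  by split; rewrite ?(agree_iv A1) ?(agree_ra A1) ?(agree_rv A1) //= ?hg ?hN ?hn // mulr0n.
have C2 : rv h1 xhi = 3 * g /\ iv h1 vp1 = 0%N.
  by split; rewrite ?(agree_iv A1) ?(agree_rv A1) //= ?hg.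
have [n1' k1' bc1 gap1 lo1] := C1; have [hi1 p11] := C2.
apply: (run_Loop (I := fun h' k' => exists i, [/\ [/\ 0 <= rv h' xlo, rv h' xhi <= 3 * g,
    rv h' xhi - rv h' xlo = 3 * g / 2 ^+ i & (i <= T)%N],
    best (rv h' xlo) (iv h' vp1), best (rv h' xhi) (iv h' vp2),
    (iv h' vp1 <= kc.-1 <= iv h' vp2)%N & (k1 <= k' + i * n.+1)%N])).
- move=> h' k' A [i [[lo0 hi3 dif iT] bl bh pk kk']] /=.
  have hn' : iv h' vn = n by rewrite (agree_iv A) //= n1'.
  have hk' : iv h' vk = kc by rewrite (agree_iv A) //= k1'.
  have hb' : ra h' aBC = bc by rewrite (agree_ra A).
  have hgap : rv h' xgap = g / (N * n)%:R by rewrite (agree_rv A).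
  rewrite hgap dif => lt.
  have ltT : (i < T)%N.
    rewrite ltn_neqAle iT andbT; apply: contraTneq lt => ->; rewrite -leNgt.
    rewrite ler_pdivrMr ?exprn_gt0 // mulrAC ler_pdivlMr //.
    by rewrite [3 * g]mulrC -mulrA ler_pM2l // ltW.
  have pay : (n.+1 <= k')%N.
    have : (i.+1 * n.+1 <= T * n.+1)%N by rewrite leq_mul2r ltT orbT.
    by move: kk kk1 kk'; rewrite /T !mulSn; clear; nia.
  split; first by lia.
  do 3 hstep; apply: run_ARGP => //=; first by lia.
  set mid := (_ + _) / 2; move=> h2 k2 A2 b2 kk2.
  have [e1 e2 e3] : [/\ rv h2 xv = mid, rv h2 xlo = rv h' xlo & rv h2 xhi = rv h' xhi].
    by split; rewrite (agree_rv A2).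
  have [e4 e5 e6] : [/\ iv h2 vk = kc, iv h2 vp1 = iv h' vp1 & iv h2 vp2 = iv h' vp2].
    by split; rewrite (agree_iv A2).
  have pos : 0 < 3 * g / 2 ^+ i by rewrite divr_gt0 ?exprn_gt0 ?mulr_gt0.
  have half : 3 * g / 2 ^+ i.+1 = (3 * g / 2 ^+ i) / 2 by rewrite exprSr invfM mulrA.
  have pn : (iv h2 vp < n)%N by case: b2.
  apply: run_Cond => /=; rewrite e4 => pk2.
    do 2 hstep; hstep; first by rewrite /=; lia.
    exists i.+1; rewrite /= e1 e3 e6 half mulSn; split=> //; [|lia|lia].
    by split=> //; move: pos lo0 hi3; rewrite -dif /mid => *; lra.
  do 2 hstep; hstep; first by rewrite /=; lia.
  exists i.+1; rewrite /= e1 e2 e5 half mulSn; split=> //; [|lia|lia].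
  by split=> //; move: pos lo0 hi3; rewrite -dif /mid => *; lra.
- move=> h' k' A _ [i [[lo0 hi3 dif iT] bl bh pk kk']] /=.
  have hgap : rv h' xgap = g / (N * n)%:R by rewrite (agree_rv A).
  rewrite hgap -leNgt => ge; exists (rv h' xlo), (rv h' xhi); split=> //.
    split=> //; rewrite -subr_ge0 dif divr_ge0 ?exprn_ge0 ?mulr_ge0 //; exact: ltW.
  have : (i * n.+1 <= T * n.+1)%N by rewrite leq_mul2r iT orbT.
  by move: kk1 kk'; rewrite /T; clear; nia.
- exists 0%N; rewrite /= lo1 hi1 p11 expr0 divr1 subr0; split=> //; [|by apply: high b1|lia].
  by split=> // q qn; rewrite !mul0r !sub0r bc0 oppr0 oppr_le0; apply: bcge.
Qed.

End Bisect.

Lemma run_CHOOSE Q h k kc : iv h vk = kc -> (iv h vp1 <= X)%N -> (iv h vp2 <= X)%N ->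
  (ia h iBL (iv h vp1) <= X)%N -> (ia h iBL (iv h vp2) <= X)%N ->
  (forall h', agree CHOOSE h h' -> iv h' vl1 = ia h iBL (iv h' vp1) -> iv h' vl2 = ia h iBL (iv h' vp2) ->
     iv h' vp2 = iv h vp2 ->
     (if (iv h vp1 < kc.-1)%N && (iv h vp2 - iv h vp1 <= 2 * (kc.-1 - iv h vp1))%N
      then iv h' vp1 = iv h vp2 else iv h' vp1 = iv h vp1) -> Q h' k) ->
  run CHOOSE Q h k.
Proof.
move=> hk p1X p2X l1X l2X HQ.
suff : run CHOOSE (fun h' k' => [/\ k' = k, iv h' vl1 = ia h iBL (iv h' vp1) /\ iv h' vl2 = ia h iBL (iv h' vp2),
     iv h' vp2 = iv h vp2 &
     (if (iv h vp1 < kc.-1)%N && (iv h vp2 - iv h vp1 <= 2 * (kc.-1 - iv h vp1))%N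
      then iv h' vp1 = iv h vp2 else iv h' vp1 = iv h vp1)]) h k.
  by move/run_mono; apply=> h' k' a _ [-> [a1 a2] a3 a4]; apply: HQ.
rewrite /CHOOSE; do 2 hstep; first by [].
do 2 hstep; first by [].
apply: run_Cond => /=; rewrite hk subn1 => lt; last by hstep; split=> //=; rewrite (negbTE lt).
apply: run_Cond => /=; rewrite hk subn1 => lt2.
  by hstep; split=> //=; rewrite lt /= leqNgt lt2.
rewrite -leqNgt in lt2; do 2 hstep; first by [].
by hstep; [|split=> //=; rewrite lt lt2].
Qed.

End Main.

(** * Rounding *)

(** The part of a vertex is the number of open boundaries up to its position. Openness is read off
    the rank, which fixes the number of parts even if boundaries coincide. *)
Definition LABELS F p l :=
  SetI vc #0 ;; SetI vj #0 ;;
  Loop (CI $vj $vn)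
    (Cond (CI (IArr iRK ($l * $vn + $vj)) $p) (SetI vc ($vc + #1)) Skip ;;
     PutI F (IArr iVT ($l * $vn + $vj)) $vc ;; SetI vj ($vj + #1)).

(* Marks, for each of the parts [0 .. vp1] of [iF1], one part of [iF2] that
   meets it. *)
Definition REP :=
  SetI vj #0 ;;
  Loop (CI $vj $vn) (PutI iM1 (IArr iF1 $vj) (IArr iF2 $vj) ;; SetI vj ($vj + #1)) ;;
  SetI vj #0 ;;
  Loop (CI $vj ($vp1 + #1)) (PutI iM2 (IArr iM1 $vj) #1 ;; SetI vj ($vj + #1)).

Definition NEQ x y p := Cond (CI $x $y) p (Cond (CI $y $x) p Skip).

Definition DEG :=
  SetI vj #0 ;;
  Loop (CI $vj $vm)
    (GetW vu ($vj * #2) ;; GetW vx ($vj * #2 + #1) ;; GetC xs $vj ;;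
     SetI vu (IArr iF2 $vu) ;; SetI vx (IArr iF2 $vx) ;;
     NEQ vu vx (PutR aDG $vu (RArr aDG $vu + $xs) ;; PutR aDG $vx (RArr aDG $vx + $xs)) ;;
     SetI vj ($vj + #1)).

Definition PKEY :=
  Cond (CI $vp ($vp2 + #1))
    (Cond (CI #0 (IArr iM2 $vp)) Skip (SetR xv (#1 / (#1 + RArr aDG $vp)))) Skip.

Definition PICK :=
  FILL PKEY ;; SetI vi #1 ;; SetI vq ($vk - #1 - $vp1 + #1) ;; SELECT (PutI iCH $vp #1).

(** Works in place: the half-edges [2j] and [2j + 1] are read before entry [j] is written, and
    [j <= 2j], so those of later edges stay intact. The variables of the two cuts serve as
    scratch. *)
Definition OUT :=
  SetI vj #0 ;;
  Loop (CI $vj $vm)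
    (GetW vu ($vj * #2) ;; GetW vx ($vj * #2 + #1) ;; SetI vc #0 ;;
     SetI vp1 (IArr iF1 $vu) ;; SetI vp2 (IArr iF1 $vx) ;; NEQ vp1 vp2 (SetI vc #1) ;;
     SetI vp1 (IArr iF2 $vu) ;; SetI vp2 (IArr iF2 $vx) ;;
     NEQ vp1 vp2 (Cond (CI #0 (IArr iCH $vp1 + IArr iCH $vp2)) (SetI vc #1) Skip) ;;
     PutW $vj $vc ;; SetI vj ($vj + #1)).

Definition label (rk : nat -> nat) p j := (\sum_(0 <= i < j.+1) (rk i < p)%N)%N.

Section Rounding.
Variables (R : realType) (X n m M r : nat) (src : nat -> nat) (c : nat -> R).
Hypotheses (Mr : M = (2 ^ r)%N) (nM : (n <= M)%N) (MX : (M * 2 <= X)%N) (mX : (m * 2 <= X)%N).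
Hypotheses (nX : (n + 2 <= X)%N) (n0 : (0 < n)%N).
Hypothesis srcn : forall i, (i < m * 2)%N -> (src i < n)%N.
Implicit Types h : hst R.
Notation run := (run X (m * 2)).
Notation env := (env n m M src c).

Lemma run_NEQ x y p Q h k : (iv h x != iv h y -> run p Q h k) ->
  (iv h x = iv h y -> Q h k) -> run (NEQ x y p) Q h k.
Proof.
move=> H1 H2; apply: run_Cond => /= lt; first by apply: H1; rewrite neq_ltn lt.
apply: run_Cond => /= gt; first by apply: H1; rewrite neq_ltn gt orbT.
by hstep; apply: H2; lia.
Qed.

Lemma run_LABELS F pv lv Q h k p l : iv h vn = n -> iv h pv = p -> iv h lv = l ->
  [/\ pv != vc, pv != vj, lv != vc & lv != vj] -> F != iRK -> F != iVT ->
  (forall i j, (i < n)%N -> (j < n)%N -> vtl n h l i = vtl n h l j -> i = j) -> (n <= k)%N ->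
  (forall h' k', agree (LABELS F pv lv) h h' ->
     (forall j, (j < n)%N -> ia h' F (vtl n h l j) = label (rkl n h l) p j) -> (k <= k' + n)%N -> Q h' k') ->
  run (LABELS F pv lv) Q h k.
Proof.
move=> hn hp hl [pc pj lc lj] FR FV inj kn HQ.
suff : run (LABELS F pv lv) (fun h' k' =>
     (forall j, (j < n)%N -> ia h' F (vtl n h l j) = label (rkl n h l) p j) /\ (k <= k' + n)%N) h k.
  by move/run_mono; apply=> h' k' a _ [t1 l']; apply: HQ.
rewrite /LABELS; do 2 hstep; first by [].
do 2 hstep; first by [].
apply: (run_Loop (I := fun h' k' => [/\ (iv h' vj <= n)%N, (k <= k' + iv h' vj)%N,
   iv h' vc = (\sum_(0 <= i < iv h' vj) (rkl n h l i < p)%N)%N /\ (iv h' vc <= iv h' vj)%N &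
   forall j, (j < iv h' vj)%N -> ia h' F (vtl n h l j) = label (rkl n h l) p j])).
- move=> h' k' A [jn kk [hc cj] H] /=.
  have hn' : iv h' vn = n by rewrite (agree_iv A).
  have hp' : iv h' pv = p by rewrite (agree_iv A) /= ?inE ?negb_or ?pc ?pj // (negbTE pc) (negbTE pj).
  have hl' : iv h' lv = l by rewrite (agree_iv A) /= ?inE ?negb_or ?lc ?lj // (negbTE lc) (negbTE lj).
  have RK : ia h' iRK = ia h iRK by rewrite (agree_ia A) //= inE eq_sym.
  have VT : ia h' iVT = ia h iVT by rewrite (agree_ia A) //= inE eq_sym.
  set j := iv h' vj in jn kk hc cj H *; rewrite hn' => lt; split; first by lia.
  have step h2 : iv h2 vj = j -> iv h2 vc = label (rkl n h l) p j -> iv h2 lv = l -> iv h2 vn = n -> ia h2 = ia h' ->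
    run (PutI F (IArr iVT ($lv * $vn + $vj)) $vc ;; SetI vj ($vj + #1)) (fun h' k' => [/\ (iv h' vj <= n)%N, (k <= k' + iv h' vj)%N,
   iv h' vc = (\sum_(0 <= i < iv h' vj) (rkl n h l i < p)%N)%N /\ (iv h' vc <= iv h' vj)%N &
   forall j, (j < iv h' vj)%N -> ia h' F (vtl n h l j) = label (rkl n h l) p j]) h2 k'.-1.
    move=> e1 e2 e3 e4 e5.
    have lab : (label (rkl n h l) p j <= j.+1)%N.
      by rewrite /label big_nat_recr //= -hc; case: (_ < p)%N; lia.
    hstep; hstep; first by rewrite e2; lia.
    hstep; first by rewrite /= e1; lia.
    rewrite /= e1 e2 e3 e4 e5 addn1; split=> //; first by lia.
    move=> i; rewrite ltnS leq_eqVlt => /orP[/eqP ->|il]; first by rewrite eqxx /= VT -/(vtl n h l j) eqxx.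
    rewrite eqxx /= VT -/(vtl n h l j); case: eqP => [E|_]; last exact: H.
    by have := inj i j ltac:(lia) lt E; lia.
  hstep; apply: run_Cond => /=; rewrite -/j hl' hn' hp' RK -/(rkl n h l j) => cmp.
    hstep; first by lia.
    apply: step => //=; last by rewrite (negbTE lc).
    by rewrite addn1 /label big_nat_recr //= -hc cmp addn1.
  by hstep; apply: step => //=; rewrite /label big_nat_recr //= -hc (negbTE cmp) addn0.
- move=> h' k' A _ [jn kk _ H] /=; have hn' : iv h' vn = n by rewrite (agree_iv A).
  by rewrite hn' -leqNgt => ge; split; [move=> j jl; apply: H|]; lia.
- by split=> //=; [lia|rewrite big_geq].
Qed.

Lemma run_REP Q h k f1 f2 p1 : iv h vn = n -> iv h vp1 = p1 -> (p1 < n)%N ->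
  (forall u, (u < n)%N -> [/\ ia h iF1 u = f1 u, ia h iF2 u = f2 u, (f1 u <= p1)%N & (f2 u <= X)%N]) ->
  (forall y, ia h iM2 y = 0%N) -> (n + p1.+1 <= k)%N ->
  (forall h' k' s, agree REP h h' ->
     (forall u, (u < n)%N -> exists u', [/\ (u' < n)%N, f1 u' = f1 u & ia h' iM2 (f2 u') != 0%N]) ->
     size s = p1.+1 -> (forall y, ia h' iM2 y != 0%N -> y \in s) -> (k <= k' + (n + p1.+1))%N -> Q h' k') ->
  run REP Q h k.
Proof.
move=> hn hp pn hf z kk HQ.
suff : run REP (fun h' k' => exists s, [/\
     (forall u, (u < n)%N -> exists u', [/\ (u' < n)%N, f1 u' = f1 u & ia h' iM2 (f2 u') != 0%N]),
     size s = p1.+1, (forall y, ia h' iM2 y != 0%N -> y \in s) & (k <= k' + (n + p1.+1))%N]) h k.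
  by move/run_mono; apply=> h' k' a _ [s [t1 t2 t3 l]]; apply: HQ t1 t2 t3 l.
rewrite /REP; do 2 hstep; first by [].
hstep; apply: (run_Loop (I := fun h' k' => [/\ (iv h' vj <= n)%N, (k <= k' + iv h' vj)%N &
   forall u, (u < iv h' vj)%N -> exists u', [/\ (u' < n)%N, f1 u' = f1 u & ia h' iM1 (f1 u) = f2 u']])).
- move=> h' k' A [jn kk' H] /=; have hn' : iv h' vn = n by rewrite (agree_iv A).
  have F1 : ia h' iF1 = ia h iF1 by rewrite (agree_ia A).
  have F2 : ia h' iF2 = ia h iF2 by rewrite (agree_ia A).
  rewrite hn' => lt; split; first by lia.
  have [g1 g2 g3 g4] := hf _ lt.
  hstep; hstep; first by rewrite F2 g2.
  hstep; first by rewrite /=; lia.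
  rewrite /= F1 F2 g1 g2 addn1; split; [by []|lia|] => u ul.
  case: (f1 u =P f1 (iv h' vj)) => [E|ne]; first by exists (iv h' vj).
  have [|u' [a1 a2 a3]] := H u; last by exists u'.
  by move: ul; rewrite ltnS leq_eqVlt => /orP[/eqP E|//]; rewrite E in ne.
- move=> h' k' A _ [jn kk' H] /=; have hn' : iv h' vn = n by rewrite (agree_iv A).
  have hp' : iv h' vp1 = p1 by rewrite (agree_iv A).
  have z' y : ia h' iM2 y = 0%N by rewrite (agree_ia A) //= z.
  rewrite hn' -leqNgt => ge; do 2 hstep; first by [].
  apply: (run_Loop (I := fun h2 k2 => [/\ (iv h2 vj <= p1.+1)%N, (k' <= k2 + iv h2 vj)%N,
     forall i, (i < iv h2 vj)%N -> ia h2 iM2 (ia h' iM1 i) != 0%N &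
     forall y, ia h2 iM2 y != 0%N -> y \in [seq ia h' iM1 i | i <- iota 0 p1.+1]])).
  + move=> h2 k2 A2 [jp kk2 H1 H2] /=; have hp2 : iv h2 vp1 = p1 by rewrite (agree_iv A2).
    have M1 : ia h2 iM1 = ia h' iM1 by rewrite (agree_ia A2).
    rewrite hp2 addn1 => lt; split; first by lia.
    hstep; hstep; first by lia.
    hstep; first by rewrite /=; lia.
    rewrite /= M1 addn1; split; [by []|lia| |].
      move=> i; rewrite ltnS leq_eqVlt => /orP[/eqP ->|il]; first by rewrite eqxx.
      by case: ifP => // _; apply: H1.
    move=> y; case: ifP => [/eqP -> _|_]; last exact: H2.
    have it : iv h2 vj \in iota 0 p1.+1 by rewrite mem_iota.
    exact: (map_f (ia h' iM1) it).
  + move=> h2 k2 A2 _ [jp kk2 H1 H2] /=; have hp2 : iv h2 vp1 = p1 by rewrite (agree_iv A2).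
    rewrite hp2 addn1 -leqNgt => ge2; exists [seq ia h' iM1 i | i <- iota 0 p1.+1].
    split=> //; [|by rewrite size_map size_iota|by lia].
    move=> u un; have [|u' [a1 a2 a3]] := H u; first by lia.
    exists u'; split=> //; rewrite -a3; apply: H1; have [_ _ g3 _] := hf u un; lia.
  + by split=> //=; [lia|move=> y; rewrite z'].
- by split=> //=; lia.
Qed.

Definition degree (f : nat -> nat) y : R := \sum_(0 <= e < m | f (src (e * 2)%N) != f (src (e * 2 + 1)%N))
  ((f (src (e * 2)%N) == y)%:R + (f (src (e * 2 + 1)%N) == y)%:R) * c e.

Lemma run_DEG Q h k f : env h -> (forall u, (u < n)%N -> ia h iF2 u = f u /\ (f u <= X)%N) ->
  (forall y, ra h aDG y = 0) -> (m <= k)%N ->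
  (forall h' k', agree DEG h h' -> (forall y, ra h' aDG y = degree f y) -> (k <= k' + m)%N -> Q h' k') ->
  run DEG Q h k.
Proof.
move=> he hf z kk HQ.
suff : run DEG (fun h' k' => (forall y, ra h' aDG y = degree f y) /\ (k <= k' + m)%N) h k.
  by move/run_mono; apply=> h' k' a _ [t1 l]; apply: HQ.
pose D j y := \sum_(0 <= e < j | f (src (e * 2)%N) != f (src (e * 2 + 1)%N))
  ((f (src (e * 2)%N) == y)%:R + (f (src (e * 2 + 1)%N) == y)%:R) * c e : R.
rewrite /DEG; do 2 hstep; first by [].
apply: (run_Loop (I := fun h' k' => [/\ (iv h' vj <= m)%N, (k <= k' + iv h' vj)%N &
   forall y, ra h' aDG y = D (iv h' vj) y])).
- move=> h' k' A [jm kk' H] /=.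
  have he' : env h' by apply: (env_agree A isT); case: he => *; split.
  have F2 : ia h' iF2 = ia h iF2 by rewrite (agree_ia A).
  set j := iv h' vj in jm kk' H *; rewrite (env_m he') => lt; split; first by lia.
  have DE y : D j.+1 y = D j y + (if f (src (j * 2)%N) != f (src (j * 2 + 1)%N) then
      ((f (src (j * 2)%N) == y)%:R + (f (src (j * 2 + 1)%N) == y)%:R) * c j else 0).
    by rewrite /D big_mkcond big_nat_recr //= -big_mkcond.
  have w1 : iw h' (j * 2)%N = src (j * 2)%N by rewrite (env_w he') //; lia.
  have w2 : iw h' (j * 2 + 1)%N = src (j * 2 + 1)%N by rewrite (env_w he') //; lia.
  have [f1 f1X] := hf _ (srcn (i := (j * 2)%N) ltac:(lia)).
  have [f2 f2X] := hf _ (srcn (i := (j * 2 + 1)%N) ltac:(lia)).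
  hstep; apply: run_GetW; rewrite /= -/j ?w1; first by lia.
  hstep; apply: run_GetW; rewrite /= -/j ?w2; first by lia.
  hstep; apply: run_GetC; rewrite /= -/j ?(env_c he') //; first by lia.
  hstep; hstep; first by rewrite F2 f1.
  hstep; hstep; first by rewrite F2 f2.
  rewrite /= F2 f1 f2; hstep; apply: run_NEQ => /= ne.
    do 3 hstep; hstep; first by rewrite -/j; lia.
    rewrite /= -/j addn1; split; [by []|lia|] => y; rewrite DE ne /= !H.
    move: ne; set a := f (src (j * 2)%N); set b := f (src (j * 2 + 1)%N) => ne.
    have ba : (b == a) = false by rewrite eq_sym (negbTE ne).
    case: (y =P b) => [->|nb]; first by rewrite ba eqxx (negbTE ne) add0r mul1r.
    have -> : (b == y) = false by apply/eqP => E; apply: nb.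
    case: (y =P a) => [->|na]; first by rewrite eqxx addr0 mul1r.
    have -> : (a == y) = false by apply/eqP => E; apply: na.
    by rewrite addr0 mul0r addr0.
  hstep; first by rewrite -/j; lia.
  rewrite /= -/j addn1; split; [by []|lia|] => y.
  by rewrite DE ne eqxx /= addr0.
- move=> h' k' A _ [jm kk' H] /=.
  have he' : env h' by apply: (env_agree A isT); case: he => *; split.
  rewrite (env_m he') -leqNgt => ge; have E : iv h' vj = m by lia.
  by split; [move=> y; rewrite H E|lia].
- by split=> //= [|y]; [lia|rewrite z /D big_geq].
Qed.

Lemma run_PICK Q h k kc p1 p2 : env h -> iv h vk = kc -> iv h vp1 = p1 -> iv h vp2 = p2 ->
  (p2 < n)%N -> (kc <= n)%N -> let D := fun y => (y <= p2)%N && (ia h iM2 y == 0%N) in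
  (forall y, 0 <= ra h aDG y) -> (kc.-1 - p1 <= count D (iota 0 M))%N -> (forall y, ia h iCH y = 0%N) ->
  (2 * M + n * (2 * r).+1 <= k)%N ->
  (forall h' k' ext, agree PICK h h' -> selected D (ra h aDG) ext -> size ext = (kc.-1 - p1)%N ->
     (forall y, (ia h' iCH y != 0%N) = (y \in ext)) -> (k <= k' + (2 * M + n * (2 * r).+1))%N -> Q h' k') ->
  run PICK Q h k.
Proof.
move=> he hk hp1 hp2 p2n kn D dge cnt z kk HQ.
suff : run PICK (fun h' k' => exists ext, [/\ selected D (ra h aDG) ext, size ext = (kc.-1 - p1)%N,
     (forall y, (ia h' iCH y != 0%N) = (y \in ext)) & (k <= k' + (2 * M + n * (2 * r).+1))%N]) h k.
  by move/run_mono; apply=> h' k' a _ [ext [t1 t2 t3 l]]; apply: HQ t1 t2 t3 l.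
rewrite /PICK; hstep.
apply: (run_FILL (g := fun p => if D p then 1 / (1 + ra h aDG p) else -1) Mr nM MX mX nX (env_M he)) => //.
- by lia.
- move=> h' k' p A hp pM hx.
  have hp2' : iv h' vp2 = p2 by rewrite (agree_iv A).
  have M2 : ia h' iM2 = ia h iM2 by rewrite (agree_ia A).
  have DG : ra h' aDG = ra h aDG by rewrite (agree_ra A).
  apply: run_Cond => /=; rewrite hp hp2' addn1 ltnS => pp; last by hstep; rewrite /D (negbTE pp).
  rewrite /D pp; apply: run_Cond => /=; rewrite hp M2 => m2.
    by hstep; rewrite -leqn0 leqNgt m2.
  by hstep; rewrite -leqn0 leqNgt m2 /= hp DG mulr1n.
move=> h1 k1 d1 A1 tr1 kk1.
have [k1' p1' M1] : [/\ iv h1 vk = kc, iv h1 vp1 = p1 & iv h1 vM = M].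
  by split; rewrite (agree_iv A1) // (env_M he).
do 2 hstep; first by lia.
do 2 hstep; first by rewrite k1' p1'; lia.
rewrite /= k1' p1' subn1 addn1; set h2 := setI _ _ _.
pose J (ext : seq nat) (f : nat -> nat -> nat) (A : nat -> nat -> R) := forall y, (f iCH y != 0%N) = (y \in ext).
have le : ((kc.-1 - p1) * (2 * r).+1 <= n * (2 * r).+1)%N by rewrite leq_mul2r; apply/orP; right; lia.
apply: (run_SELECT (D := D) (key := ra h aDG) (J := J) (d := d1) (q := (kc.-1 - p1)%N) Mr nM MX mX nX) => //.
- by lia.
- by move=> p /andP[pp _]; lia.
- move=> h' k' ext v A hv hi lt Dv sel Jv; hstep; first by lia.
  by split=> // y; rewrite /= hv mem_rcons inE; case: ifP => // _; rewrite Jv.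
- by move=> y; rewrite /= (agree_ia A1) // z.
- by lia.
move=> h3 k3 ext A3 sel sz J3 kk3; exists ext; split=> //; lia.
Qed.

Lemma run_OUT Q h k f1 f2 : (forall i, (i < m * 2)%N -> iw h i = src i) -> iv h vm = m ->
  (forall u, (u < n)%N -> [/\ ia h iF1 u = f1 u, ia h iF2 u = f2 u, (f1 u <= X)%N & (f2 u <= X)%N]) ->
  (m <= k)%N ->
  (forall h' k', agree OUT h h' -> (forall e, (e < m)%N -> let a := src (e * 2)%N in let b := src (e * 2 + 1)%N in
     (iw h' e != 0%N) = (f1 a != f1 b) || (f2 a != f2 b) && ((ia h iCH (f2 a) != 0%N) || (ia h iCH (f2 b) != 0%N))) ->
     (k <= k' + m)%N -> Q h' k') ->
  run OUT Q h k.
Proof.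
move=> hw hm hf kk HQ.
pose O h' e := let a := src (e * 2)%N in let b := src (e * 2 + 1)%N in
     (iw h' e != 0%N) = (f1 a != f1 b) || (f2 a != f2 b) && ((ia h iCH (f2 a) != 0%N) || (ia h iCH (f2 b) != 0%N)).
suff : run OUT (fun h' k' => (forall e, (e < m)%N -> O h' e) /\ (k <= k' + m)%N) h k.
  by move/run_mono; apply=> h' k' a _ [t1 l]; apply: HQ.
rewrite /OUT; do 2 hstep; first by [].
pose Inv h' k' := [/\ (iv h' vj <= m)%N, (k <= k' + iv h' vj)%N,
   (forall i, (iv h' vj <= i < m * 2)%N -> iw h' i = src i) & forall e, (e < iv h' vj)%N -> O h' e].
apply: (run_Loop (I := Inv)).
- move=> h' k' A [jm kk' H1 H2] /=.
  have hm' : iv h' vm = m by rewrite (agree_iv A).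
  have iaE : ia h' = ia h by apply/funext => a; rewrite (agree_ia A).
  set j := iv h' vj in jm kk' H1 H2 *; rewrite hm' => lt; split; first by lia.
  have w1 : iw h' (j * 2)%N = src (j * 2)%N by rewrite H1 //; lia.
  have w2 : iw h' (j * 2 + 1)%N = src (j * 2 + 1)%N by rewrite H1 //; lia.
  have [a1 a2 a3 a4] := hf _ (srcn (i := (j * 2)%N) ltac:(lia)).
  have [b1 b2 b3 b4] := hf _ (srcn (i := (j * 2 + 1)%N) ltac:(lia)).
  hstep; apply: run_GetW; rewrite /= -/j ?w1; first by lia.
  hstep; apply: run_GetW; rewrite /= -/j ?w2; first by lia.
  do 2 hstep; first by [].
  do 2 hstep; first by rewrite iaE a1.
  do 2 hstep; first by rewrite iaE b1.
  rewrite /= iaE a1 b1.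
  have fin h2 (b : bool) : iv h2 vj = j -> iv h2 vc = b -> iw h2 = iw h' -> 
     b = (f1 (src (j * 2)%N) != f1 (src (j * 2 + 1)%N)) || (f2 (src (j * 2)%N) != f2 (src (j * 2 + 1)%N)) && ((ia h iCH (f2 (src (j * 2)%N)) != 0%N) || (ia h iCH (f2 (src (j * 2 + 1)%N)) != 0%N)) ->
     run (PutW $vj $vc ;; SetI vj ($vj + #1)) Inv h2 k'.-1.
    move=> e1 e2 e3 bE; hstep; apply: run_PutW; rewrite /= ?e1 ?e2; [lia|case: (b); lia|].
    hstep; first by rewrite /= e1; lia.
    rewrite /Inv /= e1 ?e2 e3 addn1; split; [by []|lia| |].
      by move=> i ii; rewrite (_ : (i == j) = false) ?H1 //; lia.
    move=> e; rewrite ltnS leq_eqVlt /O /= => /orP[/eqP ->|el].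
      by rewrite eqxx eqb0 negbK.
    by rewrite (ltn_eqF el) e3 (H2 e el).
  have second h2 b : iv h2 vj = j -> iv h2 vu = src (j * 2)%N -> iv h2 vx = src (j * 2 + 1)%N -> iv h2 vc = nat_of_bool b -> iw h2 = iw h' -> ia h2 = ia h ->
     b = (f1 (src (j * 2)%N) != f1 (src (j * 2 + 1)%N)) ->
     run (SetI vp1 (IArr iF2 $vu) ;; SetI vp2 (IArr iF2 $vx) ;;
     NEQ vp1 vp2 (Cond (CI #0 (IArr iCH $vp1 + IArr iCH $vp2)) (SetI vc #1) Skip) ;;
     PutW $vj $vc ;; SetI vj ($vj + #1)) Inv h2 k'.-1.
    move=> e1 e2 e3 e4 e5 e6 bE.
    do 2 hstep; first by rewrite e6 e2 a2.
    do 2 hstep; first by rewrite e6 e3 b2.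
    rewrite /= e6 e2 e3 a2 b2; hstep; apply: run_NEQ => /= ne; last first.
      by apply: (fin _ b) => //; rewrite -bE ne eqxx orbF.
    apply: run_Cond => /=; rewrite e6 addn_gt0 !lt0n => ch.
      by hstep; [lia|apply: (fin _ true) => //; rewrite ne ch orbT].
    by hstep; apply: (fin _ b) => //; rewrite (negbTE ch) andbF orbF -bE.
  hstep; apply: run_NEQ => /= ne; first by hstep; [lia|apply: (second _ true) => //; rewrite ne].
  by apply: (second _ false) => //; rewrite ne eqxx.
- move=> h' k' A _ [jm kk' H1 H2] /=.
  have hm' : iv h' vm = m by rewrite (agree_iv A).
  by rewrite hm' -leqNgt => ge; split; [move=> e em; apply: H2|]; lia.
- by rewrite /Inv /=; split=> //; first [lia|move=> i /andP[_ im]; rewrite hw].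
Qed.

End Rounding.

Section Labels.
Variables (R : realType) (n : nat) (d : nat -> R) (rk : nat -> nat) (sn : nat -> R).
Hypotheses (rkd : ranked n d rk sn).

Lemma labelS p j : label rk p j.+1 = (label rk p j + (rk j.+1 < p))%N.
Proof. by rewrite /label [LHS]big_nat_recr. Qed.

Lemma label_p0 p : (p < n)%N -> label rk p 0 = 0%N.
Proof. by move=> pn; rewrite /label big_nat1 (rkd_0 rkd) ltnNge ltnW. Qed.

Lemma label_last p : (p < n)%N -> label rk p n.-1 = p.
Proof.
move=> pn; rewrite /label prednK; last by lia.
rewrite big_ltn ?(ranked_count rkd pn); last by lia.
by rewrite (rkd_0 rkd) [(n < p)%N]ltnNge ltnW.
Qed.

Lemma label_mono p i j : (i <= j)%N -> (label rk p i <= label rk p j)%N.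
Proof.
elim: j => [|j IH]; first by rewrite leqn0 => /eqP ->.
rewrite leq_eqVlt => /orP[/eqP ->//|ij]; rewrite labelS.
by apply: leq_trans (IH ij) (leq_addr _ _).
Qed.

Lemma label_le p j : (p < n)%N -> (j < n)%N -> (label rk p j <= p)%N.
Proof.
by move=> pn jn; rewrite -[X in (_ <= X)%N](label_last pn); apply: label_mono; lia.
Qed.

Lemma label_onto p v : (p < n)%N -> (v <= p)%N -> exists2 j, (j < n)%N & label rk p j = v.
Proof.
move=> pn vp; suff H k : (v <= label rk p k)%N -> exists2 j, (j <= k)%N & label rk p j = v.
  by have [|j jn E] := H n.-1; [rewrite label_last|exists j; lia].
elim: k => [|k IH].
  by rewrite label_p0 // leqn0 => /eqP ->; exists 0%N; rewrite ?label_p0.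
case: (leqP v (label rk p k)) => [/IH [j jk E] _|lt]; first by exists j => //; lia.
rewrite labelS => le; exists k.+1 => //; rewrite labelS.
by case: (rk k.+1 < p)%N le; lia.
Qed.

Lemma label_diff p i j : (i <= j)%N -> label rk p i != label rk p j ->
  exists2 b, (i < b <= j)%N & (rk b < p)%N.
Proof.
elim: j => [|j IH]; first by rewrite leqn0 => /eqP ->; rewrite eqxx.
rewrite leq_eqVlt => /orP[/eqP ->|ij]; first by rewrite eqxx.
rewrite labelS; case: ltnP => [lt _|_]; first by exists j.+1; rewrite ?ij ?leqnn.
by rewrite addn0 => /(IH ij)[b bi lt]; exists b => //; lia.
Qed.

Lemma ranked_le p b : (p < n)%N -> (0 < b < n)%N -> (rk b < p)%N -> d b <= sn p.
Proof.
move=> pn bn lt; have [_ ->] := ranked_nth rkd bn.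
by apply: (rkd_sorted rkd) => //; lia.
Qed.

Lemma ranked_below T : let p := (\sum_(1 <= j < n) (d j <= T)%R)%N in
  (p < n)%N \/ n = 0%N.
Proof.
move=> p; case: (posnP n) => [->|n0]; [by right|left].
suff : (p <= n.-1)%N by lia.
apply: (@leq_trans (\sum_(1 <= j < n) 1)%N); first by apply: leq_sum => j _; case: (_ <= _).
by rewrite sum_nat_const_nat muln1 subn1.
Qed.

Lemma ranked_at T : let p := (\sum_(1 <= j < n) (d j <= T)%R)%N in (0 < p < n)%N -> sn p <= T.
Proof.
move=> p pn; rewrite leNgt; apply/negP => lt; suff : (p < p)%N by rewrite ltnn.
have {1}-> : p = (\sum_(1 <= i < n) (sn i <= T)%R)%N.
  apply/eqP; rewrite -(eqr_nat R) !natr_sum; apply/eqP.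
  exact: (ranked_sum rkd (fun _ x => (x <= T)%R%:R)).
apply: (@leq_ltn_trans p.-1); last by lia.
rewrite (@big_cat_nat _ _ _ p) //=; [|lia|lia].
rewrite [X in (_ + X <= _)%N]big_nat [X in (_ + X <= _)%N]big1 ?addn0 => [|i /andP[pi ii]]; last first.
  rewrite leNgt (lt_le_trans lt) //; apply: (rkd_sorted rkd); lia.
apply: (@leq_trans (\sum_(1 <= j < p) 1)%N); first by apply: leq_sum => j _; case: (_ <= _).
by rewrite sum_nat_const_nat muln1 subn1.
Qed.

End Labels.

(** * Costs of the available cuts and value of the packing *)

Section Values.
Variables (R : realType) (n m : nat) (src : nat -> nat) (c : nat -> R) (h : hst R) (L : nat) (sn : nat -> nat -> R).
Hypotheses (n0 : (0 < n)%N) (L0 : (0 < L)%N) (c_gt0 : forall e, (e < m)%N -> 0 < c e).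
Hypothesis ls : levels n m src c h L sn.
Notation d := (dll n h).
Notation bc := (ra h aBC).

Lemma ls_ordering l : (l <= L)%N -> ordering n (vtl n h l) (d l).
Proof. by case: l => [|l] lL; [exact: (ls_ord ls)|have [] := ls_level ls lL]. Qed.

Lemma lcost_cut l (P : pred nat) T : (0 < l <= L)%N -> 0 <= T ->
  (forall s e, level_uses n m (fun e => src (e * 2)%N) (fun e => src (e * 2 + 1)%N) c (vtl n h l.-1) (d l.-1) (vtl n h l) (d l) s ->
     (e < m)%N -> P e -> s e + c e <= T) ->
  \sum_(0 <= e < m | P e) c e <= lcost n h l T.
Proof.
case: l => // l lL T0 H; have [[s Hs] or' _] := ls_level ls lL.
have or := ls_ordering (l := l) ltac:(lia).
apply: (cut_cost c_gt0 n0 (or_d0 or) (or_d0 or') Hs (or_d or) (or_d or')) => // e em.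
exact: H Hs em.
Qed.

Lemma lcost_ge0 l T : (0 < l <= L)%N -> 0 <= T -> 0 <= lcost n h l T.
Proof.
move=> lL T0; have := @lcost_cut l pred0 T lL T0; rewrite big_pred0_eq; apply=> //.
Qed.

Lemma sn_ge0 l i : (0 < l <= L)%N -> (0 < i < n)%N -> 0 <= sn l i.
Proof.
move=> lL iN; have [[ext pe H] _ _] := ls_rank ls lL.
have [|_ E] := H i.-1; first by lia.
rewrite (_ : i = i.-1.+1) ?E; last by lia.
apply: (or_d (ls_ordering _)); first by lia.
have : nth 0%N ext i.-1 \in ext by rewrite mem_nth // (perm_size pe) size_iota; lia.
by rewrite (perm_mem pe) mem_index_iota => /andP[].
Qed.

Lemma bc_ge0 p : (p < n)%N -> 0 <= bc p.
Proof.
move=> pn; case: (posnP p) => [->|p0]; first by rewrite (ls_0 ls).1.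
have [lL ->] := ls_bl ls L0 (i := p) ltac:(lia).
by apply: lcost_ge0 => //; apply: sn_ge0 => //; lia.
Qed.

(** The tabulated costs are taken at boundaries only. For arbitrary [T] with [p > 0] open
    boundaries, the [p]-th boundary is at most [T], and by [slack_mono] the cut there is no more
    expensive. *)
Lemma levels_conj lam a : (forall p, (p < n)%N -> lam * p%:R - bc p <= a) ->
  forall l T, (l < L)%N -> 0 <= T ->
  lam * (\sum_(1 <= j < n) (d l.+1 j <= T)%R%:R) - (slack n (d l) T - slack n (d l.+1) T) <= a.
Proof.
move=> Ha l T lL T0; have rk := ls_rank ls (l := l.+1) ltac:(lia).
rewrite -natr_sum; set p := (\sum_(1 <= j < n) _)%N.
have [pn|//] := ranked_below n (d l.+1) T; last by move=> E; move: n0; rewrite E.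
rewrite -/p in pn; case: (posnP p) => [->|p0].
  rewrite mulr0 sub0r; have := Ha 0%N n0; rewrite (ls_0 ls).1 mulr0 subr0.
  have := @lcost_ge0 l.+1 T ltac:(lia) T0; rewrite /lcost /= => a1 a2; lra.
have snT : sn l.+1 p <= T by apply: (ranked_at rk); rewrite -/p p0 pn.
have s0 : 0 <= sn l.+1 p by apply: sn_ge0; lia.
have := Ha p pn; have := ls_bc ls (l := l.+1) (i := p) ltac:(lia) ltac:(lia).
have [[s Hs] or' _] := ls_level ls lL; have or := ls_ordering (l := l) ltac:(lia).
have TT : 0 <= sn l.+1 p <= T by rewrite s0.
have := slack_mono c_gt0 n0 (or_d0 or) (or_d0 or') Hs TT.
by rewrite /lcost /=; lra.
Qed.

Lemma slack_L T : slack n (d L) T = slack n (sn L) T.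
Proof.
by have rk := ls_rank ls (l := L) ltac:(lia); rewrite /slack -(ranked_sum rk (fun _ x => Num.max 0 (T - x))).
Qed.

(** Each term of the slack is nonnegative and at least [T - sn L i]. Together with [levels_tight]
    this makes the sum of the [k - 1] smallest boundaries a maximum over [T]: the upper bound feeds
    the growth argument, and its attainment bounds the linear program. *)
Lemma levels_lower k : (0 < k <= n)%N -> forall T, 0 <= T ->
  T * (k%:R - 1) - slack n (d L) T <= \sum_(1 <= i < k) sn L i.
Proof.
move=> kn T T0; rewrite slack_L /slack (@big_cat_nat _ _ _ k) //=; try lia.
have a1 : 0 <= \sum_(k <= i < n) Num.max 0 (T - sn L i) by apply: sumr_ge0 => i _; rewrite le_max lexx.
have a2 : \sum_(1 <= i < k) (T - sn L i) <= \sum_(1 <= i < k) Num.max 0 (T - sn L i).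
  by apply: ler_sum => i _; rewrite le_max lexx orbT.
have E : \sum_(1 <= i < k) T = T * (k%:R - 1).
  by rewrite sumr_const_nat -[LHS]mulr_natr natrB //; lia.
move: a2; rewrite sumrB E.
by move: a1; lra.
Qed.

Lemma levels_tight k : (1 < k <= n)%N ->
  \sum_(1 <= i < k) sn L i = sn L k.-1 * (k%:R - 1) - slack n (d L) (sn L k.-1).
Proof.
move=> kn; rewrite slack_L; have rk := ls_rank ls (l := L) ltac:(lia).
rewrite (@slack_split _ n k (sn L)); [|lia| |].
- by rewrite -subn1 natrB; [ring|lia].
- by move=> j jk; apply: (rkd_sorted rk); lia.
- by move=> j jk; apply: (rkd_sorted rk); lia.
Qed.

Lemma levels_pos k : (1 < k <= n)%N -> 0 < \sum_(1 <= i < k) sn L i.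
Proof.
move=> kn; have pos i : (0 < i < n)%N -> 0 < sn L i.
  move=> iN; have [[ext pe H] _ _] := ls_rank ls (l := L) ltac:(lia).
  have [|_ E] := H i.-1; first by lia.
  rewrite (_ : i = i.-1.+1) ?E; last by lia.
  have : nth 0%N ext i.-1 \in ext by rewrite mem_nth // (perm_size pe) size_iota; lia.
  rewrite (perm_mem pe) mem_index_iota => jn.
  have [L' E'] : exists L', L = L'.+1 by exists L.-1; lia.
  have [_ _ p] := ls_level ls (l := L') ltac:(lia).
  by rewrite E'; apply: p.
rewrite big_ltn //; last by lia.
rewrite ltr_wpDr ?pos //; last by lia.
by rewrite big_nat; apply: sumr_ge0 => i ii; apply: ltW; apply: pos; lia.
Qed.

(** Two ends with different labels have an open boundary between them, and by [lu_cross] the use of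
    the edge is over when that boundary opens. So [cut_cost] applies to all separated edges. *)
Lemma cut_labels f p : (p < n)%N ->
  (forall j, (j < n)%N -> f (vtl n h (ia h iBL p) j) = label (rkl n h (ia h iBL p)) p j) ->
  (forall i, (i < m * 2)%N -> (src i < n)%N) ->
  \sum_(0 <= e < m | f (src (e * 2)%N) != f (src (e * 2 + 1)%N)) c e <= bc p.
Proof.
move=> pn fE srcn; set l := ia h iBL p in fE.
have lL : (l <= L)%N.
  case: (posnP p) => [p0|p0]; first by rewrite /l p0 (ls_0 ls).2.
  by have [/andP[]] := ls_bl ls L0 (i := p) ltac:(lia).
have [or1 or2 or3 or4] := ls_ordering lL.
have surj v : (v < n)%N -> exists2 j, (j < n)%N & vtl n h l j = v.
  move=> vn; pose F (i : 'I_n) : 'I_n := Ordinal (or1 i (ltn_ord i)).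
  have fi : injective F by move=> i j /(congr1 val) /= /or2 E; apply/val_inj/E.
  have [f' _ f'K] := injF_bij fi.
  by exists (f' (Ordinal vn)); rewrite ?ltn_ord //; have /(congr1 val) := f'K (Ordinal vn).
case: (posnP p) => [p0|p0].
  rewrite big_nat_cond big_pred0 ?bc_ge0 // => e; apply/negbTE; rewrite !negb_and negbK.
  case: ltnP => //= em; have [i i_n <-] := surj _ (srcn (e * 2)%N ltac:(lia)).
  have [j jn <-] := surj _ (srcn (e * 2 + 1)%N ltac:(lia)).
  by rewrite !fE // p0 /label !big1 ?orbT.
have [l0 ->] := ls_bl ls L0 (i := p) ltac:(lia); rewrite -/l in l0 *.
have rk := ls_rank ls l0.
apply: lcost_cut => //; first by apply: sn_ge0 => //; lia.
move=> s e Hs em; have [i i_n Ei] := surj _ (srcn (e * 2)%N ltac:(lia)).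
have [j jn Ej] := surj _ (srcn (e * 2 + 1)%N ltac:(lia)).
rewrite -Ei -Ej !fE // => ne.
case: (leqP i j) => ij.
  have [b bi lt] := label_diff ij ne.
  apply: (@le_trans _ _ (d l b)); last by apply: (ranked_le rk) => //; lia.
  by apply: (lu_cross Hs em _ bi jn); left.
rewrite eq_sym in ne; have [b bi lt] := label_diff (ltnW ij) ne.
apply: (@le_trans _ _ (d l b)); last by apply: (ranked_le rk) => //; lia.
by apply: (lu_cross Hs em _ bi i_n); right.
Qed.

End Values.

(** * Rounding at a factor of two *)

(** A selected key is at most any key left over; summing over all such pairs gives that the selected
    ones are no larger on average. *)
Lemma selected_average (R : realType) (D : pred nat) (key : nat -> R) ext b :
  (forall p, D p -> (p < b)%N) -> selected D key ext ->
  (\sum_(y <- ext) key y) * (count D (iota 0 b))%:R <= (size ext)%:R * \sum_(0 <= y < b | D y) key y.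
Proof.
move=> Db [u1 u2 u3].
pose rest := [seq y <- seq.filter D (iota 0 b) | y \notin ext].
have uD : uniq (seq.filter D (iota 0 b)) by rewrite filter_uniq ?iota_uniq.
have pe : perm_eq (seq.filter D (iota 0 b)) (ext ++ rest).
  apply: uniq_perm => //.
    rewrite cat_uniq u1 filter_uniq // andbT; apply/hasPn => y.
    by rewrite mem_filter => /andP[].
  move=> y; rewrite mem_cat !mem_filter mem_iota /=.
  case: (boolP (y \in ext)) => //= ye; by rewrite (u2 y ye) Db ?u2.
have -> : (count D (iota 0 b))%:R = (size ext)%:R + (size rest)%:R :> R.
  by rewrite -size_filter (perm_size pe) size_cat natrD.
have -> : \sum_(0 <= y < b | D y) key y = \sum_(y <- ext) key y + \sum_(y <- rest) key y.
  by rewrite /index_iota subn0 -big_filter (perm_big _ pe) big_cat.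
rewrite mulrDr mulrDr [_ * (size ext)%:R]mulrC lerD2l.
have le y z : y \in ext -> z \in rest -> key y <= key z.
  move=> ye; rewrite !mem_filter => /and3P[zN Dz _].
  rewrite -(nth_index 0%N ye); apply: u3; rewrite ?index_mem //.
  by apply: contra zN; apply: mem_take.
have c1 (s : seq nat) x : \sum_(z <- s) x = x * (size s)%:R :> R.
  by rewrite big_const_seq count_predT iter_addr addr0 mulr_natr.
have -> : (\sum_(y <- ext) key y) * (size rest)%:R = \sum_(y <- ext) \sum_(z <- rest) key y.
  by rewrite mulr_suml; apply: eq_bigr => y _; rewrite c1.
have -> : (size ext)%:R * (\sum_(y <- rest) key y) = \sum_(y <- ext) \sum_(z <- rest) key z.
  by rewrite mulrC c1.
rewrite big_seq [X in _ <= X]big_seq; apply: ler_sum => y ye.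
by rewrite big_seq [X in _ <= X]big_seq; apply: ler_sum => z ze; apply: le.
Qed.

(** With [x = q - p1] and [y = p2 - p1], the hypothesis on [V] reads [b p1 + hi * x <= V], and
    optimality of [p2] at [hi] gives [b p2 <= b p1 + hi * y]. If [y <= 2 * x], then [b p2 <= 2 * V].
    If [2 * x < y], the averaged supplement is [S <= (x / y) * 2 * b p2 <= b p1 + 2 * hi * x], again
    at most [2 * V] together with [b p1]. *)
Lemma round_value (R : realType) (n q p1 p2 : nat) (b : nat -> R) lo hi V : 0 <= lo -> lo <= hi ->
  best n b lo p1 -> best n b hi p2 -> (p1 <= q <= p2)%N -> (forall p, (p < n)%N -> 0 <= b p) ->
  lo * q%:R - (lo * p1%:R - b p1) + (hi - lo) * (q - p1)%:R <= V ->
  [/\ p1 = q -> b p1 <= V,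
      (p1 < q)%N -> (p2 - p1 <= 2 * (q - p1))%N -> b p2 <= 2 * V &
      (p1 < q)%N -> (2 * (q - p1) < p2 - p1)%N -> forall S, S * (p2 - p1)%:R <= (q - p1)%:R * (2 * b p2) ->
        b p1 + S <= 2 * V].
Proof.
move=> lo0 lohi [p1n _] [p2n /(_ p1 p1n) H2] /andP[p1q qp2] b0 HV.
have b1 := b0 _ p1n; have b2 := b0 _ p2n.
have E1 : (q - p1)%:R = q%:R - p1%:R :> R by rewrite natrB.
have E2 : (p2 - p1)%:R = p2%:R - p1%:R :> R by rewrite natrB //; lia.
set x := (q - p1)%:R in E1 HV *; set y := (p2 - p1)%:R in E2 *.
have HV' : b p1 + hi * x <= V by move: HV; rewrite E1; lra.
have H2' : b p2 <= b p1 + hi * y by move: H2; rewrite E2; lra.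
have x0 : 0 <= x by rewrite ler0n.
have hi0 : 0 <= hi by lra.
have hx : 0 <= hi * x by rewrite mulr_ge0.
split.
- by move=> _; lra.
- move=> lt le; have yx : y <= 2 * x by rewrite /y /x -natrM ler_nat.
  have : hi * y <= hi * (2 * x) by rewrite ler_wpM2l.
  by move: HV' H2' b1; lra.
- move=> lt gt S HS; have yx : 2 * x <= y by rewrite /y /x -natrM ler_nat ltnW.
  have y0N : (0 < p2 - p1)%N by clear -gt; lia.
  have y0 : 0 < y by rewrite ltr0n.
  have HS2 : S * y <= x * (2 * (b p1 + hi * y)).
    by apply: le_trans HS _; rewrite ler_wpM2l // ler_wpM2l.
  have HS3 : S * y <= b p1 * y + 2 * hi * x * y.
    apply: le_trans HS2 _; have : b p1 * (2 * x) <= b p1 * y by rewrite ler_wpM2l.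
    by lra.
  have : S <= b p1 + 2 * hi * x.
    by rewrite -(ler_pM2r y0) mulrDl.
  by move: HV'; lra.
Qed.

Lemma weight_bound (R : realType) (x : R) (b1 b2 b3 b4 : bool) : 0 < x ->
  (if b1 || b2 && (b3 || b4) then x else 0) <=
  (if b1 then x else 0) + (if b2 then (b3%:R + b4%:R) * x else 0).
Proof. by move=> x0; case: b1; case: b2; case: b3; case: b4 => /=; lra. Qed.

Section Cut.
Import fintype finset fingraph.
Variables (R : realType) (n m : nat) (G : ugraph n m) (c : nat -> R) (f1 f2 : nat -> nat).
Variables (p1 p2 kc : nat) (mk : pred nat) (ext : seq nat).
Hypothesis c_gt0 : forall e, (e < m)%N -> 0 < c e.
Hypothesis f1le : forall u, (u < n)%N -> (f1 u <= p1)%N.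
Hypothesis f2le : forall u, (u < n)%N -> (f2 u <= p2)%N.
Hypothesis f1onto : forall i, (i <= p1)%N -> exists2 u, (u < n)%N & f1 u = i.
Hypothesis f2onto : forall i, (i <= p2)%N -> exists2 u, (u < n)%N & f2 u = i.
Hypothesis rep : forall u, (u < n)%N -> exists u', [/\ (u' < n)%N, f1 u' = f1 u & mk (f2 u')].
Hypothesis ext_uniq : uniq ext.
Hypothesis extD : forall y, y \in ext -> (y <= p2)%N && ~~ mk y.

Definition cut_edge a b := (f1 a != f1 b) || (f2 a != f2 b) && ((f2 a \in ext) || (f2 b \in ext)).

(** A vertex is labelled by its coarse part and, if its fine part is picked, by that part, otherwise
    by 0. Each coarse part meets a marked fine part, which is never picked, so all [p1 + 1] labels
    with second entry 0 occur. Each picked part adds a further label; it may be split among coarse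
    parts, which only helps. *)
Lemma cut_kcut (C : {set 'I_m}) : (kc <= p1.+1 + size ext)%N ->
  (forall e : 'I_m, (e \in C) = cut_edge (ends G e).1 (ends G e).2) -> is_kcut G kc C.
Proof.
move=> kle HC.
pose f (u : 'I_n) : 'I_p1.+1 * 'I_p2.+2 :=
  (inord (f1 u), if f2 u \in ext then inord (f2 u).+1 else ord0).
apply: (kcut_labels (f := f)).
  move=> e; rewrite HC /cut_edge negb_or negbK => /andP[/eqP E1]; rewrite /f E1.
  rewrite negb_and negbK negb_or => /orP[/eqP ->//|/andP[/negbTE -> /negbTE ->]] //.
apply: leq_trans kle _.
set Im := [set f u | u : 'I_n].
pose A := [set (i, ord0 : 'I_p2.+2) | i : 'I_p1.+1].
have cA : #|A| = p1.+1 by rewrite card_imset ?card_ord // => i j [].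
have AIm : A \subset Im.
  apply/fintype.subsetP => x /imsetP[i _ ->].
  have [u un Eu] := f1onto (i := i) (ltn_ord i).
  have [u' [u'n E' mu']] := rep un.
  apply/imsetP; exists (Ordinal u'n) => //; rewrite /f /= E' Eu inord_val.
  by case: ifP => // /extD /andP[_]; rewrite mu'.
pose B := Im :\: A.
have cB : (size ext <= #|B|)%N.
  apply: (@leq_trans #|snd @: B|); last exact: leq_imset_card.
  have u2 : uniq [seq inord y.+1 : 'I_p2.+2 | y <- ext].
    rewrite map_inj_in_uniq // => x y /extD/andP[xp _] /extD/andP[yp _] /(congr1 val).
    by rewrite /= !inordK // => -[].
  rewrite -(size_map (fun y => inord y.+1 : 'I_p2.+2)) -(card_uniqP u2).
  apply/subset_leq_card/fintype.subsetP => z /mapP[y ye ->].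
  have yp : (y <= p2)%N by have /andP[] := extD ye.
  have [u un Eu] := f2onto yp.
  apply/imsetP; exists (f (Ordinal un)); last by rewrite /f /= Eu ye.
  suff : f (Ordinal un) \in B by [].
  apply/finset.setDP; split; first by apply/imsetP; exists (Ordinal un).
  apply/negP => /imsetP[i _ /(congr1 snd)]; rewrite /f /= Eu ye => /(congr1 val).
  by rewrite /= inordK.
have H : (p1.+1 + size ext <= #|A| + #|B|)%N by rewrite cA leq_add2l.
by apply: leq_trans H _; rewrite /B finset.cardsD (finset.setIidPr AIm) subnKC // subset_leq_card.
Qed.

Variable src : nat -> nat.
Hypothesis srcn : forall i, (i < m * 2)%N -> (src i < n)%N.
Notation deg := (degree m src c f2).

Lemma cut_weight : \sum_(0 <= e < m | cut_edge (src (e * 2)%N) (src (e * 2 + 1)%N)) c e <=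
  \sum_(0 <= e < m | f1 (src (e * 2)%N) != f1 (src (e * 2 + 1)%N)) c e + \sum_(y <- ext) deg y.
Proof.
have -> : \sum_(y <- ext) deg y = \sum_(0 <= e < m | f2 (src (e * 2)%N) != f2 (src (e * 2 + 1)%N))
   ((f2 (src (e * 2)%N) \in ext)%:R + (f2 (src (e * 2 + 1)%N) \in ext)%:R) * c e.
  rewrite /degree exchange_big /=; apply: eq_bigr => e _; rewrite -mulr_suml big_split /=.
  have E a : \sum_(y <- ext) (a == y)%:R = (a \in ext)%:R :> R.
    have -> : \sum_(y <- ext) (a == y)%:R = \sum_(y <- ext | y == a) 1 :> R.
      by rewrite [RHS]big_mkcond; apply: eq_bigr => y _; rewrite eq_sym; case: eqP.
    rewrite big_const_seq iter_addr addr0 -(count_uniq_mem a ext_uniq).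
    by congr (_%:R); apply: eq_count => y; rewrite /= eq_sym.
  by rewrite !E.
rewrite [X in X <= _]big_mkcond [X in _ <= X + _]big_mkcond [X in _ <= _ + X]big_mkcond -big_split /=.
apply: ler_sum_nat => e /andP[_ em]; have ce := c_gt0 em; rewrite /cut_edge.
move: (f1 _ != _) (f2 _ != f2 _) (f2 (src (e * 2)%N) \in ext) (f2 (src (e * 2 + 1)%N) \in ext).
by move=> b1 b2 b3 b4; exact: weight_bound.
Qed.

Lemma degree_total : \sum_(0 <= y < p2.+1) deg y =
  2 * \sum_(0 <= e < m | f2 (src (e * 2)%N) != f2 (src (e * 2 + 1)%N)) c e.
Proof.
rewrite /degree exchange_big /= mulr_sumr [LHS]big_nat_cond [RHS]big_nat_cond.
apply: eq_bigr => e /andP[/andP[_ em] _].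
rewrite -mulr_suml big_split /=.
have E a : (a <= p2)%N -> \sum_(0 <= y < p2.+1) (a == y)%:R = 1 :> R.
  move=> ap; rewrite (bigD1_seq a) ?iota_uniq ?mem_index_iota //= eqxx big1 ?addr0 // => y ya.
  by rewrite eq_sym (negbTE ya).
by rewrite !E ?f2le //; apply: srcn; lia.
Qed.

End Cut.

Section Value.
Variables (R : realType) (n m : nat) (src : nat -> nat) (c : nat -> R) (h : hst R) (L : nat) (sn : nat -> nat -> R).
Hypotheses (n0 : (0 < n)%N) (L0 : (0 < L)%N) (c_gt0 : forall e, (e < m)%N -> 0 < c e).
Hypothesis ls : levels n m src c h L sn.
Notation bc := (ra h aBC).
Variables (N r k : nat) (g : R).
Hypotheses (N6 : (6 <= N)%N) (r0 : (0 < r)%N) (nr : (n <= 2 ^ r)%N) (LE : L = (N.+1 * (8 * N * r))%N).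
Hypotheses (kn : (1 < k <= n)%N) (gE : L%:R * g = \sum_(1 <= i < k) sn L i).

Lemma scaled_pos : 0 < g.
Proof.
have := levels_pos n0 L0 ls kn; rewrite -gE pmulr_rgt0 //.
by rewrite ltr0n.
Qed.

Lemma best_value lam p : 0 <= lam -> best n bc lam p ->
  lam * (k%:R - 1) - (lam * p%:R - bc p) <= (1 + N%:R^-1) * g + lam / (4 * N%:R).
Proof.
move=> lam0 [pn Hp].
have a0 : 0 <= lam * p%:R - bc p.
  by have := Hp 0%N n0; rewrite (ls_0 ls).1 mulr0 subr0.
have N0 : (0 < N)%N by apply: leq_trans N6.
apply: (chain_value (ls_d0 ls) (fun l lL => ls_level ls lL) (ls_ord ls) lam0 a0 N0 r0 nr LE).
- move=> l T lL T0; exact: (levels_conj n0 L0 c_gt0 ls Hp lL T0).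
- by move=> T T0; rewrite gE; apply: (levels_lower n0 L0 ls _ T0); case/andP: kn => /ltnW -> ->.
Qed.

Let NR6 : 6 <= N%:R :> R. Proof. by rewrite ler_nat. Qed.
Let NV : N%:R^-1 <= 6^-1 :> R.
Proof. by rewrite lef_pV2 ?posrE ?NR6 // ltr0n (leq_trans _ N6). Qed.
Let NV0 : 0 < N%:R^-1 :> R. Proof. by rewrite invr_gt0 ltr0n (leq_trans _ N6). Qed.
Let N4 lam : lam / (4 * N%:R) = lam * N%:R^-1 / 4 :> R.
Proof. by rewrite invfM mulrA mulrAC. Qed.

(** If [p < k - 1], the left side of [best_value] at [lam = 3 * g] is at least [3 * g], whereas the
    right side is at most [(1 + 1/6 + 1/8) * g] for [N >= 6]. *)
Lemma best_high p : best n bc (3 * g) p -> (k.-1 <= p)%N.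
Proof.
move=> bp; rewrite leqNgt; apply/negP => lt; have gg := scaled_pos.
have := @best_value (3 * g) p; rewrite N4 => /(_ _ bp) H.
have b0 := bc_ge0 n0 L0 c_gt0 ls bp.1.
have : p%:R + 1 <= k%:R - 1 :> R.
  have kE : k%:R = k.-1%:R + 1 :> R by rewrite natr1 prednK //; lia.
  have : p.+1%:R <= k.-1%:R :> R by rewrite ler_nat.
  by rewrite -natr1 kE; lra.
have g3 : 0 <= 3 * g by rewrite mulr_ge0 // ltW.
have {}H := H g3.
have gN : g * N%:R^-1 <= g * 6^-1 by rewrite ler_wpM2l // ltW.
move=> pk; have : 3 * g * (p%:R + 1) <= 3 * g * (k%:R - 1) by rewrite ler_wpM2l.
by move: H b0 gN gg; lra.
Qed.

(** The three losses are [g / N] from [best_value], at most [3 * g / (4 * N)] from its term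
    [lo / (4 * N)], and [g / N] from the gap of the bisection; together less than [3 * g / N]. *)
Lemma interp_value lo hi p : 0 <= lo -> lo <= hi -> hi <= 3 * g -> hi - lo <= g / (N * n)%:R ->
  best n bc lo p -> (p <= k.-1)%N ->
  lo * (k.-1)%:R - (lo * p%:R - bc p) + (hi - lo) * (k.-1 - p)%:R <= (1 + 3 / N%:R) * g.
Proof.
move=> lo0 lohi hi3 gap bp pk; have gg := scaled_pos; have := best_value lo0 bp; rewrite N4.
have kE : k%:R = k.-1%:R + 1 :> R by rewrite natr1 prednK //; lia.
rewrite [in X in X -> _]kE addrK.
have n0' : 0 < n%:R :> R by rewrite ltr0n.
have H2 : (hi - lo) * (k.-1 - p)%:R <= g * N%:R^-1.
  apply: (@le_trans _ _ ((g / (N * n)%:R) * n%:R)).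
    apply: ler_pM => //; first by lra.
    by rewrite ler_nat; lia.
  by rewrite natrM invfM mulrA mulfVK ?gt_eqF.
have H3 : lo * N%:R^-1 <= 3 * g * N%:R^-1 by apply: ler_wpM2r; [exact: ltW|exact: le_trans hi3].
have gN0 : 0 < g * N%:R^-1 by rewrite mulr_gt0.
by move=> H1; move: H1 H2 H3 gN0; lra.
Qed.

(** The integrated packing bound is used at the time [T] where boundary [k - 1] of the last level
    opens. *)
Lemma lower_lp (G : ugraph n m) (c' : 'I_m -> R) : connected_graph G -> (forall e, 0 < c' e) ->
  (fun e => src (e * 2)%N) = end1 G -> (fun e => src (e * 2 + 1)%N) = end2 G -> c = ext 0 c' ->
  g <= lp_optimum G c' k.
Proof.
move=> cG c0 E1 E2 E3; have LR : 0 < L%:R :> R by rewrite ltr0n.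
rewrite -(ler_pM2l LR) gE (levels_tight n0 L0 ls kn).
have kn' : (k <= n)%N by case/andP: kn.
apply: (chain_lp_optimum cG kn' c0 n0 L0 (ls_d0 ls) (ls_ord ls)).
  by move=> l lL; have := ls_level ls lL; rewrite E1 E2 E3.
by apply: (sn_ge0 n0 L0 ls); lia.
Qed.

Lemma label_facts p : (p < n)%N -> let l := ia h iBL p in
  [/\ (l <= L)%N, forall j, (j < n)%N -> (label (rkl n h l) p j <= p)%N &
   forall v, (v <= p)%N -> exists2 j, (j < n)%N & label (rkl n h l) p j = v].
Proof.
move=> pn l; case: (posnP p) => [p0|p0].
  have E j : label (rkl n h l) p j = 0%N by rewrite p0 /label big1.
  have l0 : l = 0%N by rewrite /l p0 (ls_0 ls).2.
  split; [by rewrite l0|by move=> j _; rewrite E|move=> v vp].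
  by exists 0%N => //; rewrite E; move: vp; rewrite p0 leqn0 => /eqP.
have [|lL _] := ls_bl ls L0 (i := p); first by rewrite p0.
have rk := ls_rank ls lL.
split; first by case/andP: lL.
  by move=> j jn; apply: (label_le rk).
by move=> v vp; apply: (label_onto rk).
Qed.

End Value.

Lemma ordering_onto (R : realType) n vt (d : nat -> R) v : ordering n vt d -> (v < n)%N ->
  exists2 j, (j < n)%N & vt j = v.
Proof.
case=> or1 or2 _ _ vn; pose F (i : 'I_n) : 'I_n := Ordinal (or1 i (ltn_ord i)).
have fi : injective F by move=> i j /(congr1 val) /= /or2 E; apply/val_inj/E.
have [f' _ f'K] := injF_bij fi.
by exists (f' (Ordinal vn)); rewrite ?ltn_ord //; have /(congr1 val) := f'K (Ordinal vn).
Qed.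

Section Cost.
Variables (R : realType) (n m : nat) (src : nat -> nat) (c : nat -> R) (bc : nat -> R) (f1 f2 : nat -> nat).
Variables (q P1 P2 p1 : nat) (lo hi V : R) (mk : pred nat) (s ext : seq nat).
Hypothesis c_gt0 : forall e, (e < m)%N -> 0 < c e.
Hypothesis srcn : forall i, (i < m * 2)%N -> (src i < n)%N.
Hypothesis bc0 : forall p, (p < n)%N -> 0 <= bc p.
Hypotheses (lo0 : 0 <= lo) (lohi : lo <= hi) (b1 : best n bc lo P1) (b2 : best n bc hi P2) (Pq : (P1 <= q <= P2)%N).
Hypothesis HV : lo * q%:R - (lo * P1%:R - bc P1) + (hi - lo) * (q - P1)%:R <= V.
Hypothesis choice : if (P1 < q)%N && (P2 - P1 <= 2 * (q - P1))%N then p1 = P2 else p1 = P1.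
Hypothesis cut1 : \sum_(0 <= e < m | f1 (src (e * 2)%N) != f1 (src (e * 2 + 1)%N)) c e <= bc p1.
Hypothesis cut2 : \sum_(0 <= e < m | f2 (src (e * 2)%N) != f2 (src (e * 2 + 1)%N)) c e <= bc P2.
Hypothesis f2le : forall u, (u < n)%N -> (f2 u <= P2)%N.
Notation deg := (degree m src c f2).
Let D y := (y <= P2)%N && ~~ mk y.
Hypotheses (sel : selected D deg ext) (sz : size ext = (q - p1)%N).
Hypotheses (ss : size s = p1.+1) (smk : forall y, mk y -> y \in s).

Lemma deg_ge0 y : 0 <= deg y.
Proof.
rewrite /degree big_nat_cond; apply: sumr_ge0 => e /andP[/andP[_ em] _].
by apply: mulr_ge0; [rewrite addr_ge0|exact: ltW (c_gt0 em)].
Qed.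

(** At most [p1 + 1] of the [P2 + 1] fine parts are marked. Sparing one per coarse part thus still
    leaves the denominator [P2 - p1] of the averaging. *)
Lemma count_unmarked b : (P2.+1 <= b)%N -> (P2 - p1 <= count D (iota 0 b))%N.
Proof.
move=> Pb; have -> : iota 0 b = iota 0 P2.+1 ++ iota P2.+1 (b - P2.+1) by rewrite -iotaD subnKC.
rewrite count_cat; apply: leq_trans (leq_addr _ _).
have : (size (iota 0 P2.+1) <= size (seq.filter D (iota 0 P2.+1) ++ s))%N.
  apply: uniq_leq_size (iota_uniq _ _) _ => y yi; rewrite mem_cat mem_filter yi andbT.
  move: yi; rewrite mem_iota /D => /andP[_ yP]; rewrite (_ : (y <= P2)%N) //=.
  by case: (boolP (mk y)) => //= /smk.
by rewrite size_iota size_cat size_filter ss; clear; lia.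
Qed.

Lemma rounded_cost :
  \sum_(0 <= e < m | cut_edge f1 f2 ext (src (e * 2)%N) (src (e * 2 + 1)%N)) c e <= 2 * V.
Proof.
have [ue _ _] := sel.
have [r1 r2 r3] := round_value lo0 lohi b1 b2 Pq bc0 HV.
have p1n := bc0 b1.1.
apply: (le_trans (cut_weight f1 f2 c_gt0 ue src)).
(* A cut that has enough parts by itself gets no supplement. *)
have S0 : (q <= p1)%N -> \sum_(y <- ext) deg y = 0.
  by rewrite -subn_eq0 -sz => /nilP ->; rewrite big_nil.
move: cut1 S0; case: ifP choice => [/andP[lt le] pE|no pE] c1 S0.
  by rewrite S0 ?addr0; [apply: le_trans c1 _; rewrite pE; apply: r2|rewrite pE; lia].
have [E|ne] := eqVneq P1 q.
  rewrite S0 ?addr0; last by rewrite pE E.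
  apply: le_trans c1 _; rewrite pE; apply: (le_trans (r1 E)).
  by have := r1 E; move: p1n; lra.
have lt : (P1 < q)%N by move: Pq ne; clear; lia.
have gt : (2 * (q - P1) < P2 - P1)%N by move: no; rewrite lt /= => /negbT; rewrite -ltnNge.
apply: (@le_trans _ _ (bc P1 + \sum_(y <- ext) deg y)); first by rewrite lerD2r -pE.
apply: r3 => //; set S := \sum_(y <- ext) _.
have SS0 : 0 <= S by apply: sumr_ge0 => y _; apply: deg_ge0.
have DP p : D p -> (p < P2.+1)%N by case/andP.
have := selected_average DP sel; rewrite -/S sz pE => avg.
apply: (@le_trans _ _ (S * (count D (iota 0 P2.+1))%:R)).
  by rewrite ler_wpM2l // ler_nat; have := count_unmarked (leqnn P2.+1); rewrite pE.
apply: (le_trans avg); rewrite ler_wpM2l //.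
apply: (@le_trans _ _ (\sum_(0 <= y < P2.+1) deg y)).
  rewrite big_mkcond; apply: ler_sum => y _; case: ifP => // _; exact: deg_ge0.
by rewrite (degree_total c f2le ue srcn) ler_wpM2l.
Qed.

End Cost.

(** * The assembled program, its time and the final constants *)

Definition BODY :=
  SIZES ;; ADJ ;; INIT ;; LEVELS ;; LOWER ;; BISECT ;; CHOOSE ;;
  LABELS iF1 vp1 vl1 ;; LABELS iF2 vp2 vl2 ;; REP ;; DEG ;; PICK.

(** For [k <= 1] all labels are still 0, and the output is the empty cut. *)
Definition MAIN := Cond (CI #1 $vk) BODY Skip ;; OUT.

Definition source n m (G : ugraph n m) i := if odd i then end2 G i./2 else end1 G i./2.

Lemma source1 n m (G : ugraph n m) e : source G (e * 2)%N = end1 G e.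
Proof. by rewrite /source muln2 odd_double doubleK. Qed.

Lemma source2 n m (G : ugraph n m) e : source G (e * 2 + 1)%N = end2 G e.
Proof. by rewrite /source muln2 addn1 /= odd_double /= uphalf_double. Qed.

Lemma source_lt n m (G : ugraph n m) i : (i < m * 2)%N -> (source G i < n)%N.
Proof.
move=> im; have e_m : (i./2 < m)%N by lia.
rewrite /source -[i./2]/(val (Ordinal e_m)) end1_ord end2_ord.
by case: odd; apply: ltn_ord.
Qed.

Lemma source_loopless n m (G : ugraph n m) e : (e < m)%N -> source G (e * 2)%N <> source G (e * 2 + 1)%N.
Proof.
move=> em; rewrite source1 source2 -[e]/(val (Ordinal em)) end1_ord end2_ord => /val_inj E.
by have := ends_loopless G (Ordinal em); rewrite E eqxx.
Qed.

Lemma source_cut n m (G : ugraph n m) (P : pred nat) x y : connected_graph G ->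
  (x < n)%N -> (y < n)%N -> P x -> ~~ P y ->
  exists2 e, (e < m)%N & P (source G (e * 2)%N) != P (source G (e * 2 + 1)%N).
Proof.
move=> cG xn yn Px Py.
case: (pselect (exists2 e, (e < m)%N & P (source G (e * 2)%N) != P (source G (e * 2 + 1)%N))) => // nex.
have same (e : 'I_m) : P (ends G e).1 = P (ends G e).2.
  apply/eqP; apply: contra_notT nex => ne; exists e => //.
  by rewrite source1 source2 end1_ord end2_ord.
have cl : fingraph.closed (adj G [set: 'I_m]%SET) [pred u : 'I_n | P u].
  move=> u v; rewrite !inE => /existsP[e /andP[_ /orP[/eqP E|/eqP E]]]; have := same e; rewrite E //.
have := closed_connect cl (cG (Ordinal xn) (Ordinal yn)).
by rewrite !inE /= Px (negbTE Py).
Qed.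

Section Body.
Variables (R : realType) (n m : nat) (G : ugraph n m) (c' : 'I_m -> R) (k : nat) (eps : R) (Nm r X : nat).
Notation src := (source G).
Notation c := (ext 0 c').
Notation M := (2 ^ r)%N.
Hypotheses (cG : connected_graph G) (c'0 : forall e, 0 < c' e).
Hypotheses (kn : (1 < k <= n)%N) (eps0 : 0 < eps) (eps1 : eps < 1).
Hypotheses (Nm0 : (0 < Nm)%N) (Nme : 6 <= Nm%:R * eps) (r0 : (0 < r)%N) (nr : (2 ^ r.-1 < n <= 2 ^ r)%N).
Hypotheses (MX : (M * 2 <= X)%N) (mX : (m * 2 <= X)%N) (nX : (n + 2 <= X)%N).
Hypothesis LX : ((Nm.+1 * (8 * Nm * n)).+2 * n <= X)%N.
Implicit Types h : hst R.
Notation run := (run X (m * 2)).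
Notation env := (env n m M src c).

Definition body_time := (Nm + n + m * 2 + n + Nm.+1 * (8 * Nm * r) * (level_time n m M r).+1 + k +
  (Nm + r + 3) * n.+1 + n + n + (n + n) + m + (2 * M + n * (2 * r).+1))%N.

Lemma r_le : (r <= n)%N.
Proof. by have := ltn_expl r.-1 (erefl (1 < 2)%N); lia. Qed.

(** Identifies the exponent found by the program with the one fixed beforehand for the time and word
    bounds. *)
Lemma log_unique r' : (0 < r')%N -> (2 ^ r'.-1 < n <= 2 ^ r')%N -> r' = r.
Proof.
move=> r'0 /andP[a b]; have /andP[d e] := nr.
have : (2 ^ r'.-1 < 2 ^ r)%N by lia.
have : (2 ^ r.-1 < 2 ^ r')%N by lia.
by rewrite !ltn_exp2l //; lia.
Qed.

Lemma run_BODY Q h t : iv h vn = n -> iv h vm = m -> iv h vk = k -> rv h xeps = eps ->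
  (forall a i, ia h a i = 0%N) -> (forall a i, ra h a i = 0) ->
  (forall i, (i < m * 2)%N -> iw h i = src i) -> (forall e, (e < m)%N -> rw h e = c e) ->
  (body_time <= t)%N ->
  (forall h' t' f1 f2 ext, agree BODY h h' ->
    (forall u, (u < n)%N -> [/\ ia h' iF1 u = f1 u, ia h' iF2 u = f2 u, (f1 u <= X)%N & (f2 u <= X)%N]) ->
    (forall y, (ia h' iCH y != 0%N) = (y \in ext)) ->
    (forall C : {set 'I_m}, (forall e : 'I_m, (e \in C) = cut_edge f1 f2 ext (ends G e).1 (ends G e).2) -> is_kcut G k C) ->
    \sum_(0 <= e < m | cut_edge f1 f2 ext (src (e * 2)%N) (src (e * 2 + 1)%N)) c e <= (2 + eps) * lp_optimum G c' k ->
    (t <= t' + body_time)%N -> Q h' t') ->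
  run BODY Q h t.
Proof.
move=> hn hm hk he z zr hw hc ht HQ.
pose P h' t' := exists f1 f2 ext, [/\ (forall u, (u < n)%N -> [/\ ia h' iF1 u = f1 u, ia h' iF2 u = f2 u, (f1 u <= X)%N & (f2 u <= X)%N]),
    (forall y, (ia h' iCH y != 0%N) = (y \in ext)),
    (forall C : {set 'I_m}, (forall e : 'I_m, (e \in C) = cut_edge f1 f2 ext (ends G e).1 (ends G e).2) -> is_kcut G k C),
    \sum_(0 <= e < m | cut_edge f1 f2 ext (src (e * 2)%N) (src (e * 2 + 1)%N)) c e <= (2 + eps) * lp_optimum G c' k &
    (t <= t' + body_time)%N].
suff : run BODY P h t.
  by move/run_mono; apply=> h' t' a _ [f1 [f2 [ext [a1 a2 a3 a4 a5]]]]; apply: HQ a a1 a2 a3 a4 a5.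
have [k1 kn'] : (1 < k)%N /\ (k <= n)%N by apply/andP.
have n1 : (1 < n)%N by apply: leq_trans kn'.
have n0 : (0 < n)%N by apply: ltnW.
have nM : (n <= M)%N by case/andP: nr.
have srcn := @source_lt n m G.
have c_gt0 e : (e < m)%N -> 0 < c e by move=> em; rewrite -[e]/(val (Ordinal em)) ext_ord.
have loopless := @source_loopless n m G.
have cut (p : pred nat) x y := @source_cut n m G p x y cG.
have Mr : M = (2 ^ r)%N by [].
have kX : (k + 1 <= X)%N by clear -kn' nX; lia.
have nX2 : (2 * n <= X)%N by clear -nM MX; lia.
have LmX : (Nm.+1 * (8 * Nm * n) <= X)%N by move: LX n0; clear; nia.
set tL := (Nm.+1 * (8 * Nm * r) * (level_time n m M r).+1)%N.
set tB := ((Nm + r + 3) * n.+1)%N.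
set tP := (2 * M + n * (2 * r).+1)%N.
have btE : body_time = (Nm + n + m * 2 + n + tL + k + tB + n + n + (n + n) + m + tP)%N by [].
rewrite btE in ht.
rewrite /BODY; hstep; apply: (run_SIZES (n := n) m (eps := eps) (Nm := Nm)) => //; first by clear -ht; lia.
move=> h1 t1 N r1 A1 N1 M1 L1 NNm Neps r1n r1b tt1.
have r1E : r1 = r by apply: log_unique => //; case/andP: r1n.
rewrite r1E in M1 L1; set L := (N.+1 * (8 * N * r))%N in L1.
have N0 : (0 < N)%N by case/andP: NNm.
have LLm : (L <= Nm.+1 * (8 * Nm * r))%N.
  have NN : (N <= Nm)%N by case/andP: NNm.
  by rewrite /L; apply: leq_mul => //; rewrite leq_mul2r leq_mul2l NN !orbT.
have L0 : (0 < L)%N by rewrite /L !muln_gt0 N0 r0.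
have LtL : (L * (level_time n m M r).+1 <= tL)%N by rewrite leq_mul2r LLm orbT.
have LX2 : (L.+2 * n <= X)%N.
  apply: leq_trans LX; rewrite leq_mul2r; apply/orP; right; rewrite !ltnS.
  by apply: (leq_trans LLm); rewrite leq_mul2l leq_mul2l r_le !orbT.
have N6 : (6 <= N)%N.
  rewrite -(ler_nat R); apply: le_trans Neps _; rewrite ler_piMr //; exact: ltW.
have ia1 : ia h1 = ia h by apply/funext => a; rewrite (agree_ia A1).
have ra1 : ra h1 = ra h by apply/funext => a; rewrite (agree_ra A1).
have ev1 : env h1.
  by split=> //; rewrite ?(agree_iv A1) // ?(agree_iw A1) // ?(agree_rw A1).
hstep; apply: (run_ADJ Mr nM MX mX nX ev1); [by move=> v; rewrite ia1 z|by clear -ht tt1; lia|].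
move=> h2 t2 A2 ad2 tt2.
have ev2 : env h2 by apply: (env_agree A2 isT).
hstep; apply: (run_INIT (n := n) m); [exact: env_n ev2|by clear -nX; lia|by clear -ht tt1 tt2; lia|].
move=> h3 t3 A3 vt3 tt3.
have ev3 : env h3 by apply: (env_agree A3 isT).
have ad3 : adjl m src h3 by apply: (adj_agree A3 isT).
have zi3 a i : a \notin [:: iHD; iNX; iVT] -> ia h3 a i = 0%N.
  rewrite !inE !negb_or => /and3P[q1 q2 q3]; rewrite (agree_ia A3) ?inE // (agree_ia A2) ?inE ?negb_or ?q1 ?q2 //.
  by rewrite ia1 z.
have zr3 a i : ra h3 a i = 0 by rewrite (agree_ra A3) // (agree_ra A2) // ra1 zr.
have lev3 : levels n m src c h3 0 (fun _ _ => 0).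
  have dz j : dll n h3 0 j = 0 by rewrite /dll; case: ifP => // _; rewrite zr3.
  split=> //.
  - split=> [j jn|i j i_n jn||j jn]; rewrite ?dz //; rewrite /vtl mul0n ?add0n ?vt3 //.
  - by move=> l i; lia.
  - by move=> l i; lia.
  - by rewrite zr3 zi3.
hstep; apply: (run_LEVELS Mr nM MX mX nX n0 srcn c_gt0 loopless cut LX2 ev3 ad3) => //.
- by rewrite (agree_iv A3) // (agree_iv A2).
- by clear -ht tt1 tt2 tt3 LtL; lia.
move=> h4 t4 sn A4 ls tt4.
have ev4 : env h4 by apply: (env_agree A4 isT).
have iv4 x : x \in [:: vk; vN; vL] -> iv h4 x = iv h1 x.
  by rewrite !inE => /or3P[]/eqP ->; rewrite (agree_iv A4) // (agree_iv A3) // (agree_iv A2).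
have k4 : iv h4 vk = k by rewrite iv4 // (agree_iv A1).
have N4 : iv h4 vN = N by rewrite iv4.
have L4 : iv h4 vL = L by rewrite iv4.
have zi4 a i : a \in [:: iM2; iCH] -> ia h4 a i = 0%N.
  by rewrite !inE => /orP[]/eqP ->; rewrite (agree_ia A4) // zi3.
have zr4 i : ra h4 aDG i = 0 by rewrite (agree_ra A4) // zr3.
set bc := ra h4 aBC.
have bc0 : bc 0%N = 0 by case: (ls_0 ls).
have bcge p : (p < n)%N -> 0 <= bc p by move=> pn; apply: (bc_ge0 n0 L0 c_gt0 ls).
hstep; apply: (run_LOWER m (kc := k)) => //; [by clear -ht tt1 tt2 tt3 tt4 LtL; lia|by apply: ltnW|].
move=> h5 t5 A5 g5 tt5; set g := rv h5 xg in g5.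
have gE : L%:R * g = \sum_(1 <= i < k) sn L i.
  rewrite g5 L4 mulrC mulfVK; last by rewrite pnatr_eq0 -lt0n.
  rewrite big_nat [RHS]big_nat; apply: eq_bigr => i /andP[i0 ik].
  by rewrite (ls_so ls) // i0 (leq_trans ik).
have nr' : (n <= 2 ^ r)%N by [].
have LE : L = (N.+1 * (8 * N * r))%N by [].
have g_gt0 : 0 < g := scaled_pos n0 L0 ls kn gE.
have ia5 : ia h5 = ia h4 by apply/funext => a; rewrite (agree_ia A5).
have ra5 : ra h5 = ra h4 by apply/funext => a; rewrite (agree_ra A5).
have [n5 N5 k5] : [/\ iv h5 vn = n, iv h5 vN = N & iv h5 vk = k].
  by split; rewrite (agree_iv A5) // (env_n ev4).
have BB : ((N + r + 3) * n.+1 <= tB)%N.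
  by rewrite leq_mul2r; apply/orP; right; case/andP: NNm => _; clear; lia.
have nX1 : (n + 1 <= X)%N by clear -nX; lia.
hstep; apply: (run_BISECT m (bc := bc) n0 nX1 bc0 (g := g) (N := N) (r := r) (kc := k)) => //.
- by rewrite ra5.
- by apply: ltnW.
- by move=> p; apply: (best_high n0 L0 c_gt0 ls N6 r0 nr' LE kn gE).
- by clear -ht tt1 tt2 tt3 tt4 tt5 LtL BB; lia.
move=> h6 t6 lo hi A6 lo0 lohi hi3 gap b1 b2 Pq tt6.
have ia6 : ia h6 = ia h4 by apply/funext => a; rewrite (agree_ia A6) // ia5.
have ra6 : ra h6 = ra h4 by apply/funext => a; rewrite (agree_ra A6) // ra5.
have k6 : iv h6 vk = k by rewrite (agree_iv A6).
set P1 := iv h6 vp1 in b1 Pq; set P2 := iv h6 vp2 in b2 Pq.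
have BLX p : (p < n)%N -> (ia h4 iBL p <= X)%N.
  move=> pn; have [lL _ _] := label_facts n0 L0 ls pn; apply: (leq_trans lL).
  by move: LX2 n0; clear; nia.
have P1n : (P1 < n)%N by case: b1.
have P2n : (P2 < n)%N by case: b2.
hstep; apply: (run_CHOOSE m (kc := k)) => //; rewrite -?/P1 -?/P2 ?ia6 ?BLX //; [by clear -P1n nX; lia|by clear -P2n nX; lia|].
move=> h7 A7 l17 l27 p27 ch7; set p1 := iv h7 vp1 in l17 ch7.
have ia7 : ia h7 = ia h4 by apply/funext => a; rewrite (agree_ia A7) // ia6.
have ra7 : ra h7 = ra h4 by apply/funext => a; rewrite (agree_ra A7) // ra6.
have ev7 : env h7.
  apply: (env_agree A7 isT); apply: (env_agree A6 isT); apply: (env_agree A5 isT); exact: ev4.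
have k7 : iv h7 vk = k by rewrite (agree_iv A7).
have p1n : (p1 < n)%N by move: ch7; case: ifP => _ ->.
rewrite p27 in l27.
have [l1L lab1 onto1] := label_facts n0 L0 ls p1n.
have [l2L lab2 onto2] := label_facts n0 L0 ls P2n.
set l1 := ia h4 iBL p1 in l17 l1L lab1 onto1; set l2 := ia h4 iBL P2 in l27 l2L lab2 onto2.
have or1 := ls_ordering ls l1L; have or2 := ls_ordering ls l2L.
have vt7 l : vtl n h7 l = vtl n h4 l by rewrite /vtl ia7.
have rk7 l : rkl n h7 l = rkl n h4 l by rewrite /rkl ia7.
hstep; apply: (run_LABELS Mr nM MX mX nX n0 (p := p1) (l := l1) (env_n ev7)) => //.
- by rewrite vt7; exact: or_inj or1.
- by clear -ht tt1 tt2 tt3 tt4 tt5 tt6 LtL BB; lia.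
move=> h8 t8 A8 lab8 tt8.
have ev8 : env h8 by apply: (env_agree A8 isT).
have vt8 l : vtl n h8 l = vtl n h4 l by rewrite /vtl (agree_ia A8) // ia7.
have rk8 l : rkl n h8 l = rkl n h4 l by rewrite /rkl (agree_ia A8) // ia7.
hstep; apply: (run_LABELS Mr nM MX mX nX n0 (p := P2) (l := l2) (env_n ev8)) => //.
- by rewrite (agree_iv A8).
- by rewrite (agree_iv A8) // l27.
- by rewrite vt8; exact: or_inj or2.
- by clear -ht tt1 tt2 tt3 tt4 tt5 tt6 tt8 LtL BB; lia.
move=> h9 t9 A9 lab9 tt9.
have ev9 : env h9 by apply: (env_agree A9 isT).
pose f1 u := ia h8 iF1 u; pose f2 u := ia h9 iF2 u.
rewrite vt7 rk7 in lab8; rewrite vt8 rk8 in lab9.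
have f1E j : (j < n)%N -> f1 (vtl n h4 l1 j) = label (rkl n h4 l1) p1 j by apply: lab8.
have f2E j : (j < n)%N -> f2 (vtl n h4 l2 j) = label (rkl n h4 l2) P2 j by apply: lab9.
have f1le u : (u < n)%N -> (f1 u <= p1)%N.
  by move=> un; have [j jn <-] := ordering_onto or1 un; rewrite f1E //; apply: lab1.
have f2le u : (u < n)%N -> (f2 u <= P2)%N.
  by move=> un; have [j jn <-] := ordering_onto or2 un; rewrite f2E //; apply: lab2.
have f1onto i : (i <= p1)%N -> exists2 u, (u < n)%N & f1 u = i.
  by move=> ip; have [j jn E] := onto1 i ip; exists (vtl n h4 l1 j); rewrite ?f1E //; apply: (or_lt or1).
have f2onto i : (i <= P2)%N -> exists2 u, (u < n)%N & f2 u = i.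
  by move=> ip; have [j jn E] := onto2 i ip; exists (vtl n h4 l2 j); rewrite ?f2E //; apply: (or_lt or2).
have F19 : ia h9 iF1 = ia h8 iF1 by rewrite (agree_ia A9).
have nle u : (u < n)%N -> (u <= X)%N by move=> un; clear -un nX; lia.
have p19 : iv h9 vp1 = p1 by rewrite (agree_iv A9) // (agree_iv A8).
have P29 : iv h9 vp2 = P2 by rewrite (agree_iv A9) // (agree_iv A8).
have z9 y : ia h9 iM2 y = 0%N by rewrite (agree_ia A9) // (agree_ia A8) // ia7 zi4.
hstep; apply: (run_REP Mr nM MX mX nX n0 (f1 := f1) (f2 := f2) (p1 := p1) (env_n ev9)) => //.
- move=> u un; split=> //; [by rewrite F19|exact: f1le|].
  exact: leq_trans (f2le u un) (nle _ P2n).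
- by clear -ht tt1 tt2 tt3 tt4 tt5 tt6 tt8 tt9 LtL BB p1n; lia.
move=> h10 t10 s A10 rep ss smk tt10.
have ev10 : env h10 by apply: (env_agree A10 isT).
have F110 : ia h10 iF1 = ia h8 iF1 by rewrite (agree_ia A10) // F19.
have F210 : ia h10 iF2 = ia h9 iF2 by rewrite (agree_ia A10).
hstep; apply: (run_DEG Mr nM MX mX nX n0 srcn (f := f2) ev10).
- move=> u un; split; [by rewrite F210|exact: leq_trans (f2le u un) (nle _ P2n)].
- by move=> y; rewrite (agree_ra A10) // (agree_ra A9) // (agree_ra A8) // ra7.
- by clear -ht tt1 tt2 tt3 tt4 tt5 tt6 tt8 tt9 tt10 LtL BB p1n; lia.
move=> h11 t11 A11 dg tt11.
have ev11 : env h11 by apply: (env_agree A11 isT).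
have ia11 : ia h11 = ia h10 by apply/funext => a; rewrite (agree_ia A11).
pose mk y := ia h10 iM2 y != 0%N.
have degE : ra h11 aDG = degree m src c f2 by apply/funext => y; rewrite dg.
have iv11 x : x \in [:: vk; vp1; vp2] -> iv h11 x = iv h9 x.
  by rewrite !inE => /or3P[]/eqP ->; rewrite (agree_iv A11) // (agree_iv A10).
pose D y := (y <= P2)%N && ~~ mk y.
have DE : D = (fun y => (y <= P2)%N && (ia h11 iM2 y == 0%N)).
  by apply/funext => y; rewrite /D /mk ia11 negbK.
pose V := (1 + 3 / N%:R) * g.
have HV := interp_value n0 L0 c_gt0 ls N6 r0 nr' LE kn gE lo0 lohi hi3 gap b1 (proj1 (andP Pq)).
have ch : if (P1 < k.-1)%N && (P2 - P1 <= 2 * (k.-1 - P1))%N then p1 = P2 else p1 = P1 := ch7.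
have cnt b : (P2.+1 <= b)%N -> (P2 - p1 <= count D (iota 0 b))%N.
  exact: (count_unmarked ss smk).
have cnt2 : (k.-1 - p1 <= count D (iota 0 M))%N.
  apply: leq_trans (cnt M _); last by clear -P2n nM; lia.
  by case/andP: Pq; clear; lia.
apply: (run_PICK (kc := k) (p1 := p1) (p2 := P2) Mr nM MX mX nX n0 ev11) => //.
- by rewrite iv11 // (agree_iv A9) // (agree_iv A8).
- by rewrite iv11.
- by rewrite iv11.
- by move=> y; rewrite degE; apply: deg_ge0.
- by rewrite -DE.
- by move=> y; rewrite ia11 (agree_ia A10) // (agree_ia A9) // (agree_ia A8) // ia7 zi4.
- by rewrite -/tP; clear -ht tt1 tt2 tt3 tt4 tt5 tt6 tt8 tt9 tt10 tt11 LtL BB p1n; lia.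
move=> h12 t12 ext A12; rewrite -DE degE => sel sz chE tt12.
exists f1, f2, ext; split.
- move=> u un; split.
  + by rewrite (agree_ia A12) // ia11 F110.
  + by rewrite (agree_ia A12) // ia11 F210.
  + exact: leq_trans (f1le u un) (nle _ p1n).
  + exact: leq_trans (f2le u un) (nle _ P2n).
- exact: chE.
- have [ue uD _] := sel; move=> C HC.
  apply: (cut_kcut (mk := mk) f1onto f2onto rep ue uD _ HC).
  by rewrite sz; clear; lia.
- have W := rounded_cost c_gt0 srcn bcge lo0 lohi b1 b2 Pq HV ch
    (cut_labels n0 L0 c_gt0 ls p1n f1E srcn) (cut_labels n0 L0 c_gt0 ls P2n f2E srcn) f2le sel sz ss smk.
  apply: (le_trans W).
  have gLP : g <= lp_optimum G c' k.
    apply: (lower_lp n0 L0 ls N6 r0 nr' LE kn gE cG c'0) => //; apply/funext => e; [exact: source1|exact: source2].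
  have NR : 0 < N%:R :> R by rewrite ltr0n.
  (* The interpolation loss [3 / N] is doubled by the rounding; this is where [6 <= N * eps] is
     spent. *)
  have e6 : 2 * (3 / N%:R) <= eps by rewrite mulrA -natrM ler_pdivrMr // mulrC.
  apply: (@le_trans _ _ ((2 + eps) * g)).
    rewrite mulrA; apply: ler_wpM2r; first exact: ltW.
    by rewrite mulrDr mulr1 lerD2l.
  by apply: ler_wpM2l => //; apply: addr_ge0 => //; apply: ltW.
- rewrite btE; move: tt1 tt2 tt3 tt4 tt5 tt6 tt8 tt9 tt10 tt11 tt12 LtL BB p1n; rewrite -/tP.
  by clear; lia.
Qed.

End Body.

Section MainRun.
Variables (R : realType) (n m : nat) (G : ugraph n m) (c' : 'I_m -> R) (k : nat) (eps : R) (Nm r X : nat).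
Notation src := (source G).
Notation c := (ext 0 c').
Notation M := (2 ^ r)%N.
Hypotheses (cG : connected_graph G) (c'0 : forall e, 0 < c' e).
Hypotheses (kn : (k <= n)%N) (eps0 : 0 < eps) (eps1 : eps < 1).
Hypotheses (Nm0 : (0 < Nm)%N) (Nme : 6 <= Nm%:R * eps) (r0 : (0 < r)%N).
Hypotheses (nM : (n <= M)%N) (nr : (1 < n)%N -> (2 ^ r.-1 < n <= M)%N).
Hypotheses (MX : (M * 2 <= X)%N) (mX : (m * 2 <= X)%N) (nX : (n + 2 <= X)%N).
Hypothesis LX : ((Nm.+1 * (8 * Nm * n)).+2 * n <= X)%N.

Definition main_time := (m + if (1 < k)%N then body_time n m k Nm r else 0)%N.

Lemma run_MAIN (h : hst R) t : iv h vn = n -> iv h vm = m -> iv h vk = k -> rv h xeps = eps ->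
  (forall a i, ia h a i = 0%N) -> (forall a i, ra h a i = 0) ->
  (forall i, (i < m * 2)%N -> iw h i = src i) -> (forall e, (e < m)%N -> rw h e = c e) ->
  (main_time <= t)%N ->
  run X (m * 2) MAIN (fun h' _ => forall C : {set 'I_m}, (forall e : 'I_m, (e \in C) = (iw h' e != 0%N)) ->
    is_kcut G k C /\ capacity c' C <= (2 + eps) * lp_optimum G c' k) h t.
Proof.
move=> hn hm hk he z zr hw hc ht; rewrite /MAIN; hstep.
have lp0 : 0 <= lp_optimum G c' k.
  apply: lp_lower => //; move=> x [_ x01]; apply: sumr_ge0 => e _.
  by apply: mulr_ge0; [exact: ltW|have /andP[] := x01 e].
case: (posnP n) => [n0|n0].
  have m0 : (m = 0)%N.
    case: (posnP m) => // m0; have := ltn_ord (ends G (Ordinal m0)).1.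
    by move=> H; exfalso; move: H; clear -n0; lia.
  have kF : (1 < k)%N = false by clear -kn n0; lia.
  apply: run_Cond => /=; rewrite hk kF // => _; hstep.
  rewrite /OUT; do 2 hstep; first by [].
  apply: (run_Loop (I := fun h' _ => True)) => // [h' k' A _|h' k' A _ _ _ C HC] /=.
    by move=> H; exfalso; move: H; rewrite [iv h' vm](agree_iv A) //= hm m0 ltn0.
  have CE : C = finset.set0.
    by apply/finset.setP => e; exfalso; have := ltn_ord e; clear -m0; lia.
  split; first by rewrite /is_kcut (_ : k = 0%N) //; clear -kn n0; lia.
  by rewrite CE /capacity finset.big_set0 mulr_ge0 ?addr_ge0 ?(ltW eps0).
have Mr : M = (2 ^ r)%N by [].
have srcn := @source_lt n m G.
have out (h1 : hst R) t1 f1 f2 (ext : seq nat) : (forall i, (i < m * 2)%N -> iw h1 i = src i) -> iv h1 vm = m -> (m <= t1)%N ->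
  (forall u, (u < n)%N -> [/\ ia h1 iF1 u = f1 u, ia h1 iF2 u = f2 u, (f1 u <= X)%N & (f2 u <= X)%N]) ->
  (forall y, (ia h1 iCH y != 0%N) = (y \in ext)) ->
  (forall C : {set 'I_m}, (forall e : 'I_m, (e \in C) = cut_edge f1 f2 ext (ends G e).1 (ends G e).2) -> is_kcut G k C) ->
  \sum_(0 <= e < m | cut_edge f1 f2 ext (src (e * 2)%N) (src (e * 2 + 1)%N)) c e <= (2 + eps) * lp_optimum G c' k ->
  run X (m * 2) OUT (fun h' _ => forall C : {set 'I_m}, (forall e : 'I_m, (e \in C) = (iw h' e != 0%N)) ->
    is_kcut G k C /\ capacity c' C <= (2 + eps) * lp_optimum G c' k) h1 t1.
  move=> w1 m1 mt hf hch hcut hcost.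
  apply: (run_OUT Mr nM MX mX nX n0 srcn w1 m1 hf mt) => h2 t2 A2 out2 _ C HC.
  have HC' (e : 'I_m) : (e \in C) = cut_edge f1 f2 ext (src (e * 2)%N) (src (e * 2 + 1)%N).
    by rewrite HC (out2 e (ltn_ord e)) /cut_edge !hch.
  split.
    by apply: hcut => e; rewrite HC' source1 source2 end1_ord end2_ord.
  apply: le_trans hcost; rewrite big_mkord /capacity.
  by rewrite le_eqVlt; apply/orP; left; apply/eqP; apply: eq_big => [e|e _]; rewrite ?HC' ?ext_ord.
apply: run_Cond => /=; rewrite hk => k1.
  have kn2 : (1 < k <= n)%N by rewrite k1.
  have n1 : (1 < n)%N by apply: leq_trans kn.
  rewrite /main_time k1 in ht.
  apply: (run_BODY cG c'0 kn2 eps0 eps1 Nm0 Nme r0 (nr n1) MX mX nX LX hn hm hk he z zr hw hc).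
    by apply: leq_trans ht; apply: leq_addl.
  move=> h1 t1 f1 f2 ext A1 hf hch hcut hcost tt.
  have ev1 : iv h1 vm = m by rewrite (agree_iv A1).
  have w1 i : (i < m * 2)%N -> iw h1 i = src i by rewrite (agree_iw A1) //; apply: hw.
  have mt : (m <= t1)%N by move: ht tt; clear; lia.
  exact: (out h1 t1 f1 f2 ext w1 ev1 mt hf hch hcut hcost).
hstep; apply: (out _ _ (fun=> 0%N) (fun=> 0%N) [::]) => //.
- by rewrite /main_time (negbTE k1) addn0 in ht.
- by move=> y; rewrite z.
- move=> C HC; apply: (kcut_labels (f := fun=> tt)) => //.
  apply: (@leq_trans 1); first by rewrite leqNgt.
  by rewrite card_gt0; apply/finset.set0Pn; exists tt; apply/imsetP; exists (Ordinal n0).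
- rewrite big_pred0 => [|e]; last by rewrite /cut_edge eqxx.
  by rewrite mulr_ge0 ?addr_ge0 ?(ltW eps0).
Qed.

End MainRun.

(** One factor [r] and both factors [Nm] come from the number of levels, the other [r] from the
    depth of the tree. Connectivity gives [n <= m + 1], so that every [n] is absorbed by [m]. The
    dominant term is [16 * 49 = 784] times the product. *)
Lemma main_time_le n m k Nm r : (1 < n)%N -> (n <= m.+1)%N -> (k <= n)%N -> (0 < Nm)%N -> (0 < r)%N ->
  (2 ^ r.-1 < n)%N -> ((main_time n m k Nm r).+1 <= 1000 * (m * (r * r) * (Nm * Nm)))%N.
Proof.
move=> n1 nm kn N0 r0 rn.
have M2 : (2 ^ r < 2 * n)%N by rewrite -(prednK r0) expnS; lia.
apply: (@leq_trans (m + body_time n m k Nm r).+1).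
  by rewrite /main_time; case: ifP => _; lia.
rewrite /body_time; set lt := (level_time n m (2 ^ r) r).+1.
move: (2 ^ r)%N M2 @lt => M M2; rewrite /level_time.
have m1 : (0 < m)%N by lia.
set Y := (m * (r * r) * (Nm * Nm))%N.
have Ym : (m <= Y)%N by rewrite /Y -mulnA leq_pmulr // !muln_gt0 r0 N0.
have Ymr : (m * r <= Y)%N.
  have -> : Y = (m * r * (r * (Nm * Nm)))%N by rewrite /Y; ring.
  by rewrite leq_pmulr // !muln_gt0 r0 N0.
have YN : (Nm <= Y)%N by rewrite /Y mulnA leq_pmull // !muln_gt0 r0 N0 m1.
have YmrN : (m * r * Nm <= Y)%N.
  have -> : Y = (m * r * Nm * (r * Nm))%N by rewrite /Y; ring.
  by rewrite leq_pmulr // muln_gt0 r0.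
have mr : (m <= m * r)%N by rewrite leq_pmulr.
have nr : (n * r <= 2 * (m * r))%N by rewrite mulnA leq_mul2r; lia.
have A1 : ((2 * M + (n + m * 2) * (4 * r).+1 + (2 * M + n * (2 * r).+1) + 3 * n).+1 <= 49 * (m * r))%N.
  have -> : ((n + m * 2) * (4 * r).+1 = 4 * (n * r) + 8 * (m * r) + n + 2 * m)%N by ring.
  have -> : (n * (2 * r).+1 = 2 * (n * r) + n)%N by ring.
  by clear -M2 nm mr nr m1; lia.
have A2 : (Nm.+1 * (8 * Nm * r) <= 16 * (Nm * Nm * r))%N.
  have : (Nm.+1 * (8 * Nm * r) <= (2 * Nm) * (8 * Nm * r))%N by rewrite leq_mul2r; lia.
  by move/leq_trans; apply; rewrite leq_eqVlt; apply/orP; left; apply/eqP; ring.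
have A3 := leq_mul A2 A1.
have E3 : (16 * (Nm * Nm * r) * (49 * (m * r)) = 784 * Y)%N by rewrite /Y; ring.
rewrite E3 in A3.
have A4 : ((Nm + r + 3) * n.+1 <= 15 * Y)%N.
  have a : (Nm + r + 3 <= 5 * (r * Nm))%N.
    have : (r <= r * Nm)%N by rewrite leq_pmulr.
    have : (Nm <= r * Nm)%N by rewrite leq_pmull.
    by clear -N0; lia.
  have b : (n.+1 <= 3 * m)%N by clear -nm m1; lia.
  apply: (leq_trans (leq_mul a b)).
  by have -> : (5 * (r * Nm) * (3 * m) = 15 * (m * r * Nm))%N by [ring]; rewrite leq_mul2l YmrN orbT.
have -> : (n * (2 * r).+1 = 2 * (n * r) + n)%N by ring.
move: A3 A4; set q1 := (_ * _)%N; set q2 := ((Nm + r + 3) * _)%N => A3 A4.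
by clear -A3 A4 Ym Ymr YN M2 nm mr nr m1 kn; lia.
Qed.

(** Variable [x] lives in register [2x]: [k] moves to register 4 and then [m] to register 2, in this
    order because register 2 held [k]. Register 1 becomes the base address [2 * m]; register 3 is
    still 0. *)
Definition kcut_program :=
  Seq (Do (IOp IAdd 4 2 3)) (Seq (Do (IOp IAdd 2 1 3)) (Seq (Do (IOp IAdd 1 1 1)) (comp MAIN))).

Lemma edges_le n m (G : ugraph n m) : (m <= n * n)%N.
Proof.
have inj : injective (ends G) by move=> e f E; apply: (ends_simple (u := G)); left.
by have := leq_card _ inj; rewrite card_prod !card_ord.
Qed.

Lemma vertices_le n m (G : ugraph n m) : connected_graph G -> (n <= m.+1)%N.
Proof.
move=> cG; have := tree_size cG; rewrite cardsT card_ord; lia.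
Qed.

Lemma wf_main : wf MAIN.
Proof. by vm_compute. Qed.

Lemma log_bound (R : realType) (n r : nat) : (1 < n)%N -> (0 < r)%N -> (2 ^ r.-1 < n)%N ->
  r%:R * ln (2 : R) <= 2 * ln (n%:R : R).
Proof.
move=> n1 r0 rn; have n2 : (2 : R) <= n%:R by rewrite ler_nat.
have l2 : ln (2 : R) <= ln (n%:R : R) by rewrite ler_ln ?posrE //; lra.
have lr : ln (2 : R) * r.-1%:R <= ln (n%:R : R).
  rewrite mulr_natr -lnXn // ler_ln ?posrE ?exprn_gt0 //; last by lra.
  by rewrite -natrX ler_nat ltnW.
have -> : r%:R = r.-1%:R + 1 :> R by rewrite natr1 prednK.
by move: l2 lr; lra.
Qed.

(** Here [b] is [ln 2] and [l] is [ln n], and [(2 * 12) ^+ 2] collects [r <= 2 * l / b] and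
    [Nm <= 12 / eps]. The program needs only two logarithms; the third is put in as [l / b >= 1]. *)
Lemma time_real (R : realType) (m r Nm : nat) (eps b l : R) : 0 < eps -> 0 < b -> b <= l ->
  r%:R * b <= 2 * l -> Nm%:R * eps <= 12 ->
  (m * (r * r) * (Nm * Nm))%:R <= (2 * 12) ^+ 2 / b ^+ 3 * (m%:R * l ^+ 3 / eps ^+ 2) :> R.
Proof.
move=> e0 b0 bl rb Ne.
have r1 : r%:R <= 2 * l / b by rewrite ler_pdivlMr.
have N1 : Nm%:R <= 12 / eps by rewrite ler_pdivlMr.
have l0 : 0 < l by apply: lt_le_trans bl.
have rr : r%:R * r%:R <= (2 * l / b) * (2 * l / b) by apply: ler_pM.
have NN : Nm%:R * Nm%:R <= (12 / eps) * (12 / eps) by apply: ler_pM.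
have lb : 1 <= l / b by rewrite ler_pdivlMr // mul1r.
rewrite !natrM.
apply: (@le_trans _ _ (m%:R * ((2 * l / b) * (2 * l / b)) * ((12 / eps) * (12 / eps)))).
  by apply: ler_pM => //; apply: ler_wpM2l.
pose z := m%:R * (l / b) ^+ 2 / eps ^+ 2.
have z0 : 0 <= (2 * 12) ^+ 2 * z.
  apply: mulr_ge0; first exact: sqr_ge0.
  by apply: divr_ge0; [apply: mulr_ge0 => //; exact: sqr_ge0|exact: sqr_ge0].
have -> : m%:R * ((2 * l / b) * (2 * l / b)) * ((12 / eps) * (12 / eps)) = (2 * 12) ^+ 2 * z * 1.
  by rewrite /z; field; rewrite !gt_eqF.
have -> : (2 * 12) ^+ 2 / b ^+ 3 * (m%:R * l ^+ 3 / eps ^+ 2) = (2 * 12) ^+ 2 * z * (l / b).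
  by rewrite /z; field; rewrite !gt_eqF.
exact: ler_wpM2l.
Qed.

Theorem theorem2 (R : realType) :
  exists (P : program) (d : nat) (eps0 K : R), 0 < eps0 /\
    forall (eps : R), 0 < eps -> eps < eps0 ->
    forall (n m : nat) (G : ugraph n m) (c : 'I_m -> R) (k : nat),
      connected_graph G -> (forall e, 0 < c e) -> (k <= n)%N ->
      exists (t : nat) (s : state R),
        [/\ exec (word_bound n d eps) P (input G c k eps) t s,
            is_kcut G k (output m s),
            capacity c (output m s) <= (2 + eps) * lp_optimum G c k &
            (1 < n)%N -> t%:R <= K * (m%:R * ln n%:R ^+ 3 / eps ^+ 2)].
Proof.
pose w := wt MAIN; pose S := sz MAIN; pose b : R := ln 2.
have b0 : 0 < b by apply: ln_gt0; rewrite ltr1n.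
(* Stored integers are at most [X = a ^ 13] for [a = n + q + 2], where [q] is [1 / eps] rounded
   down, and intermediate ones at most [X ^ w]. In the time constant, 3 pays for the prologue. *)
exists kcut_program, (13 * w)%N, 1, ((3 + S * 1000)%:R * ((2 * 12) ^+ 2 / b ^+ 3)); split=> //.
move=> eps e0 e1 n m G c k cG c0 kn.
pose q := Num.truncn eps^-1; pose a := (n + q + 2)%N; pose X := (a ^ 13)%N.
have /andP[ql qu] : q%:R <= eps^-1 < q.+1%:R.
  by apply: truncn_itv; rewrite invr_ge0 ltW.
(* An upper bound for the [N] that the program finds, with [6 <= Nm * eps <= 12]. It occurs only in
   the bounds, since the machine cannot compute [q] by rounding. *)
pose Nm := (6 * q.+1)%N.
have Nm0 : (0 < Nm)%N by [].
have Nme : 6 <= Nm%:R * eps.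
  rewrite natrM -mulrA ler_peMr // ltW //.
  by rewrite -ltr_pdivrMr // div1r.
have Nme2 : Nm%:R * eps <= 12.
  have qe : q%:R * eps <= 1 by rewrite -ler_pdivlMr // div1r.
  by rewrite natrM -natr1; move: qe e1; lra.
pose r := maxn 1 (up_log 2 n).
have r0 : (0 < r)%N by rewrite leq_max.
have nr : (1 < n)%N -> (2 ^ r.-1 < n <= 2 ^ r)%N.
  move=> n1; have -> : r = up_log 2 n.
    by apply/maxn_idPr; rewrite up_log_gt0.
  by have := up_log_bounds (erefl (1 < 2)%N) n1.
have nM : (n <= 2 ^ r)%N.
  case: (ltnP 1 n) => [/nr /andP[]//|n1].
  by apply: (leq_trans n1); rewrite expn_gt0.
have mn := edges_le G.
have a2 : (2 <= a)%N by rewrite /a leq_addl.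
have na : (n + 2 <= a)%N by rewrite /a leq_add2r leq_addr.
have qa : (q.+1 <= a)%N by rewrite /a; clear; lia.
have aX i : (i <= 13)%N -> (a ^ i <= X)%N by move=> i13; rewrite leq_pexp2l //; lia.
have two i : (2 ^ i <= a ^ i)%N by case: i => // i; rewrite leq_exp2r.
have a1X : (a <= X)%N by have := aX 1%N isT; rewrite expn1.
have sX : (stride <= X)%N by apply: leq_trans (two 5%N) (aX 5%N isT).
have mm : (m <= a ^ 2)%N.
  apply: (leq_trans mn); rewrite -mulnn; apply: leq_mul; apply: leq_trans na; apply: leq_addr.
have mX : (m * 2 <= X)%N.
  apply: leq_trans (aX 3%N isT); rewrite expnSr; exact: leq_mul.
have rn1 : (1 < n)%N -> (2 ^ r < 2 * n)%N.
  by move=> /nr /andP[rn _]; rewrite -(prednK r0) expnS ltn_pmul2l.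
have MX : (2 ^ r * 2 <= X)%N.
  apply: leq_trans (aX 3%N isT); rewrite expnSr; apply: leq_mul => //.
  case: (ltnP 1 n) => [n1|n1].
    apply: (leq_trans (ltnW (rn1 n1))); rewrite -mulnn; apply: leq_mul => //.
    by apply: leq_trans na; apply: leq_addr.
  have -> : r = 1%N.
    apply/maxn_idPl; rewrite leqNgt; apply/negP => lt.
    have : (0 < up_log 2 n)%N by apply: ltnW.
    by rewrite up_log_gt0 /= ltnNge n1.
  by apply: leq_trans (two 2%N).
(* The largest indices, those of the arrays over all levels, determine the exponent 13:
   [336 * a^3 + 2 <= 2^9 * a^3 <= a^9 * a^3], times [n <= a]. *)
have LX : ((Nm.+1 * (8 * Nm * n)).+2 * n <= X)%N.
  have n_a : (n <= a)%N by apply: leq_trans na; apply: leq_addr.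
  have h1 : (Nm <= 6 * a)%N by rewrite leq_mul2l.
  have h2 : (Nm.+1 <= 7 * a)%N by clear -h1 a2; lia.
  have h3 : (8 * Nm * n <= 8 * (6 * a) * a)%N by rewrite leq_mul // leq_mul2l.
  have h4 := leq_mul h2 h3.
  have E : (7 * a * (8 * (6 * a) * a) = 336 * a ^ 3)%N by ring.
  rewrite E in h4.
  have a3 : (1 <= a ^ 3)%N by rewrite expn_gt0; clear -a2; lia.
  have h5 : ((Nm.+1 * (8 * Nm * n)).+2 <= 2 ^ 9 * a ^ 3)%N.
    have -> : (2 ^ 9 = 512)%N by []. 
    by move: h4 a3; clear; move: (Nm.+1 * _)%N (a ^ 3)%N => u v; lia.
  apply: (leq_trans (leq_mul h5 n_a)).
  apply: (@leq_trans (a ^ 9 * a ^ 3 * a)).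
    by rewrite leq_mul2r leq_mul2r two !orbT.
  by rewrite -expnD -expnSr.
have nX : (n + 2 <= X)%N by apply: leq_trans a1X.
pose s0 := input G c k eps.
pose h0 := HSt (nth 0%N [:: n; m; k]) (fun x => nth 0 [:: eps] x.*2) (fun _ _ => 0%N) (fun _ _ => 0)
  (imem s0) (rmem s0) : hst R.
have w0 : forall i, (i < m * 2)%N -> iw h0 i = source G i.
  by move=> i _; rewrite /= /source /end1 /end2 /ext; case: insub => [e|] //; case: odd.
have [ticks [h1 [ex1 tk Q1]]] := run_MAIN cG c0 kn e0 e1 Nm0 Nme r0 nM nr MX mX nX LX
  (h := h0) erefl erefl erefl erefl (fun _ _ => erefl) (fun _ _ => erefl) w0 (fun _ _ => erefl) (leqnn _).
pose W := word_bound n (13 * w) eps.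
have WE : W = (X ^ w)%N by rewrite /W /word_bound expnM.
have XW : (X <= W)%N.
  rewrite WE -{1}[X]expn1 leq_pexp2l //; first by rewrite expn_gt0; clear -a2; lia.
pose s3 := instr_eval (IOp IAdd 1 1 1) (instr_eval (IOp IAdd 2 1 3) (instr_eval (IOp IAdd 4 2 3) s0)).
have kX : (k <= X)%N by clear -kn nX; lia.
have beyond i : (m * 2 <= i)%N -> imem s0 i = 0%N /\ rmem s0 i = 0.
  move=> im; rewrite /= !insubN //; rewrite -leqNgt; clear -im; lia.
have sm : sim (m * 2) h0 s3.
  split=> //=.
  - by move=> [|[|[|x]]] //=; rewrite ?addn0 //; case: x.
  - by rewrite muln2 addnn.
  - by move=> x i _; have [] := beyond (i * stride + x + m * 2)%N (leq_addl _ _).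
  - by move=> x i _; have [] := beyond (i * stride + x + m * 2)%N (leq_addl _ _).
have sml : small X h0.
  split=> //=.
  - move=> [|[|[|x]]] //=; [|by apply: leq_trans mX; rewrite leq_pmulr|by rewrite nth_nil].
    by apply: leq_trans nX; apply: leq_addr.
  - move=> i; case: insub => [e|] //; have lt u : ((u : 'I_n) <= X)%N.
      by apply: leq_trans (ltnW (ltn_ord u)) _; apply: leq_trans nX; apply: leq_addr.
    by case: odd.
have [t' [s' [ex' sm' _ tb]]] := comp_ok sX mX ex1 sml sm wf_main (eq_leq (esym WE)).
have prologue i s : no_overflow W i s -> exec W (Do i) s 1 (instr_eval i s) by apply: ExecDo.
have kcE : forall e : 'I_m, (e \in output m s') = (iw h1 e != 0%N).
  move=> e; rewrite inE (sim_iw sm') //.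
  by apply: leq_trans (ltn_ord e) _; rewrite leq_pmulr.
have [kc cost] := Q1 _ kcE.
exists (1 + (1 + (1 + t')))%N, s'; split=> //.
  apply: ExecSeq; first by apply: prologue; rewrite /= addn0; exact: leq_trans kX XW.
  apply: ExecSeq; first by apply: prologue; rewrite /= addn0; apply: leq_trans XW; apply: leq_trans mX; rewrite leq_pmulr.
  apply: ExecSeq; last exact: ex'.
  by apply: prologue; rewrite /= addnn -muln2; apply: leq_trans mX XW.
move=> n1; have /andP[rn _] := nr n1.
have mt := main_time_le n1 (vertices_le cG) kn Nm0 r0 rn.
set Y := (m * (r * r) * (Nm * Nm))%N in mt.
have bl : b <= ln n%:R by rewrite ler_ln ?posrE ?ler_nat // ltr0n ltnW.
have YR := time_real m e0 b0 bl (log_bound R n1 r0 rn) Nme2.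
have Y0 : (0 < Y)%N.
  have m0 : (0 < m)%N by have := vertices_le cG; clear -n1; lia.
  by rewrite /Y !muln_gt0 m0 r0.
apply: (@le_trans _ _ ((3 + S * 1000)%:R * Y%:R)).
  rewrite -natrM ler_nat; have : (t' <= S * (1000 * Y))%N.
    by apply: (leq_trans tb); rewrite leq_mul2l; apply/orP; right; apply: leq_trans mt; rewrite ltnS.
  rewrite mulnDl -mulnA; move: (S * _)%N => u; clear -Y0; lia.
rewrite -[X in _ <= X]mulrA; apply: ler_wpM2l; [exact: ler0n|exact: YR].
Qed.
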